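(* Let $V$ be a complex Hilbert space, $\Omega\subset\mathbb C$ open, and $P\in C^2_{\mathrm{op}}(\Omega,\mathrm{End}^+V)$. Then $P$ has semipositive curvature if and only if for every disc $\overline{D_r(z_0)}\subset\Omega$ $$\mathfrak T(P,z_0,r)\le P(z_0).$$
   Context: $\mathrm{End}\,V$ is the space of continuous linear operators on $V$, $\mathrm{GL}(V)$ its group of invertible elements, $\mathrm{End}^+V$ the cone of positive (self-adjoint) invertible operators. $C^2_{\mathrm{op}}$ means twice continuously differentiable for the operator norm; $C_{\mathrm{op}}$ means continuous for the operator norm. $P\in C^2_{\mathrm{op}}(\Omega,\mathrm{End}^+V)$ has semipositive curvature if $P_{\overline z}P^{-1}P_z-P_{z\overline z}\ge 0$ on $\Omega$ (subscripts denote partial derivatives). $D_r(z_0)=\{z\in\mathbb C:|z-z_0|<r\}$, and $\oint$ denotes the average $\frac1{2\pi r}\int_{\partial D_r(z_0)}$; $|dz|$ is arc length. For continuous $Q:\partial D_r(z_0)\to\mathrm{End}^+V$, $$\mathfrak S(Q,z_0,r)=\oint Q\,|dz|-\oint Q\,dz\Big(\oint Q\,|dz|\Big)^{-1}\oint Q\,d\overline z.$$ Further, $$\mathfrak T(P,z_0,r)=\min_H\ H^*(z_0)^{-1}\,\mathfrak S(H^*PH,z_0,r)\,H(z_0)^{-1},$$ the minimum (in the order of self-adjoint operators) being taken over all $H\in C_{\mathrm{op}}(\overline{D_r(z_0)},\mathrm{GL}(V))$ that are holomorphic on $D_r(z_0)$; here $H^*(z)=H(z)^*$. This minimum exists for $P\in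 C^2_{\mathrm{op}}(\Omega,\mathrm{End}^+V)$. *)

(* Defs.v *)
From Stdlib Require Import Reals Lra ClassicalEpsilon FunctionalExtensionality
  PropExtensionality ProofIrrelevance.
From Coquelicot Require Import Coquelicot.

Open Scope R_scope.

Lemma minus_plus_plus {G : AbelianGroup} (a b c d : G) :
  minus (plus a b) (plus c d) = plus (minus a c) (minus b d).
Proof.
  unfold minus. rewrite opp_plus, <- !plus_assoc. f_equal.
  rewrite !plus_assoc. f_equal. apply plus_comm.
Qed.

(* The inner product is linear in the first variable.  [inner_norm] says at once
   that it is positive definite and that it induces the norm, hence the complete
   topology, of the underlying Banach space. *)
Record HilbertSpace := {
  hilbert_sort :> CompleteNormedModule C_AbsRing;
  inner : hilbert_sort -> hilbert_sort -> C;
  inner_plus_l : forall u v w,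
    inner (plus u v) w = Cplus (inner u w) (inner v w);
  inner_scal_l : forall (a : C) u w,
    inner (scal a u) w = Cmult a (inner u w);
  inner_conj : forall u v, inner v u = Cconj (inner u v);
  inner_norm : forall v, inner v v = RtoC (norm v ^ 2)
}.

Arguments inner {h} u v.

(* [is_linear] is Coquelicot's notion of a bounded (i.e. continuous) linear map. *)
Record BOp (V : NormedModule C_AbsRing) := mkBOp {
  bop_fun :> V -> V;
  bop_linear : is_linear bop_fun
}.

Arguments mkBOp {V} bop_fun bop_linear.
Arguments bop_fun {V} b x.
Arguments bop_linear {V} b.

Section BOpStructures.

Context {V : NormedModule C_AbsRing}.

Lemma bop_ext (A B : BOp V) : (forall v, A v = B v) -> A = B.
Proof.
  destruct A as [f Hf], B as [g Hg]; simpl; intros H.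
  assert (E : f = g) by (apply functional_extensionality; exact H).
  subst g. f_equal. apply proof_irrelevance.
Qed.

Lemma is_linear_bop_plus (A B : BOp V) : is_linear (fun v => plus (A v) (B v)).
Proof.
  destruct (bop_linear A) as [Ap As [M [HM HA]]].
  destruct (bop_linear B) as [Bp Bs [N [HN HB]]].
  split.
  - intros u v. rewrite Ap, Bp. rewrite <- !plus_assoc. f_equal.
    rewrite !plus_assoc. f_equal. apply plus_comm.
  - intros a v. rewrite As, Bs. symmetry. apply (@scal_distr_l C_Ring V).
  - exists (M + N). split; [lra|]. intros v.
    eapply Rle_trans; [apply norm_triangle|].
    specialize (HA v). specialize (HB v). lra.
Qed.

Lemma is_linear_bop_scal (a : C) (A : BOp V) : is_linear (fun v => scal a (A v)).
Proof.
  destruct (bop_linear A) as [Ap As [M [HM HA]]].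
  split.
  - intros u v. rewrite Ap. apply (@scal_distr_l C_Ring V).
  - intros b v. rewrite As.
    rewrite (scal_assoc a b), (scal_assoc b a). f_equal. apply Cmult_comm.
  - exists (Cmod a * M + 1). pose proof (Cmod_ge_0 a) as Ha.
    assert (Haf : 0 <= Cmod a * M) by (apply Rmult_le_pos; lra).
    split; [lra|]. intros v.
    eapply Rle_trans; [apply (norm_scal a)|].
    change (abs a) with (Cmod a).
    pose proof (norm_ge_0 v). specialize (HA v).
    assert (Cmod a * norm (A v) <= Cmod a * (M * norm v))
      by (apply Rmult_le_compat_l; assumption).
    lra.
Qed.

Lemma is_linear_bop_opp (A : BOp V) : is_linear (fun v => opp (A v)).
Proof.
  apply (is_linear_comp A opp); [apply bop_linear|apply is_linear_opp].
Qed.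

Lemma is_linear_bop_mult (A B : BOp V) : is_linear (fun v => A (B v)).
Proof. apply (is_linear_comp B A); apply bop_linear. Qed.

Definition bop_plus (A B : BOp V) : BOp V := mkBOp _ (is_linear_bop_plus A B).
Definition bop_opp (A : BOp V) : BOp V := mkBOp _ (is_linear_bop_opp A).
Definition bop_zero : BOp V := mkBOp _ is_linear_zero.
Definition bop_mult (A B : BOp V) : BOp V := mkBOp _ (is_linear_bop_mult A B).
Definition bop_one : BOp V := mkBOp _ is_linear_id.
Definition bop_scal (a : C) (A : BOp V) : BOp V :=
  mkBOp _ (is_linear_bop_scal a A).

Definition BOp_AbelianMonoid_mixin : AbelianMonoid.mixin_of (BOp V).
Proof.
  apply (AbelianMonoid.Mixin (BOp V) bop_plus bop_zero).
  - intros A B; apply bop_ext; intros v; apply plus_comm.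
  - intros A B D; apply bop_ext; intros v; apply plus_assoc.
  - intros A; apply bop_ext; intros v; apply plus_zero_r.
Defined.

Canonical BOp_AbelianMonoid :=
  AbelianMonoid.Pack (BOp V) BOp_AbelianMonoid_mixin (BOp V).

Definition BOp_AbelianGroup_mixin : AbelianGroup.mixin_of BOp_AbelianMonoid.
Proof.
  apply (AbelianGroup.Mixin BOp_AbelianMonoid bop_opp).
  intros A; apply bop_ext; intros v; apply (plus_opp_r (A v)).
Defined.

Canonical BOp_AbelianGroup :=
  AbelianGroup.Pack (BOp V)
    (AbelianGroup.Class _ _ BOp_AbelianGroup_mixin) (BOp V).

Definition BOp_Ring_mixin : Ring.mixin_of BOp_AbelianGroup.
Proof.
  apply (Ring.Mixin BOp_AbelianGroup bop_mult bop_one).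
  - intros A B D; apply bop_ext; reflexivity.
  - intros A; apply bop_ext; reflexivity.
  - intros A; apply bop_ext; reflexivity.
  - intros A B D; apply bop_ext; reflexivity.
  - intros A B D; apply bop_ext; intros v.
    apply (linear_plus A (bop_linear A)).
Defined.

Canonical BOp_Ring :=
  Ring.Pack (BOp V) (Ring.Class _ _ BOp_Ring_mixin) (BOp V).

Definition BOp_ModuleSpace_mixin :
  ModuleSpace.mixin_of C_Ring BOp_AbelianGroup.
Proof.
  apply (ModuleSpace.Mixin C_Ring BOp_AbelianGroup bop_scal).
  - intros a b A; apply bop_ext; intros v; apply (scal_assoc a b (A v)).
  - intros A; apply bop_ext; intros v; apply (scal_one (A v)).
  - intros a A B; apply bop_ext; intros v; apply (scal_distr_l a (A v) (B v)).
  - intros a b A; apply bop_ext; intros v; apply (scal_distr_r a b (A v)).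
Defined.

Canonical BOp_ModuleSpace :=
  ModuleSpace.Pack C_Ring (BOp V)
    (ModuleSpace.Class _ _ _ BOp_ModuleSpace_mixin) (BOp V).

Definition bop_norm (A : BOp V) : R :=
  real (Lub_Rbar (fun x => exists v : V, norm v <= 1 /\ x = norm (A v))).

Lemma bop_norm_lub (A : BOp V) :
  is_lub_Rbar (fun x => exists v : V, norm v <= 1 /\ x = norm (A v))
    (Finite (bop_norm A)).
Proof.
  unfold bop_norm.
  set (E := fun x => exists v : V, norm v <= 1 /\ x = norm (A v)).
  pose proof (Lub_Rbar_correct E) as [Hub Hlub].
  destruct (linear_norm A (bop_linear A)) as [M [HM HA]].
  assert (H1 : Rbar_le (Lub_Rbar E) (Finite M)).
  { apply Hlub. intros x [v [Hv ->]]. simpl.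
    specialize (HA v).
    assert (M * norm v <= M * 1) by (apply Rmult_le_compat_l; lra). lra. }
  assert (H0 : Rbar_le (Finite (norm (A zero))) (Lub_Rbar E)).
  { apply Hub. exists zero. split; [rewrite norm_zero; lra|reflexivity]. }
  destruct (Lub_Rbar E) as [l| |] eqn:El; simpl in *; try contradiction.
  split; assumption.
Qed.

Lemma bop_norm_bound (A : BOp V) (v : V) : norm (A v) <= bop_norm A * norm v.
Proof.
  pose proof (bop_linear A) as HL.
  destruct (Req_dec (norm v) 0) as [E|E].
  { destruct (linear_norm A HL) as [M [_ HA]]. specialize (HA v).
    rewrite E in *. lra. }
  pose proof (norm_ge_0 v) as Hv. assert (0 < norm v) by lra.
  set (w := scal (RtoC (/ norm v)) v).
  assert (Hw : norm w <= 1).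
  { unfold w. eapply Rle_trans; [apply (norm_scal (RtoC (/ norm v)))|].
    change (abs (RtoC (/ norm v))) with (Cmod (RtoC (/ norm v))).
    rewrite Cmod_R, Rabs_pos_eq by (left; apply Rinv_0_lt_compat; assumption).
    rewrite Rinv_l; lra. }
  assert (Ev : v = scal (RtoC (norm v)) w).
  { unfold w. rewrite (scal_assoc (RtoC (norm v)) (RtoC (/ norm v)) v).
    change (mult (RtoC (norm v)) (RtoC (/ norm v)))
      with (Cmult (RtoC (norm v)) (RtoC (/ norm v))).
    rewrite <- RtoC_mult, Rinv_r by assumption. symmetry. apply (scal_one v). }
  assert (HAw : norm (A w) <= bop_norm A).
  { destruct (bop_norm_lub A) as [Hub _].
    apply (Hub (norm (A w))). exists w. split; [exact Hw|reflexivity]. }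
  rewrite Ev at 1. rewrite (linear_scal A HL).
  eapply Rle_trans; [apply (norm_scal (RtoC (norm v)))|].
  change (abs (RtoC (norm v))) with (Cmod (RtoC (norm v))).
  rewrite Cmod_R, Rabs_pos_eq by assumption.
  rewrite Rmult_comm. apply Rmult_le_compat_r; assumption.
Qed.

Lemma bop_norm_le (A : BOp V) (M : R) :
  0 <= M -> (forall v, norm (A v) <= M * norm v) -> bop_norm A <= M.
Proof.
  intros HM H. destruct (bop_norm_lub A) as [_ Hlub].
  apply (Hlub (Finite M)). intros x [v [Hv ->]]. simpl.
  specialize (H v).
  assert (M * norm v <= M * 1) by (apply Rmult_le_compat_l; lra). lra.
Qed.

Lemma bop_norm_ge_0 (A : BOp V) : 0 <= bop_norm A.
Proof.
  destruct (bop_norm_lub A) as [Hub _].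
  eapply Rle_trans; [apply (norm_ge_0 (A zero))|].
  apply (Hub (norm (A zero))). exists zero.
  split; [rewrite norm_zero; lra|reflexivity].
Qed.

Lemma bop_norm_triangle (A B : BOp V) :
  bop_norm (plus A B) <= bop_norm A + bop_norm B.
Proof.
  pose proof (bop_norm_ge_0 A). pose proof (bop_norm_ge_0 B).
  apply bop_norm_le; [lra|]. intros v.
  eapply Rle_trans; [apply (norm_triangle (A v) (B v))|].
  pose proof (bop_norm_bound A v). pose proof (bop_norm_bound B v). lra.
Qed.

Lemma bop_norm_scal (a : C) (A : BOp V) :
  bop_norm (bop_scal a A) <= Cmod a * bop_norm A.
Proof.
  apply bop_norm_le.
  { apply Rmult_le_pos; [apply Cmod_ge_0|apply bop_norm_ge_0]. }
  intros v. eapply Rle_trans; [apply (norm_scal a (A v))|].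
  change (abs a) with (Cmod a). rewrite Rmult_assoc.
  apply Rmult_le_compat_l; [apply Cmod_ge_0|apply bop_norm_bound].
Qed.

Lemma bop_norm_eq_0 (A : BOp V) : bop_norm A = 0 -> A = zero.
Proof.
  intros H. apply bop_ext. intros v. apply norm_eq_zero.
  pose proof (bop_norm_bound A v) as Hb. rewrite H in Hb.
  pose proof (norm_ge_0 (A v)). simpl. lra.
Qed.

Lemma bop_norm_zero : bop_norm zero = 0.
Proof.
  apply Rle_antisym; [|apply bop_norm_ge_0].
  apply bop_norm_le; [lra|]. intros v.
  change (norm (@zero V) <= 0 * norm v). rewrite norm_zero. lra.
Qed.

Lemma bop_norm_minus_sym (A B : BOp V) :
  bop_norm (minus A B) = bop_norm (minus B A).
Proof.
  assert (H : forall A B : BOp V, bop_norm (minus A B) <= bop_norm (minus B A)).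
  { intros A' B'. apply bop_norm_le; [apply bop_norm_ge_0|]. intros v.
    change (norm (minus (A' v) (B' v)) <= bop_norm (minus B' A') * norm v).
    rewrite <- (opp_minus (B' v) (A' v)), norm_opp.
    apply (bop_norm_bound (minus B' A') v). }
  apply Rle_antisym; apply H.
Qed.

Definition bop_ball (A : BOp V) (eps : R) (B : BOp V) : Prop :=
  bop_norm (minus B A) < eps.

Definition BOp_UniformSpace_mixin : UniformSpace.mixin_of (BOp V).
Proof.
  apply (UniformSpace.Mixin (BOp V) bop_zero bop_ball).
  - intros A e. unfold bop_ball. rewrite minus_eq_zero.
    apply Rle_lt_trans with 0; [right; exact bop_norm_zero|apply cond_pos].
  - intros A B e H. unfold bop_ball. rewrite bop_norm_minus_sym. exact H.
  - intros A B D e1 e2 H1 H2. unfold bop_ball in *.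
    rewrite (minus_trans B D A).
    eapply Rle_lt_trans; [apply bop_norm_triangle|]. lra.
Defined.

Canonical BOp_UniformSpace :=
  UniformSpace.Pack (BOp V) BOp_UniformSpace_mixin (BOp V).

Canonical BOp_NormedModuleAux :=
  NormedModuleAux.Pack C_AbsRing (BOp V)
    (NormedModuleAux.Class C_AbsRing (BOp V)
       (ModuleSpace.class _ BOp_ModuleSpace) BOp_UniformSpace_mixin) (BOp V).

Definition BOp_NormedModule_mixin :
  NormedModule.mixin_of C_AbsRing BOp_NormedModuleAux.
Proof.
  apply (NormedModule.Mixin C_AbsRing BOp_NormedModuleAux bop_norm 1).
  - exact bop_norm_triangle.
  - exact bop_norm_scal.
  - intros A B eps H. exact H.
  - intros A B eps H. rewrite Rmult_1_l. exact H.
  - exact bop_norm_eq_0.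
Defined.

Canonical BOp_NormedModule :=
  NormedModule.Pack C_AbsRing (BOp V)
    (NormedModule.Class _ _ _ BOp_NormedModule_mixin) (BOp V).

Lemma norm_minus_triangle (x y z : V) :
  norm (minus x z) <= norm (minus x y) + norm (minus y z).
Proof. rewrite (minus_trans y x z). apply (@norm_triangle C_AbsRing V). Qed.

Lemma norm_le_minus' (x y : V) : norm x <= norm (minus x y) + norm y.
Proof.
  assert (E : x = plus (minus x y) y).
  { symmetry. unfold minus. etransitivity; [symmetry; apply plus_assoc|].
    etransitivity; [|apply plus_zero_r]. f_equal. apply (@plus_opp_l V). }
  rewrite E at 1. apply (@norm_triangle C_AbsRing V).
Qed.

Lemma norm_le_minus (x y : V) : norm y <= norm (minus x y) + norm x.
Proof.
  assert (E : norm (minus x y) = norm (minus y x)).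
  { rewrite <- (opp_minus y x). apply (@norm_opp C_AbsRing V). }
  rewrite E. apply norm_le_minus'.
Qed.

Lemma bop_complete_aux (F : (BOp V -> Prop) -> Prop) (l : V -> V) :
  ProperFilter F -> cauchy F ->
  (forall v (eps : posreal),
     F (fun A : BOp V => norm (minus (A v) (l v)) < eps)) ->
  exists L : BOp V, forall eps : posreal, F (ball L eps).
Proof.
  intros FF HF Hl.
  assert (Heq : forall x y : V,
             (forall eps : posreal, norm (minus x y) < 3 * eps) -> x = y).
  { intros x y H.
    assert (E : norm (minus x y) = 0).
    { apply Rle_antisym; [|apply norm_ge_0]. apply Rnot_lt_le. intros H0.
      assert (Hd : 0 < norm (minus x y) / 3) by lra.
      specialize (H (mkposreal _ Hd)). simpl in H. lra. }
    apply norm_eq_zero in E.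
    apply (plus_reg_r (opp y)). rewrite plus_opp_r. exact E. }
  assert (Hlin : is_linear l).
  { split.
    - intros u v. apply Heq. intros eps.
      destruct (filter_ex _ (filter_and _ _ (Hl (plus u v) eps)
                 (filter_and _ _ (Hl u eps) (Hl v eps)))) as [A [H1 [H2 H3]]].
      rewrite (linear_plus A (bop_linear A)) in H1.
      replace (minus (l (plus u v)) (plus (l u) (l v))) with
        (plus (opp (minus (plus (A u) (A v)) (l (plus u v))))
           (plus (minus (A u) (l u)) (minus (A v) (l v)))).
      2:{ symmetry.
          etransitivity; [apply (minus_trans (plus (A u) (A v)))|].
          f_equal; [symmetry; apply opp_minus|exact (@minus_plus_plus V (A u) (A v) (l u) (l v))]. }
      replace (3 * eps) with (eps + (eps + eps)) by ring.
      eapply Rle_lt_trans; [apply norm_triangle|].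
      apply Rplus_lt_compat; [rewrite norm_opp; exact H1|].
      eapply Rle_lt_trans; [apply norm_triangle|].
      apply Rplus_lt_compat; [exact H2|exact H3].
    - intros a v. apply Heq. intros eps.
      pose proof (Cmod_ge_0 a) as Ha.
      assert (Hd : 0 < eps / (Cmod a + 1))
        by (apply Rdiv_lt_0_compat; [apply cond_pos|lra]).
      destruct (filter_ex _ (filter_and _ _ (Hl (scal a v) eps)
                 (Hl v (mkposreal _ Hd)))) as [A [H1 H2]].
      rewrite (linear_scal A (bop_linear A)) in H1.
      replace (minus (l (scal a v)) (scal a (l v))) with
        (plus (opp (minus (scal a (A v)) (l (scal a v))))
           (scal a (minus (A v) (l v)))).
      + eapply Rle_lt_trans; [apply norm_triangle|].
        replace (3 * eps) with (eps + 2 * eps) by ring.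
        apply Rplus_lt_compat.
        * eapply Rle_lt_trans; [right|exact H1].
          apply (@norm_opp C_AbsRing V).
        * eapply Rle_lt_trans; [apply (@norm_scal C_AbsRing V)|].
          change (abs a) with (Cmod a). simpl in H2.
          pose proof (cond_pos eps) as He.
          apply Rle_lt_trans with (Cmod a * (eps / (Cmod a + 1))).
          { apply Rmult_le_compat_l; [exact Ha|left; exact H2]. }
          apply Rle_lt_trans with ((Cmod a + 1) * (eps / (Cmod a + 1))).
          { apply Rmult_le_compat_r; lra. }
          replace ((Cmod a + 1) * (eps / (Cmod a + 1))) with (pos eps)
            by (field; lra).
          lra.
      + assert (E : scal a (minus (A v) (l v))
                    = minus (scal a (A v)) (scal a (l v))).
        { unfold minus. etransitivity; [apply (@scal_distr_l C_Ring V)|].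
          f_equal. apply (@scal_opp_r C_Ring V). }
        rewrite E. symmetry.
        etransitivity; [apply (minus_trans (scal a (A v)))|].
        f_equal. symmetry. apply opp_minus.
    - destruct (HF (mkposreal 1 Rlt_0_1)) as [A0 HA0].
      pose proof (bop_norm_ge_0 A0) as H0.
      exists (bop_norm A0 + 1). split; [lra|]. intros v.
      apply Rnot_lt_le. intros Hc.
      assert (Hd : 0 < norm (l v) - (bop_norm A0 + 1) * norm v) by lra.
      destruct (filter_ex _ (filter_and _ _ (Hl v (mkposreal _ Hd)) HA0))
        as [A [H1 H2]].
      simpl in H1. change (bop_norm (minus A A0) < 1) in H2.
      pose proof (bop_norm_bound (minus A A0) v) as H3.
      change (norm (minus (A v) (A0 v)) <= bop_norm (minus A A0) * norm v) in H3.
      pose proof (bop_norm_bound A0 v) as H4.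
      pose proof (norm_ge_0 v) as Hv.
      assert (H5 : bop_norm (minus A A0) * norm v <= 1 * norm v)
        by (apply Rmult_le_compat_r; lra).
      assert (H6 : norm (l v) <= norm (minus (A v) (l v))
                     + norm (minus (A v) (A0 v)) + norm (A0 v)).
      { pose proof (norm_le_minus (A v) (l v)).
        pose proof (norm_le_minus' (A v) (A0 v)). lra. }
      lra. }
  exists (mkBOp l Hlin). intros eps.
  assert (Hd : 0 < eps / 3) by (pose proof (cond_pos eps); lra).
  destruct (HF (mkposreal _ Hd)) as [A0 HA0].
  eapply filter_imp; [|exact HA0]. intros A HA.
  change (bop_norm (minus A A0) < eps / 3) in HA.
  change (bop_norm (minus A (mkBOp l Hlin)) < eps).
  apply Rle_lt_trans with (2 * (eps / 3)); [|pose proof (cond_pos eps); lra].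
  apply bop_norm_le; [lra|]. intros v.
  change (norm (minus (A v) (l v)) <= 2 * (eps / 3) * norm v).
  apply Rnot_lt_le. intros Hc.
  assert (Hd2 : 0 < norm (minus (A v) (l v)) - 2 * (eps / 3) * norm v) by lra.
  destruct (filter_ex _ (filter_and _ _ (Hl v (mkposreal _ Hd2)) HA0))
    as [B [H1 H2]].
  simpl in H1. change (bop_norm (minus B A0) < eps / 3) in H2.
  rewrite bop_norm_minus_sym in H2.
  pose proof (bop_norm_bound (minus A A0) v) as H3.
  pose proof (bop_norm_bound (minus A0 B) v) as H4.
  change (norm (minus (A v) (A0 v)) <= bop_norm (minus A A0) * norm v) in H3.
  change (norm (minus (A0 v) (B v)) <= bop_norm (minus A0 B) * norm v) in H4.
  pose proof (norm_ge_0 v) as Hv.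
  assert (H5 : bop_norm (minus A A0) * norm v <= eps / 3 * norm v)
    by (apply Rmult_le_compat_r; lra).
  assert (H6 : bop_norm (minus A0 B) * norm v <= eps / 3 * norm v)
    by (apply Rmult_le_compat_r; lra).
  assert (H7 : norm (minus (A v) (l v)) <= norm (minus (A v) (A0 v))
                 + (norm (minus (A0 v) (B v)) + norm (minus (B v) (l v)))).
  { pose proof (norm_minus_triangle (A v) (A0 v) (l v)).
    pose proof (norm_minus_triangle (A0 v) (B v) (l v)). lra. }
  lra.
Qed.

End BOpStructures.

Section BOpComplete.

Context {V : CompleteNormedModule C_AbsRing}.

Lemma bop_complete (F : (BOp V -> Prop) -> Prop) :
  ProperFilter F -> cauchy F ->
  exists L : BOp V, forall eps : posreal, F (ball L eps).
Proof.
  intros FF HF.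
  set (Fv := fun v : V => filtermap (fun A : BOp V => A v) F).
  assert (HFv : forall v, ProperFilter (Fv v))
    by (intros v; apply filtermap_proper_filter; exact FF).
  assert (HCv : forall v, cauchy (Fv v)).
  { intros v eps.
    pose proof (norm_ge_0 v) as Hv.
    assert (Hd : 0 < eps / (norm v + 1))
      by (apply Rdiv_lt_0_compat; [apply cond_pos|lra]).
    destruct (HF (mkposreal _ Hd)) as [A HA].
    exists (A v). unfold Fv, filtermap.
    eapply filter_imp; [|exact HA]. intros B HB.
    apply (norm_compat1 (A v) (B v) eps).
    change (bop_norm (minus B A) < eps / (norm v + 1)) in HB.
    eapply Rle_lt_trans; [apply (bop_norm_bound (minus B A) v)|].
    assert (H1 : bop_norm (minus B A) * (norm v + 1) < eps).
    { apply Rmult_lt_compat_r with (r := norm v + 1) in HB; [|lra].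
      unfold Rdiv in HB. rewrite Rmult_assoc, Rinv_l, Rmult_1_r in HB; lra. }
    pose proof (bop_norm_ge_0 (minus B A)). lra. }
  set (l := fun v : V => lim (Fv v)).
  assert (Hl : forall v (eps : posreal),
             F (fun A : BOp V => norm (minus (A v) (l v)) < eps)).
  { intros v eps. pose proof (norm_factor_gt_0 (V := V)) as Hf.
    assert (Hd : 0 < eps / (@norm_factor _ V))
      by (apply Rdiv_lt_0_compat; [apply cond_pos|exact Hf]).
    pose proof (complete_cauchy (Fv v) (HFv v) (HCv v) (mkposreal _ Hd)) as H.
    unfold Fv, filtermap in H. eapply filter_imp; [|exact H].
    intros A HA. apply (@norm_compat2 C_AbsRing V) in HA. simpl in HA.
    replace (norm_factor * (eps / norm_factor)) with (pos eps) in HA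
      by (field; lra).
    exact HA. }
  exact (bop_complete_aux F l FF HF Hl).
Qed.

Definition bop_lim (F : (BOp V -> Prop) -> Prop) : BOp V :=
  epsilon (inhabits bop_zero) (fun L => forall eps : posreal, F (ball L eps)).

Definition BOp_CompleteSpace_mixin : CompleteSpace.mixin_of (@BOp_UniformSpace V).
Proof.
  apply (CompleteSpace.Mixin (@BOp_UniformSpace V) bop_lim).
  - intros F FF HF. unfold bop_lim. apply epsilon_spec.
    apply bop_complete; assumption.
  - intros F1 F2 H12 H21. replace F2 with F1; [intros eps; apply ball_center|].
    apply functional_extensionality. intros Q.
    apply propositional_extensionality. split; [apply H21|apply H12].
Defined.

Canonical BOp_CompleteSpace :=
  CompleteSpace.Pack (BOp V)
    (CompleteSpace.Class _ BOp_UniformSpace_mixin BOp_CompleteSpace_mixin)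
    (BOp V).

Canonical BOp_CompleteNormedModule :=
  CompleteNormedModule.Pack C_AbsRing (BOp V)
    (CompleteNormedModule.Class _ _ (NormedModule.class _ (@BOp_NormedModule V))
       BOp_CompleteSpace_mixin) (BOp V).

End BOpComplete.

(* Needed for Riemann integrals and real partial derivatives.  As for [C] itself
   in Coquelicot, the real structures are not canonical and are given by name. *)
Section BOpReal.

Variable V : CompleteNormedModule C_AbsRing.

Definition BOp_R_ModuleSpace_mixin :
  ModuleSpace.mixin_of R_Ring (@BOp_AbelianGroup V).
Proof.
  apply (ModuleSpace.Mixin R_Ring (@BOp_AbelianGroup V)
           (fun (t : R) (A : BOp V) => bop_scal (RtoC t) A)).
  - intros s t A. change (scal (RtoC s) (scal (RtoC t) A)
                          = scal (RtoC (s * t)) A).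
    rewrite (scal_assoc (RtoC s) (RtoC t) A), RtoC_mult. reflexivity.
  - intros A. apply (scal_one A).
  - intros t A B. apply (scal_distr_l (RtoC t) A B).
  - intros s t A. change (scal (RtoC (s + t)) A
                          = plus (scal (RtoC s) A) (scal (RtoC t) A)).
    rewrite RtoC_plus. apply (scal_distr_r (RtoC s) (RtoC t) A).
Defined.

Definition BOp_R_ModuleSpace : ModuleSpace R_Ring :=
  ModuleSpace.Pack R_Ring (BOp V)
    (ModuleSpace.Class _ _ _ BOp_R_ModuleSpace_mixin) (BOp V).

Definition BOp_R_NormedModuleAux : NormedModuleAux R_AbsRing :=
  NormedModuleAux.Pack R_AbsRing (BOp V)
    (NormedModuleAux.Class R_AbsRing (BOp V)
       (ModuleSpace.class _ BOp_R_ModuleSpace) BOp_UniformSpace_mixin) (BOp V).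

Definition BOp_R_NormedModule_mixin :
  NormedModule.mixin_of R_AbsRing BOp_R_NormedModuleAux.
Proof.
  apply (NormedModule.Mixin R_AbsRing BOp_R_NormedModuleAux bop_norm 1).
  - exact bop_norm_triangle.
  - intros t A. change (bop_norm (bop_scal (RtoC t) A) <= Rabs t * bop_norm A).
    rewrite <- Cmod_R. apply bop_norm_scal.
  - intros A B eps H. exact H.
  - intros A B eps H. rewrite Rmult_1_l. exact H.
  - exact bop_norm_eq_0.
Defined.

Definition BOp_R_NormedModule : NormedModule R_AbsRing :=
  NormedModule.Pack R_AbsRing (BOp V)
    (NormedModule.Class _ _ _ BOp_R_NormedModule_mixin) (BOp V).

Definition BOp_R_CompleteNormedModule : CompleteNormedModule R_AbsRing :=
  CompleteNormedModule.Pack R_AbsRing (BOp V)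
    (CompleteNormedModule.Class _ _ (NormedModule.class _ BOp_R_NormedModule)
       BOp_CompleteSpace_mixin) (BOp V).

End BOpReal.

Section Operators.

Context {V : HilbertSpace}.
Implicit Types A B : BOp V.

Definition is_inverse A B : Prop := mult A B = one /\ mult B A = one.

Definition invertible A : Prop := exists B, is_inverse A B.

(* Meaningful only for invertible operators. *)
Definition bop_inv A : BOp V := epsilon (inhabits zero) (is_inverse A).

Definition is_adjoint A B : Prop :=
  forall u v : V, inner (A u) v = inner u (B v).

(* An adjoint always exists, by the Riesz representation theorem, and is unique. *)
Definition adj A : BOp V := epsilon (inhabits zero) (is_adjoint A).

Definition nonneg A : Prop :=
  adj A = A /\ forall v : V, 0 <= Re (inner (A v) v).

Definition bop_le A B : Prop := nonneg (minus B A).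

Definition pos_invertible A : Prop := nonneg A /\ invertible A.

End Operators.

Section Calculus.

Context {V : HilbertSpace}.
Implicit Types F : C -> BOp V.

Definition is_dx F (z : C) (L : BOp V) : Prop :=
  is_derive (V := BOp_R_NormedModule V) (fun t : R => F (t, snd z)) (fst z) L.

Definition is_dy F (z : C) (L : BOp V) : Prop :=
  is_derive (V := BOp_R_NormedModule V) (fun t : R => F (fst z, t)) (snd z) L.

Definition dx F (z : C) : BOp V := iota (is_dx F z).
Definition dy F (z : C) : BOp V := iota (is_dy F z).

Definition C1_op (Omega : C -> Prop) F : Prop :=
  (forall z, Omega z -> (exists L, is_dx F z L) /\ (exists L, is_dy F z L)) /\
  continuous_on Omega (dx F) /\ continuous_on Omega (dy F).

Definition C2_op (Omega : C -> Prop) F : Prop :=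
  C1_op Omega F /\ C1_op Omega (dx F) /\ C1_op Omega (dy F).

Definition d_z F (z : C) : BOp V :=
  scal (RtoC (1 / 2)) (minus (dx F z) (scal Ci (dy F z))).

Definition d_zbar F (z : C) : BOp V :=
  scal (RtoC (1 / 2)) (plus (dx F z) (scal Ci (dy F z))).

Definition semipositive_curvature (Omega : C -> Prop) (P : C -> BOp V) : Prop :=
  forall z, Omega z ->
    nonneg (minus (mult (mult (d_zbar P z) (bop_inv (P z))) (d_z P z))
                  (d_zbar (d_z P) z)).

End Calculus.

Definition open_disc (z0 : C) (r : R) (z : C) : Prop := Cmod (z - z0) < r.
Definition closed_disc (z0 : C) (r : R) (z : C) : Prop := Cmod (z - z0) <= r.

Definition circle (z0 : C) (r t : R) : C :=
  Cplus z0 (Cmult (RtoC r) (cos t, sin t)).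

Definition circle' (r t : R) : C :=
  Cmult (Cmult Ci (RtoC r)) (cos t, sin t).

Section Averages.

Context {V : HilbertSpace}.
Implicit Types Q P H : C -> BOp V.

(* The average [1 / (2 pi r)] times the integral over the circle of [Q] against
   the (scalar) measure [w t dt] in the parametrization [circle z0 r]. *)
Definition circle_avg (w : R -> C) Q (z0 : C) (r : R) : BOp V :=
  scal (RtoC (/ (2 * PI * r)))
    (RInt (V := BOp_R_CompleteNormedModule V)
       (fun t => scal (w t) (Q (circle z0 r t))) 0 (2 * PI)).

Definition avg_abs_dz Q (z0 : C) (r : R) : BOp V :=
  circle_avg (fun _ => RtoC r) Q z0 r.

Definition avg_dz Q (z0 : C) (r : R) : BOp V :=
  circle_avg (fun t => circle' r t) Q z0 r.

Definition avg_dzbar Q (z0 : C) (r : R) : BOp V :=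
  circle_avg (fun t => Cconj (circle' r t)) Q z0 r.

Definition frakS Q (z0 : C) (r : R) : BOp V :=
  minus (avg_abs_dz Q z0 r)
    (mult (mult (avg_dz Q z0 r) (bop_inv (avg_abs_dz Q z0 r)))
       (avg_dzbar Q z0 r)).

Definition admissible (z0 : C) (r : R) H : Prop :=
  (forall z, closed_disc z0 r z -> invertible (H z)) /\
  continuous_on (closed_disc z0 r) H /\
  (forall z, open_disc z0 r z -> ex_derive (K := C_AbsRing) H z).

Definition frakS_twist P (z0 : C) (r : R) H : BOp V :=
  mult (mult (bop_inv (adj (H z0)))
          (frakS (fun z => mult (mult (adj (H z)) (P z)) (H z)) z0 r))
    (bop_inv (H z0)).

Definition is_frakT P (z0 : C) (r : R) (T : BOp V) : Prop :=
  (exists H, admissible z0 r H /\ T = frakS_twist P z0 r H) /\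
  (forall H, admissible z0 r H -> bop_le T (frakS_twist P z0 r H)).

End Averages.

(* Main.v *)
(* With H normalized to 1 at z0, the quadratic form of T(P, z0, r) at v is the minimum of
   the average of <P F, F> over the circle, F ranging over holomorphic fields with F(z0) = v.

   Semipositive curvature implies the inequality: on the circle P factors as H^* P H = T with H
   holomorphic and invertible, H(z0) = 1 and T constant. Indeed the Fourier coefficients
   of H solve a Toeplitz equation in which 1 - tau P is a contraction, so that P H has
   no positive frequencies and Y = (P H)^* is the boundary value of a holomorphic function;
   Y H is then holomorphic and self-adjoint on the circle, hence constant. The constant T is the
   minimum, and comparing P^-1 with local holomorphic fields shows that
   <P^-1 Y^* w, Y^* w> is subharmonic, with boundary values <T w, w>; its value at z0
   gives T P(z0)^-1 T <= T, that is, T <= P(z0).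

   Conversely, the averages of <P g, g> over small circles, g(w) = v - (w - z) P^-1 P_z v,
   expand as <P v, v> - r^2 <curvature v, v> + o(r^2), and no holomorphic field does
   better to this order. *)

(* The main obstacle is the regularity of [H]. The Toeplitz equation, h = 1 + (positive frequencies
   of E h) with E = 1 - tau P, is solved by a contraction for square-summable coefficients, whereas
   admissibility asks for norm continuity on the closed disc. Differentiating the equation twice
   along the circle, where the C^2 hypothesis enters, bounds k^2 times the k-th coefficient, so that
   the power series converge uniformly. All estimates are made on trigonometric polynomials, one
   vector at a time, so that no space of square-integrable functions has to be built. A second
   obstacle is that Y H = T only provides a left inverse of H, which in infinite dimension need not
   be a right inverse. But then 1 - H T^-1 Y is a continuous family of idempotents vanishing at the
   centre, hence everywhere. In the converse direction the affine field g is chosen so that P g is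
   antiholomorphic to first order. A holomorphic perturbation vanishing at the centre then pairs to
   zero with it on average, up to an error that its own energy absorbs. *)
Require Import Defs.
From Stdlib Require Import Reals ZArith Lra Lia Psatz ClassicalEpsilon FunctionalExtensionality.
From Coquelicot Require Import Coquelicot.
Import Defs.
Open Scope R_scope.

(** * Hilbert space geometry *)

Ltac ceq := unfold Re, Im in *; apply injective_projections; simpl; try ring.

Section Inner.
Context {V : HilbertSpace}.
Implicit Types u v w : V.

Lemma vnorm_eq_0 u : norm u = 0 -> u = zero.
Proof. exact (@norm_eq_zero C_AbsRing V u). Qed.
Lemma vnorm_zero : norm (@zero V) = 0.
Proof. exact (@norm_zero C_AbsRing V). Qed.
Lemma vnorm_ge_0 u : 0 <= norm u.
Proof. exact (@norm_ge_0 C_AbsRing V u). Qed.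
Lemma vnorm_triangle u v : norm (plus u v) <= norm u + norm v.
Proof. exact (@norm_triangle C_AbsRing V u v). Qed.
Lemma vnorm_opp u : norm (opp u) = norm u.
Proof. exact (@norm_opp C_AbsRing V u). Qed.

Lemma inner_plus_r u v w : inner u (plus v w) = Cplus (inner u v) (inner u w).
Proof.
  rewrite inner_conj, inner_plus_l, Cplus_conj, <- !inner_conj. reflexivity.
Qed.

Lemma inner_scal_r (a : C) u w : inner u (scal a w) = Cmult (Cconj a) (inner u w).
Proof.
  rewrite inner_conj, inner_scal_l, Cmult_conj, <- inner_conj. reflexivity.
Qed.

Lemma opp_scal u : opp u = scal (RtoC (-1)) u.
Proof.
  etransitivity; [symmetry; apply (@scal_opp_one C_Ring V u)|].
  f_equal. unfold opp, one, RtoC; simpl. unfold Copp; simpl. f_equal; ring.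
Qed.

Lemma inner_opp_l u w : inner (opp u) w = Copp (inner u w).
Proof. rewrite opp_scal, inner_scal_l. ceq. Qed.

Lemma inner_opp_r u w : inner u (opp w) = Copp (inner u w).
Proof.
  rewrite inner_conj, inner_opp_l, Copp_conj, <- inner_conj. reflexivity.
Qed.

Lemma inner_minus_l u v w : inner (minus u v) w = Cminus (inner u w) (inner v w).
Proof. unfold minus. rewrite inner_plus_l, inner_opp_l. reflexivity. Qed.

Lemma inner_minus_r u v w : inner u (minus v w) = Cminus (inner u v) (inner u w).
Proof. unfold minus. rewrite inner_plus_r, inner_opp_r. reflexivity. Qed.

Lemma inner_zero_l w : inner zero w = RtoC 0.
Proof.
  transitivity (inner (plus w (opp w)) w).
  - f_equal. symmetry. apply (@plus_opp_r V).
  - rewrite inner_plus_l, inner_opp_l. ring.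
Qed.

Lemma inner_zero_r w : inner w zero = RtoC 0.
Proof. rewrite inner_conj, inner_zero_l. unfold Cconj, RtoC; simpl. f_equal; ring. Qed.

Lemma norm_sq_inner u : norm u ^ 2 = Re (inner u u).
Proof. rewrite inner_norm. reflexivity. Qed.

Lemma inner_eq_0 u : inner u u = RtoC 0 -> u = zero.
Proof.
  intros H. apply vnorm_eq_0. pose proof (norm_sq_inner u) as E. rewrite H in E.
  simpl in E. pose proof (vnorm_ge_0 u). nra.
Qed.

Lemma minus_zero_eq u v : minus u v = zero -> u = v.
Proof.
  intros E. apply (plus_reg_r (opp v)).
  etransitivity; [exact E|]. symmetry. apply (@plus_opp_r V).
Qed.

Lemma inner_ext u v : (forall w, inner u w = inner v w) -> u = v.
Proof.
  intros H. apply minus_zero_eq, inner_eq_0.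
  rewrite inner_minus_l, H. ring.
Qed.

Lemma inner_conj_re u v : Re (inner v u) = Re (inner u v).
Proof. rewrite inner_conj. reflexivity. Qed.

Lemma inner_conj_im u v : Im (inner v u) = - Im (inner u v).
Proof. rewrite inner_conj. reflexivity. Qed.

Lemma norm_sq_plus u v :
  norm (plus u v) ^ 2 = norm u ^ 2 + 2 * Re (inner u v) + norm v ^ 2.
Proof.
  rewrite !norm_sq_inner, !inner_plus_l, !inner_plus_r.
  pose proof (inner_conj_re u v) as E. unfold Re in *; simpl. rewrite E. ring.
Qed.

Lemma norm_sq_minus u v :
  norm (minus u v) ^ 2 = norm u ^ 2 - 2 * Re (inner u v) + norm v ^ 2.
Proof.
  rewrite !norm_sq_inner, !inner_minus_l, !inner_minus_r.
  pose proof (inner_conj_re u v) as E. unfold Re in *; simpl. rewrite E. ring.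
Qed.

(** The axioms of a normed module give only an inequality; equality comes from the inner product. *)
Lemma norm_scal_C (a : C) u : norm (scal a u) = Cmod a * norm u.
Proof.
  assert (norm (scal a u) ^ 2 = (Cmod a * norm u) ^ 2) as E.
  { rewrite norm_sq_inner, inner_scal_l, inner_scal_r, inner_norm.
    rewrite Rpow_mult_distr, Cmod2_alt. unfold Re, Im, RtoC; simpl. ring. }
  pose proof (vnorm_ge_0 (scal a u)). pose proof (vnorm_ge_0 u).
  pose proof (Cmod_ge_0 a).
  apply Rsqr_inj; [assumption| apply Rmult_le_pos; assumption|].
  unfold Rsqr. simpl in E. lra.
Qed.

Lemma re_inner_le u v : Re (inner u v) <= norm u * norm v.
Proof.
  pose proof (vnorm_ge_0 u) as Hu. pose proof (vnorm_ge_0 v) as Hv.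
  destruct (Req_dec (norm v) 0) as [E|E].
  { apply vnorm_eq_0 in E. subst v. rewrite inner_zero_r, vnorm_zero. simpl. lra. }
  destruct (Req_dec (norm u) 0) as [E'|E'].
  { apply vnorm_eq_0 in E'. subst u. rewrite inner_zero_l, vnorm_zero. simpl. lra. }
  (* The two vectors are scaled to equal length; the square of their distance is then 2 |u| |v| (|u|
     |v| - Re <u, v>). *)
  pose proof (norm_sq_minus (scal (RtoC (norm v)) u) (scal (RtoC (norm u)) v)) as H.
  rewrite !norm_scal_C, !Cmod_R, !Rabs_pos_eq in H by assumption.
  rewrite inner_scal_l, inner_scal_r in H.
  replace (Re (norm v * (Cconj (norm u) * inner u v))%C)
    with (norm u * norm v * Re (inner u v)) in H
    by (unfold Re, Cconj, RtoC; simpl; ring).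
  match type of H with ?a = _ => assert (H0 : 0 <= a) by apply pow2_ge_0 end.
  rewrite H in H0. assert (0 < norm u * norm v) by (apply Rmult_lt_0_compat; lra).
  apply Rmult_le_reg_l with (norm u * norm v); [assumption|].
  nra.
Qed.

(** Multiplying u by the conjugate of <u, v> makes the inner product real and nonnegative, which
    reduces to [re_inner_le]. *)
Lemma inner_le u v : Cmod (inner u v) <= norm u * norm v.
Proof.
  destruct (Req_dec (Cmod (inner u v)) 0) as [E|E].
  { rewrite E. apply Rmult_le_pos; apply vnorm_ge_0. }
  set (a := inner u v) in *.
  pose proof (re_inner_le (scal (Cconj a) u) v) as H.
  rewrite norm_scal_C, Cmod_conj, inner_scal_l in H. fold a in H.
  replace (Re (Cconj a * a)%C) with (Cmod a * Cmod a) in H.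
  2:{ pose proof (Cmod2_alt a) as Ea. simpl in Ea. unfold Re, Im, Cconj in *; simpl in *. nra. }
  pose proof (Cmod_ge_0 a). apply Rmult_le_reg_l with (Cmod a); [lra|]. lra.
Qed.

Lemma re_inner_ge u v : - (norm u * norm v) <= Re (inner u v).
Proof.
  pose proof (inner_le u v). pose proof (re_le_Cmod (inner u v)) as H1.
  unfold Rabs in H1; destruct (Rcase_abs _) in H1; lra.
Qed.

Lemma norm_le_inner u (M : R) : 0 <= M ->
  Re (inner u u) <= M * norm u -> norm u <= M.
Proof.
  intros HM H. rewrite <- norm_sq_inner in H. pose proof (vnorm_ge_0 u).
  destruct (Req_dec (norm u) 0) as [E|E]; [lra|].
  apply Rmult_le_reg_r with (norm u); [lra|]. simpl in H. lra.
Qed.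

End Inner.

(** * Riesz representation *)

Section Riesz.
Context {V : HilbertSpace}.
Implicit Types (x y e u v : V).
Variable phi : V -> C.
Hypothesis phi_plus : forall u v, phi (plus u v) = Cplus (phi u) (phi v).
Hypothesis phi_scal : forall (a : C) u, phi (scal a u) = Cmult a (phi u).
Variable M : R.
Hypothesis phi_bound : forall u, Cmod (phi u) <= M * norm u.

(** The variational functional of Riesz: its derivative at x in the direction e is 2 (Re <x, e> - Re
    phi(e)), so a minimiser represents Re phi. *)
Let J (x : V) : R := norm x ^ 2 - 2 * Re (phi x).

Lemma riesz_expand x e (t : R) :
  J (plus x (scal (RtoC t) e)) =
  J x + 2 * t * (Re (inner x e) - Re (phi e)) + t ^ 2 * norm e ^ 2.
Proof.
  unfold J. rewrite norm_sq_plus, norm_scal_C, Cmod_R, phi_plus, phi_scal, inner_scal_r.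
  rewrite Rpow_mult_distr, pow2_abs. unfold Re; simpl. ring.
Qed.

Lemma riesz_lower x : - M ^ 2 <= J x.
Proof.
  unfold J. pose proof (phi_bound x) as H. pose proof (re_le_Cmod (phi x)) as H1.
  apply Rabs_le_between in H1. pose proof (pow2_ge_0 (norm x - M)). lra.
Qed.

Lemma riesz_parallelogram x y :
  norm (minus x y) ^ 2 =
  2 * J x + 2 * J y - 4 * J (scal (RtoC (1/2)) (plus x y)).
Proof.
  unfold J. rewrite norm_sq_minus, norm_scal_C, Rpow_mult_distr, norm_sq_plus, Cmod_R,
    phi_scal, phi_plus, pow2_abs. unfold Re; simpl. field.
Qed.

(** A minimising sequence is Cauchy by the parallelogram identity, because J at a midpoint cannot go
    below the infimum. *)
Lemma riesz_minimizer : exists y : V, forall x, J y <= J x.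
Proof.
  destruct (completeness (fun s => exists x, s = - J x)) as [d [Hub Hlub]].
  { exists (M ^ 2). intros s [x ->]. pose proof (riesz_lower x). lra. }
  { exists (- J zero). exists zero. reflexivity. }
  assert (HJ : forall x, - d <= J x).
  { intros x. assert (- J x <= d) by (apply Hub; exists x; reflexivity). lra. }
  assert (Hex : forall n : nat, exists x, J x < - d + / (INR n + 1)).
  { intros n. apply NNPP. intros Hn.
    assert (d <= d - / (INR n + 1)).
    { apply Hlub. intros s [x ->]. apply Rnot_lt_le. intros Hx. apply Hn. exists x. lra. }
    pose proof (RinvN_pos n). lra. }
  pose (xs := fun n => proj1_sig (constructive_indefinite_description _ (Hex n))).
  assert (Hxs : forall n, J (xs n) < - d + / (INR n + 1)).
  { intros n. unfold xs. apply (proj2_sig (constructive_indefinite_description _ (Hex n))). }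
  assert (Hc : exists y : V, filterlim xs eventually (locally y)).
  { apply (filterlim_locally_cauchy (U := CompleteNormedModule.CompleteSpace C_AbsRing V)).
    intros eps. assert (He : 0 < eps ^ 2 / 4) by (pose proof (cond_pos eps); nra).
    destruct (nfloor_ex (/ (eps ^ 2 / 4))) as [N [HN1 HN2]].
    { left; apply Rinv_0_lt_compat; assumption. }
    assert (Hinv : / (INR N + 1) < eps ^ 2 / 4).
    { rewrite <- (Rinv_inv (eps ^ 2 / 4)). apply Rinv_lt_contravar; [|assumption].
      apply Rmult_lt_0_compat; [apply Rinv_0_lt_compat; assumption|].
      pose proof (pos_INR N). lra. }
    exists (fun n => (N <= n)%nat). split; [exists N; auto|].
    intros n m Hn Hm. apply (@norm_compat1 C_AbsRing V).
    assert (Hb : forall k, (N <= k)%nat -> J (xs k) < - d + eps ^ 2 / 4).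
    { intros k Hk. eapply Rlt_trans; [apply Hxs|]. apply Rplus_lt_compat_l.
      eapply Rle_lt_trans; [|exact Hinv]. apply Rinv_le_contravar.
      - pose proof (pos_INR N); lra.
      - apply le_INR in Hk. lra. }
    pose proof (riesz_parallelogram (xs m) (xs n)) as Hp.
    pose proof (HJ (scal (RtoC (1/2)) (plus (xs m) (xs n)))).
    pose proof (Hb n Hn). pose proof (Hb m Hm).
    assert (norm (minus (xs m) (xs n)) ^ 2 < eps ^ 2) by lra.
    apply Rnot_le_lt. intros Hle. pose proof (cond_pos eps).
    assert (eps ^ 2 <= norm (minus (xs m) (xs n)) ^ 2) by (apply pow_incr; split; [lra| exact Hle]).
    lra. }
  destruct Hc as [y Hy]. exists y. intros x.
  apply Rle_trans with (- d); [|apply HJ].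
  apply le_epsilon. intros eps Heps.
  (* Expanding J at the limit y, the terms linear in e = xs n - y are at most 2 (|y| + |M|) |e|,
     which is below K |e|. *)
  set (K := 2 * (norm y + Rabs M) + 1).
  assert (HK : 0 < K) by (unfold K; pose proof (vnorm_ge_0 y); pose proof (Rabs_pos M); lra).
  assert (Hd : 0 < Rmin 1 (eps / 2 / K)).
  { apply Rmin_pos; [lra|]. apply Rdiv_lt_0_compat; lra. }
  pose proof (proj1 (filterlim_locally_ball_norm (K := C_AbsRing) (U := CompleteNormedModule.NormedModule C_AbsRing V) xs y) Hy (mkposreal _ Hd)) as Hn.
  destruct Hn as [N HN].
  destruct (nfloor_ex (/ (eps / 2))) as [N2 [HN1 HN2]].
  { left; apply Rinv_0_lt_compat; lra. }
  set (n := max N N2).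
  specialize (HN n (Nat.le_max_l _ _)). unfold ball_norm in HN. simpl in HN.
  set (e := minus (xs n) y) in *.
  assert (Ex : xs n = plus y (scal (RtoC 1) e)).
  { apply inner_ext. intros w. unfold e. rewrite inner_plus_l, inner_scal_l, inner_minus_l. ring. }
  pose proof (Hxs n) as H1. rewrite Ex, riesz_expand in H1.
  pose proof (re_inner_ge y e). pose proof (phi_bound e). pose proof (re_le_Cmod (phi e)) as H3.
  apply Rabs_le_between in H3.
  assert (Hn2 : / (INR n + 1) < eps / 2).
  { rewrite <- (Rinv_inv (eps / 2)). apply Rinv_lt_contravar.
    - apply Rmult_lt_0_compat; [apply Rinv_0_lt_compat; lra| pose proof (pos_INR n); lra].
    - eapply Rlt_le_trans; [exact HN2|]. apply Rplus_le_compat_r, le_INR. apply Nat.le_max_r. }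
  assert (HN' : norm e < Rmin 1 (eps / 2 / K)) by exact HN.
  pose proof (Rmin_r 1 (eps / 2 / K)) as Hmin.
  assert (He2 : K * norm e <= eps / 2).
  { replace (eps / 2) with (K * (eps / 2 / K)) by (field; lra).
    apply Rmult_le_compat_l; lra. }
  pose proof (vnorm_ge_0 e). pose proof (Rle_abs M). pose proof (pow2_ge_0 (norm e)).
  assert (M * norm e <= Rabs M * norm e) by (apply Rmult_le_compat_r; assumption).
  unfold K in He2. lra.
Qed.

Lemma riesz : exists y : V, forall x, phi x = inner x y.
Proof.
  destruct riesz_minimizer as [y Hy]. exists y.
  assert (HR : forall x, Re (phi x) = Re (inner x y)).
  { intros h. set (a := Re (inner y h) - Re (phi h)).
    rewrite inner_conj_re. apply Rminus_diag_uniq_sym. fold a.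
    (* The optimal step would be -a / |h|^2; the added 1 keeps -a / b defined for h = 0 and still
       lowers J by a^2 (b + 1) / b^2. *)
    set (b := norm h ^ 2 + 1). assert (Hb : 0 < b) by (unfold b; pose proof (pow2_ge_0 (norm h)); lra).
    pose proof (Hy (plus y (scal (RtoC (- a / b)) h))) as H. rewrite riesz_expand in H.
    fold a in H.
    assert (H2 : a * a * (b + 1) <= 0).
    { apply Rmult_le_reg_r with (/ (b * b)); [apply Rinv_0_lt_compat; nra|].
      replace (norm h ^ 2) with (b - 1) in H by (unfold b; ring).
      replace (a * a * (b + 1) * / (b * b)) with
        (- (2 * (- a / b) * a + (- a / b) ^ 2 * (b - 1))) by (field; lra). lra. }
    nra. }
  intros x. apply injective_projections; [apply HR|].
  pose proof (HR (scal Ci x)) as H. rewrite phi_scal, inner_scal_l in H.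
  unfold Re in H; simpl in H. lra.
Qed.

End Riesz.

(** * Bounded operators *)

Section OpBasics.
Context {V : HilbertSpace}.
Implicit Types (u v w : V) (A B E : BOp V).

Lemma app_plus A B v : (plus A B : BOp V) v = plus (A v : V) (B v).
Proof. reflexivity. Qed.
Lemma app_opp A v : (opp A : BOp V) v = opp (A v : V).
Proof. reflexivity. Qed.
Lemma app_minus A B v : (minus A B : BOp V) v = minus (A v : V) (B v).
Proof. reflexivity. Qed.
Lemma app_scal (a : C) A v : (scal a A : BOp V) v = scal a (A v : V).
Proof. reflexivity. Qed.
Lemma app_mult A B v : (mult A B : BOp V) v = A (B v).
Proof. reflexivity. Qed.
Lemma app_one v : (one : BOp V) v = v.
Proof. reflexivity. Qed.
Lemma app_zero v : (zero : BOp V) v = (zero : V).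
Proof. reflexivity. Qed.

Lemma lin_plus A u v : A (plus u v) = plus (A u : V) (A v).
Proof. exact (linear_plus A (bop_linear A) u v). Qed.
Lemma lin_scal A (a : C) u : A (scal a u) = scal a (A u : V).
Proof. exact (linear_scal A (bop_linear A) a u). Qed.
Lemma lin_opp A u : A (opp u) = opp (A u : V).
Proof. rewrite (opp_scal u), (opp_scal (A u)). apply lin_scal. Qed.
Lemma lin_minus A u v : A (minus u v) = minus (A u : V) (A v).
Proof. unfold minus. rewrite lin_plus, lin_opp. reflexivity. Qed.

Lemma op_ext_inner A B :
  (forall u w, inner (A u) w = inner (B u) w) -> A = B.
Proof. intros H. apply bop_ext. intros v. apply inner_ext. apply H. Qed.

Lemma bop_norm_mult A B : bop_norm (mult A B) <= bop_norm A * bop_norm B.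
Proof.
  apply bop_norm_le.
  - apply Rmult_le_pos; apply bop_norm_ge_0.
  - intros v. change (norm (A (B v)) <= bop_norm A * bop_norm B * norm v).
    eapply Rle_trans; [apply bop_norm_bound|]. rewrite Rmult_assoc.
    apply Rmult_le_compat_l; [apply bop_norm_ge_0|apply bop_norm_bound].
Qed.

Lemma bop_norm_one : bop_norm (one : BOp V) <= 1.
Proof. apply bop_norm_le; [lra|]. intros v. change (norm v <= 1 * norm v). lra. Qed.

Lemma bop_norm_opp A : bop_norm (opp A) = bop_norm A.
Proof.
  assert (H : forall B : BOp V, bop_norm (opp B) <= bop_norm B).
  { intros B. apply bop_norm_le; [apply bop_norm_ge_0|]. intros v.
    rewrite app_opp, vnorm_opp. apply bop_norm_bound. }
  apply Rle_antisym; [apply H|]. rewrite <- (opp_opp A) at 1. apply H.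
Qed.

Lemma bop_norm_minus_le A B : bop_norm (minus A B) <= bop_norm A + bop_norm B.
Proof.
  unfold minus. eapply Rle_trans; [apply bop_norm_triangle|].
  right. f_equal. apply bop_norm_opp.
Qed.

Lemma bop_norm_dist A B : bop_norm A <= bop_norm B + bop_norm (minus A B).
Proof.
  replace A with (plus B (minus A B)) at 1; [apply bop_norm_triangle|].
  apply op_ext_inner. intros u w.
  rewrite app_plus, app_minus, inner_plus_l, inner_minus_l. ring.
Qed.

Lemma inner_op_le A u w : Cmod (inner (A u) w) <= bop_norm A * norm u * norm w.
Proof.
  eapply Rle_trans; [apply inner_le|].
  apply Rmult_le_compat_r; [apply vnorm_ge_0|apply bop_norm_bound].
Qed.

(** The Riesz vector of x -> <A x, v> is chosen for each v; its linearity in v follows from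
    uniqueness. *)
Lemma is_adjoint_exists A : exists B, is_adjoint A B.
Proof.
  assert (H : forall v, exists y, forall x : V, inner (A x) v = inner x y).
  { intros v. apply (riesz (fun x => inner (A x) v)) with (M := bop_norm A * norm v).
    - intros x y. rewrite lin_plus, inner_plus_l. reflexivity.
    - intros a x. rewrite lin_scal, inner_scal_l. reflexivity.
    - intros x. eapply Rle_trans; [apply inner_op_le|]. lra. }
  pose (b := fun v => proj1_sig (constructive_indefinite_description _ (H v))).
  assert (Hb : forall v x, inner (A x) v = inner x (b v)).
  { intros v. unfold b. apply (proj2_sig (constructive_indefinite_description _ (H v))). }
  assert (Hb' : forall v x, inner (b v) x = inner v (A x)).
  { intros v x. rewrite inner_conj, <- Hb, <- inner_conj. reflexivity. }
  assert (Hl : @is_linear C_AbsRing V V b).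
  { split.
    - intros x y. apply inner_ext. intros w.
      rewrite inner_plus_l, !Hb', inner_plus_l. reflexivity.
    - intros a x. apply inner_ext. intros w.
      change (inner (b (scal a x)) w = inner (scal a (b x)) w).
      rewrite inner_scal_l, !Hb', inner_scal_l. reflexivity.
    - exists (bop_norm A + 1). pose proof (bop_norm_ge_0 A). split; [lra|].
      intros x. apply norm_le_inner.
      + apply Rmult_le_pos; [lra|apply vnorm_ge_0].
      + rewrite Hb'. eapply Rle_trans; [apply re_inner_le|].
        pose proof (bop_norm_bound A (b x)). pose proof (vnorm_ge_0 x).
        pose proof (vnorm_ge_0 (b x)).
        change (norm x * norm (A (b x)) <= (bop_norm A + 1) * norm x * norm (b x)).
        assert (norm x * norm (A (b x)) <= norm x * (bop_norm A * norm (b x)))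
          by (apply Rmult_le_compat_l; assumption).
        assert (0 <= norm x * norm (b x)) by (apply Rmult_le_pos; assumption).
        lra. }
  exists (mkBOp b Hl). intros u v. apply Hb.
Qed.

Lemma inner_adj_r A u v : inner (A u) v = inner u (adj A v).
Proof. exact (epsilon_spec (inhabits zero) (is_adjoint A) (is_adjoint_exists A) u v). Qed.

Lemma inner_adj_l A u v : inner (adj A u) v = inner u (A v).
Proof. rewrite inner_conj, <- inner_adj_r, <- inner_conj. reflexivity. Qed.

Lemma adj_unique A B : is_adjoint A B -> adj A = B.
Proof.
  intros H. apply op_ext_inner. intros u w. rewrite inner_adj_l.
  rewrite inner_conj, H, <- inner_conj. reflexivity.
Qed.

Lemma adj_minus A B : adj (minus A B) = minus (adj A) (adj B).
Proof.
  apply adj_unique. intros u v.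
  rewrite !app_minus, inner_minus_l, inner_minus_r, !inner_adj_r. reflexivity.
Qed.

Lemma adj_mult A B : adj (mult A B) = mult (adj B) (adj A).
Proof.
  apply adj_unique. intros u v. rewrite !app_mult, !inner_adj_r. reflexivity.
Qed.

Lemma adj_one : adj (one : BOp V) = one.
Proof. apply adj_unique. intros u v. reflexivity. Qed.

Lemma bop_norm_adj_le A : bop_norm (adj A) <= bop_norm A.
Proof.
  apply bop_norm_le; [apply bop_norm_ge_0|]. intros v.
  apply norm_le_inner.
  - apply Rmult_le_pos; [apply bop_norm_ge_0|apply vnorm_ge_0].
  - rewrite inner_adj_l. eapply Rle_trans; [apply re_inner_le|].
    pose proof (bop_norm_bound A (adj A v)). pose proof (vnorm_ge_0 v).
    rewrite Rmult_assoc. rewrite (Rmult_comm (bop_norm A)), Rmult_assoc.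
    apply Rmult_le_compat_l; [assumption|]. rewrite Rmult_comm. assumption.
Qed.

(** Polarisation over the complex numbers: the vectors u + w and u + i w recover the real and
    imaginary parts of <A u, w>. *)
Lemma op_ext_quad A B :
  (forall v, inner (A v) v = inner (B v) v) -> A = B.
Proof.
  intros H. apply op_ext_inner. intros u w.
  pose proof (H (plus u w)) as H1. pose proof (H (plus u (scal Ci w))) as H2.
  pose proof (H u) as H3. pose proof (H w) as H4.
  rewrite !lin_plus, !inner_plus_l, !inner_plus_r, H3, H4 in H1.
  rewrite !lin_plus, !lin_scal, !inner_plus_l, !inner_plus_r, !inner_scal_l,
    !inner_scal_r, H3, H4 in H2.
  apply (f_equal fst) in H1 as H1a. apply (f_equal snd) in H1 as H1b.
  apply (f_equal fst) in H2 as H2a. apply (f_equal snd) in H2 as H2b.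
  simpl in *. apply injective_projections; lra.
Qed.

Lemma bop_inv_spec A : invertible A -> is_inverse A (bop_inv A).
Proof. intros H. apply (epsilon_spec (inhabits zero) (is_inverse A) H). Qed.

Lemma bop_inv_app_l A v : invertible A -> bop_inv A (A v) = v.
Proof.
  intros H. destruct (bop_inv_spec A H) as [_ H2].
  change (bop_inv A (A v)) with ((mult (bop_inv A) A : BOp V) v). rewrite H2. reflexivity.
Qed.

Lemma bop_inv_app_r A v : invertible A -> A (bop_inv A v) = v.
Proof.
  intros H. destruct (bop_inv_spec A H) as [H1 _].
  change (A (bop_inv A v)) with ((mult A (bop_inv A) : BOp V) v). rewrite H1. reflexivity.
Qed.

Lemma bop_inv_unique A B : is_inverse A B -> bop_inv A = B.
Proof.
  intros H. apply bop_ext. intros v.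
  assert (HA : invertible A) by (exists B; exact H).
  rewrite <- (bop_inv_app_l A (B v) HA).
  f_equal. destruct H as [H _]. change (A (B v)) with ((mult A B : BOp V) v).
  rewrite H. reflexivity.
Qed.

Lemma nonneg_sym A u v : nonneg A -> inner (A u) v = inner u (A v).
Proof. intros [H _]. rewrite inner_adj_r, H. reflexivity. Qed.

Lemma nonneg_im A v : nonneg A -> Im (inner (A v) v) = 0.
Proof.
  intros H. pose proof (nonneg_sym A v v H) as E.
  pose proof (inner_conj_im v (A v)) as E2. rewrite E in *. lra.
Qed.

Lemma selfadj_of_quad_real A : (forall v, Im (inner (A v) v) = 0) -> adj A = A.
Proof.
  intros H. apply op_ext_quad. intros v. rewrite inner_adj_l.
  apply injective_projections.
  - apply inner_conj_re.
  - pose proof (H v). pose proof (inner_conj_im (A v) v). unfold Im in *. lra.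
Qed.

(** Nonnegativity of A is tested on u - N^-1 A u, for every positive N above the norm. Letting N
    decrease to the norm covers the case where the norm is zero. *)
Lemma nonneg_norm_sq A u : nonneg A -> norm (A u) ^ 2 <= bop_norm A * Re (inner (A u) u).
Proof.
  intros HA.
  assert (Hs : forall N, 0 < N -> bop_norm A <= N -> norm (A u) ^ 2 <= N * Re (inner (A u) u)).
  { intros N HN HAN.
    pose proof (proj2 HA (minus u (scal (RtoC (/ N)) (A u : V)))) as H.
    rewrite lin_minus, lin_scal, inner_minus_l, !inner_minus_r, !inner_scal_r, !inner_scal_l in H.
    rewrite (nonneg_sym A (A u) u HA), inner_norm in H.
    pose proof (re_inner_le (A (A u)) (A u)) as H1.
    pose proof (bop_norm_bound A (A u)) as H2. pose proof (vnorm_ge_0 (A u)) as H0.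
    assert (H3 : Re (inner (A (A u)) (A u)) <= N * norm (A u) ^ 2).
    { change (norm (A (A u)) <= bop_norm A * norm (A u)) in H2.
      assert (norm (A (A u)) <= N * norm (A u)).
      { eapply Rle_trans; [exact H2|]. apply Rmult_le_compat_r; assumption. }
      simpl. nra. }
    match type of H with 0 <= ?a => replace a with
      (Re (inner (A u) u) - 2 * / N * norm (A u) ^ 2
       + / N * / N * Re (inner (A (A u)) (A u))) in H end.
    2:{ unfold Re, Cconj, RtoC; simpl. ring. }
    assert (Hi : 0 < / N) by (apply Rinv_0_lt_compat; assumption).
    assert (H4 : / N * / N * Re (inner (A (A u)) (A u)) <= / N * / N * (N * norm (A u) ^ 2))
      by (apply Rmult_le_compat_l; [nra|assumption]).
    replace (/ N * / N * (N * norm (A u) ^ 2)) with (/ N * norm (A u) ^ 2) in H4 by (field; lra).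
    apply Rmult_le_reg_l with (/ N); [assumption|].
    rewrite <- Rmult_assoc, Rinv_l by lra. lra. }
  apply le_epsilon. intros eps Heps. pose proof (proj2 HA u) as Hq.
  pose proof (bop_norm_ge_0 A).
  set (q := Re (inner (A u) u)) in *.
  assert (Hd : 0 < eps / (q + 1)) by (apply Rdiv_lt_0_compat; lra).
  eapply Rle_trans; [apply (Hs (bop_norm A + eps / (q + 1))); lra|].
  rewrite Rmult_plus_distr_r. apply Rplus_le_compat_l.
  apply Rmult_le_reg_r with (q + 1); [lra|].
  replace (eps / (q + 1) * q * (q + 1)) with (eps * q) by (field; lra). nra.
Qed.

Lemma nonneg_bop_inv A : pos_invertible A -> nonneg (bop_inv A).
Proof.
  intros [HA Hi]. split.
  - apply adj_unique. intros u v.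
    rewrite <- (bop_inv_app_r A v Hi) at 1. rewrite <- (nonneg_sym A _ _ HA).
    rewrite bop_inv_app_r by exact Hi. reflexivity.
  - intros v. rewrite <- (bop_inv_app_r A v Hi) at 2.
    rewrite inner_conj_re. apply (proj2 HA).
Qed.

(** This is [nonneg_norm_sq] for the inverse, at the vector A v. It makes a positive invertible
    operator coercive. *)
Lemma pos_invertible_lower A v : pos_invertible A ->
  norm v ^ 2 <= bop_norm (bop_inv A) * Re (inner (A v) v).
Proof.
  intros HA. pose proof (nonneg_norm_sq (bop_inv A) (A v) (nonneg_bop_inv A HA)) as H.
  rewrite !bop_inv_app_l in H by apply HA. rewrite inner_conj_re in H. exact H.
Qed.

(** With step tau the square of the left side is at most (1 - 2 tau c + tau^2 N^2) |v|^2, and tau =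
    c / N^2 minimises this factor, giving 1 - (c / N)^2. *)
Lemma coercive_contraction A (c N : R) v : 0 < c <= N ->
  c * norm v ^ 2 <= Re (inner (A v) v) -> norm (A v) <= N * norm v ->
  norm (minus v (scal (RtoC (c / N ^ 2)) (A v : V))) <= sqrt (1 - (c / N) ^ 2) * norm v.
Proof.
  intros Hc H1 H2.
  assert (HcN : 0 < c / N <= 1).
  { split; [apply Rdiv_lt_0_compat; lra|]. apply Rle_div_l; lra. }
  apply Rsqr_incr_0; [|apply vnorm_ge_0|apply Rmult_le_pos; [apply sqrt_pos|apply vnorm_ge_0]].
  rewrite Rsqr_mult, Rsqr_sqrt by nra. rewrite !Rsqr_pow2.
  rewrite norm_sq_minus, norm_scal_C, inner_scal_r, Cmod_R.
  rewrite Rpow_mult_distr, pow2_abs.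
  replace (Re (Cconj (RtoC (c / N ^ 2)) * inner v (A v))%C)
    with (c / N ^ 2 * Re (inner (A v) v)).
  2:{ rewrite (inner_conj_re v (A v)). unfold Re; simpl; ring. }
  pose proof (vnorm_ge_0 (A v)). pose proof (vnorm_ge_0 v).
  assert (H3 : norm (A v) ^ 2 <= N ^ 2 * norm v ^ 2).
  { rewrite <- Rpow_mult_distr. apply pow_incr. split; assumption. }
  assert (Hk : 0 < c / N ^ 2) by (apply Rdiv_lt_0_compat; nra).
  assert (H4 : c / N ^ 2 * (c * norm v ^ 2) <= c / N ^ 2 * Re (inner (A v) v))
    by (apply Rmult_le_compat_l; lra).
  assert (H5 : (c / N ^ 2) ^ 2 * norm (A v) ^ 2 <= (c / N ^ 2) ^ 2 * (N ^ 2 * norm v ^ 2))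
    by (apply Rmult_le_compat_l; [apply pow2_ge_0|assumption]).
  replace ((c / N ^ 2) ^ 2 * (N ^ 2 * norm v ^ 2)) with ((c / N) ^ 2 * norm v ^ 2) in H5
    by (field; lra).
  replace (c / N ^ 2 * (c * norm v ^ 2)) with ((c / N) ^ 2 * norm v ^ 2) in H4
    by (field; lra).
  lra.
Qed.

End OpBasics.

(* The rewrite rules are instantiated by hand because the same operation occurs
   through several, only convertible, canonical structures. *)
Ltac inner_rule t k :=
  match t with
  | context [@inner ?V (@plus ?G ?u ?v) ?w] => k constr:(@inner_plus_l V u v w : @inner V (@plus G u v) w = _)
  | context [@inner ?V ?w (@plus ?G ?u ?v)] => k constr:(@inner_plus_r V w u v : @inner V w (@plus G u v) = _)
  | context [@inner ?V (@minus ?G ?u ?v) ?w] => k constr:(@inner_minus_l V u v w : @inner V (@minus G u v) w = _)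
  | context [@inner ?V ?w (@minus ?G ?u ?v)] => k constr:(@inner_minus_r V w u v : @inner V w (@minus G u v) = _)
  | context [@inner ?V (@opp ?G ?u) ?w] => k constr:(@inner_opp_l V u w : @inner V (@opp G u) w = _)
  | context [@inner ?V ?w (@opp ?G ?u)] => k constr:(@inner_opp_r V w u : @inner V w (@opp G u) = _)
  | context [@inner ?V (@scal ?K ?G ?a ?u) ?w] => k constr:(@inner_scal_l V a u w : @inner V (@scal K G a u) w = _)
  | context [@inner ?V ?w (@scal ?K ?G ?a ?u)] => k constr:(@inner_scal_r V a w u : @inner V w (@scal K G a u) = _)
  | context [@inner ?V (@zero ?G) ?w] => k constr:(@inner_zero_l V w : @inner V (@zero G) w = _)
  | context [@inner ?V ?w (@zero ?G)] => k constr:(@inner_zero_r V w : @inner V w (@zero G) = _)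
  | context [@bop_fun (CompleteNormedModule.NormedModule _ (hilbert_sort ?V)) (@plus ?G ?A ?B) ?u] => k constr:(@app_plus V A B u : @bop_fun (CompleteNormedModule.NormedModule _ (hilbert_sort V)) (@plus G A B) u = _)
  | context [@bop_fun (CompleteNormedModule.NormedModule _ (hilbert_sort ?V)) (@minus ?G ?A ?B) ?u] => k constr:(@app_minus V A B u : @bop_fun (CompleteNormedModule.NormedModule _ (hilbert_sort V)) (@minus G A B) u = _)
  | context [@bop_fun (CompleteNormedModule.NormedModule _ (hilbert_sort ?V)) (@opp ?G ?A) ?u] => k constr:(@app_opp V A u : @bop_fun (CompleteNormedModule.NormedModule _ (hilbert_sort V)) (@opp G A) u = _)
  | context [@bop_fun (CompleteNormedModule.NormedModule _ (hilbert_sort ?V)) (@scal ?K ?G ?a ?A) ?u] => k constr:(@app_scal V a A u : @bop_fun (CompleteNormedModule.NormedModule _ (hilbert_sort V)) (@scal K G a A) u = _)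
  | context [@bop_fun (CompleteNormedModule.NormedModule _ (hilbert_sort ?V)) (@mult ?G ?A ?B) ?u] => k constr:(@app_mult V A B u : @bop_fun (CompleteNormedModule.NormedModule _ (hilbert_sort V)) (@mult G A B) u = _)
  | context [@bop_fun (CompleteNormedModule.NormedModule _ (hilbert_sort ?V)) (@one ?G) ?u] => k constr:(@app_one V u : @bop_fun (CompleteNormedModule.NormedModule _ (hilbert_sort V)) (@one G) u = _)
  | context [@bop_fun (CompleteNormedModule.NormedModule _ (hilbert_sort ?V)) (@zero ?G) ?u] => k constr:(@app_zero V u : @bop_fun (CompleteNormedModule.NormedModule _ (hilbert_sort V)) (@zero G) u = _)
  | context [@bop_fun (CompleteNormedModule.NormedModule _ (hilbert_sort ?V)) ?A (@plus ?G ?u ?v)] => k constr:(@lin_plus V A u v : @bop_fun (CompleteNormedModule.NormedModule _ (hilbert_sort V)) A (@plus G u v) = _)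
  | context [@bop_fun (CompleteNormedModule.NormedModule _ (hilbert_sort ?V)) ?A (@minus ?G ?u ?v)] => k constr:(@lin_minus V A u v : @bop_fun (CompleteNormedModule.NormedModule _ (hilbert_sort V)) A (@minus G u v) = _)
  | context [@bop_fun (CompleteNormedModule.NormedModule _ (hilbert_sort ?V)) ?A (@opp ?G ?u)] => k constr:(@lin_opp V A u : @bop_fun (CompleteNormedModule.NormedModule _ (hilbert_sort V)) A (@opp G u) = _)
  | context [@bop_fun (CompleteNormedModule.NormedModule _ (hilbert_sort ?V)) ?A (@scal ?K ?G ?a ?u)] => k constr:(@lin_scal V A a u : @bop_fun (CompleteNormedModule.NormedModule _ (hilbert_sort V)) A (@scal K G a u) = _)
  end.

Ltac inner_simpl := repeat match goal with |- ?g => inner_rule g ltac:(fun E => rewrite E) end.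

Ltac inner_simpl_in H := repeat (let t := type of H in inner_rule t ltac:(fun E => rewrite E in H)).

(** An operator identity is checked on matrix coefficients, where it becomes a ring identity in
    C. *)
Ltac op_ring :=
  apply op_ext_inner; intros ? ?; inner_simpl; ring.

(** * Limits of complex numbers and of operators *)

(** The filter is arbitrary so that one set of rules serves points of the line ([locally]), points
    of a planar domain ([nearC]) and sequences ([eventually]). *)
Definition limC {X : Type} (F : (X -> Prop) -> Prop) (f : X -> C) (a : C) : Prop :=
  forall eps, 0 < eps -> F (fun x => Cmod (f x - a) < eps).

Section LimC.
Context {X : Type} {F : (X -> Prop) -> Prop} {FF : Filter F}.
Implicit Types f g : X -> C.

Lemma limC_const (a : C) : limC F (fun _ => a) a.
Proof.
  intros eps He. apply filter_forall. intros _.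
  replace (a - a)%C with (RtoC 0) by ring. rewrite Cmod_0. exact He.
Qed.

Lemma limC_plus f g a b : limC F f a -> limC F g b ->
  limC F (fun x => f x + g x)%C (a + b)%C.
Proof.
  intros Hf Hg eps He. assert (H2 : 0 < eps / 2) by lra.
  generalize (filter_and _ _ (Hf _ H2) (Hg _ H2)). apply filter_imp.
  intros x [H3 H4]. replace (f x + g x - (a + b))%C with ((f x - a) + (g x - b))%C by ring.
  eapply Rle_lt_trans; [apply Cmod_triangle|]. lra.
Qed.

Lemma limC_opp f a : limC F f a -> limC F (fun x => - f x)%C (- a)%C.
Proof.
  intros Hf eps He. generalize (Hf _ He). apply filter_imp. intros x H.
  replace (- f x - - a)%C with (- (f x - a))%C by ring. rewrite Cmod_opp. exact H.
Qed.

Lemma limC_minus f g a b : limC F f a -> limC F g b ->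
  limC F (fun x => f x - g x)%C (a - b)%C.
Proof. intros Hf Hg. apply limC_plus; [exact Hf|apply limC_opp; exact Hg]. Qed.

Lemma limC_conj f a : limC F f a -> limC F (fun x => Cconj (f x)) (Cconj a).
Proof.
  intros Hf eps He. generalize (Hf _ He). apply filter_imp. intros x H.
  replace (Cconj (f x) - Cconj a)%C with (Cconj (f x - a)%C) by ceq.
  rewrite Cmod_conj. exact H.
Qed.

Lemma limC_mult f g a b : limC F f a -> limC F g b ->
  limC F (fun x => f x * g x)%C (a * b)%C.
Proof.
  intros Hf Hg eps He.
  pose proof (Cmod_ge_0 a). pose proof (Cmod_ge_0 b).
  set (K := Cmod a + Cmod b + 1).
  assert (HK : 0 < K) by (unfold K; lra).
  assert (Hd : 0 < Rmin 1 (eps / K)) by (apply Rmin_pos; [lra|apply Rdiv_lt_0_compat; lra]).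
  generalize (filter_and _ _ (Hf _ Hd) (Hg _ Hd)). apply filter_imp.
  intros x [H1 H2]. pose proof (Rmin_l 1 (eps / K)). pose proof (Rmin_r 1 (eps / K)).
  set (p := (f x - a)%C) in *. set (q := (g x - b)%C) in *.
  replace (f x * g x - a * b)%C with (p * q + (p * b + a * q))%C by (unfold p, q; ring).
  pose proof (Cmod_ge_0 p). pose proof (Cmod_ge_0 q).
  eapply Rle_lt_trans; [apply Cmod_triangle|].
  eapply Rle_lt_trans; [apply Rplus_le_compat_l, Cmod_triangle|].
  rewrite !Cmod_mult. set (d := Rmin 1 (eps / K)) in *.
  assert (K * d <= eps).
  { replace eps with (K * (eps / K)) by (field; lra). apply Rmult_le_compat_l; lra. }
  assert (Cmod p * Cmod q <= 1 * Cmod q) by (apply Rmult_le_compat_r; lra).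
  assert (Cmod p * Cmod b <= d * Cmod b) by (apply Rmult_le_compat_r; lra).
  assert (Cmod a * Cmod q <= Cmod a * d) by (apply Rmult_le_compat_l; lra).
  unfold K in *. lra.
Qed.

Lemma limC_ext f g a : (forall x, f x = g x) -> limC F f a -> limC F g a.
Proof.
  intros H Hf eps He. generalize (Hf eps He). apply filter_imp. intros x. rewrite H. auto.
Qed.

Lemma limC_unique {PF : ProperFilter F} f a b : limC F f a -> limC F f b -> a = b.
Proof.
  intros Ha Hb.
  assert (E : Cmod (a - b) = 0).
  { apply Rle_antisym; [|apply Cmod_ge_0]. apply le_epsilon. intros eps He.
    assert (H2 : 0 < eps / 2) by lra.
    destruct (filter_ex _ (filter_and _ _ (Ha _ H2) (Hb _ H2))) as [x [H3 H4]].
    replace (a - b)%C with (- (f x - a) + (f x - b))%C by ring.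
    eapply Rle_trans; [apply Cmod_triangle|]. rewrite Cmod_opp. lra. }
  apply Cmod_eq_0 in E. replace a with (a - b + b)%C by ring. rewrite E. ring.
Qed.

End LimC.

Definition limO {V : HilbertSpace} {X : Type} (F : (X -> Prop) -> Prop)
  (f : X -> BOp V) (A : BOp V) : Prop :=
  forall eps, 0 < eps -> F (fun x => bop_norm (minus (f x) A) < eps).

Lemma limO_filterlim {V : HilbertSpace} {X : Type} (F : (X -> Prop) -> Prop)
  {FF : Filter F} (f : X -> BOp V) (A : BOp V) :
  limO F f A <-> filterlim f F (locally A).
Proof.
  split.
  - intros H. apply filterlim_locally. intros eps. apply (H eps (cond_pos eps)).
  - intros H eps He. exact (proj1 (filterlim_locally f A) H (mkposreal eps He)).
Qed.

Section LimO.
Context {V : HilbertSpace}.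
Context {X : Type} {F : (X -> Prop) -> Prop} {FF : Filter F}.
Implicit Types (f g : X -> BOp V) (A B : BOp V).

Lemma limO_const A : limO F (fun _ => A) A.
Proof.
  intros eps He. apply filter_forall. intros _. rewrite minus_eq_zero.
  eapply Rle_lt_trans; [right; exact bop_norm_zero|exact He].
Qed.

Lemma op_minus_plus A B A' B' :
  minus (plus A B) (plus A' B') = plus (minus A A') (minus B B').
Proof. exact (minus_plus_plus A B A' B'). Qed.

Lemma limO_plus f g A B : limO F f A -> limO F g B ->
  limO F (fun x => plus (f x) (g x)) (plus A B).
Proof.
  intros Hf Hg eps He. assert (H2 : 0 < eps / 2) by lra.
  generalize (filter_and _ _ (Hf _ H2) (Hg _ H2)). apply filter_imp.
  intros x [H3 H4]. rewrite op_minus_plus.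
  eapply Rle_lt_trans; [apply bop_norm_triangle|]. lra.
Qed.

Lemma limO_opp f A : limO F f A -> limO F (fun x => opp (f x)) (opp A).
Proof.
  intros Hf eps He. generalize (Hf _ He). apply filter_imp. intros x H.
  replace (minus (opp (f x)) (opp A)) with (opp (minus (f x) A)).
  - rewrite bop_norm_opp. exact H.
  - op_ring.
Qed.

Lemma limO_minus f g A B : limO F f A -> limO F g B ->
  limO F (fun x => minus (f x) (g x)) (minus A B).
Proof. intros Hf Hg. apply limO_plus; [exact Hf|apply limO_opp; exact Hg]. Qed.

Lemma limO_adj f A : limO F f A -> limO F (fun x => adj (f x)) (adj A).
Proof.
  intros Hf eps He. generalize (Hf _ He). apply filter_imp. intros x H.
  rewrite <- adj_minus. eapply Rle_lt_trans; [apply bop_norm_adj_le|exact H].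
Qed.

Lemma limO_mult f g A B : limO F f A -> limO F g B ->
  limO F (fun x => mult (f x) (g x)) (mult A B).
Proof.
  intros Hf Hg eps He.
  pose proof (bop_norm_ge_0 A). pose proof (bop_norm_ge_0 B).
  set (K := bop_norm A + bop_norm B + 1).
  assert (HK : 0 < K) by (unfold K; lra).
  assert (Hd : 0 < Rmin 1 (eps / K)) by (apply Rmin_pos; [lra|apply Rdiv_lt_0_compat; lra]).
  generalize (filter_and _ _ (Hf _ Hd) (Hg _ Hd)). apply filter_imp.
  intros x [H1 H2]. pose proof (Rmin_l 1 (eps / K)). pose proof (Rmin_r 1 (eps / K)).
  set (p := minus (f x) A) in *. set (q := minus (g x) B) in *.
  apply Rle_lt_trans with (bop_norm (plus (mult p q) (plus (mult p B) (mult A q)))).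
  { right. f_equal. unfold p, q. op_ring. }
  pose proof (bop_norm_ge_0 p). pose proof (bop_norm_ge_0 q).
  eapply Rle_lt_trans; [apply bop_norm_triangle|].
  eapply Rle_lt_trans; [apply Rplus_le_compat_l, bop_norm_triangle|].
  set (d := Rmin 1 (eps / K)) in *.
  assert (K * d <= eps).
  { replace eps with (K * (eps / K)) by (field; lra). apply Rmult_le_compat_l; lra. }
  pose proof (bop_norm_mult p q). pose proof (bop_norm_mult p B).
  pose proof (bop_norm_mult A q).
  assert (bop_norm p * bop_norm q <= 1 * bop_norm q) by (apply Rmult_le_compat_r; lra).
  assert (bop_norm p * bop_norm B <= d * bop_norm B) by (apply Rmult_le_compat_r; lra).
  assert (bop_norm A * bop_norm q <= bop_norm A * d) by (apply Rmult_le_compat_l; lra).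
  unfold K in *. lra.
Qed.

Lemma bop_norm_scal_one (a : C) : bop_norm (scal a (one : BOp V)) <= Cmod a.
Proof.
  eapply Rle_trans; [apply bop_norm_scal|]. pose proof bop_norm_one (V := V).
  pose proof (Cmod_ge_0 a). nra.
Qed.

Lemma limO_scal (a : X -> C) f b A : limC F a b -> limO F f A ->
  limO F (fun x => scal (a x) (f x)) (scal b A).
Proof.
  intros Ha Hf.
  assert (H1 : limO F (fun x => scal (a x) (one : BOp V)) (scal b (one : BOp V))).
  { intros eps He. generalize (Ha _ He). apply filter_imp. intros x H.
    eapply Rle_lt_trans; [|exact H].
    eapply Rle_trans; [|apply bop_norm_scal_one]. right. f_equal.
    op_ring. }
  intros eps He. generalize (limO_mult _ _ _ _ H1 Hf eps He). apply filter_imp. intros x H.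
  eapply Rle_lt_trans; [|exact H]. right. f_equal. op_ring.
Qed.

Lemma limO_ext f g A : (forall x, f x = g x) -> limO F f A -> limO F g A.
Proof.
  intros H Hf eps He. generalize (Hf eps He). apply filter_imp. intros x. rewrite H. auto.
Qed.

Lemma limC_inner f A (u w : V) : limO F f A ->
  limC F (fun x => inner (f x u) w) (inner (A u) w).
Proof.
  intros Hf eps He.
  set (K := norm u * norm w + 1).
  assert (HK : 0 < K).
  { unfold K. pose proof (Rmult_le_pos _ _ (vnorm_ge_0 u) (vnorm_ge_0 w)). lra. }
  assert (Hd : 0 < eps / K) by (apply Rdiv_lt_0_compat; lra).
  generalize (Hf _ Hd). apply filter_imp. intros x H.
  rewrite <- inner_minus_l, <- app_minus.
  eapply Rle_lt_trans; [apply inner_op_le|].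
  pose proof (bop_norm_ge_0 (minus (f x) A)).
  apply Rle_lt_trans with (bop_norm (minus (f x) A) * K); [unfold K; lra|].
  replace eps with (eps / K * K) by (field; lra). apply Rmult_lt_compat_r; assumption.
Qed.

Lemma limO_norm_bound {PF : ProperFilter F} f A M :
  limO F f A -> F (fun x => bop_norm (f x) <= M) -> bop_norm A <= M.
Proof.
  intros Hf HM. apply le_epsilon. intros eps He.
  destruct (filter_ex _ (filter_and _ _ (Hf _ He) HM)) as [x [H1 H2]].
  pose proof (bop_norm_dist A (f x)) as H3. rewrite bop_norm_minus_sym in H3. lra.
Qed.

Lemma limO_unique {PF : ProperFilter F} f A B : limO F f A -> limO F f B -> A = B.
Proof.
  intros HA HB. apply op_ext_inner. intros u w.
  eapply limC_unique; apply limC_inner; [exact HA|exact HB].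
Qed.

(** The resolvent identity B^-1 - A^-1 = - B^-1 (B - A) A^-1 is used twice: first to bound the norm
    of B^-1 by 2 N once B is within 1 / (2 N) of A, then for the limit. *)
Lemma limO_bop_inv f A : invertible A -> F (fun x => invertible (f x)) ->
  limO F f A -> limO F (fun x => bop_inv (f x)) (bop_inv A).
Proof.
  intros HA Hi Hf.
  set (N := bop_norm (bop_inv A) + 1).
  assert (HN : 0 < N) by (unfold N; pose proof (bop_norm_ge_0 (bop_inv A)); lra).
  intros eps He.
  assert (Hd : 0 < Rmin (/ (2 * N)) (eps / (2 * N ^ 2))).
  { apply Rmin_pos; [apply Rinv_0_lt_compat; lra|apply Rdiv_lt_0_compat; nra]. }
  generalize (filter_and _ _ Hi (Hf _ Hd)). apply filter_imp. intros x [Hx H].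
  set (d := bop_norm (minus (f x) A)) in *.
  pose proof (Rmin_l (/ (2 * N)) (eps / (2 * N ^ 2))).
  pose proof (Rmin_r (/ (2 * N)) (eps / (2 * N ^ 2))).
  assert (E : minus (bop_inv (f x)) (bop_inv A) =
    opp (mult (bop_inv (f x)) (mult (minus (f x) A) (bop_inv A)))).
  { apply op_ext_inner. intros u w. inner_simpl.
    rewrite bop_inv_app_l, (bop_inv_app_r A) by assumption. ring. }
  set (B := bop_inv (f x)) in *.
  assert (H3 : bop_norm (minus B (bop_inv A)) <= bop_norm B * (d * N)).
  { rewrite E. eapply Rle_trans; [right; apply bop_norm_opp|].
    eapply Rle_trans; [apply bop_norm_mult|].
    apply Rmult_le_compat_l; [apply bop_norm_ge_0|].
    eapply Rle_trans; [apply bop_norm_mult|].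
    apply Rmult_le_compat_l; [apply bop_norm_ge_0|unfold N; lra]. }
  pose proof (bop_norm_dist B (bop_inv A)) as H4. pose proof (bop_norm_ge_0 B).
  assert (Hd0 : 0 <= d) by apply bop_norm_ge_0.
  assert (H5 : d * N <= 1 / 2).
  { replace (1 / 2) with (/ (2 * N) * N) by (field; lra). apply Rmult_le_compat_r; lra. }
  assert (H6 : bop_norm B <= 2 * N).
  { assert (bop_norm B * (d * N) <= bop_norm B * (1 / 2)) by (apply Rmult_le_compat_l; assumption).
    unfold N in *. lra. }
  apply Rle_lt_trans with (2 * N * (d * N)).
  { eapply Rle_trans; [exact H3|]. apply Rmult_le_compat_r; [nra|exact H6]. }
  replace (2 * N * (d * N)) with (d * (2 * N ^ 2)) by ring.
  replace eps with (eps / (2 * N ^ 2) * (2 * N ^ 2)) by (field; lra).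
  apply Rmult_lt_compat_r; [nra|]. lra.
Qed.

End LimO.

(** * Completeness and inversion of coercive operators *)

Section Completeness.
Context {V : HilbertSpace}.
Implicit Types A B : BOp V.

Lemma limO_seq_exists (a : nat -> BOp V) (d : nat -> R) (M : R) :
  (forall n, bop_norm (minus (a (S n)) (a n)) <= d (S n)) ->
  (forall n, sum_f_R0 d n <= M) ->
  exists A, limO eventually a A.
Proof.
  intros Hd HS.
  assert (Hd0 : forall n, 0 <= d (S n)).
  { intros n. eapply Rle_trans; [|apply Hd]. apply bop_norm_ge_0. }
  assert (Hcv : ex_finite_lim_seq (sum_f_R0 d)).
  { apply ex_finite_lim_seq_incr with M; [|exact HS].
    intros n. simpl. pose proof (Hd0 n). lra. }
  destruct Hcv as [l Hl].
  assert (Htail : forall n k, bop_norm (minus (a (n + k)%nat) (a n))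
                   <= sum_f_R0 d (n + k) - sum_f_R0 d n).
  { intros n k. induction k as [|k IH].
    - rewrite Nat.add_0_r, minus_eq_zero. right.
      etransitivity; [exact bop_norm_zero|ring].
    - rewrite Nat.add_succ_r. simpl.
      rewrite (minus_trans (a (n + k)%nat)).
      eapply Rle_trans; [apply bop_norm_triangle|].
      pose proof (Hd (n + k)%nat). lra. }
  assert (Hx : exists A, filterlim a eventually (locally A)).
  { apply (filterlim_locally_cauchy (U := BOp_CompleteSpace)).
    intros eps. apply is_lim_seq_spec in Hl.
    assert (He : 0 < eps / 4) by (pose proof (cond_pos eps); lra).
    destruct (Hl (mkposreal _ He)) as [N HN]. simpl in HN.
    exists (fun n => (N <= n)%nat). split; [exists N; auto|].
    assert (Hb : forall n, (N <= n)%nat -> bop_norm (minus (a n) (a N)) < eps / 2).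
    { intros n Hn. replace n with (N + (n - N))%nat by lia.
      eapply Rle_lt_trans; [apply Htail|].
      pose proof (HN N (le_n _)) as H1. pose proof (HN (N + (n - N))%nat ltac:(lia)) as H2.
      apply Rabs_lt_between in H1, H2. lra. }
    intros u v Hu Hv. change (bop_norm (minus (a v) (a u)) < eps).
    rewrite (minus_trans (a N)). eapply Rle_lt_trans; [apply bop_norm_triangle|].
    rewrite (bop_norm_minus_sym (a N)).
    pose proof (Hb u Hu). pose proof (Hb v Hv). lra. }
  destruct Hx as [A HA]. exists A. apply limO_filterlim; [apply eventually_filter|exact HA].
Qed.

(** A Neumann series: E = 1 - tau A is a strict contraction, so the sum L of its powers gives the
    right inverse tau L. Coercivity makes A injective, hence this inverse is two-sided. *)
Lemma coercive_invertible A (c : R) : 0 < c ->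
  (forall v : V, c * norm v ^ 2 <= Re (inner (A v) v)) -> invertible A.
Proof.
  intros Hc HA.
  set (N := bop_norm A + 1). pose proof (bop_norm_ge_0 A) as HN0.
  assert (HN : 0 < N) by (unfold N; lra).
  (* In the zero space c may exceed the norm of A; the minimum with N supplies the inequality that
     [coercive_contraction] asks for. *)
  set (c' := Rmin c N). assert (Hc' : 0 < c' <= N).
  { split; [apply Rmin_pos; assumption|apply Rmin_r]. }
  set (tau := c' / N ^ 2). set (rho := sqrt (1 - (c' / N) ^ 2)).
  assert (Htau : 0 < tau) by (apply Rdiv_lt_0_compat; [lra|nra]).
  assert (HcN : 0 < c' / N <= 1).
  { split; [apply Rdiv_lt_0_compat; lra|]. apply Rle_div_l; lra. }
  assert (Hrho : 0 <= rho < 1).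
  { split; [apply sqrt_pos|]. unfold rho. rewrite <- sqrt_1 at 2.
    apply sqrt_lt_1; nra. }
  set (E := minus one (scal (RtoC tau) A) : BOp V).
  assert (HE : bop_norm E <= rho).
  { apply bop_norm_le; [lra|]. intros v.
    change (norm (minus v (scal (RtoC tau) (A v : V))) <= rho * norm v).
    apply coercive_contraction; [exact Hc'| |].
    - eapply Rle_trans; [|apply HA]. apply Rmult_le_compat_r; [apply pow2_ge_0|apply Rmin_l].
    - eapply Rle_trans; [apply bop_norm_bound|].
      apply Rmult_le_compat_r; [apply vnorm_ge_0|unfold N; lra]. }
  (* The partial sums 1 + E + ... + E^n in Horner form, so that passing to the limit in the
     recursion gives L = 1 + E L. *)
  pose (Sn := fix Sn (n : nat) : BOp V :=
    match n with O => one | S n => plus one (mult E (Sn n)) end).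
  destruct (limO_seq_exists Sn (fun n => rho ^ n) (/ (1 - rho))) as [L HL].
  { assert (Hn1 : forall n, bop_norm (minus (Sn (S n)) (Sn n)) <= rho ^ S n).
    { induction n as [|n IH].
      - replace (minus (Sn 1%nat) (Sn 0%nat)) with E; [simpl; lra|].
        simpl. op_ring.
      - replace (minus (Sn (S (S n))) (Sn (S n))) with (mult E (minus (Sn (S n)) (Sn n))).
        + eapply Rle_trans; [apply bop_norm_mult|]. change (rho ^ S (S n)) with (rho * rho ^ S n).
          apply Rmult_le_compat; [apply bop_norm_ge_0|apply bop_norm_ge_0|exact HE|exact IH].
        + change (Sn (S (S n))) with (plus one (mult E (Sn (S n)))).
          change (Sn (S n)) with (plus one (mult E (Sn n))) at 3.
          op_ring. }
    exact Hn1. }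
  { intros n. rewrite tech3 by lra.
    apply Rmult_le_reg_r with (1 - rho); [lra|]. unfold Rdiv.
    rewrite Rmult_assoc, Rinv_l by lra.
    pose proof (pow_le rho (S n) (proj1 Hrho)). lra. }
  assert (EL : L = plus one (mult E L)).
  { apply (limO_unique (F := eventually) (fun n => Sn (S n))).
    - intros eps He. destruct (HL eps He) as [N0 HN0']. exists N0. intros n Hn. apply HN0'. lia.
    - simpl. apply limO_plus; [apply limO_const|]. apply limO_mult; [apply limO_const|exact HL]. }
  assert (HR : mult A (scal (RtoC tau) L) = one).
  { apply op_ext_inner. intros u w. rewrite app_mult, app_scal, lin_scal, inner_scal_l.
    pose proof (f_equal (fun B : BOp V => inner (B u) w) EL) as H. cbv beta in H.
    unfold E in H. inner_simpl_in H. rewrite !app_one in *.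
    replace (RtoC tau * inner (A (L u)) w)%C with
      (inner (L u) w - (inner (L u) w - RtoC tau * inner (A (L u)) w))%C by ring.
    rewrite H at 1. ring. }
  assert (Hinj : forall v : V, (A v : V) = zero -> v = zero).
  { intros v Hv. apply vnorm_eq_0. specialize (HA v). rewrite Hv in HA. inner_simpl_in HA.
    simpl in HA. pose proof (vnorm_ge_0 v).
    destruct (Req_dec (norm v) 0) as [E0|E0]; [exact E0|].
    assert (0 < c * (norm v * (norm v * 1))).
    { apply Rmult_lt_0_compat; [lra|]. rewrite Rmult_1_r. apply Rmult_lt_0_compat; lra. }
    lra. }
  (* For the other side, A sends (tau L A - 1) v to zero by the right inverse, and A is
     injective. *)
  exists (scal (RtoC tau) L). split; [exact HR|].
  apply bop_ext. intros v. apply minus_zero_eq, Hinj.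
  apply inner_ext. intros w.
  pose proof (f_equal (fun B : BOp V => inner (B (A v)) w) HR) as H. cbv beta in H.
  inner_simpl_in H. inner_simpl. rewrite H. ring.
Qed.

End Completeness.

(** * Averages over a period *)

Definition ravg (f : R -> R) : R := / (2 * PI) * RInt f 0 (2 * PI).
Definition cavg (f : R -> C) : C :=
  (ravg (fun t => Re (f t)), ravg (fun t => Im (f t))).

Definition contR (f : R -> R) : Prop := forall t, continuous f t.
Definition contC (f : R -> C) : Prop := forall t, limC (locally t) f (f t).
Definition contO {V : HilbertSpace} (F : R -> BOp V) : Prop :=
  forall t, limO (locally t) F (F t).

Lemma im_le_Cmod (c : C) : Rabs (Im c) <= Cmod c.
Proof.
  pose proof (re_le_Cmod (Cmult Ci c)) as H. rewrite Cmod_mult, Cmod_Ci, Rmult_1_l in H.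
  unfold Re in H; simpl in H. unfold Im.
  replace (0 * fst c - 1 * snd c) with (- snd c) in H by ring. rewrite Rabs_Ropp in H. exact H.
Qed.

Lemma Re_conj_mult (c : C) : Re (Cconj c * c)%C = Cmod c * Cmod c.
Proof.
  pose proof (Cmod2_alt c) as Ec. unfold Re, Im, Cconj in *; simpl in *. lra.
Qed.

Section LimReal.
Context {X : Type} {F : (X -> Prop) -> Prop} {FF : Filter F}.

Lemma limC_re (f : X -> C) a : limC F f a -> filterlim (fun x => Re (f x)) F (locally (Re a)).
Proof.
  intros H. apply filterlim_locally. intros eps. generalize (H eps (cond_pos eps)).
  apply filter_imp. intros x Hx. change (Rabs (Re (f x) - Re a) < eps).
  eapply Rle_lt_trans; [|exact Hx]. exact (re_le_Cmod (f x - a)).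
Qed.

Lemma limC_im (f : X -> C) a : limC F f a -> filterlim (fun x => Im (f x)) F (locally (Im a)).
Proof.
  intros H. apply filterlim_locally. intros eps. generalize (H eps (cond_pos eps)).
  apply filter_imp. intros x Hx. change (Rabs (Im (f x) - Im a) < eps).
  eapply Rle_lt_trans; [|exact Hx]. exact (im_le_Cmod (f x - a)).
Qed.

Lemma limC_re_im (f : X -> C) a : filterlim (fun x => Re (f x)) F (locally (Re a)) ->
  filterlim (fun x => Im (f x)) F (locally (Im a)) -> limC F f a.
Proof.
  intros H1 H2 eps He. assert (Hd : 0 < eps / 2) by lra.
  pose proof (proj1 (filterlim_locally _ _) H1 (mkposreal _ Hd)) as H3.
  pose proof (proj1 (filterlim_locally _ _) H2 (mkposreal _ Hd)) as H4.
  generalize (filter_and _ _ H3 H4). clear H3 H4. apply filter_imp. intros x [H3 H4].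
  change (Rabs (Re (f x) - Re a) < eps / 2) in H3.
  change (Rabs (Im (f x) - Im a) < eps / 2) in H4.
  replace (f x - a)%C with (RtoC (Re (f x) - Re a) + Ci * RtoC (Im (f x) - Im a))%C by ceq.
  eapply Rle_lt_trans; [apply Cmod_triangle|].
  rewrite Cmod_mult, Cmod_Ci, !Cmod_R. lra.
Qed.
End LimReal.

Lemma contC_re f : contC f -> contR (fun t => Re (f t)).
Proof. intros H t. apply limC_re, H. Qed.
Lemma contC_im f : contC f -> contR (fun t => Im (f t)).
Proof. intros H t. apply limC_im, H. Qed.
Lemma contC_of f : contR (fun t => Re (f t)) -> contR (fun t => Im (f t)) -> contC f.
Proof. intros H1 H2 t. apply limC_re_im; [apply H1|apply H2]. Qed.

Lemma contC_const a : contC (fun _ => a).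
Proof. intros t. apply limC_const. Qed.
Lemma contC_plus f g : contC f -> contC g -> contC (fun t => f t + g t)%C.
Proof. intros Hf Hg t. apply limC_plus; auto. Qed.
Lemma contC_minus f g : contC f -> contC g -> contC (fun t => f t - g t)%C.
Proof. intros Hf Hg t. apply limC_minus; auto. Qed.
Lemma contC_mult f g : contC f -> contC g -> contC (fun t => f t * g t)%C.
Proof. intros Hf Hg t. apply limC_mult; auto. Qed.
Lemma contC_opp f : contC f -> contC (fun t => - f t)%C.
Proof. intros Hf t. apply limC_opp; auto. Qed.
Lemma contC_conj f : contC f -> contC (fun t => Cconj (f t)).
Proof. intros Hf t. apply limC_conj; auto. Qed.

Section ContO.
Context {V : HilbertSpace}.
Implicit Types F G : R -> BOp V.
Lemma contO_const A : contO (fun _ => A : BOp V).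
Proof. intros t. apply limO_const. Qed.
Lemma contO_plus F G : contO F -> contO G -> contO (fun t => plus (F t) (G t)).
Proof. intros HF HG t. apply limO_plus; auto. Qed.
Lemma contO_minus F G : contO F -> contO G -> contO (fun t => minus (F t) (G t)).
Proof. intros HF HG t. apply limO_minus; auto. Qed.
Lemma contO_mult F G : contO F -> contO G -> contO (fun t => mult (F t) (G t)).
Proof. intros HF HG t. apply limO_mult; auto. Qed.
Lemma contO_adj F : contO F -> contO (fun t => adj (F t)).
Proof. intros HF t. apply limO_adj; auto. Qed.
Lemma contO_scal a F : contC a -> contO F -> contO (fun t => scal (a t) (F t)).
Proof. intros Ha HF t. apply limO_scal; auto. Qed.
Lemma contC_inner F (u w : V) : contO F -> contC (fun t => inner (F t u) w).
Proof. intros HF t. apply (limC_inner F (F t)); auto. Qed.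
Lemma contC_inner2 F G (u w : V) : contO F -> contO G -> contC (fun t => inner (F t u) (G t w)).
Proof.
  intros HF HG t. apply limC_ext with (fun s => inner ((mult (adj (G s)) (F s) : BOp V) u) w).
  { intros s. rewrite app_mult, inner_adj_l. reflexivity. }
  replace (inner (F t u) (G t w)) with (inner ((mult (adj (G t)) (F t) : BOp V) u) w)
    by (rewrite app_mult, inner_adj_l; reflexivity).
  apply (contC_inner (fun s => mult (adj (G s)) (F s))). apply contO_mult; [apply contO_adj|]; auto.
Qed.
End ContO.

Lemma ex_RInt_contR f a b : contR f -> ex_RInt f a b.
Proof. intros H. apply (ex_RInt_continuous (V := R_CompleteNormedModule)). intros z _. apply H. Qed.

Lemma two_PI_pos : 0 < 2 * PI.
Proof. pose proof PI_RGT_0. lra. Qed.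

Lemma ravg_ext f g : (forall t, f t = g t) -> ravg f = ravg g.
Proof. intros H. replace g with f; [reflexivity|]. apply functional_extensionality, H. Qed.

Lemma ravg_plus f g : contR f -> contR g -> ravg (fun t => f t + g t) = ravg f + ravg g.
Proof.
  intros Hf Hg. unfold ravg.
  pose proof (RInt_plus (V := R_CompleteNormedModule) f g 0 (2 * PI)
    (ex_RInt_contR _ _ _ Hf) (ex_RInt_contR _ _ _ Hg)) as H.
  unfold plus in H; simpl in H. rewrite H. ring.
Qed.

Lemma ravg_scal (k : R) f : contR f -> ravg (fun t => k * f t) = k * ravg f.
Proof.
  intros Hf. unfold ravg.
  pose proof (RInt_scal (V := R_CompleteNormedModule) f 0 (2 * PI) k
    (ex_RInt_contR _ _ _ Hf)) as H.
  unfold scal in H; simpl in H; unfold mult in H; simpl in H. rewrite H. ring.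
Qed.

Lemma contR_scal (k : R) f : contR f -> contR (fun t => k * f t).
Proof. intros Hf t. apply (continuous_scal_r (K := R_AbsRing) (V := R_NormedModule)). apply Hf. Qed.

Lemma contR_plus f g : contR f -> contR g -> contR (fun t => f t + g t).
Proof. intros Hf Hg t. apply (continuous_plus (K := R_AbsRing) (V := R_NormedModule)); auto. Qed.

Lemma contR_const (k : R) : contR (fun _ => k).
Proof. intros t. apply continuous_const. Qed.

Lemma ravg_const (k : R) : ravg (fun _ => k) = k.
Proof.
  unfold ravg. rewrite RInt_const. unfold scal; simpl; unfold mult; simpl.
  pose proof PI_RGT_0. field. lra.
Qed.

Lemma ravg_le f g : contR f -> contR g -> (forall t, f t <= g t) -> ravg f <= ravg g.
Proof.
  intros Hf Hg H. unfold ravg. pose proof two_PI_pos.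
  apply Rmult_le_compat_l; [left; apply Rinv_0_lt_compat; assumption|].
  apply RInt_le; [lra|apply ex_RInt_contR; assumption|apply ex_RInt_contR; assumption|auto].
Qed.

Lemma cavg_ext f g : (forall t, f t = g t) -> cavg f = cavg g.
Proof. intros H. replace g with f; [reflexivity|]. apply functional_extensionality, H. Qed.

Lemma cavg_plus f g : contC f -> contC g -> cavg (fun t => f t + g t)%C = (cavg f + cavg g)%C.
Proof.
  intros Hf Hg. apply injective_projections; simpl.
  - rewrite <- ravg_plus; [reflexivity|apply contC_re|apply contC_re]; assumption.
  - rewrite <- ravg_plus; [reflexivity|apply contC_im|apply contC_im]; assumption.
Qed.

Lemma cavg_scal (a : C) f : contC f -> cavg (fun t => a * f t)%C = (a * cavg f)%C.
Proof.
  intros Hf. pose proof (contC_re f Hf). pose proof (contC_im f Hf).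
  apply injective_projections; simpl.
  - rewrite (ravg_ext _ (fun t => fst a * Re (f t) + (- snd a) * Im (f t))).
    + rewrite ravg_plus, !ravg_scal; auto using contR_scal. ring.
    + intros t. unfold Re, Im; simpl. ring.
  - rewrite (ravg_ext _ (fun t => fst a * Im (f t) + snd a * Re (f t))).
    + rewrite ravg_plus, !ravg_scal; auto using contR_scal.
    + intros t. unfold Re, Im; simpl. ring.
Qed.

Lemma cavg_opp f : contC f -> cavg (fun t => - f t)%C = (- cavg f)%C.
Proof.
  intros Hf. rewrite (cavg_ext _ (fun t => RtoC (-1) * f t)%C).
  - rewrite cavg_scal by assumption. ceq.
  - intros t. ceq.
Qed.

Lemma cavg_minus f g : contC f -> contC g -> cavg (fun t => f t - g t)%C = (cavg f - cavg g)%C.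
Proof.
  intros Hf Hg. unfold Cminus. rewrite (cavg_plus f (fun t => - g t)%C); auto using contC_opp.
  rewrite cavg_opp by assumption. reflexivity.
Qed.

Lemma cavg_conj f : contC f -> cavg (fun t => Cconj (f t)) = Cconj (cavg f).
Proof.
  intros Hf. apply injective_projections; simpl; [reflexivity|].
  rewrite (ravg_ext _ (fun t => (-1) * Im (f t))).
  - rewrite ravg_scal; [ring|apply contC_im; assumption].
  - intros t. unfold Im; simpl. ring.
Qed.

Lemma cavg_const a : cavg (fun _ => a) = a.
Proof. unfold cavg. rewrite !ravg_const. destruct a; reflexivity. Qed.

(** The average c is rotated to the positive axis by multiplying f with the conjugate of c; real
    parts are then compared pointwise. *)
Lemma cavg_le_ravg f g : contC f -> contR g -> (forall t, Cmod (f t) <= g t) ->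
  Cmod (cavg f) <= ravg g.
Proof.
  intros Hf Hg H. set (c := cavg f).
  destruct (Req_dec (Cmod c) 0) as [E|E].
  { rewrite E. rewrite <- (ravg_const 0). apply ravg_le; auto using contR_const.
    intros t. eapply Rle_trans; [apply Cmod_ge_0|apply H]. }
  pose proof (Cmod_ge_0 c) as Hc.
  assert (H1 : Re (cavg (fun t => Cconj c * f t)%C) <= ravg (fun t => Cmod c * g t)).
  { change (ravg (fun t => Re (Cconj c * f t)%C) <= ravg (fun t => Cmod c * g t)).
    apply ravg_le.
    - apply (contC_re (fun t => Cconj c * f t)%C). apply contC_mult; auto using contC_const.
    - apply contR_scal; assumption.
    - intros t. eapply Rle_trans; [eapply Rle_trans; [apply Rle_abs|apply re_le_Cmod]|].
      rewrite Cmod_mult, Cmod_conj. apply Rmult_le_compat_l; auto. }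
  rewrite cavg_scal, ravg_scal in H1 by assumption. fold c in H1.
  rewrite Re_conj_mult in H1.
  apply Rmult_le_reg_l with (Cmod c); lra.
Qed.

Lemma cavg_bound f M : contC f -> (forall t, Cmod (f t) <= M) -> Cmod (cavg f) <= M.
Proof.
  intros Hf H. rewrite <- (ravg_const M). apply cavg_le_ravg; auto using contR_const.
Qed.

Lemma ravg_derive f df : (forall t, is_derive f t (df t)) -> contR df ->
  f (2 * PI) = f 0 -> ravg df = 0.
Proof.
  intros H Hc Hp. unfold ravg.
  rewrite (is_RInt_unique (V := R_CompleteNormedModule) df 0 (2 * PI) (minus (f (2 * PI)) (f 0))).
  - rewrite Hp. unfold minus, plus, opp; simpl. ring.
  - apply (is_RInt_derive (V := R_CompleteNormedModule) f df); intros; [apply H|apply Hc].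
Qed.

(** The character exp(i k t). *)
Definition ek (k : Z) (t : R) : C := (cos (IZR k * t), sin (IZR k * t)).

Lemma ek_0 t : ek 0 t = RtoC 1.
Proof. unfold ek. rewrite Rmult_0_l, cos_0, sin_0. reflexivity. Qed.

Lemma ek_plus j k t : ek (j + k) t = (ek j t * ek k t)%C.
Proof.
  unfold ek. rewrite plus_IZR, Rmult_plus_distr_r, cos_plus, sin_plus. ceq.
Qed.

Lemma ek_opp k t : ek (- k) t = Cconj (ek k t).
Proof.
  unfold ek, Cconj; simpl. rewrite opp_IZR, Ropp_mult_distr_l_reverse, cos_neg, sin_neg. reflexivity.
Qed.

Lemma Cmod_ek k t : Cmod (ek k t) = 1.
Proof.
  unfold Cmod, ek; simpl. rewrite !Rmult_1_r.
  pose proof (sin2_cos2 (IZR k * t)) as H. unfold Rsqr in H.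
  rewrite Rplus_comm, H. apply sqrt_1.
Qed.

Lemma ek_conj_mult k t : (Cconj (ek k t) * ek k t = 1)%C.
Proof. rewrite <- ek_opp, <- ek_plus, Z.add_opp_diag_l. apply ek_0. Qed.

Lemma ek_period k : ek k (2 * PI) = ek k 0.
Proof.
  unfold ek. rewrite Rmult_0_r, cos_0, sin_0.
  replace (IZR k * (2 * PI)) with (2 * IZR k * PI) by ring.
  destruct (Z.le_gt_cases 0 k) as [H|H].
  - rewrite <- (Z2Nat.id k H), <- INR_IZR_INZ.
    pose proof (cos_period 0 (Z.to_nat k)) as H1. pose proof (sin_period 0 (Z.to_nat k)) as H2.
    rewrite Rplus_0_l in *. rewrite H1, H2, cos_0, sin_0. reflexivity.
  - replace (2 * IZR k * PI) with (- (2 * INR (Z.to_nat (- k)) * PI)).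
    + rewrite cos_neg, sin_neg.
      pose proof (cos_period 0 (Z.to_nat (- k))) as H1.
      pose proof (sin_period 0 (Z.to_nat (- k))) as H2.
      rewrite Rplus_0_l in *. rewrite H1, H2, cos_0, sin_0. f_equal. ring.
    + rewrite INR_IZR_INZ, Z2Nat.id by lia. rewrite opp_IZR. ring.
Qed.

Definition derC (f : R -> C) (t : R) (l : C) : Prop :=
  is_derive (fun s => Re (f s)) t (Re l) /\ is_derive (fun s => Im (f s)) t (Im l).

Lemma derC_mult f g t a b : derC f t a -> derC g t b ->
  derC (fun s => f s * g s)%C t (a * g t + f t * b)%C.
Proof.
  intros [H1 H2] [H3 H4]. unfold Re, Im in *.
  split; unfold Re, Im; simpl.
  - eapply is_derive_ext; [intros s; reflexivity|].
    evar_last.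
    + apply (is_derive_minus (K := R_AbsRing) (V := R_NormedModule)
        (fun s => fst (f s) * fst (g s)) (fun s => snd (f s) * snd (g s))).
      * apply (is_derive_mult (fun s => fst (f s)) (fun s => fst (g s))); [apply H1|apply H3|].
        intros; apply Rmult_comm.
      * apply (is_derive_mult (fun s => snd (f s)) (fun s => snd (g s))); [apply H2|apply H4|].
        intros; apply Rmult_comm.
    + unfold minus, plus, opp, mult; simpl. ring.
  - evar_last.
    + apply (is_derive_plus (K := R_AbsRing) (V := R_NormedModule)
        (fun s => fst (f s) * snd (g s)) (fun s => snd (f s) * fst (g s))).
      * apply (is_derive_mult (fun s => fst (f s)) (fun s => snd (g s))); [apply H1|apply H4|].
        intros; apply Rmult_comm.
      * apply (is_derive_mult (fun s => snd (f s)) (fun s => fst (g s))); [apply H2|apply H3|].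
        intros; apply Rmult_comm.
    + unfold minus, plus, opp, mult; simpl. ring.
Qed.

Lemma derC_ek k t : derC (ek k) t (Ci * RtoC (IZR k) * ek k t)%C.
Proof.
  split; unfold Re, Im, ek; simpl; auto_derive; auto; ring.
Qed.

Lemma derC_cont f t l : derC f t l -> limC (locally t) f (f t).
Proof.
  intros [H1 H2]. apply limC_re_im.
  - apply (ex_derive_continuous (fun s => Re (f s))). exists (Re l). exact H1.
  - apply (ex_derive_continuous (fun s => Im (f s))). exists (Im l). exact H2.
Qed.

Lemma contC_ek k : contC (ek k).
Proof. intros t. eapply derC_cont, derC_ek. Qed.

Lemma cavg_derive f df : (forall t, derC f t (df t)) -> contC df ->
  f (2 * PI) = f 0 -> cavg df = RtoC 0.
Proof.
  intros H Hc Hp. apply injective_projections; simpl.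
  - apply (ravg_derive (fun t => Re (f t))); [intros t; apply H|apply contC_re, Hc|rewrite Hp; reflexivity].
  - apply (ravg_derive (fun t => Im (f t))); [intros t; apply H|apply contC_im, Hc|rewrite Hp; reflexivity].
Qed.

(** The derivative of exp(-i k t) f has zero average by periodicity. The factor -i is the
    normalisation in which D = -i d/dt multiplies the k-th Fourier coefficient by k. *)
Lemma cavg_by_parts k f df : (forall t, derC f t (df t)) -> contC df ->
  f (2 * PI) = f 0 ->
  (RtoC (IZR k) * cavg (fun t => ek (- k) t * f t) = cavg (fun t => ek (- k) t * (- Ci * df t)))%C.
Proof.
  intros H Hc Hp.
  assert (Hf : contC f) by (intros t; eapply derC_cont, H).
  pose proof (cavg_derive (fun t => ek (- k) t * f t)%C
    (fun t => Ci * RtoC (IZR (- k)) * ek (- k) t * f t + ek (- k) t * df t)%C) as E.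
  assert (H1 : contC (fun t => ek (- k) t * f t)%C) by (apply contC_mult; auto using contC_ek).
  assert (H2 : contC (fun t => ek (- k) t * df t)%C) by (apply contC_mult; auto using contC_ek).
  rewrite (cavg_ext _ (fun t => Ci * RtoC (IZR (- k)) * (ek (- k) t * f t) + ek (- k) t * df t)%C) in E
    by (intros t; ring).
  rewrite cavg_plus, cavg_scal in E; auto using contC_mult, contC_const.
  rewrite (cavg_ext (fun t => ek (- k) t * (- Ci * df t))%C (fun t => - Ci * (ek (- k) t * df t))%C)
    by (intros t; ring).
  rewrite cavg_scal by assumption.
  set (p := cavg (fun t => ek (- k) t * f t)%C) in *.
  set (q := cavg (fun t => ek (- k) t * df t)%C) in *.
  assert (E' : (Ci * RtoC (IZR (- k)) * p + q)%C = RtoC 0).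
  { apply E.
    - intros t. apply derC_mult; [apply derC_ek|apply H].
    - apply contC_plus; [|assumption].
      apply contC_mult; auto. apply contC_mult; auto using contC_ek, contC_const.
    - rewrite ek_period, Hp. reflexivity. }
  rewrite opp_IZR in E'. rewrite RtoC_opp in E'.
  replace q with (Ci * RtoC (IZR k) * p)%C.
  - unfold Ci. ceq.
  - replace q with (Ci * RtoC (IZR k) * p + (Ci * - RtoC (IZR k) * p + q))%C by ring.
    rewrite E'. ring.
Qed.

Lemma cavg_ek k : cavg (ek k) = if Z.eq_dec k 0 then RtoC 1 else RtoC 0.
Proof.
  destruct (Z.eq_dec k 0) as [->|Hk].
  - rewrite (cavg_ext _ (fun _ => RtoC 1)) by (intros t; apply ek_0). apply cavg_const.
  - pose proof (cavg_derive (ek k) _ (derC_ek k)) as E.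
    rewrite cavg_scal in E by apply contC_ek.
    assert (E' : (Ci * RtoC (IZR k) * cavg (ek k))%C = RtoC 0).
    { apply E; [|apply ek_period]. apply contC_mult; auto using contC_const, contC_ek. }
    assert (Hnz : (Ci * RtoC (IZR k))%C <> RtoC 0).
    { intros H0. apply (f_equal snd) in H0. simpl in H0. apply Hk, eq_IZR. lra. }
    replace (cavg (ek k)) with (/ (Ci * RtoC (IZR k)) * (Ci * RtoC (IZR k) * cavg (ek k)))%C.
    + rewrite E'. ring.
    + field. split; [|intros H0; apply Hnz; rewrite H0; ring].
      intros H0; apply Hnz; rewrite H0; ring.
Qed.

(** * Averages of operator functions *)

Section OpAverage.
Context {V : HilbertSpace}.

(** A bounded real-linear functional commutes with Riemann sums and hence with their limit. It is
    applied to the real and imaginary parts of a matrix coefficient, which reduces operator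
    integrals to scalar ones. *)
Lemma is_RInt_functional (l : BOp V -> R) (K : R) (F : R -> BOp V) a b (I : BOp V) :
  (forall A B, l (plus A B) = l A + l B) ->
  (forall (k : R) (A : BOp V), l (scal (RtoC k) A) = k * l A) ->
  (forall A, Rabs (l A) <= K * bop_norm A) ->
  is_RInt (V := BOp_R_NormedModule V) F a b I -> is_RInt (fun t => l (F t)) a b (l I).
Proof.
  intros Hp Hs Hb H. unfold is_RInt in *.
  assert (E : forall ptd, scal (sign (b - a)) (Riemann_sum (fun t => l (F t)) ptd) =
    l (scal (sign (b - a)) (Riemann_sum (V := BOp_R_ModuleSpace V) F ptd) : BOp_R_ModuleSpace V)).
  { intros ptd. change (sign (b - a) * Riemann_sum (fun t => l (F t)) ptd =
      l (scal (RtoC (sign (b - a))) (Riemann_sum (V := BOp_R_ModuleSpace V) F ptd : BOp V))).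
    rewrite Hs. f_equal.
    assert (H0 : l zero = 0).
    { pose proof (Hp zero zero) as E0. rewrite plus_zero_l in E0. lra. }
    apply (SF_cons_ind (T := R) (fun ptd => Riemann_sum (fun t => l (F t)) ptd =
      l (Riemann_sum (V := BOp_R_ModuleSpace V) F ptd))).
    - intros x0. symmetry. exact H0.
    - intros h s IH. rewrite !Riemann_sum_cons, IH.
      change ((SF_h s - fst h) * l (F (snd h)) + l (Riemann_sum (V := BOp_R_ModuleSpace V) F s)
        = l (plus (scal (RtoC (SF_h s - fst h)) (F (snd h)))
              (Riemann_sum (V := BOp_R_ModuleSpace V) F s : BOp V))).
      rewrite Hp, Hs. reflexivity. }
  eapply filterlim_ext; [intros ptd; symmetry; apply E|].
  apply (filterlim_comp _ _ _ _ l _ (locally I) _ H).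
  apply filterlim_locally. intros eps.
  assert (HK : 0 < Rabs K + 1) by (pose proof (Rabs_pos K); lra).
  assert (Hd : 0 < eps / (Rabs K + 1)) by (apply Rdiv_lt_0_compat; [apply cond_pos|lra]).
  exists (mkposreal _ Hd). intros A HA. change (bop_norm (minus A I) < eps / (Rabs K + 1)) in HA.
  change (Rabs (l A - l I) < eps).
  assert (El : l A - l I = l (minus A I)).
  { replace (l A) with (l (plus (minus A I) I)).
    - rewrite Hp. ring.
    - f_equal. op_ring. }
  rewrite El. eapply Rle_lt_trans; [apply Hb|].
  pose proof (bop_norm_ge_0 (minus A I)). pose proof (Rle_abs K).
  apply Rle_lt_trans with (bop_norm (minus A I) * (Rabs K + 1)).
  - rewrite Rmult_comm. apply Rmult_le_compat_l; [assumption|lra].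
  - replace (pos eps) with (eps / (Rabs K + 1) * (Rabs K + 1)) by (field; lra).
    apply Rmult_lt_compat_r; assumption.
Qed.

Lemma ex_RInt_contO (F : R -> BOp V) a b : contO F ->
  ex_RInt (V := BOp_R_CompleteNormedModule V) F a b.
Proof.
  intros HF. apply (ex_RInt_continuous (V := BOp_R_CompleteNormedModule V)).
  intros t _. apply limO_filterlim; [apply locally_filter|apply HF].
Qed.

Lemma inner_RInt (F : R -> BOp V) (u w : V) a b : contO F ->
  inner (RInt (V := BOp_R_CompleteNormedModule V) F a b u) w =
  (RInt (fun t => Re (inner (F t u) w)) a b, RInt (fun t => Im (inner (F t u) w)) a b).
Proof.
  intros HF.
  pose proof (RInt_correct (V := BOp_R_CompleteNormedModule V) F a b (ex_RInt_contO F a b HF)) as H.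
  apply injective_projections; simpl; symmetry; apply is_RInt_unique.
  - apply (is_RInt_functional (fun A => Re (inner (A u) w)) (norm u * norm w) F a b) in H.
    + exact H.
    + intros A B. inner_simpl. reflexivity.
    + intros k A. inner_simpl. unfold Re; simpl. ring.
    + intros A. eapply Rle_trans; [apply re_le_Cmod|].
      eapply Rle_trans; [apply inner_op_le|]. lra.
  - apply (is_RInt_functional (fun A => Im (inner (A u) w)) (norm u * norm w) F a b) in H.
    + exact H.
    + intros A B. inner_simpl. reflexivity.
    + intros k A. inner_simpl. unfold Im; simpl. ring.
    + intros A. eapply Rle_trans; [apply im_le_Cmod|].
      eapply Rle_trans; [apply inner_op_le|]. lra.
Qed.

Definition oavg (F : R -> BOp V) : BOp V :=
  scal (RtoC (/ (2 * PI))) (RInt (V := BOp_R_CompleteNormedModule V) F 0 (2 * PI)).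

Lemma inner_oavg (F : R -> BOp V) (u w : V) : contO F ->
  inner (oavg F u) w = cavg (fun t => inner (F t u) w).
Proof.
  intros HF. unfold oavg. rewrite app_scal, inner_scal_l, inner_RInt by exact HF.
  unfold cavg, ravg. ceq.
Qed.

Lemma oavg_bound (F : R -> BOp V) M : contO F -> 0 <= M ->
  (forall t, bop_norm (F t) <= M) -> bop_norm (oavg F) <= M.
Proof.
  intros HF HM H. apply bop_norm_le; [exact HM|]. intros v. apply norm_le_inner.
  - apply Rmult_le_pos; [exact HM|apply vnorm_ge_0].
  - rewrite inner_oavg by exact HF.
    eapply Rle_trans; [eapply Rle_trans; [apply Rle_abs|apply re_le_Cmod]|].
    apply cavg_bound; [apply contC_inner; exact HF|]. intros t.
    eapply Rle_trans; [apply inner_op_le|].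
    apply Rmult_le_compat_r; [apply vnorm_ge_0|].
    apply Rmult_le_compat_r; [apply vnorm_ge_0|apply H].
Qed.

End OpAverage.

(** * Goursat's lemma and the mean value property *)

Lemma Cmod_le_abs (z : C) : Cmod z <= Rabs (fst z) + Rabs (snd z).
Proof.
  replace z with (RtoC (fst z) + Ci * RtoC (snd z))%C at 1 by ceq.
  eapply Rle_trans; [apply Cmod_triangle|]. rewrite Cmod_mult, Cmod_Ci, !Cmod_R. lra.
Qed.

(** Compactness of the enclosing square is applied to a gauge extended beyond the disc by half the
    distance to it: the neighbourhood of an outside point then misses the disc, so the point u that
    is found lies inside. *)
Lemma disc_compact (z0 : C) (r : R) (delta : C -> R) :
  (forall z, closed_disc z0 r z -> 0 < delta z) ->
  exists d, 0 < d /\ forall z, closed_disc z0 r z ->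
    exists u, closed_disc z0 r u /\ Cmod (z - u) < delta u /\ d <= delta u.
Proof.
  intros Hd.
  assert (Hex : forall u v : R, exists p : posreal,
    (closed_disc z0 r (u, v) -> pos p = delta (u, v) / 2) /\
    (~ closed_disc z0 r (u, v) -> pos p = (Cmod ((u, v) - z0) - r) / 2)).
  { intros u v. destruct (classic (closed_disc z0 r (u, v))) as [H|H].
    - assert (Hp : 0 < delta (u, v) / 2) by (specialize (Hd _ H); lra).
      exists (mkposreal _ Hp). simpl. split; [auto|contradiction].
    - assert (Hp : 0 < (Cmod ((u, v) - z0) - r) / 2).
      { unfold closed_disc in H. lra. }
      exists (mkposreal _ Hp). simpl. split; [contradiction|auto]. }
  pose (p := fun u v => proj1_sig (constructive_indefinite_description _ (Hex u v))).
  assert (Hp : forall u v, (closed_disc z0 r (u, v) -> pos (p u v) = delta (u, v) / 2) /\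
    (~ closed_disc z0 r (u, v) -> pos (p u v) = (Cmod ((u, v) - z0) - r) / 2)).
  { intros u v. apply (proj2_sig (constructive_indefinite_description _ (Hex u v))). }
  destruct (compactness_value_2d (fst z0 - r) (fst z0 + r) (snd z0 - r) (snd z0 + r) p)
    as [d Hcomp].
  exists d. split; [apply cond_pos|]. intros z Hz.
  assert (Hx : fst z0 - r <= fst z <= fst z0 + r).
  { pose proof (re_le_Cmod (z - z0)) as H. unfold closed_disc in Hz.
    unfold Re in H; simpl in H. apply Rabs_le_between in H. lra. }
  assert (Hy : snd z0 - r <= snd z <= snd z0 + r).
  { pose proof (im_le_Cmod (z - z0)) as H. unfold closed_disc in Hz.
    unfold Im in H; simpl in H. apply Rabs_le_between in H. lra. }
  specialize (Hcomp _ _ Hx Hy). apply NNPP in Hcomp.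
  destruct Hcomp as [u [v [_ [_ [H1 [H2 H3]]]]]].
  assert (Hzu : Cmod (z - (u, v)) < 2 * p u v).
  { eapply Rle_lt_trans; [apply Cmod_le_abs|]. simpl.
    change (fst z + - u) with (fst z - u). change (snd z + - v) with (snd z - v). lra. }
  destruct (classic (closed_disc z0 r (u, v))) as [H|H].
  - exists (u, v). destruct (Hp u v) as [E _]. rewrite (E H) in *.
    pose proof (Hd _ H). repeat split; [exact H|lra|lra].
  - exfalso. destruct (Hp u v) as [_ E]. rewrite (E H) in *.
    unfold closed_disc in *.
    assert (Cmod ((u, v) - z0) <= Cmod (z - (u, v)) + Cmod (z - z0)).
    { replace ((u, v) - z0)%C with (- (z - (u, v)) + (z - z0))%C by ring.
      eapply Rle_trans; [apply Cmod_triangle|]. rewrite Cmod_opp. lra. }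
    lra.
Qed.

Definition contC_on (D : C -> Prop) (f : C -> C) : Prop :=
  forall z, D z -> forall eps, 0 < eps ->
  exists d, 0 < d /\ forall w, D w -> Cmod (w - z) < d -> Cmod (f w - f z) < eps.

Lemma heine_disc (z0 : C) (r : R) (f : C -> C) : contC_on (closed_disc z0 r) f ->
  forall eps, 0 < eps -> exists d, 0 < d /\
  forall z w, closed_disc z0 r z -> closed_disc z0 r w -> Cmod (w - z) < d ->
    Cmod (f w - f z) < eps.
Proof.
  intros Hf eps He.
  (* The estimate is asked on twice the radius: if z is within [delta u] of u and w within [delta u]
     of z, both stay in the doubled neighbourhood of u. *)
  assert (Hex : forall z, exists d, closed_disc z0 r z ->
    0 < d /\ forall w, closed_disc z0 r w -> Cmod (w - z) < 2 * d -> Cmod (f w - f z) < eps / 2).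
  { intros z. destruct (classic (closed_disc z0 r z)) as [H|H]; [|exists 0; contradiction].
    destruct (Hf z H (eps / 2)) as [d [Hd Hw]]; [lra|].
    exists (d / 2). intros _. split; [lra|]. intros w Hw1 Hw2. apply Hw; [exact Hw1|lra]. }
  pose (delta := fun z => proj1_sig (constructive_indefinite_description _ (Hex z))).
  assert (Hdelta : forall z, closed_disc z0 r z ->
    0 < delta z /\ forall w, closed_disc z0 r w -> Cmod (w - z) < 2 * delta z -> Cmod (f w - f z) < eps / 2).
  { intros z. apply (proj2_sig (constructive_indefinite_description _ (Hex z))). }
  destruct (disc_compact z0 r delta) as [d [Hd Hc]].
  { intros z Hz. apply Hdelta, Hz. }
  exists d. split; [exact Hd|]. intros z w Hz Hw Hzw.
  destruct (Hc z Hz) as [u [Hu [H1 H2]]]. destruct (Hdelta u Hu) as [H3 H4].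
  pose proof (H4 z Hz ltac:(lra)) as H5.
  assert (H6 : Cmod (f w - f u) < eps / 2).
  { apply H4; [exact Hw|].
    replace (w - u)%C with ((w - z) + (z - u))%C by ring.
    eapply Rle_lt_trans; [apply Cmod_triangle|]. lra. }
  replace (f w - f z)%C with ((f w - f u) + - (f z - f u))%C by ring.
  eapply Rle_lt_trans; [apply Cmod_triangle|]. rewrite Cmod_opp. lra.
Qed.

Definition cderiv (f : C -> C) (z L : C) : Prop :=
  forall eps, 0 < eps -> exists d, 0 < d /\ forall w, Cmod (w - z) < d ->
    Cmod (f w - f z - L * (w - z)) <= eps * Cmod (w - z).

Lemma cderiv_lip (f : C -> C) z L : cderiv f z L ->
  exists d, 0 < d /\ forall w, Cmod (w - z) < d ->
    Cmod (f w - f z) <= (Cmod L + 1) * Cmod (w - z).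
Proof.
  intros H. destruct (H 1 Rlt_0_1) as [d [Hd Hw]]. exists d. split; [exact Hd|].
  intros w Hwz. specialize (Hw w Hwz).
  replace (f w - f z)%C with ((f w - f z - L * (w - z)) + L * (w - z))%C by ring.
  eapply Rle_trans; [apply Cmod_triangle|]. rewrite Cmod_mult. lra.
Qed.

Lemma cderiv_comp f g z L M : cderiv g z M -> cderiv f (g z) L ->
  cderiv (fun w => f (g w)) z (L * M)%C.
Proof.
  intros Hg Hf eps He.
  destruct (cderiv_lip g z M Hg) as [d1 [Hd1 H1]].
  set (K := Cmod M + 1) in *. pose proof (Cmod_ge_0 M). pose proof (Cmod_ge_0 L).
  assert (HK : 0 < K) by (unfold K; lra).
  destruct (Hf (eps / 2 / K)) as [d2 [Hd2 H2]]; [repeat apply Rdiv_lt_0_compat; lra|].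
  destruct (Hg (eps / 2 / (Cmod L + 1))) as [d3 [Hd3 H3]]; [repeat apply Rdiv_lt_0_compat; lra|].
  exists (Rmin d1 (Rmin (d2 / K) d3)). split.
  { repeat apply Rmin_pos; auto. apply Rdiv_lt_0_compat; assumption. }
  intros w Hw.
  pose proof (Rmin_l d1 (Rmin (d2 / K) d3)). pose proof (Rmin_r d1 (Rmin (d2 / K) d3)).
  pose proof (Rmin_l (d2 / K) d3). pose proof (Rmin_r (d2 / K) d3).
  specialize (H1 w ltac:(lra)). specialize (H3 w ltac:(lra)).
  pose proof (Cmod_ge_0 (w - z)).
  assert (Hgw : Cmod (g w - g z) < d2).
  { eapply Rle_lt_trans; [exact H1|].
    replace d2 with (K * (d2 / K)) by (field; lra). apply Rmult_lt_compat_l; lra. }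
  specialize (H2 _ Hgw).
  replace (f (g w) - f (g z) - L * M * (w - z))%C with
    ((f (g w) - f (g z) - L * (g w - g z)) + L * (g w - g z - M * (w - z)))%C by ring.
  eapply Rle_trans; [apply Cmod_triangle|]. rewrite Cmod_mult.
  assert (eps / 2 / K * Cmod (g w - g z) <= eps / 2 * Cmod (w - z)).
  { replace (eps / 2 * Cmod (w - z)) with (eps / 2 / K * (K * Cmod (w - z))) by (field; lra).
    apply Rmult_le_compat_l; [|exact H1]. left; repeat apply Rdiv_lt_0_compat; lra. }
  assert (Cmod L * Cmod (g w - g z - M * (w - z)) <= eps / 2 * Cmod (w - z)).
  { apply Rle_trans with ((Cmod L + 1) * (eps / 2 / (Cmod L + 1) * Cmod (w - z))).
    - apply Rmult_le_compat; [lra|apply Cmod_ge_0|lra|exact H3].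
    - right. field. lra. }
  lra.
Qed.

Definition cint (f : R -> C) (a b : R) : C :=
  (RInt (fun t => Re (f t)) a b, RInt (fun t => Im (f t)) a b).

Definition ccont_on (f : R -> C) (a b : R) : Prop :=
  forall t, a <= t <= b -> limC (locally t) f (f t).

Lemma ccont_on_ex f a b : a <= b -> ccont_on f a b ->
  ex_RInt (fun t => Re (f t)) a b /\ ex_RInt (fun t => Im (f t)) a b.
Proof.
  intros Hab H. split; apply (ex_RInt_continuous (V := R_CompleteNormedModule));
    intros t Ht; rewrite Rmin_left, Rmax_right in Ht by lra.
  - apply limC_re, H, Ht.
  - apply limC_im, H, Ht.
Qed.

Lemma cint_Chasles f a b c : a <= b <= c -> ccont_on f a c ->
  cint f a c = (cint f a b + cint f b c)%C.
Proof.
  intros [H1 H2] Hf.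
  destruct (ccont_on_ex f a b H1) as [E1 E2]. { intros t Ht. apply Hf. lra. }
  destruct (ccont_on_ex f b c H2) as [E3 E4]. { intros t Ht. apply Hf. lra. }
  apply injective_projections; simpl; symmetry; apply (RInt_Chasles (V := R_CompleteNormedModule)); assumption.
Qed.

(** Meant for two opposite sides of a rectangle, on which the integrands differ by nearly a
    constant. The factor 2 comes from estimating the two components separately. *)
Lemma cint_approx f g k M a b : a <= b -> ccont_on f a b -> ccont_on g a b ->
  (forall t, a <= t <= b -> Cmod (f t - g t - k) <= M) ->
  Cmod (cint f a b - cint g a b - k * RtoC (b - a)) <= 2 * M * (b - a).
Proof.
  intros Hab Hf Hg H.
  destruct (ccont_on_ex f a b Hab Hf) as [E1 E2].
  destruct (ccont_on_ex g a b Hab Hg) as [E3 E4].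
  assert (Hr : forall p q : R -> R, forall c, ex_RInt p a b -> ex_RInt q a b ->
    (forall t, a <= t <= b -> Rabs (p t - q t - c) <= M) ->
    Rabs (RInt p a b - RInt q a b - c * (b - a)) <= (b - a) * M).
  { intros p q c Hp Hq Hb.
    apply (norm_RInt_le_const (V := R_NormedModule) (fun t => p t - q t - c) a b); [exact Hab|exact Hb|].
    apply (is_RInt_minus (V := R_NormedModule) (fun t => p t - q t) (fun _ => c)).
    - apply (is_RInt_minus (V := R_NormedModule)); apply (RInt_correct (V := R_CompleteNormedModule)); assumption.
    - replace (c * (b - a)) with (@scal R_Ring R_NormedModule (b - a) c) by (unfold scal; simpl; unfold mult; simpl; ring).
      apply (is_RInt_const (V := R_NormedModule)). }
  eapply Rle_trans; [apply Cmod_le_abs|].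
  assert (A1 : Rabs (fst (cint f a b - cint g a b - k * RtoC (b - a))%C) <= (b - a) * M).
  { simpl. match goal with |- Rabs ?x <= _ => replace x with
      (RInt (fun t => Re (f t)) a b - RInt (fun t => Re (g t)) a b - Re k * (b - a))
      by (unfold Re; ring) end.
    apply Hr; auto. intros t Ht. eapply Rle_trans; [|apply (H t Ht)].
    exact (re_le_Cmod (f t - g t - k)). }
  assert (A2 : Rabs (snd (cint f a b - cint g a b - k * RtoC (b - a))%C) <= (b - a) * M).
  { simpl. match goal with |- Rabs ?x <= _ => replace x with
      (RInt (fun t => Im (f t)) a b - RInt (fun t => Im (g t)) a b - Im k * (b - a))
      by (unfold Im; ring) end.
    apply Hr; auto. intros t Ht. eapply Rle_trans; [|apply (H t Ht)].
    exact (im_le_Cmod (f t - g t - k)). }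
  lra.
Qed.

Section Goursat.
Variables (g : C -> C) (a0 b0 c0 d0 : R).
Hypothesis Hab : a0 < b0.
Hypothesis Hcd : c0 < d0.
Hypothesis g_diff : forall x y, a0 <= x <= b0 -> c0 <= y <= d0 -> exists L, cderiv g (x, y) L.

(** The counterclockwise contour integral along the boundary of the rectangle [a, b] x [c, d]. *)
Definition rect_int (a b c d : R) : C :=
  (cint (fun x => g (x, c)) a b - cint (fun x => g (x, d)) a b
   + Ci * (cint (fun y => g (b, y)) c d - cint (fun y => g (a, y)) c d))%C.

Lemma goursat_cont x y : a0 <= x <= b0 -> c0 <= y <= d0 ->
  forall eps, 0 < eps -> exists d, 0 < d /\ forall w, Cmod (w - (x, y)) < d -> Cmod (g w - g (x, y)) < eps.
Proof.
  intros Hx Hy eps He. destruct (g_diff x y Hx Hy) as [L HL].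
  destruct (cderiv_lip _ _ _ HL) as [d [Hd Hw]].
  pose proof (Cmod_ge_0 L).
  exists (Rmin d (eps / (Cmod L + 1))). split.
  { apply Rmin_pos; [exact Hd|]. apply Rdiv_lt_0_compat; lra. }
  intros w Hwz. pose proof (Rmin_l d (eps / (Cmod L + 1))). pose proof (Rmin_r d (eps / (Cmod L + 1))).
  eapply Rle_lt_trans; [apply Hw; lra|].
  replace eps with ((Cmod L + 1) * (eps / (Cmod L + 1))) by (field; lra).
  apply Rmult_lt_compat_l; lra.
Qed.

Lemma goursat_cont_h y a b : a0 <= a -> b <= b0 -> c0 <= y <= d0 -> ccont_on (fun x => g (x, y)) a b.
Proof.
  intros Ha Hb Hy t Ht eps He. destruct (goursat_cont t y ltac:(lra) Hy eps He) as [d [Hd H]].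
  exists (mkposreal d Hd). intros s Hs. apply H.
  eapply Rle_lt_trans; [apply Cmod_le_abs|]. simpl.
  replace (y + - y) with 0 by ring. rewrite Rabs_R0, Rplus_0_r. exact Hs.
Qed.

Lemma goursat_cont_v x c d : c0 <= c -> d <= d0 -> a0 <= x <= b0 -> ccont_on (fun y => g (x, y)) c d.
Proof.
  intros Ha Hb Hx t Ht eps He. destruct (goursat_cont x t Hx ltac:(lra) eps He) as [e [Hd H]].
  exists (mkposreal e Hd). intros s Hs. apply H.
  eapply Rle_lt_trans; [apply Cmod_le_abs|]. simpl.
  replace (x + - x) with 0 by ring. rewrite Rabs_R0, Rplus_0_l. exact Hs.
Qed.

Lemma rect_int_split a m b c k d : a0 <= a -> a <= m <= b -> b <= b0 ->
  c0 <= c -> c <= k <= d -> d <= d0 ->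
  rect_int a b c d = (rect_int a m c k + rect_int m b c k + rect_int a m k d + rect_int m b k d)%C.
Proof.
  intros. unfold rect_int.
  rewrite (cint_Chasles (fun x => g (x, c)) a m b), (cint_Chasles (fun x => g (x, d)) a m b),
    (cint_Chasles (fun y => g (a, y)) c k d), (cint_Chasles (fun y => g (b, y)) c k d).
  all: try (split; lra).
  - ring.
  - apply goursat_cont_v; lra.
  - apply goursat_cont_v; lra.
  - apply goursat_cont_h; lra.
  - apply goursat_cont_h; lra.
Qed.

(** The affine part of g differs between opposite sides by a constant, and the contributions of the
    two pairs of sides cancel. The remainder is at most eta s pointwise, which costs 4 eta s per
    unit of length over a total length of at most s. *)
Lemma rect_int_local L x y eta s a b c d :
  a0 <= a -> a <= x <= b -> b <= b0 -> c0 <= c -> c <= y <= d -> d <= d0 ->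
  0 <= eta -> (b - a) + (d - c) <= s ->
  (forall w, Cmod (w - (x, y)) <= s -> Cmod (g w - g (x, y) - L * (w - (x, y))) <= eta * Cmod (w - (x, y))) ->
  Cmod (rect_int a b c d) <= 4 * eta * s ^ 2.
Proof.
  intros Ha Hx Hb Hc Hy Hd He Hs H.
  assert (Hw : forall u v, a <= u <= b -> c <= v <= d ->
    Cmod (g (u, v) - g (x, y) - L * ((u, v) - (x, y))) <= eta * s).
  { intros u v Hu Hv.
    assert (Hm : Cmod ((u, v) - (x, y)) <= s).
    { eapply Rle_trans; [apply Cmod_le_abs|]. simpl. eapply Rle_trans; [|exact Hs].
      apply Rplus_le_compat; apply Rabs_le; lra. }
    eapply Rle_trans; [apply H, Hm|]. apply Rmult_le_compat_l; assumption. }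
  unfold rect_int.
  pose proof (cint_approx (fun x => g (x, c)) (fun x => g (x, d)) (L * (Ci * RtoC (c - d)))%C (2 * (eta * s)) a b) as H1.
  pose proof (cint_approx (fun y => g (b, y)) (fun y => g (a, y)) (L * RtoC (b - a))%C (2 * (eta * s)) c d) as H2.
  cbv beta in H1, H2.
  match type of H1 with _ -> _ -> _ -> _ -> Cmod (?p - ?q - _) <= _ => set (h1 := p) in *; set (h2 := q) in * end.
  match type of H2 with _ -> _ -> _ -> _ -> Cmod (?p - ?q - _) <= _ => set (v1 := p) in *; set (v2 := q) in * end.
  assert (H1' : Cmod (h1 - h2 - L * (Ci * RtoC (c - d)) * RtoC (b - a)) <= 2 * (2 * (eta * s)) * (b - a)).
  { apply H1; [lra|apply goursat_cont_h; lra|apply goursat_cont_h; lra|].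
    intros t Ht. pose proof (Hw t c Ht ltac:(lra)) as A. pose proof (Hw t d Ht ltac:(lra)) as B.
    replace (g (t, c) - g (t, d) - L * (Ci * RtoC (c - d)))%C with
      ((g (t, c) - g (x, y) - L * ((t, c) - (x, y))) + - (g (t, d) - g (x, y) - L * ((t, d) - (x, y))))%C
      by ceq.
    eapply Rle_trans; [apply Cmod_triangle|]. rewrite Cmod_opp. lra. }
  assert (H2' : Cmod (v1 - v2 - L * RtoC (b - a) * RtoC (d - c)) <= 2 * (2 * (eta * s)) * (d - c)).
  { apply H2; [lra|apply goursat_cont_v; lra|apply goursat_cont_v; lra|].
    intros t Ht. pose proof (Hw b t ltac:(lra) Ht) as A. pose proof (Hw a t ltac:(lra) Ht) as B.
    replace (g (b, t) - g (a, t) - L * RtoC (b - a))%C with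
      ((g (b, t) - g (x, y) - L * ((b, t) - (x, y))) + - (g (a, t) - g (x, y) - L * ((a, t) - (x, y))))%C
      by ceq.
    eapply Rle_trans; [apply Cmod_triangle|]. rewrite Cmod_opp. lra. }
  clear H1 H2.
  replace (h1 - h2 + Ci * (v1 - v2))%C with
    ((h1 - h2 - L * (Ci * RtoC (c - d)) * RtoC (b - a)) + Ci * (v1 - v2 - L * RtoC (b - a) * RtoC (d - c)))%C by ceq.
  eapply Rle_trans; [apply Cmod_triangle|]. rewrite Cmod_mult, Cmod_Ci.
  assert (Hes : 0 <= eta * s) by (apply Rmult_le_pos; lra).
  assert (eta * s * (b - a + (d - c)) <= eta * s * s) by (apply Rmult_le_compat_l; assumption).
  simpl. lra.
Qed.

(** The n-th rectangle of the bisection is recorded by its lower left corner alone, its size being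
    determined by n. *)
Let bad (eps : R) (n : nat) (p : R * R) : Prop :=
  a0 <= fst p /\ fst p + (b0 - a0) / 2 ^ n <= b0 /\ c0 <= snd p /\ snd p + (d0 - c0) / 2 ^ n <= d0 /\
  eps / 4 ^ n < Cmod (rect_int (fst p) (fst p + (b0 - a0) / 2 ^ n) (snd p) (snd p + (d0 - c0) / 2 ^ n)).

Let refines (n : nat) (p q : R * R) : Prop :=
  fst p <= fst q /\ fst q + (b0 - a0) / 2 ^ S n <= fst p + (b0 - a0) / 2 ^ n /\
  snd p <= snd q /\ snd q + (d0 - c0) / 2 ^ S n <= snd p + (d0 - c0) / 2 ^ n.

(** The integrals over the four quarters add up to the whole, so they cannot all be at most a
    quarter of the threshold. *)
Lemma goursat_refine eps n p : bad eps n p -> exists q, bad eps (S n) q /\ refines n p q.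
Proof.
  intros [H1 [H2 [H3 [H4 H5]]]].
  assert (H2n : 0 < 2 ^ n) by (apply pow_lt; lra).
  assert (H4n : 0 < 4 ^ n) by (apply pow_lt; lra).
  assert (E1 : (b0 - a0) / 2 ^ n = 2 * ((b0 - a0) / 2 ^ S n)) by (simpl; field; lra).
  assert (E2 : (d0 - c0) / 2 ^ n = 2 * ((d0 - c0) / 2 ^ S n)) by (simpl; field; lra).
  assert (E3 : eps / 4 ^ n = 4 * (eps / 4 ^ S n)) by (simpl; field; lra).
  assert (P1 : 0 < (b0 - a0) / 2 ^ S n) by (apply Rdiv_lt_0_compat; [lra|apply pow_lt; lra]).
  assert (P2 : 0 < (d0 - c0) / 2 ^ S n) by (apply Rdiv_lt_0_compat; [lra|apply pow_lt; lra]).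
  unfold bad, refines. rewrite E1, E2, E3 in *.
  set (h := (b0 - a0) / 2 ^ S n) in *. set (k := (d0 - c0) / 2 ^ S n) in *.
  set (e := eps / 4 ^ S n) in *. destruct p as [a c]. simpl in *.
  apply NNPP. intros Hn.
  assert (Hq : forall q : R * R, (fst q = a \/ fst q = a + h) -> (snd q = c \/ snd q = c + k) ->
    Cmod (rect_int (fst q) (fst q + h) (snd q) (snd q + k)) <= e).
  { intros q Hq1 Hq2. apply Rnot_lt_le. intros Hlt. apply Hn. exists q.
    destruct q as [a' c']; simpl in *. repeat split; try exact Hlt;
    destruct Hq1 as [-> | ->], Hq2 as [-> | ->]; lra. }
  pose proof (Hq (a, c) (or_introl eq_refl) (or_introl eq_refl)) as Q1.
  pose proof (Hq (a + h, c) (or_intror eq_refl) (or_introl eq_refl)) as Q2.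
  pose proof (Hq (a, c + k) (or_introl eq_refl) (or_intror eq_refl)) as Q3.
  pose proof (Hq (a + h, c + k) (or_intror eq_refl) (or_intror eq_refl)) as Q4.
  simpl in *.
  rewrite (rect_int_split a (a + h) (a + 2 * h) c (c + k) (c + 2 * k)) in H5 by lra.
  replace (a + h + h) with (a + 2 * h) in * by ring.
  replace (c + k + k) with (c + 2 * k) in * by ring.
  pose proof (Cmod_triangle (rect_int a (a + h) c (c + k) + rect_int (a + h) (a + 2 * h) c (c + k) + rect_int a (a + h) (c + k) (c + 2 * k)) (rect_int (a + h) (a + 2 * h) (c + k) (c + 2 * k))).
  pose proof (Cmod_triangle (rect_int a (a + h) c (c + k) + rect_int (a + h) (a + 2 * h) c (c + k)) (rect_int a (a + h) (c + k) (c + 2 * k))).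
  pose proof (Cmod_triangle (rect_int a (a + h) c (c + k)) (rect_int (a + h) (a + 2 * h) c (c + k))).
  lra.
Qed.

Lemma nested_limit (u : nat -> R) (h : R) : 0 < h ->
  (forall n, u n <= u (S n) /\ u (S n) + h / 2 ^ S n <= u n + h / 2 ^ n) ->
  exists x, forall n, u n <= x <= u n + h / 2 ^ n.
Proof.
  intros Hh Hu.
  assert (Hmono : forall n m, u n <= u (n + m)%nat /\ u (n + m)%nat + h / 2 ^ (n + m) <= u n + h / 2 ^ n).
  { intros n m. induction m as [|m IH]; [rewrite Nat.add_0_r; lra|].
    rewrite Nat.add_succ_r. pose proof (Hu (n + m)%nat). lra. }
  assert (Hpos : forall n, 0 < h / 2 ^ n) by (intros n; apply Rdiv_lt_0_compat; [lra|apply pow_lt; lra]).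
  assert (Hle : forall n m, u m <= u n + h / 2 ^ n).
  { intros n m. destruct (Nat.le_ge_cases n m) as [H|H].
    - pose proof (Hmono n (m - n)%nat) as H1. replace (n + (m - n))%nat with m in H1 by lia.
      pose proof (Hpos m). lra.
    - pose proof (Hmono m (n - m)%nat) as H1. replace (m + (n - m))%nat with n in H1 by lia.
      pose proof (Hpos n). lra. }
  destruct (completeness (fun s => exists n, s = u n)) as [x [Hub Hlub]].
  - exists (u 0%nat + h / 2 ^ 0). intros s [m ->]. apply Hle.
  - exists (u 0%nat). exists 0%nat. reflexivity.
  - exists x. intros n. split.
    + apply Hub. exists n. reflexivity.
    + apply Hlub. intros s [m ->]. apply Hle.
Qed.

Theorem goursat : rect_int a0 b0 c0 d0 = RtoC 0.
Proof.
  apply Cmod_eq_0. apply Rle_antisym; [|apply Cmod_ge_0].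
  apply Rnot_lt_le. intros Hpos.
  set (eps := Cmod (rect_int a0 b0 c0 d0) / 2).
  assert (Heps : 0 < eps) by (unfold eps; lra).
  assert (Hb0 : bad eps 0 (a0, c0)).
  { unfold bad. simpl. rewrite !Rdiv_1_r. replace (a0 + (b0 - a0)) with b0 by ring.
    replace (c0 + (d0 - c0)) with d0 by ring. unfold eps. repeat split; lra. }
  assert (Hnext : forall n p, exists q, bad eps n p -> bad eps (S n) q /\ refines n p q).
  { intros n p. destruct (classic (bad eps n p)) as [H|H].
    - destruct (goursat_refine eps n p H) as [q Hq]. exists q. auto.
    - exists p. contradiction. }
  pose (next := fun n p => proj1_sig (constructive_indefinite_description _ (Hnext n p))).
  assert (Hn : forall n p, bad eps n p -> bad eps (S n) (next n p) /\ refines n p (next n p)).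
  { intros n p. apply (proj2_sig (constructive_indefinite_description _ (Hnext n p))). }
  pose (sq := fix sq (n : nat) : R * R := match n with O => (a0, c0) | S n => next n (sq n) end).
  assert (Hbad : forall n, bad eps n (sq n)).
  { induction n as [|n IH]; [exact Hb0|]. apply (Hn n (sq n) IH). }
  assert (Href : forall n, refines n (sq n) (sq (S n))).
  { intros n. apply (Hn n (sq n) (Hbad n)). }
  destruct (nested_limit (fun n => fst (sq n)) (b0 - a0) ltac:(lra)) as [x Hx].
  { intros n. destruct (Href n) as [A [B _]]. split; [exact A|exact B]. }
  destruct (nested_limit (fun n => snd (sq n)) (d0 - c0) ltac:(lra)) as [y Hy].
  { intros n. destruct (Href n) as [_ [_ [A B]]]. split; [exact A|exact B]. }
  assert (Hx0 : a0 <= x <= b0).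
  { pose proof (Hx 0%nat) as H. simpl in H. rewrite Rdiv_1_r in H. lra. }
  assert (Hy0 : c0 <= y <= d0).
  { pose proof (Hy 0%nat) as H. simpl in H. rewrite Rdiv_1_r in H. lra. }
  destruct (g_diff x y Hx0 Hy0) as [L HL].
  set (S0 := (b0 - a0) + (d0 - c0)). assert (HS0 : 0 < S0) by (unfold S0; lra).
  (* The tolerance is fixed so that [rect_int_local], with s = S0 / 2^N, gives exactly eps / 4^N,
     the value that a bad rectangle exceeds. *)
  destruct (HL (eps / (4 * S0 ^ 2))) as [d [Hd Hw]].
  { apply Rdiv_lt_0_compat; [lra|]. assert (0 < S0 ^ 2) by (apply pow_lt; lra). lra. }
  destruct (pow_lt_1_zero (1 / 2) ltac:(rewrite Rabs_pos_eq; lra) (d / S0)) as [N HN].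
  { apply Rdiv_lt_0_compat; lra. }
  specialize (HN N (le_n _)).
  assert (H2N : 0 < 2 ^ N) by (apply pow_lt; lra).
  rewrite Rabs_pos_eq in HN by (apply pow_le; lra).
  assert (HsN : S0 / 2 ^ N < d).
  { unfold Rdiv at 1. replace (/ 2 ^ N) with ((1 / 2) ^ N).
    - replace d with (S0 * (d / S0)) by (field; lra). apply Rmult_lt_compat_l; assumption.
    - replace (1 / 2) with (/ 2) by lra. rewrite pow_inv. reflexivity. }
  destruct (Hbad N) as [H1 [H2 [H3 [H4 H5]]]].
  apply Rlt_not_le in H5. apply H5.
  eapply Rle_trans; [apply (rect_int_local L x y (eps / (4 * S0 ^ 2)) (S0 / 2 ^ N))|].
  - exact H1.
  - apply (Hx N).
  - exact H2.
  - exact H3.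
  - apply (Hy N).
  - exact H4.
  - left. apply Rdiv_lt_0_compat; [lra|]. assert (0 < S0 ^ 2) by (apply pow_lt; lra). lra.
  - unfold S0. right. field. lra.
  - intros w Hww. apply Hw. lra.
  - right. replace (4 ^ N) with (2 ^ N * 2 ^ N).
    + field. lra.
    + rewrite <- Rpow_mult_distr. replace (2 * 2) with 4 by ring. reflexivity.
Qed.
End Goursat.

(** * Polar coordinates and the mean value property *)

Definition cexp (w : C) : C := Cmult (RtoC (exp (fst w))) (cos (snd w), sin (snd w)).

Lemma cexp_plus z w : cexp (z + w) = (cexp z * cexp w)%C.
Proof. unfold cexp; simpl. rewrite exp_plus, cos_plus, sin_plus. ceq. Qed.

Lemma Cmod_cis t : Cmod (cos t, sin t) = 1.
Proof.
  replace (cos t, sin t) with (ek 1 t) by (unfold ek; rewrite Rmult_1_l; reflexivity).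
  apply Cmod_ek.
Qed.

Lemma Cmod_cexp w : Cmod (cexp w) = exp (fst w).
Proof.
  unfold cexp. rewrite Cmod_mult, Cmod_R, Cmod_cis, Rabs_pos_eq by (left; apply exp_pos). ring.
Qed.

Lemma first_order_at_0 (f : R -> R) l : is_derive f 0 l -> forall eps, 0 < eps ->
  exists d, 0 < d /\ forall x, Rabs x < d -> Rabs (f x - f 0 - l * x) <= eps * Rabs x.
Proof.
  intros [_ H] eps He. specialize (H 0 (fun P HP => HP) (mkposreal eps He)).
  destruct H as [d Hd]. exists d. split; [apply cond_pos|]. intros x Hx.
  assert (Hb : ball 0 d x) by (change (Rabs (x - 0) < d); rewrite Rminus_0_r; exact Hx).
  specialize (Hd x Hb).
  unfold norm, minus, plus, opp, scal in Hd; simpl in Hd; unfold abs, mult in Hd; simpl in Hd.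
  replace (x + - 0) with x in Hd by ring.
  replace (f x - f 0 - l * x) with (f x + - f 0 + - (x * l)) by ring. exact Hd.
Qed.

(** The addition formula reduces the claim to the expansion cexp h = 1 + h + o(h) at the origin,
    which follows from those of exp, cos and sin there. *)
Lemma cderiv_cexp w : cderiv cexp w (cexp w).
Proof.
  intros eps He. set (K := Cmod (cexp w) + 1).
  assert (HK : 0 < K) by (unfold K; pose proof (Cmod_ge_0 (cexp w)); lra).
  set (e := Rmin 1 (eps / (9 * K))).
  assert (Hee : 0 < e) by (apply Rmin_pos; [lra|apply Rdiv_lt_0_compat; lra]).
  assert (De : is_derive exp 0 1).
  { evar_last; [apply is_derive_exp|apply exp_0]. }
  assert (Dc : is_derive cos 0 0).
  { evar_last; [apply is_derive_cos|rewrite sin_0; ring]. }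
  assert (Ds : is_derive sin 0 1).
  { evar_last; [apply is_derive_sin|apply cos_0]. }
  destruct (first_order_at_0 _ _ De e Hee) as [d1 [Hd1 H1]].
  destruct (first_order_at_0 _ _ Dc e Hee) as [d2 [Hd2 H2]].
  destruct (first_order_at_0 _ _ Ds e Hee) as [d3 [Hd3 H3]].
  rewrite exp_0 in H1. rewrite cos_0 in H2. rewrite sin_0 in H3.
  exists (Rmin (e / 2) (Rmin d1 (Rmin d2 d3))). split; [repeat apply Rmin_pos; lra|].
  intros z Hz.
  set (h := (z - w)%C) in *. assert (Ez : z = (w + h)%C) by (unfold h; ring).
  rewrite Ez, cexp_plus. clearbody h.
  replace (cexp w * cexp h - cexp w - cexp w * h)%C with (cexp w * (cexp h - 1 - h))%C by ring.
  rewrite Cmod_mult.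
  assert (Hm : Cmod h < e / 2 /\ Cmod h < d1 /\ Cmod h < d2 /\ Cmod h < d3).
  { repeat split; (eapply Rlt_le_trans; [exact Hz|]).
    - apply Rmin_l.
    - eapply Rle_trans; [apply Rmin_r|apply Rmin_l].
    - eapply Rle_trans; [apply Rmin_r|]. eapply Rle_trans; [apply Rmin_r|apply Rmin_l].
    - eapply Rle_trans; [apply Rmin_r|]. eapply Rle_trans; [apply Rmin_r|apply Rmin_r]. }
  destruct Hm as [M0 [M1 [M2 M3]]].
  pose proof (re_le_Cmod h) as Hx. pose proof (im_le_Cmod h) as Hy. unfold Re in Hx; unfold Im in Hy.
  set (x := fst h) in *. set (y := snd h) in *.
  specialize (H1 x ltac:(lra)). specialize (H2 y ltac:(lra)). specialize (H3 y ltac:(lra)).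
  pose proof (Rmin_l 1 (eps / (9 * K))) as He1. fold e in He1.
  pose proof (Rmin_r 1 (eps / (9 * K))) as He2. fold e in He2.
  set (m := Cmod h) in *.
  assert (Hm0 : 0 <= m) by apply Cmod_ge_0.
  assert (Hx1 : Rabs (exp x - 1) <= e).
  { replace (exp x - 1) with ((exp x - 1 - 1 * x) + x) by ring.
    eapply Rle_trans; [apply Rabs_triang|].
    assert (e * Rabs x <= 1 * Rabs x) by (apply Rmult_le_compat_r; [apply Rabs_pos|exact He1]).
    lra. }
  assert (Hexp : 0 < exp x <= 2).
  { split; [apply exp_pos|]. apply Rabs_le_between in Hx1. lra. }
  assert (A1 : Rabs (exp x * cos y - 1 - x) <= 3 * e * m).
  { replace (exp x * cos y - 1 - x) with ((exp x - 1 - 1 * x) + exp x * (cos y - 1 - 0 * y)) by ring.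
    eapply Rle_trans; [apply Rabs_triang|]. rewrite Rabs_mult, (Rabs_pos_eq (exp x)) by lra.
    assert (e * Rabs x <= e * m) by (apply Rmult_le_compat_l; lra).
    assert (e * Rabs y <= e * m) by (apply Rmult_le_compat_l; lra).
    assert (exp x * Rabs (cos y - 1 - 0 * y) <= 2 * (e * m)).
    { apply Rmult_le_compat; [lra|apply Rabs_pos|lra|lra]. }
    lra. }
  assert (A2 : Rabs (exp x * sin y - y) <= 3 * e * m).
  { replace (exp x * sin y - y) with (exp x * (sin y - 0 - 1 * y) + (exp x - 1) * y) by ring.
    eapply Rle_trans; [apply Rabs_triang|]. rewrite !Rabs_mult, (Rabs_pos_eq (exp x)) by lra.
    assert (e * Rabs y <= e * m) by (apply Rmult_le_compat_l; lra).
    assert (exp x * Rabs (sin y - 0 - 1 * y) <= 2 * (e * m)).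
    { apply Rmult_le_compat; [lra|apply Rabs_pos|lra|lra]. }
    assert (Rabs (exp x - 1) * Rabs y <= e * m).
    { apply Rmult_le_compat; [apply Rabs_pos|apply Rabs_pos|lra|lra]. }
    lra. }
  assert (A3 : Cmod (cexp h - 1 - h) <= 6 * e * m).
  { eapply Rle_trans; [apply Cmod_le_abs|].
    replace (fst (cexp h - 1 - h)%C) with (exp x * cos y - 1 - x) by (unfold cexp; simpl; fold x y; ring).
    replace (snd (cexp h - 1 - h)%C) with (exp x * sin y - y) by (unfold cexp; simpl; fold x y; ring).
    lra. }
  apply Rle_trans with (K * (6 * (eps / (9 * K)) * m)).
  - apply Rmult_le_compat; [apply Cmod_ge_0|apply Cmod_ge_0|unfold K; lra|].
    eapply Rle_trans; [exact A3|]. apply Rmult_le_compat_r; [exact Hm0|lra].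
  - replace (K * (6 * (eps / (9 * K)) * m)) with (6 / 9 * (eps * m)) by (field; lra).
    assert (0 <= eps * m) by (apply Rmult_le_pos; lra). lra.
Qed.

Lemma circle_cexp z0 s t : 0 < s -> circle z0 s t = (z0 + cexp (ln s, t))%C.
Proof. intros Hs. unfold circle, cexp; simpl. rewrite exp_ln by exact Hs. reflexivity. Qed.

Lemma circle_sub z0 s t : (circle z0 s t - z0 = RtoC s * ek 1 t)%C.
Proof. unfold circle, ek. rewrite Rmult_1_l. ring. Qed.

Lemma Cmod_circle_sub z0 s t : 0 <= s -> Cmod (circle z0 s t - z0) = s.
Proof.
  intros Hs. rewrite circle_sub, Cmod_mult, Cmod_R, Cmod_ek, Rabs_pos_eq by exact Hs. ring.
Qed.

Lemma circle_dist z0 s s' t : Cmod (circle z0 s t - circle z0 s' t) = Rabs (s - s').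
Proof.
  unfold circle. replace (z0 + RtoC s * (cos t, sin t) - (z0 + RtoC s' * (cos t, sin t)))%C
    with (RtoC (s - s') * (cos t, sin t))%C by ceq.
  rewrite Cmod_mult, Cmod_R, Cmod_cis. ring.
Qed.

Lemma circle_continuous z0 s t : 0 <= s -> forall eps, 0 < eps ->
  locally t (fun t' => Cmod (circle z0 s t' - circle z0 s t) < eps).
Proof.
  intros Hs eps He. assert (Hd : 0 < eps / (s + 1)) by (apply Rdiv_lt_0_compat; lra).
  pose proof (contC_ek 1 t _ Hd) as H. revert H. apply filter_imp. intros t' H.
  replace (circle z0 s t' - circle z0 s t)%C with ((circle z0 s t' - z0) - (circle z0 s t - z0))%C by ring.
  rewrite !circle_sub.
  replace (RtoC s * ek 1 t' - RtoC s * ek 1 t)%C with (RtoC s * (ek 1 t' - ek 1 t))%C by ring.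
  rewrite Cmod_mult, Cmod_R, Rabs_pos_eq by exact Hs.
  pose proof (Cmod_ge_0 (ek 1 t' - ek 1 t)).
  replace eps with ((s + 1) * (eps / (s + 1))) by (field; lra).
  apply Rle_lt_trans with ((s + 1) * Cmod (ek 1 t' - ek 1 t)).
  - apply Rmult_le_compat_r; lra.
  - apply Rmult_lt_compat_l; lra.
Qed.

Lemma contC_circle z0 r s f : 0 <= s <= r -> contC_on (closed_disc z0 r) f ->
  contC (fun t => f (circle z0 s t)).
Proof.
  intros Hs Hf t eps He.
  assert (Hin : forall t, closed_disc z0 r (circle z0 s t)).
  { intros t'. unfold closed_disc. rewrite Cmod_circle_sub; lra. }
  destruct (Hf _ (Hin t) eps He) as [d [Hd H]].
  generalize (circle_continuous z0 s t (proj1 Hs) d Hd). apply filter_imp.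
  intros t' Ht'. apply H; [apply Hin|exact Ht'].
Qed.

Section MeanValue.
Variables (z0 : C) (r : R) (f : C -> C).
Hypothesis Hr : 0 < r.
Hypothesis f_cont : contC_on (closed_disc z0 r) f.
Hypothesis f_diff : forall z, open_disc z0 r z -> exists L, cderiv f z L.

(* In logarithmic coordinates the annulus is a rectangle. *)
Lemma circle_mean_const s1 s2 : 0 < s1 < s2 -> s2 < r ->
  cavg (fun t => f (circle z0 s1 t)) = cavg (fun t => f (circle z0 s2 t)).
Proof.
  intros [Hs1 Hs12] Hs2.
  set (g := fun w => f (z0 + cexp w)%C).
  pose proof two_PI_pos as Hpi.
  assert (Hg : rect_int g (ln s1) (ln s2) 0 (2 * PI) = RtoC 0).
  { apply goursat; [apply ln_increasing; lra|exact Hpi|].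
    intros x y Hx Hy.
    destruct (f_diff (z0 + cexp (x, y))%C) as [L HL].
    { unfold open_disc. replace (z0 + cexp (x, y) - z0)%C with (cexp (x, y)) by ring.
      rewrite Cmod_cexp. simpl. apply Rle_lt_trans with s2; [|exact Hs2].
      rewrite <- (exp_ln s2) by lra. destruct (proj2 Hx) as [H|H]; [left; apply exp_increasing, H|rewrite H; lra]. }
    exists (L * cexp (x, y))%C. unfold g.
    apply (cderiv_comp f (fun w => (z0 + cexp w)%C)); [|exact HL].
    intros eps He. destruct (cderiv_cexp (x, y) eps He) as [d [Hd H]].
    exists d. split; [exact Hd|]. intros w Hw.
    replace (z0 + cexp w - (z0 + cexp (x, y)))%C with (cexp w - cexp (x, y))%C by ring.
    apply H, Hw. }
  assert (Hp : forall x, g (x, 2 * PI) = g (x, 0)).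
  { intros x. unfold g. do 2 f_equal. unfold cexp; simpl.
    rewrite cos_2PI, sin_2PI, cos_0, sin_0. reflexivity. }
  unfold rect_int in Hg.
  replace (cint (fun x => g (x, 2 * PI)) (ln s1) (ln s2)) with
    (cint (fun x => g (x, 0)) (ln s1) (ln s2)) in Hg
    by (f_equal; apply functional_extensionality; intros x; symmetry; apply Hp).
  assert (Hv : cint (fun y => g (ln s1, y)) 0 (2 * PI) = cint (fun y => g (ln s2, y)) 0 (2 * PI)).
  { match type of Hg with (?h - ?h + Ci * (?p - ?q))%C = _ =>
      replace q with (p - (- Ci) * (h - h + Ci * (p - q)))%C by (unfold Ci; ceq) end.
    rewrite Hg. ring. }
  unfold cavg.
  apply (f_equal fst) in Hv as Hv1. apply (f_equal snd) in Hv as Hv2. simpl in Hv1, Hv2.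
  unfold g in Hv1, Hv2.
  assert (E1 : (fun t => f (circle z0 s1 t)) = (fun y => f (z0 + cexp (ln s1, y))%C)).
  { apply functional_extensionality. intros t. rewrite circle_cexp by lra. reflexivity. }
  assert (E2 : (fun t => f (circle z0 s2 t)) = (fun y => f (z0 + cexp (ln s2, y))%C)).
  { apply functional_extensionality. intros t. rewrite circle_cexp by lra. reflexivity. }
  assert (E1' := fun t => f_equal (fun h => h t) E1). assert (E2' := fun t => f_equal (fun h => h t) E2).
  simpl in E1', E2'.
  unfold ravg. f_equal; f_equal.
  - etransitivity; [|etransitivity; [exact Hv1|]]; f_equal; apply functional_extensionality; intros t;
      rewrite ?E1', ?E2'; reflexivity.
  - etransitivity; [|etransitivity; [exact Hv2|]]; f_equal; apply functional_extensionality; intros t;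
      rewrite ?E1', ?E2'; reflexivity.
Qed.

(** Since f is only continuous on the boundary and the logarithm excludes the centre, the averages
    over a small circle and over one slightly inside the boundary are compared, and uniform
    continuity closes both gaps. *)
Theorem mean_value : cavg (fun t => f (circle z0 r t)) = f z0.
Proof.
  assert (Hin : forall s t, 0 <= s <= r -> closed_disc z0 r (circle z0 s t)).
  { intros s t Hs. unfold closed_disc. rewrite Cmod_circle_sub; lra. }
  assert (E : Cmod (cavg (fun t => f (circle z0 r t)) - f z0) = 0).
  { apply Rle_antisym; [|apply Cmod_ge_0]. apply le_epsilon. intros eps He. rewrite Rplus_0_l.
    destruct (heine_disc z0 r f f_cont (eps / 2)) as [d [Hd H]]; [lra|].
    set (s1 := Rmin (r / 3) (d / 2)). set (s2 := Rmax (r / 2) (r - d / 2)).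
    assert (Hs1 : 0 < s1 <= r / 3 /\ s1 < d).
    { unfold s1. pose proof (Rmin_l (r / 3) (d / 2)). pose proof (Rmin_r (r / 3) (d / 2)).
      repeat split; [apply Rmin_pos; lra|lra|lra]. }
    assert (Hs2 : r / 2 <= s2 < r /\ r - s2 < d).
    { unfold s2. pose proof (Rmax_l (r / 2) (r - d / 2)). pose proof (Rmax_r (r / 2) (r - d / 2)).
      repeat split; [lra|apply Rmax_lub_lt; lra|lra]. }
    assert (C1 : forall s, 0 <= s <= r -> contC (fun t => f (circle z0 s t))).
    { intros s Hs. apply (contC_circle z0 r); assumption. }
    assert (A1 : Cmod (cavg (fun t => f (circle z0 s1 t)) - f z0) <= eps / 2).
    { rewrite <- (cavg_const (f z0)) at 1. rewrite <- cavg_minus by (try apply contC_const; apply C1; lra).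
      apply cavg_bound.
      - apply contC_minus; [apply C1; lra|apply contC_const].
      - intros t. left. apply H.
        + unfold closed_disc. replace (z0 - z0)%C with (RtoC 0) by ring. rewrite Cmod_0. lra.
        + apply Hin. lra.
        + rewrite Cmod_circle_sub; lra. }
    assert (A2 : Cmod (cavg (fun t => f (circle z0 r t)) - cavg (fun t => f (circle z0 s2 t))) <= eps / 2).
    { rewrite <- cavg_minus by (apply C1; lra). apply cavg_bound.
      - apply contC_minus; apply C1; lra.
      - intros t. left. apply H; [apply Hin; lra|apply Hin; lra|].
        rewrite circle_dist, Rabs_pos_eq; lra. }
    rewrite <- (circle_mean_const s1 s2) in A2 by lra.
    match goal with |- Cmod (?a - ?c) <= _ =>
      match type of A1 with Cmod (?b - _) <= _ => replace (a - c)%C with ((a - b) + (b - c))%C by ring end end.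
    eapply Rle_trans; [apply Cmod_triangle|]. lra. }
  apply Cmod_eq_0 in E.
  match type of E with (?a - ?b)%C = _ => replace a with (a - b + b)%C by ring end.
  rewrite E. ring.
Qed.
End MeanValue.

(** * Uniqueness of Fourier coefficients and the maximum principle *)

Lemma ravg_le_period f g : contR f -> contR g ->
  (forall t, 0 <= t <= 2 * PI -> f t <= g t) -> ravg f <= ravg g.
Proof.
  intros Hf Hg H. unfold ravg. pose proof two_PI_pos.
  apply Rmult_le_compat_l; [left; apply Rinv_0_lt_compat; assumption|].
  apply RInt_le; [lra|apply ex_RInt_contR; assumption|apply ex_RInt_contR; assumption|].
  intros t Ht. apply H. lra.
Qed.

Lemma contR_near f t eps : contR f -> 0 < eps ->
  exists d, 0 < d /\ forall s, Rabs (s - t) < d -> Rabs (f s - f t) < eps.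
Proof.
  intros Hf He. pose proof (proj1 (filterlim_locally _ _) (Hf t) (mkposreal eps He)) as [d Hd].
  exists d. split; [apply cond_pos|]. intros s Hs. apply (Hd s Hs).
Qed.

Lemma ravg_pos f t0 : contR f -> (forall t, 0 <= f t) -> 0 < t0 < 2 * PI -> 0 < f t0 -> 0 < ravg f.
Proof.
  intros Hf H0 Ht Hp.
  destruct (contR_near f t0 (f t0) Hf Hp) as [d [Hd Hn]].
  set (h := Rmin (d / 2) (Rmin (t0 / 2) ((2 * PI - t0) / 2))).
  assert (Hh : 0 < h /\ h < d /\ 0 < t0 - h /\ t0 + h < 2 * PI).
  { unfold h. pose proof (Rmin_l (d / 2) (Rmin (t0 / 2) ((2 * PI - t0) / 2))).
    pose proof (Rmin_r (d / 2) (Rmin (t0 / 2) ((2 * PI - t0) / 2))).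
    pose proof (Rmin_l (t0 / 2) ((2 * PI - t0) / 2)). pose proof (Rmin_r (t0 / 2) ((2 * PI - t0) / 2)).
    split; [repeat apply Rmin_pos; lra|lra]. }
  unfold ravg. apply Rmult_lt_0_compat; [apply Rinv_0_lt_compat, two_PI_pos|].
  rewrite <- (RInt_Chasles (V := R_CompleteNormedModule) f 0 (t0 - h) (2 * PI)) by (apply ex_RInt_contR; exact Hf).
  rewrite <- (RInt_Chasles (V := R_CompleteNormedModule) f (t0 - h) (t0 + h) (2 * PI)) by (apply ex_RInt_contR; exact Hf).
  assert (A1 : 0 <= RInt f 0 (t0 - h)) by (apply RInt_ge_0; [lra|apply ex_RInt_contR; exact Hf|auto]).
  assert (A3 : 0 <= RInt f (t0 + h) (2 * PI)) by (apply RInt_ge_0; [lra|apply ex_RInt_contR; exact Hf|auto]).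
  assert (A2 : 0 < RInt f (t0 - h) (t0 + h)).
  { apply RInt_gt_0; [lra| |intros; apply Hf].
    intros x Hx. specialize (Hn x). assert (Rabs (f x - f t0) < f t0).
    { apply Hn. apply Rabs_lt_between. lra. }
    apply Rabs_lt_between in H. lra. }
  unfold plus; simpl. lra.
Qed.

Lemma contR_zero_closed f : contR f -> (forall t, 0 < t < 2 * PI -> f t = 0) ->
  forall t, 0 <= t <= 2 * PI -> f t = 0.
Proof.
  intros Hf H t Ht. pose proof two_PI_pos. pose proof PI_RGT_0.
  destruct (Req_dec (f t) 0) as [E|E]; [exact E|exfalso].
  destruct (contR_near f t (Rabs (f t)) Hf (Rabs_pos_lt _ E)) as [d [Hd Hn]].
  set (h := Rmin (d / 2) PI / 2).
  assert (Hh : 0 < h /\ h < d /\ h < PI).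
  { unfold h. pose proof (Rmin_l (d / 2) PI). pose proof (Rmin_r (d / 2) PI).
    assert (0 < Rmin (d / 2) PI) by (apply Rmin_pos; lra). lra. }
  assert (Hs : exists s, 0 < s < 2 * PI /\ Rabs (s - t) < d).
  { destruct (Rle_lt_dec t PI).
    - exists (t + h). split; [lra|]. apply Rabs_lt_between. lra.
    - exists (t - h). split; [lra|]. apply Rabs_lt_between. lra. }
  destruct Hs as [s [Hs1 Hs2]]. specialize (Hn s Hs2). rewrite (H s Hs1) in Hn.
  rewrite Rminus_0_l, Rabs_Ropp in Hn. lra.
Qed.

Lemma ravg_zero f : contR f -> (forall t, 0 <= f t) -> ravg f = 0 ->
  forall t, 0 <= t <= 2 * PI -> f t = 0.
Proof.
  intros Hf H0 HA. apply contR_zero_closed; [exact Hf|]. intros t Ht.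
  destruct (Req_dec (f t) 0) as [E|E]; [exact E|].
  pose proof (ravg_pos f t Hf H0 Ht). specialize (H0 t). lra.
Qed.

Lemma contR_bounded f : contR f -> exists B, 0 < B /\ forall t, 0 <= t <= 2 * PI -> Rabs (f t) <= B.
Proof.
  intros Hf. pose proof two_PI_pos.
  destruct (continuity_ab_maj (fun t => Rabs (f t)) 0 (2 * PI)) as [M [HM _]]; [lra| |].
  - intros c _. apply continuity_pt_filterlim.
    apply (filterlim_comp _ _ _ f Rabs _ (locally (f c))); [apply Hf|].
    apply (continuous_Rabs (f c)).
  - exists (Rabs (f M) + 1). split; [pose proof (Rabs_pos (f M)); lra|].
    intros t Ht. specialize (HM t Ht). simpl in HM. lra.
Qed.

Section FourierUniqueness.

(* Tests [h] against powers of the trigonometric polynomial [1 + cos (t - t0) - cos d],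
   which exceeds 1 exactly near [t0]. *)
Lemma fourier_real_nonpos (h : R -> R) : contR h ->
  (forall k, cavg (fun t => ek k t * RtoC (h t))%C = RtoC 0) ->
  forall t0, 0 < t0 < 2 * PI -> h t0 <= 0.
Proof.
  intros Hh Hk t0 Ht0. apply Rnot_lt_le. intros Hpos.
  pose proof PI_RGT_0 as Hpi.
  assert (Hch : contC (fun t => RtoC (h t))).
  { apply contC_of; [exact Hh|exact (contR_const 0)]. }
  destruct (contR_near h t0 (h t0 / 2) Hh ltac:(lra)) as [d1 [Hd1 Hn]].
  set (d := Rmin (d1 / 2) (Rmin (t0 / 2) ((2 * PI - t0) / 2))).
  assert (Hd : 0 < d /\ d < d1 /\ d < t0 /\ t0 + d < 2 * PI /\ d < PI).
  { unfold d. pose proof (Rmin_l (d1 / 2) (Rmin (t0 / 2) ((2 * PI - t0) / 2))).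
    pose proof (Rmin_r (d1 / 2) (Rmin (t0 / 2) ((2 * PI - t0) / 2))).
    pose proof (Rmin_l (t0 / 2) ((2 * PI - t0) / 2)). pose proof (Rmin_r (t0 / 2) ((2 * PI - t0) / 2)).
    split; [repeat apply Rmin_pos; lra|lra]. }
  set (u := fun t => 1 + cos (t - t0) - cos d).
  set (alpha := (RtoC (1/2) * ek (-1) t0)%C). set (beta := (RtoC (1/2) * ek 1 t0)%C).
  assert (Hu : forall t, RtoC (u t) = (RtoC (1 - cos d) + alpha * ek 1 t + beta * ek (-1) t)%C).
  { intros t. unfold u, alpha, beta, ek.
    replace (IZR (-1) * t) with (- t) by (simpl; ring).
    replace (IZR (-1) * t0) with (- t0) by (simpl; ring).
    rewrite !Rmult_1_l, !cos_neg, !sin_neg, cos_minus. ceq; field. }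
  assert (Hcu : contC (fun t => RtoC (u t))).
  { replace (fun t => RtoC (u t)) with (fun t => (RtoC (1 - cos d) + alpha * ek 1 t + beta * ek (-1) t)%C)
      by (apply functional_extensionality; intros t; rewrite Hu; reflexivity).
    auto using contC_plus, contC_mult, contC_const, contC_ek. }
  assert (Hpow : forall n, contC (fun t => RtoC (h t * u t ^ n))).
  { induction n as [|n IH].
    - replace (fun t => RtoC (h t * u t ^ 0)) with (fun t => RtoC (h t)); [exact Hch|].
      apply functional_extensionality; intros t; f_equal; simpl; ring.
    - replace (fun t => RtoC (h t * u t ^ S n)) with (fun t => (RtoC (h t * u t ^ n) * RtoC (u t))%C).
      + apply contC_mult; assumption.
      + apply functional_extensionality; intros t. rewrite <- RtoC_mult. f_equal. simpl. ring. }
  assert (Hzero : forall n k, cavg (fun t => ek k t * RtoC (h t * u t ^ n))%C = RtoC 0).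
  { induction n as [|n IH]; intros k.
    - rewrite <- (Hk k). apply cavg_ext. intros t. simpl. rewrite Rmult_1_r. reflexivity.
    - rewrite (cavg_ext _ (fun t => RtoC (1 - cos d) * (ek k t * RtoC (h t * u t ^ n)) +
        alpha * (ek (k + 1) t * RtoC (h t * u t ^ n)) + beta * (ek (k + -1) t * RtoC (h t * u t ^ n)))%C).
      + rewrite !cavg_plus, !cavg_scal, !IH; auto using contC_plus, contC_mult, contC_const, contC_ek.
        ring.
      + intros t. rewrite !ek_plus.
        replace (h t * u t ^ S n) with (h t * u t ^ n * u t) by (simpl; ring).
        rewrite (RtoC_mult (h t * u t ^ n)), Hu. ring. }
  assert (Hint : forall n, ravg (fun t => h t * u t ^ n) = 0).
  { intros n. assert (E : ravg (fun t => Re (ek 0 t * RtoC (h t * u t ^ n))%C) = 0)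
      by exact (f_equal Re (Hzero n 0%Z)).
    rewrite <- E. apply ravg_ext. intros t. rewrite ek_0. unfold Re; simpl. ring. }
  destruct (contR_bounded h Hh) as [B [HB HB']].
  (* A tent supported where u >= 1 + eta. There h u^n is at least h(t0) / 2 (1 + eta)^n psi,
     elsewhere it is at least -B, so a zero average of h u^n contradicts the growth of (1 +
     eta)^n. *)
  set (psi := fun t => Rmax 0 (1 - 2 / d * Rabs (t - t0))).
  assert (Hpsi : contR psi).
  { assert (Epsi : psi = fun s => / 2 * ((1 - 2 / d * Rabs (s - t0)) + Rabs (1 - 2 / d * Rabs (s - t0)))).
    { apply functional_extensionality. intros s. unfold psi.
      set (x := 1 - 2 / d * Rabs (s - t0)). unfold Rmax, Rabs.
      destruct (Rle_dec 0 x), (Rcase_abs x); lra. }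
    rewrite Epsi.
    assert (Hc : contR (fun s => 1 - 2 / d * Rabs (s - t0))).
    { replace (fun s => 1 - 2 / d * Rabs (s - t0)) with (fun s => 1 + (- (2 / d)) * Rabs (s - t0))
        by (apply functional_extensionality; intros; ring).
      apply contR_plus; [apply contR_const|]. apply contR_scal. intros s.
      apply (continuous_comp (fun s => s - t0) Rabs); [|apply continuous_Rabs].
      apply (continuous_minus (K := R_AbsRing) (V := R_NormedModule)); [apply continuous_id|apply continuous_const]. }
    apply contR_scal. apply contR_plus; [exact Hc|]. intros s.
    apply (continuous_comp (fun s => 1 - 2 / d * Rabs (s - t0)) Rabs); [apply Hc|apply continuous_Rabs]. }
  assert (Hpsi0 : 0 < ravg psi).
  { apply (ravg_pos psi t0); auto.
    - intros t. apply Rmax_l.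
    - unfold psi. rewrite Rminus_diag, Rabs_R0, Rmult_0_r. rewrite Rmax_right; lra. }
  set (eta := cos (d / 2) - cos d).
  assert (Heta : 0 < eta).
  { unfold eta. assert (cos d < cos (d / 2)) by (apply cos_decreasing_1; lra). lra. }
  assert (Hcosle : forall a b, 0 <= a -> a <= b -> b <= PI -> cos b <= cos a).
  { intros a b Ha [Hab| ->] Hb; [|lra]. left. apply cos_decreasing_1; lra. }
  assert (Hlow : forall n, - B + h t0 / 2 * (1 + eta) ^ n * ravg psi <= 0).
  { intros n. rewrite <- (Hint n).
    rewrite <- ravg_scal by exact Hpsi. rewrite <- (ravg_const (- B)) at 1.
    rewrite <- ravg_plus by (auto using contR_const, contR_scal).
    apply ravg_le_period.
    - auto using contR_const, contR_scal, contR_plus.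
    - apply (contC_re _ (Hpow n)).
    - intros t Ht. specialize (HB' t Ht). specialize (Hn t).
      assert (Hcosabs : cos (t - t0) = cos (Rabs (t - t0))).
      { unfold Rabs. destruct (Rcase_abs _); [rewrite cos_neg|]; reflexivity. }
      assert (Hpn : 0 < (1 + eta) ^ n) by (apply pow_lt; lra).
      destruct (Rle_lt_dec (Rabs (t - t0)) d) as [H1|H1].
      + assert (Hh1 : h t0 / 2 <= h t).
        { assert (Rabs (h t - h t0) < h t0 / 2) as H2 by (apply Hn; lra). apply Rabs_lt_between in H2. lra. }
        destruct (Rle_lt_dec (Rabs (t - t0)) (d / 2)) as [H2|H2].
        * assert (Hu1 : 1 + eta <= u t).
          { unfold u, eta. rewrite Hcosabs. pose proof (Hcosle (Rabs (t - t0)) (d / 2) (Rabs_pos _) H2 ltac:(lra)). lra. }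
          assert (Hp1 : (1 + eta) ^ n <= u t ^ n) by (apply pow_incr; lra).
          assert (Hps : 0 <= psi t <= 1).
          { unfold psi. split; [apply Rmax_l|]. apply Rmax_lub; [lra|].
            assert (0 <= 2 / d * Rabs (t - t0)); [|lra].
            apply Rmult_le_pos; [|apply Rabs_pos]. left; apply Rdiv_lt_0_compat; lra. }
          assert (h t0 / 2 * (1 + eta) ^ n * psi t <= h t0 / 2 * (1 + eta) ^ n * 1).
          { apply Rmult_le_compat_l; [|lra]. apply Rmult_le_pos; lra. }
          assert (h t0 / 2 * (1 + eta) ^ n <= h t * u t ^ n) by (apply Rmult_le_compat; lra).
          lra.
        * assert (Hps : psi t = 0).
          { unfold psi. rewrite Rmax_left; [reflexivity|].
            assert (2 / d * (d / 2) <= 2 / d * Rabs (t - t0)).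
            { apply Rmult_le_compat_l; [left; apply Rdiv_lt_0_compat; lra|lra]. }
            replace (2 / d * (d / 2)) with 1 in H by (field; lra). lra. }
          rewrite Hps, Rmult_0_r.
          assert (Hu1 : 1 <= u t).
          { unfold u. rewrite Hcosabs. pose proof (Hcosle (Rabs (t - t0)) d (Rabs_pos _) H1 ltac:(lra)). lra. }
          assert (0 <= h t * u t ^ n) by (apply Rmult_le_pos; [lra|apply pow_le; lra]). lra.
      + assert (Hps : psi t = 0).
        { unfold psi. rewrite Rmax_left; [reflexivity|].
          assert (2 / d * (d / 2) <= 2 / d * Rabs (t - t0)).
          { apply Rmult_le_compat_l; [left; apply Rdiv_lt_0_compat; lra|lra]. }
          replace (2 / d * (d / 2)) with 1 in H by (field; lra). lra. }
        rewrite Hps, Rmult_0_r.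
        assert (Hu1 : cos (t - t0) <= cos d).
        { rewrite Hcosabs. destruct (Rle_lt_dec (Rabs (t - t0)) PI) as [H2|H2].
          - apply Hcosle; lra.
          - replace (cos (Rabs (t - t0))) with (cos (2 * PI - Rabs (t - t0))).
            + apply Hcosle; try lra. assert (Rabs (t - t0) <= 2 * PI - d); [|lra].
              apply Rabs_le. lra.
            + rewrite cos_minus, cos_2PI, sin_2PI. ring. }
        pose proof (COS_bound (t - t0)). pose proof (COS_bound d).
        assert (Hua : Rabs (u t) <= 1) by (apply Rabs_le; unfold u; lra).
        assert (Hun : Rabs (u t ^ n) <= 1).
        { rewrite <- RPow_abs. rewrite <- (pow1 n). apply pow_incr. split; [apply Rabs_pos|exact Hua]. }
        assert (Rabs (h t * u t ^ n) <= B).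
        { rewrite Rabs_mult. rewrite <- (Rmult_1_r B). apply Rmult_le_compat; try apply Rabs_pos; assumption. }
        apply Rabs_le_between in H2. lra. }
  destruct (Pow_x_infinity (1 + eta) ltac:(rewrite Rabs_pos_eq; lra) (2 * (B + 1) / (h t0 * ravg psi))) as [N HN].
  specialize (HN N (le_n _)). rewrite Rabs_pos_eq in HN by (apply pow_le; lra).
  specialize (Hlow N). apply Rge_le in HN.
  assert (Hq : 0 < h t0 * ravg psi) by (apply Rmult_lt_0_compat; assumption).
  assert (h t0 * ravg psi * (2 * (B + 1) / (h t0 * ravg psi)) <= h t0 * ravg psi * (1 + eta) ^ N).
  { apply Rmult_le_compat_l; lra. }
  replace (h t0 * ravg psi * (2 * (B + 1) / (h t0 * ravg psi))) with (2 * (B + 1)) in H by (field; split; lra).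
  lra.
Qed.

(** The real case is applied to the real parts of f, -f, i f and -i f. Their coefficients vanish
    because conjugation exchanges the frequencies k and -k, both of which are assumed to give zero.
    Continuity adds the two endpoints. *)
Lemma fourier_unique (f : R -> C) : contC f ->
  (forall k, cavg (fun t => ek k t * f t)%C = RtoC 0) ->
  forall t, 0 <= t <= 2 * PI -> f t = RtoC 0.
Proof.
  intros Hf Hk.
  assert (Hgen : forall g, contC g -> (forall k, cavg (fun t => ek k t * g t)%C = RtoC 0) ->
    forall t, 0 < t < 2 * PI -> Re (g t) <= 0).
  { intros g Hg Hgk. apply (fourier_real_nonpos (fun t => Re (g t))); [apply contC_re, Hg|].
    intros k.
    rewrite (cavg_ext _ (fun t => RtoC (1/2) * (ek k t * g t) + RtoC (1/2) * Cconj (ek (- k) t * g t))%C).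
    - rewrite cavg_plus, !cavg_scal, cavg_conj, !Hgk; auto using contC_mult, contC_conj, contC_ek, contC_const.
      ceq.
    - intros t. rewrite Cmult_conj, ek_opp, Cconj_conj. ceq; field. }
  assert (Hs : forall a : C, forall t, 0 < t < 2 * PI -> Re (a * f t)%C <= 0).
  { intros a. apply (Hgen (fun t => a * f t)%C).
    - apply contC_mult; auto using contC_const.
    - intros k. rewrite (cavg_ext _ (fun t => a * (ek k t * f t))%C) by (intros t; ring).
      rewrite cavg_scal, Hk by (apply contC_mult; auto using contC_ek). ring. }
  assert (H1 : forall t, 0 < t < 2 * PI -> f t = RtoC 0).
  { intros t Ht. pose proof (Hs (RtoC 1) t Ht). pose proof (Hs (RtoC (-1)) t Ht).
    pose proof (Hs Ci t Ht). pose proof (Hs (- Ci)%C t Ht).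
    unfold Re in *; simpl in *. apply injective_projections; simpl; lra. }
  intros t Ht. apply injective_projections; simpl.
  - apply (contR_zero_closed (fun t => Re (f t))); [apply contC_re, Hf| |exact Ht].
    intros s Hs'. rewrite (H1 s Hs'). reflexivity.
  - apply (contR_zero_closed (fun t => Im (f t))); [apply contC_im, Hf| |exact Ht].
    intros s Hs'. rewrite (H1 s Hs'). reflexivity.
Qed.

End FourierUniqueness.

Lemma circle_angle x y : x ^ 2 + y ^ 2 = 1 -> exists t, 0 <= t <= 2 * PI /\ cos t = x /\ sin t = y.
Proof.
  intros H. assert (Hx : -1 <= x <= 1) by (pose proof (pow2_ge_0 y); split; nra).
  pose proof (acos_bound x) as Hb. pose proof PI_RGT_0.
  pose proof (cos_acos x Hx) as Hc. pose proof (sin2_cos2 (acos x)) as Hsc.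
  unfold Rsqr in Hsc. rewrite Hc in Hsc.
  assert (Hs : 0 <= sin (acos x)) by (apply sin_ge_0; lra).
  destruct (Rle_lt_dec 0 y) as [Hy|Hy].
  - exists (acos x). repeat split; try lra. nra.
  - exists (2 * PI - acos x). repeat split; try lra.
    + rewrite cos_minus, cos_2PI, sin_2PI, Hc. ring.
    + rewrite sin_minus, cos_2PI, sin_2PI. nra.
Qed.

Lemma circle_param z0 r z : 0 < r -> Cmod (z - z0) = r ->
  exists t, 0 <= t <= 2 * PI /\ z = circle z0 r t.
Proof.
  intros Hr H. pose proof (Cmod2_alt (z - z0)) as E. rewrite H in E. unfold Re, Im in E.
  set (w := (z - z0)%C) in *.
  destruct (circle_angle (fst w / r) (snd w / r)) as [t [Ht [Hc Hs]]].
  { replace ((fst w / r) ^ 2 + (snd w / r) ^ 2) with ((fst w ^ 2 + snd w ^ 2) / r ^ 2) by (field; lra).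
    rewrite <- E. field. lra. }
  exists t. split; [exact Ht|]. unfold circle. rewrite Hc, Hs.
  replace z with (z0 + w)%C by (unfold w; ring). f_equal.
  apply injective_projections; simpl; field; lra.
Qed.

Definition contR_on (D : C -> Prop) (phi : C -> R) : Prop :=
  forall z, D z -> forall eps, 0 < eps ->
  exists d, 0 < d /\ forall w, D w -> Cmod (w - z) < d -> Rabs (phi w - phi z) < eps.

Lemma contR_on_of_re D f : contC_on D f -> contR_on D (fun z => Re (f z)).
Proof.
  intros H z Hz eps He. destruct (H z Hz eps He) as [d [Hd Hw]].
  exists d. split; [exact Hd|]. intros w Dw Hwz.
  eapply Rle_lt_trans; [|apply (Hw w Dw Hwz)]. exact (re_le_Cmod (f w - f z)).
Qed.

(** The tolerance in the continuity of phi may depend on the point; compactness bounds it from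
    below. Two choices of tolerance give boundedness and attainment. *)
Lemma disc_max z0 r phi : 0 <= r -> contR_on (closed_disc z0 r) phi ->
  exists z1, closed_disc z0 r z1 /\ forall z, closed_disc z0 r z -> phi z <= phi z1.
Proof.
  intros Hr Hphi.
  assert (Hz0 : closed_disc z0 r z0).
  { unfold closed_disc. replace (z0 - z0)%C with (RtoC 0) by ring. rewrite Cmod_0. exact Hr. }
  assert (Hgen : forall eta : C -> R, (forall z, closed_disc z0 r z -> 0 < eta z) ->
    exists d, 0 < d /\ forall z, closed_disc z0 r z -> exists u, closed_disc z0 r u /\
      phi z < phi u + eta u /\ d <= eta u).
  { intros eta Heta.
    assert (Hex : forall u, exists e, closed_disc z0 r u -> 0 < e /\
      forall w, closed_disc z0 r w -> Cmod (w - u) < e -> Rabs (phi w - phi u) < eta u).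
    { intros u. destruct (classic (closed_disc z0 r u)) as [H|H]; [|exists 0; contradiction].
      destruct (Hphi u H (eta u) (Heta u H)) as [e He]. exists e. auto. }
    pose (e := fun u => proj1_sig (constructive_indefinite_description _ (Hex u))).
    assert (He : forall u, closed_disc z0 r u -> 0 < e u /\
      forall w, closed_disc z0 r w -> Cmod (w - u) < e u -> Rabs (phi w - phi u) < eta u).
    { intros u. apply (proj2_sig (constructive_indefinite_description _ (Hex u))). }
    destruct (disc_compact z0 r (fun u => Rmin (e u) (eta u))) as [d [Hd Hc]].
    { intros z Hz. apply Rmin_pos; [apply He, Hz|apply Heta, Hz]. }
    exists d. split; [exact Hd|]. intros z Hz. destruct (Hc z Hz) as [u [Hu [H1 H2]]].
    exists u. split; [exact Hu|]. pose proof (Rmin_l (e u) (eta u)). pose proof (Rmin_r (e u) (eta u)).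
    split; [|lra]. destruct (He u Hu) as [_ H3].
    assert (H4 : Rabs (phi z - phi u) < eta u) by (apply H3; [exact Hz|lra]).
    apply Rabs_lt_between in H4. lra. }
  (* A lower bound d for this tolerance bounds |phi u| by 1 / d at the points u used. *)
  destruct (Hgen (fun u => / (1 + Rabs (phi u)))) as [d [Hd Hb]].
  { intros z _. apply Rinv_0_lt_compat. pose proof (Rabs_pos (phi z)). lra. }
  destruct (completeness (fun s => exists z, closed_disc z0 r z /\ s = phi z)) as [M [Hub Hlub]].
  - exists (/ d + 1). intros s [z [Hz ->]]. destruct (Hb z Hz) as [u [Hu [H1 H2]]].
    pose proof (Rabs_pos (phi u)). pose proof (Rle_abs (phi u)).
    assert (H3 : 1 + Rabs (phi u) <= / d).
    { rewrite <- (Rinv_inv (1 + Rabs (phi u))). apply Rinv_le_contravar; assumption. }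
    assert (/ (1 + Rabs (phi u)) <= 1).
    { rewrite <- Rinv_1. apply Rinv_le_contravar; lra. }
    lra.
  - exists (phi z0). exists z0. auto.
  - apply NNPP. intros Hno.
    assert (Hlt : forall z, closed_disc z0 r z -> phi z < M).
    { intros z Hz. apply Rnot_le_lt. intros Hle. apply Hno. exists z. split; [exact Hz|].
      intros w Hw. eapply Rle_trans; [|exact Hle]. apply Hub. exists w. auto. }
    (* If the supremum M were not attained, this tolerance would be positive and every value would
       stay below M - d'. *)
    destruct (Hgen (fun u => (M - phi u) / 2)) as [d' [Hd' Hb']].
    { intros z Hz. specialize (Hlt z Hz). lra. }
    assert (M <= M - d').
    { apply Hlub. intros s [z [Hz ->]]. destruct (Hb' z Hz) as [u [Hu [H1 H2]]]. lra. }
    lra.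
Qed.

(** The gain rho^2 over the value at the centre is what makes the perturbation in the maximum
    principle strictly subharmonic. *)
Lemma ravg_dist_sq z0 z1 rho : 0 <= rho ->
  ravg (fun t => Cmod (circle z1 rho t - z0) ^ 2) = Cmod (z1 - z0) ^ 2 + rho ^ 2.
Proof.
  intros Hrho. set (a := (z1 - z0)%C).
  transitivity (Re (cavg (fun t => RtoC (Cmod a ^ 2 + rho ^ 2) + RtoC (2 * rho) * Cconj a * ek 1 t)%C)).
  - apply ravg_ext. intros t.
    replace (circle z1 rho t - z0)%C with (a + RtoC rho * ek 1 t)%C
      by (rewrite <- circle_sub with (z0 := z1); unfold a; ring).
    pose proof (Cmod_ek 1 t) as E. pose proof (Cmod2_alt (ek 1 t)) as E2. rewrite E in E2.
    set (e := ek 1 t) in *. clearbody e a. rewrite !Cmod2_alt.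
    replace (rho ^ 2) with (rho ^ 2 * (Re e ^ 2 + Im e ^ 2)) by (rewrite <- E2; ring).
    unfold Re, Im, RtoC; simpl. ring.
  - rewrite cavg_plus, cavg_scal, cavg_const, cavg_ek; auto using contC_const, contC_mult, contC_ek.
    simpl. ring.
Qed.

Lemma contR_dist_sq z0 z1 rho : contR (fun t => Cmod (circle z1 rho t - z0) ^ 2).
Proof.
  replace (fun t => Cmod (circle z1 rho t - z0) ^ 2) with
    (fun t => Re (Cconj ((z1 - z0) + RtoC rho * ek 1 t) * ((z1 - z0) + RtoC rho * ek 1 t))%C).
  - apply (contC_re (fun t => Cconj ((z1 - z0) + RtoC rho * ek 1 t) * ((z1 - z0) + RtoC rho * ek 1 t))%C).
    auto 8 using contC_mult, contC_conj, contC_plus, contC_const, contC_ek.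
  - apply functional_extensionality. intros t. rewrite Re_conj_mult, <- circle_sub with (z0 := z1).
    replace (z1 - z0 + (circle z1 rho t - z1))%C with (circle z1 rho t - z0)%C by ring. ring.
Qed.

Lemma circle_in_disc z0 r z1 : open_disc z0 r z1 -> exists d, 0 < d /\
  forall rho t, 0 <= rho < d -> open_disc z0 r (circle z1 rho t).
Proof.
  unfold open_disc. intros H. exists (r - Cmod (z1 - z0)). split; [lra|].
  intros rho t Hrho.
  replace (circle z1 rho t - z0)%C with ((circle z1 rho t - z1) + (z1 - z0))%C by ring.
  eapply Rle_lt_trans; [apply Cmod_triangle|]. rewrite Cmod_circle_sub; lra.
Qed.

Lemma open_closed_disc z0 r z : open_disc z0 r z -> closed_disc z0 r z.
Proof. unfold open_disc, closed_disc. lra. Qed.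

Lemma contR_circle_on D phi z rho : 0 <= rho -> contR_on D phi -> (forall t, D (circle z rho t)) ->
  contR (fun t => phi (circle z rho t)).
Proof.
  intros Hrho Hphi HD t. apply filterlim_locally. intros eps.
  destruct (Hphi _ (HD t) eps (cond_pos eps)) as [d [Hd H]].
  generalize (circle_continuous z rho t Hrho d Hd). apply filter_imp.
  intros t' Ht'. apply H; [apply HD|exact Ht'].
Qed.

(* Adding [eta |z - z0|^2] makes the sub-mean value inequality strict. *)
Theorem max_principle z0 r phi M : 0 < r -> contR_on (closed_disc z0 r) phi ->
  (forall t, 0 <= t <= 2 * PI -> phi (circle z0 r t) <= M) ->
  (forall z1, open_disc z0 r z1 -> forall eps, 0 < eps -> exists d, 0 < d /\
    forall rho, 0 < rho < d -> phi z1 <= ravg (fun t => phi (circle z1 rho t)) + eps * rho ^ 2) ->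
  forall z, closed_disc z0 r z -> phi z <= M.
Proof.
  intros Hr Hphi Hbd Hsub z2 Hz2. apply Rnot_lt_le. intros Hlt.
  (* Half of the excess of phi z2 over M, spread over r^2: the perturbed function still exceeds at
     z2 all its boundary values, so its maximum is interior. *)
  set (eta := (phi z2 - M) / (2 * r ^ 2)).
  assert (Hr2 : 0 < r ^ 2) by (apply pow_lt; exact Hr).
  assert (Heta : 0 < eta) by (apply Rdiv_lt_0_compat; lra).
  assert (Heta2 : eta * r ^ 2 < phi z2 - M).
  { unfold eta. replace ((phi z2 - M) / (2 * r ^ 2) * r ^ 2) with ((phi z2 - M) / 2) by (field; lra). lra. }
  set (psi := fun z => phi z + eta * Cmod (z - z0) ^ 2).
  assert (Hpsi : contR_on (closed_disc z0 r) psi).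
  { intros z Hz eps He. destruct (Hphi z Hz (eps / 2)) as [d [Hd H]]; [lra|].
    set (K := 2 * eta * (2 * r) + 1).
    assert (HK : 0 < K) by (unfold K; assert (0 < eta * r) by (apply Rmult_lt_0_compat; lra); lra).
    exists (Rmin d (eps / K)). split; [apply Rmin_pos; [exact Hd|apply Rdiv_lt_0_compat; lra]|].
    intros w Hw Hwz. pose proof (Rmin_l d (eps / K)). pose proof (Rmin_r d (eps / K)).
    specialize (H w Hw ltac:(lra)). unfold psi.
    replace (phi w + eta * Cmod (w - z0) ^ 2 - (phi z + eta * Cmod (z - z0) ^ 2)) with
      ((phi w - phi z) + eta * (Cmod (w - z0) + Cmod (z - z0)) * (Cmod (w - z0) - Cmod (z - z0))) by ring.
    eapply Rle_lt_trans; [apply Rabs_triang|].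
    unfold closed_disc in *. pose proof (Cmod_ge_0 (w - z0)). pose proof (Cmod_ge_0 (z - z0)).
    assert (Hdiff : Rabs (Cmod (w - z0) - Cmod (z - z0)) <= Cmod (w - z)).
    { apply Rabs_le. pose proof (Cmod_triangle (w - z) (z - z0)) as T1.
      pose proof (Cmod_triangle (z - w) (w - z0)) as T2.
      replace (w - z + (z - z0))%C with (w - z0)%C in T1 by ring.
      replace (z - w + (w - z0))%C with (z - z0)%C in T2 by ring.
      replace (z - w)%C with (- (w - z))%C in T2 by ring. rewrite Cmod_opp in T2. lra. }
    rewrite !Rabs_mult, (Rabs_pos_eq eta), (Rabs_pos_eq (_ + _)) by lra.
    assert (eta * (Cmod (w - z0) + Cmod (z - z0)) <= eta * (2 * r)) by (apply Rmult_le_compat_l; lra).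
    assert (eta * (Cmod (w - z0) + Cmod (z - z0)) * Rabs (Cmod (w - z0) - Cmod (z - z0)) <= eta * (2 * r) * Cmod (w - z)).
    { apply Rmult_le_compat; [apply Rmult_le_pos; lra|apply Rabs_pos|lra|exact Hdiff]. }
    assert (K * Cmod (w - z) < eps).
    { replace eps with (K * (eps / K)) by (field; lra). apply Rmult_lt_compat_l; lra. }
    pose proof (Cmod_ge_0 (w - z)). unfold K in *. lra. }
  destruct (disc_max z0 r psi ltac:(lra) Hpsi) as [z1 [Hz1 Hmax]].
  assert (Hopen : open_disc z0 r z1).
  { unfold open_disc. unfold closed_disc in Hz1. destruct Hz1 as [H|H]; [exact H|exfalso].
    destruct (circle_param z0 r z1 Hr H) as [t [Ht E]].
    pose proof (Hbd t Ht) as Hb. rewrite <- E in Hb. pose proof (Hmax z2 Hz2) as Hm. unfold psi in Hm.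
    rewrite H in Hm. pose proof (pow2_ge_0 (Cmod (z2 - z0))).
    assert (0 <= eta * Cmod (z2 - z0) ^ 2) by (apply Rmult_le_pos; lra). lra. }
  (* The allowed error eta / 2 rho^2 is smaller than the gain eta rho^2 of the perturbation. *)
  destruct (Hsub z1 Hopen (eta / 2)) as [d1 [Hd1 H1]]; [lra|].
  destruct (circle_in_disc z0 r z1 Hopen) as [d2 [Hd2 H2]].
  set (rho := Rmin d1 d2 / 2).
  assert (Hrho : 0 < rho < d1 /\ rho < d2).
  { unfold rho. pose proof (Rmin_l d1 d2). pose proof (Rmin_r d1 d2).
    assert (0 < Rmin d1 d2) by (apply Rmin_pos; assumption). lra. }
  specialize (H1 rho (proj1 Hrho)).
  assert (Hin : forall t, closed_disc z0 r (circle z1 rho t)).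
  { intros t. apply open_closed_disc, H2. lra. }
  assert (Hcphi : contR (fun t => phi (circle z1 rho t))).
  { apply (contR_circle_on (closed_disc z0 r)); [lra|exact Hphi|exact Hin]. }
  assert (Hav : ravg (fun t => psi (circle z1 rho t)) <= psi z1).
  { rewrite <- (ravg_const (psi z1)). apply ravg_le.
    - apply (contR_circle_on (closed_disc z0 r)); [lra|exact Hpsi|exact Hin].
    - apply contR_const.
    - intros t. apply Hmax, Hin. }
  unfold psi in Hav.
  rewrite ravg_plus, ravg_scal, ravg_dist_sq in Hav;
    [|lra|apply contR_dist_sq|exact Hcphi|apply contR_scal, contR_dist_sq].
  assert (0 < rho ^ 2) by (apply pow_lt; lra).
  assert (0 < eta * rho ^ 2) by (apply Rmult_lt_0_compat; lra). lra.
Qed.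

(** * Holomorphic operator functions *)

(** The filter [within D (locally z)] behind [continuous_on], with moduli in place of the product
    balls of C. *)
Definition nearC (D : C -> Prop) (z : C) (P : C -> Prop) : Prop :=
  exists d, 0 < d /\ forall w, D w -> Cmod (w - z) < d -> P w.

Global Instance nearC_filter D z : Filter (nearC D z).
Proof.
  split.
  - exists 1. split; [lra|auto].
  - intros P Q [d1 [H1 P1]] [d2 [H2 P2]]. exists (Rmin d1 d2).
    split; [apply Rmin_pos; assumption|]. intros w Dw Hw.
    pose proof (Rmin_l d1 d2). pose proof (Rmin_r d1 d2). split; [apply P1|apply P2]; auto; lra.
  - intros P Q H [d [Hd HP]]. exists d. split; [exact Hd|]. auto.
Qed.

Lemma Cmod_minus_self (z : C) : Cmod (z - z) = 0.
Proof. replace (z - z)%C with (RtoC 0) by ring. apply Cmod_0. Qed.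

Lemma nearC_locally D z P : nearC D z P <-> within D (locally (T := C_UniformSpace) z) P.
Proof.
  split.
  - intros [d [Hd H]]. apply locally_C. exists (mkposreal d Hd). intros w Hw Dw. apply H; auto.
  - intros H. apply (proj1 (locally_C z (fun x => D x -> P x))) in H. destruct H as [d Hd].
    exists d. split; [apply cond_pos|]. intros w Dw Hw. apply Hd; auto.
Qed.

Section Holomorphic.
Context {V : HilbertSpace}.
Implicit Types F G : C -> BOp V.

Definition contO_on (D : C -> Prop) F : Prop := forall z, D z -> limO (nearC D z) F (F z).

Lemma contO_on_iff (D : C -> Prop) F : continuous_on D F <-> contO_on D F.
Proof.
  split.
  - intros H z Dz eps He. apply nearC_locally.
    exact (proj1 (filterlim_locally _ _) (H z Dz) (mkposreal eps He)).
  - intros H z Dz. apply filterlim_locally. intros eps. apply nearC_locally.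
    exact (H z Dz eps (cond_pos eps)).
Qed.

Definition oderiv F (z : C) (L : BOp V) : Prop :=
  forall eps, 0 < eps -> exists d, 0 < d /\ forall w, Cmod (w - z) < d ->
    bop_norm (minus (minus (F w) (F z)) (scal (w - z)%C L)) <= eps * Cmod (w - z).

Lemma ex_derive_oderiv F z :
  ex_derive (K := C_AbsRing) F z <-> exists L, oderiv F z L.
Proof.
  split.
  - intros [L [_ H]]. exists L. intros eps He.
    specialize (H z (fun P HP => HP) (mkposreal eps He)). destruct H as [d Hd].
    exists d. split; [apply cond_pos|]. intros w Hw. apply (Hd w Hw).
  - intros [L H]. exists L. split; [apply is_linear_scal_l|].
    intros x Hx. apply (is_filter_lim_locally_unique (V := AbsRing_NormedModule C_AbsRing)) in Hx. subst x.
    intros eps. destruct (H eps (cond_pos eps)) as [d [Hd Hw]].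
    exists (mkposreal d Hd). intros w Hb. apply (Hw w Hb).
Qed.

Lemma oderiv_near F z L : oderiv F z L -> limO (nearC (fun _ => True) z) F (F z).
Proof.
  intros H eps He. destruct (H 1 Rlt_0_1) as [d [Hd Hw]].
  pose proof (bop_norm_ge_0 L).
  exists (Rmin d (eps / (bop_norm L + 1))). split.
  { apply Rmin_pos; [exact Hd|apply Rdiv_lt_0_compat; lra]. }
  intros w _ Hwz. pose proof (Rmin_l d (eps / (bop_norm L + 1))).
  pose proof (Rmin_r d (eps / (bop_norm L + 1))). specialize (Hw w ltac:(lra)).
  pose proof (bop_norm_dist (minus (F w) (F z)) (scal (w - z)%C L)) as T1.
  pose proof (bop_norm_scal (w - z)%C L) as T2.
  change (bop_norm (scal (w - z)%C L) <= Cmod (w - z) * bop_norm L) in T2.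
  apply Rle_lt_trans with ((bop_norm L + 1) * Cmod (w - z)).
  - eapply Rle_trans; [exact T1|]. lra.
  - replace eps with ((bop_norm L + 1) * (eps / (bop_norm L + 1))) by (field; lra).
    apply Rmult_lt_compat_l; lra.
Qed.

Lemma oderiv_const (A : BOp V) z : oderiv (fun _ => A) z zero.
Proof.
  intros eps He. exists 1. split; [lra|]. intros w _.
  apply Rle_trans with (bop_norm (zero : BOp V)); [right; f_equal; op_ring|].
  eapply Rle_trans; [right; exact bop_norm_zero|].
  apply Rmult_le_pos; [lra|apply Cmod_ge_0].
Qed.

Lemma oderiv_plus F G z L M : oderiv F z L -> oderiv G z M ->
  oderiv (fun w => plus (F w) (G w)) z (plus L M).
Proof.
  intros HF HG eps He. destruct (HF (eps / 2)) as [d1 [Hd1 H1]]; [lra|].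
  destruct (HG (eps / 2)) as [d2 [Hd2 H2]]; [lra|].
  exists (Rmin d1 d2). split; [apply Rmin_pos; assumption|]. intros w Hw.
  pose proof (Rmin_l d1 d2). pose proof (Rmin_r d1 d2).
  specialize (H1 w ltac:(lra)). specialize (H2 w ltac:(lra)).
  apply Rle_trans with (bop_norm (plus (minus (minus (F w) (F z)) (scal (w - z)%C L))
    (minus (minus (G w) (G z)) (scal (w - z)%C M)))).
  { right. f_equal. op_ring. }
  eapply Rle_trans; [apply bop_norm_triangle|]. lra.
Qed.

Lemma oderiv_mult F G z L M : oderiv F z L -> oderiv G z M ->
  oderiv (fun w => mult (F w) (G w)) z (plus (mult L (G z)) (mult (F z) M)).
Proof.
  intros HF HG eps He.
  set (K := bop_norm (F z) + bop_norm (G z) + bop_norm L + 1).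
  pose proof (bop_norm_ge_0 (F z)). pose proof (bop_norm_ge_0 (G z)). pose proof (bop_norm_ge_0 L).
  assert (HK : 0 < K) by (unfold K; lra).
  assert (He3 : 0 < eps / (3 * K)) by (apply Rdiv_lt_0_compat; lra).
  destruct (HF _ He3) as [d1 [Hd1 J1]]. destruct (HG _ He3) as [d2 [Hd2 J2]].
  destruct (oderiv_near G z M HG _ He3) as [d3 [Hd3 J3]].
  destruct (HF 1 Rlt_0_1) as [d4 [Hd4 J4]].
  exists (Rmin (Rmin d1 d2) (Rmin d3 d4)). split; [repeat apply Rmin_pos; assumption|]. intros w Hw.
  pose proof (Rmin_l (Rmin d1 d2) (Rmin d3 d4)). pose proof (Rmin_r (Rmin d1 d2) (Rmin d3 d4)).
  pose proof (Rmin_l d1 d2). pose proof (Rmin_r d1 d2). pose proof (Rmin_l d3 d4). pose proof (Rmin_r d3 d4).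
  specialize (J1 w ltac:(lra)). specialize (J2 w ltac:(lra)). specialize (J3 w I ltac:(lra)).
  specialize (J4 w ltac:(lra)).
  set (a := minus (minus (F w) (F z)) (scal (w - z)%C L)) in *.
  set (b := minus (minus (G w) (G z)) (scal (w - z)%C M)) in *.
  set (h := Cmod (w - z)) in *. assert (Hh : 0 <= h) by apply Cmod_ge_0.
  assert (HFw : bop_norm (minus (F w) (F z)) <= K * h).
  { pose proof (bop_norm_dist (minus (F w) (F z)) (scal (w - z)%C L)) as T.
    pose proof (bop_norm_scal (w - z)%C L) as T2.
    change (bop_norm (scal (w - z)%C L) <= h * bop_norm L) in T2.
    fold a in T. assert (0 <= (bop_norm (F z) + bop_norm (G z)) * h) by (apply Rmult_le_pos; lra).
    unfold K. lra. }
  apply Rle_trans with (bop_norm (plus (plus (mult a (G z)) (mult (F z) b))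
    (mult (minus (F w) (F z)) (minus (G w) (G z))))).
  { right. f_equal. unfold a, b. op_ring. }
  eapply Rle_trans; [apply bop_norm_triangle|].
  eapply Rle_trans; [apply Rplus_le_compat_r, bop_norm_triangle|].
  pose proof (bop_norm_mult a (G z)). pose proof (bop_norm_mult (F z) b).
  pose proof (bop_norm_mult (minus (F w) (F z)) (minus (G w) (G z))).
  pose proof (bop_norm_ge_0 a). pose proof (bop_norm_ge_0 b).
  set (e := eps / (3 * K)) in *.
  assert (bop_norm a * bop_norm (G z) <= e * h * K).
  { apply Rmult_le_compat; try assumption; unfold K; lra. }
  assert (bop_norm (F z) * bop_norm b <= K * (e * h)).
  { apply Rmult_le_compat; try assumption; unfold K; lra. }
  assert (bop_norm (minus (F w) (F z)) * bop_norm (minus (G w) (G z)) <= K * h * e).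
  { apply Rmult_le_compat; try assumption; try apply bop_norm_ge_0. left; exact J3. }
  assert (E : eps * h = e * h * K + K * (e * h) + K * h * e) by (unfold e; field; lra).
  lra.
Qed.

Lemma oderiv_scal_id (z0 c : C) (A : BOp V) z :
  oderiv (fun w => scal (c * (w - z0))%C A) z (scal c A).
Proof.
  intros eps He. exists 1. split; [lra|]. intros w _.
  apply Rle_trans with (bop_norm (zero : BOp V)); [right; f_equal; op_ring|].
  eapply Rle_trans; [right; exact bop_norm_zero|].
  apply Rmult_le_pos; [lra|apply Cmod_ge_0].
Qed.

Lemma oderiv_inner F z L (u w : V) : oderiv F z L ->
  cderiv (fun x => inner (F x u) w) z (inner (L u) w).
Proof.
  intros HF eps He. set (K := norm u * norm w + 1).
  assert (HK : 0 < K).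
  { unfold K. pose proof (Rmult_le_pos _ _ (vnorm_ge_0 u) (vnorm_ge_0 w)). lra. }
  destruct (HF (eps / K)) as [d [Hd H]]; [apply Rdiv_lt_0_compat; lra|].
  exists d. split; [exact Hd|]. intros x Hx. specialize (H x Hx).
  set (R0 := minus (minus (F x) (F z)) (scal (x - z)%C L)) in *.
  replace (inner (F x u) w - inner (F z u) w - inner (L u) w * (x - z))%C with (inner (R0 u) w).
  2:{ unfold R0. inner_simpl. ring. }
  eapply Rle_trans; [apply inner_op_le|]. pose proof (bop_norm_ge_0 R0).
  apply Rle_trans with (bop_norm R0 * K); [unfold K; lra|].
  replace (eps * Cmod (x - z)) with (eps / K * Cmod (x - z) * K) by (field; lra).
  apply Rmult_le_compat_r; lra.
Qed.

(** The operator-valued disc algebra: [admissible] without the invertibility, hence stable under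
    sums and products. *)
Definition oholo (z0 : C) (r : R) F : Prop :=
  contO_on (closed_disc z0 r) F /\ forall z, open_disc z0 r z -> exists L, oderiv F z L.

Lemma oholo_const z0 r (A : BOp V) : oholo z0 r (fun _ => A).
Proof.
  split; [intros z _; apply limO_const|]. intros z _. exists zero. apply oderiv_const.
Qed.

Lemma oholo_plus z0 r F G : oholo z0 r F -> oholo z0 r G -> oholo z0 r (fun z => plus (F z) (G z)).
Proof.
  intros [H1 H2] [H3 H4]. split.
  - intros z Hz. apply limO_plus; auto.
  - intros z Hz. destruct (H2 z Hz) as [L HL]. destruct (H4 z Hz) as [M HM].
    eexists. apply oderiv_plus; eassumption.
Qed.

Lemma oholo_mult z0 r F G : oholo z0 r F -> oholo z0 r G -> oholo z0 r (fun z => mult (F z) (G z)).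
Proof.
  intros [H1 H2] [H3 H4]. split.
  - intros z Hz. apply limO_mult; auto.
  - intros z Hz. destruct (H2 z Hz) as [L HL]. destruct (H4 z Hz) as [M HM].
    eexists. apply oderiv_mult; eassumption.
Qed.

Lemma limC_id D z : limC (nearC D z) (fun w => w) z.
Proof. intros eps He. exists eps. auto. Qed.

Lemma oholo_affine z0 r (c : C) (A B : BOp V) : oholo z0 r (fun z => plus A (scal (c * (z - z0))%C B)).
Proof.
  apply oholo_plus; [apply oholo_const|]. split.
  - intros z _. apply limO_scal; [|apply limO_const].
    apply limC_mult; [apply limC_const|]. apply limC_minus; [apply limC_id|apply limC_const].
  - intros z _. eexists. apply oderiv_scal_id.
Qed.

Lemma oholo_sub z0 r F z1 rho : oholo z0 r F -> 0 < rho -> Cmod (z1 - z0) + rho < r -> oholo z1 rho F.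
Proof.
  intros [H1 H2] Hrho Hd.
  assert (Hin : forall z, closed_disc z1 rho z -> open_disc z0 r z).
  { intros z Hz. unfold closed_disc, open_disc in *.
    replace (z - z0)%C with ((z - z1) + (z1 - z0))%C by ring.
    eapply Rle_lt_trans; [apply Cmod_triangle|]. lra. }
  split.
  - intros z Hz eps He. destruct (H1 z (open_closed_disc _ _ _ (Hin z Hz)) eps He) as [d [Hd' H]].
    exists d. split; [exact Hd'|]. intros w Hw. apply H, open_closed_disc, Hin, Hw.
  - intros z Hz. apply H2, Hin, open_closed_disc, Hz.
Qed.

Lemma oholo_contC z0 r F (u w : V) : oholo z0 r F -> contC_on (closed_disc z0 r) (fun z => inner (F z u) w).
Proof. intros [H _] z Hz. exact (limC_inner F (F z) u w (H z Hz)). Qed.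

Lemma oholo_mean z0 r F (u w : V) : 0 < r -> oholo z0 r F ->
  cavg (fun t => inner (F (circle z0 r t) u) w) = inner (F z0 u) w.
Proof.
  intros Hr HF. apply (mean_value z0 r (fun z => inner (F z u) w)); [exact Hr|apply oholo_contC, HF|].
  intros z Hz. destruct (proj2 HF z Hz) as [L HL]. eexists. apply oderiv_inner, HL.
Qed.

Lemma contO_circle z0 r F : 0 < r -> contO_on (closed_disc z0 r) F -> contO (fun t => F (circle z0 r t)).
Proof.
  intros Hr HF t eps He.
  assert (Hin : forall t, closed_disc z0 r (circle z0 r t)).
  { intros t'. unfold closed_disc. rewrite Cmod_circle_sub; lra. }
  destruct (HF _ (Hin t) eps He) as [d [Hd H]].
  generalize (circle_continuous z0 r t ltac:(lra) d Hd). apply filter_imp.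
  intros t' Ht'. apply H; [apply Hin|exact Ht'].
Qed.

End Holomorphic.

(** * Scalar holomorphic functions and their boundary values *)

Definition holo (z0 : C) (r : R) (f : C -> C) : Prop :=
  contC_on (closed_disc z0 r) f /\ forall z, open_disc z0 r z -> exists L, cderiv f z L.

Lemma holo_inner {V : HilbertSpace} z0 r (F : C -> BOp V) u w :
  oholo z0 r F -> holo z0 r (fun z => inner (F z u) w).
Proof.
  intros H. split; [apply oholo_contC, H|]. intros z Hz.
  destruct (proj2 H z Hz) as [L HL]. eexists. apply oderiv_inner, HL.
Qed.

Lemma holo_sub z0 r f z1 rho : holo z0 r f -> 0 < rho -> Cmod (z1 - z0) + rho < r -> holo z1 rho f.
Proof.
  intros [H1 H2] Hrho Hd.
  assert (Hin : forall z, closed_disc z1 rho z -> open_disc z0 r z).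
  { intros z Hz. unfold closed_disc, open_disc in *.
    replace (z - z0)%C with ((z - z1) + (z1 - z0))%C by ring.
    eapply Rle_lt_trans; [apply Cmod_triangle|]. lra. }
  split.
  - intros z Hz eps He. destruct (H1 z (open_closed_disc _ _ _ (Hin z Hz)) eps He) as [d [Hd' H]].
    exists d. split; [exact Hd'|]. intros w Hw. apply H, open_closed_disc, Hin, Hw.
  - intros z Hz. apply H2, Hin, open_closed_disc, Hz.
Qed.

Lemma cderiv_mult f g z L M : cderiv f z L -> cderiv g z M ->
  cderiv (fun w => f w * g w)%C z (L * g z + f z * M)%C.
Proof.
  intros Hf Hg eps He.
  destruct (cderiv_lip f z L Hf) as [d1 [Hd1 J1]]. destruct (cderiv_lip g z M Hg) as [d2 [Hd2 J2]].
  pose proof (Cmod_ge_0 L). pose proof (Cmod_ge_0 M). pose proof (Cmod_ge_0 (f z)). pose proof (Cmod_ge_0 (g z)).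
  set (K := (Cmod L + 1) * (Cmod M + 1)). assert (HK : 0 < K) by (unfold K; nra).
  destruct (Hf (eps / 3 / (Cmod (g z) + 1))) as [d3 [Hd3 J3]]; [repeat apply Rdiv_lt_0_compat; lra|].
  destruct (Hg (eps / 3 / (Cmod (f z) + 1))) as [d4 [Hd4 J4]]; [repeat apply Rdiv_lt_0_compat; lra|].
  exists (Rmin (Rmin d1 d2) (Rmin (Rmin d3 d4) (eps / 3 / K))).
  split; [repeat apply Rmin_pos; try assumption; repeat apply Rdiv_lt_0_compat; lra|].
  intros w Hw.
  pose proof (Rmin_l (Rmin d1 d2) (Rmin (Rmin d3 d4) (eps / 3 / K))).
  pose proof (Rmin_r (Rmin d1 d2) (Rmin (Rmin d3 d4) (eps / 3 / K))).
  pose proof (Rmin_l (Rmin d3 d4) (eps / 3 / K)). pose proof (Rmin_r (Rmin d3 d4) (eps / 3 / K)).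
  pose proof (Rmin_l d1 d2). pose proof (Rmin_r d1 d2). pose proof (Rmin_l d3 d4). pose proof (Rmin_r d3 d4).
  specialize (J1 w ltac:(lra)). specialize (J2 w ltac:(lra)).
  specialize (J3 w ltac:(lra)). specialize (J4 w ltac:(lra)).
  set (h := Cmod (w - z)) in *. assert (Hh : 0 <= h) by apply Cmod_ge_0.
  replace (f w * g w - f z * g z - (L * g z + f z * M) * (w - z))%C with
    ((f w - f z - L * (w - z)) * g z + f z * (g w - g z - M * (w - z)) + (f w - f z) * (g w - g z))%C by ring.
  eapply Rle_trans; [apply Cmod_triangle|].
  eapply Rle_trans; [apply Rplus_le_compat_r, Cmod_triangle|]. rewrite !Cmod_mult.
  assert (Cmod (f w - f z - L * (w - z)) * Cmod (g z) <= eps / 3 * h).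
  { apply Rle_trans with (eps / 3 / (Cmod (g z) + 1) * h * (Cmod (g z) + 1)).
    - apply Rmult_le_compat; [apply Cmod_ge_0|lra|exact J3|lra].
    - right; field; lra. }
  assert (Cmod (f z) * Cmod (g w - g z - M * (w - z)) <= eps / 3 * h).
  { apply Rle_trans with ((Cmod (f z) + 1) * (eps / 3 / (Cmod (f z) + 1) * h)).
    - apply Rmult_le_compat; [lra|apply Cmod_ge_0|lra|exact J4].
    - right; field; lra. }
  assert (Cmod (f w - f z) * Cmod (g w - g z) <= eps / 3 * h).
  { apply Rle_trans with (((Cmod L + 1) * h) * ((Cmod M + 1) * h)).
    - apply Rmult_le_compat; try apply Cmod_ge_0; assumption.
    - replace ((Cmod L + 1) * h * ((Cmod M + 1) * h)) with (K * h * h) by (unfold K; ring).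
      apply Rmult_le_compat_r; [exact Hh|].
      replace (eps / 3) with (K * (eps / 3 / K)) by (field; lra). apply Rmult_le_compat_l; lra. }
  lra.
Qed.

Lemma cderiv_minus_const f z L a : cderiv f z L -> cderiv (fun w => f w - a)%C z L.
Proof.
  intros H eps He. destruct (H eps He) as [d [Hd Hw]]. exists d. split; [exact Hd|].
  intros w Hwz. replace (f w - a - (f z - a) - L * (w - z))%C with (f w - f z - L * (w - z))%C by ring. auto.
Qed.

Lemma holo_minus_const z0 r f a : holo z0 r f -> holo z0 r (fun z => f z - a)%C.
Proof.
  intros [H1 H2]. split.
  - intros z Hz. exact (limC_minus (F := nearC _ z) f (fun _ => a) (f z) a (H1 z Hz) (limC_const a)).
  - intros z Hz. destruct (H2 z Hz) as [L HL]. exists L. apply cderiv_minus_const, HL.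
Qed.

Lemma holo_sq z0 r f : holo z0 r f -> holo z0 r (fun z => f z * f z)%C.
Proof.
  intros [H1 H2]. split.
  - intros z Hz. exact (limC_mult (F := nearC _ z) f f (f z) (f z) (H1 z Hz) (H1 z Hz)).
  - intros z Hz. destruct (H2 z Hz) as [L HL]. eexists. apply cderiv_mult; exact HL.
Qed.

Lemma holo_mean z0 r f : 0 < r -> holo z0 r f -> cavg (fun t => f (circle z0 r t)) = f z0.
Proof. intros Hr [H1 H2]. apply mean_value; assumption. Qed.

Lemma holo_circle z0 r f : 0 < r -> holo z0 r f -> contC (fun t => f (circle z0 r t)).
Proof. intros Hr [H _]. apply (contC_circle z0 r); [lra|exact H]. Qed.

(** The maximum principle for |f|^2. It is subharmonic because, with c = f(z1), |f|^2 dominates the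
    real part of |c|^2 + 2 conj(c) (f - c), whose average over circles around z1 is |c|^2. *)
Lemma holo_zero_of_boundary z0 r f : 0 < r -> holo z0 r f ->
  (forall t, 0 <= t <= 2 * PI -> f (circle z0 r t) = RtoC 0) ->
  forall z, closed_disc z0 r z -> f z = RtoC 0.
Proof.
  intros Hr Hf Hb z Hz.
  set (phi := fun z => Re (Cconj (f z) * f z)%C).
  assert (Hphi : contR_on (closed_disc z0 r) phi).
  { apply (contR_on_of_re _ (fun z => Cconj (f z) * f z)%C). intros x Hx.
    exact (limC_mult (F := nearC _ x) _ f _ (f x) (limC_conj f (f x) (proj1 Hf x Hx)) (proj1 Hf x Hx)). }
  assert (H : phi z <= 0).
  { revert z Hz. apply max_principle; [exact Hr|exact Hphi| |].
    - intros t Ht. unfold phi. rewrite Hb by exact Ht. unfold Re; simpl. lra.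
    - intros z1 Hz1 eps He. unfold open_disc in Hz1.
      exists (r - Cmod (z1 - z0)). split; [lra|]. intros rho Hrho.
      pose proof (holo_sub z0 r f z1 rho Hf ltac:(lra) ltac:(lra)) as H1.
      pose proof (holo_circle z1 rho f ltac:(lra) H1) as Hc.
      set (c := f z1).
      assert (E : ravg (fun t => Re (Cconj c * c + (RtoC 2 * Cconj c) * (f (circle z1 rho t) - c))%C) = phi z1).
      { change (Re (cavg (fun t => (Cconj c * c + (RtoC 2 * Cconj c) * (f (circle z1 rho t) - c))%C)) = phi z1).
        rewrite cavg_plus, cavg_const, cavg_scal, cavg_minus, cavg_const, holo_mean;
          auto using contC_const, contC_minus, contC_mult; try lra.
        fold c. unfold phi. fold c. f_equal. ring. }
      rewrite <- E.
      assert (0 <= eps * rho ^ 2) by (apply Rmult_le_pos; [lra|apply pow2_ge_0]).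
      assert (ravg (fun t => Re (Cconj c * c + (RtoC 2 * Cconj c) * (f (circle z1 rho t) - c))%C)
        <= ravg (fun t => phi (circle z1 rho t))); [|lra].
      apply ravg_le.
      + apply (contC_re (fun t => Cconj c * c + (RtoC 2 * Cconj c) * (f (circle z1 rho t) - c))%C).
        auto 8 using contC_const, contC_minus, contC_mult, contC_plus.
      + apply (contC_re (fun t => Cconj (f (circle z1 rho t)) * f (circle z1 rho t))%C).
        auto using contC_mult, contC_conj.
      + intros t. unfold phi. set (p := f (circle z1 rho t)).
        pose proof (pow2_ge_0 (fst p - fst c)). pose proof (pow2_ge_0 (snd p - snd c)).
        clearbody c p. unfold Re; simpl. nra. }
  unfold phi in H. rewrite Re_conj_mult in H. pose proof (Cmod_ge_0 (f z)).
  apply Cmod_eq_0. nra.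
Qed.

(** Let g = f - f(z0), which is real on the circle because f(z0) is an average of real values. The
    mean value property of g^2 gives (Re g)^2 zero average, so g vanishes on the circle. *)
Lemma holo_real_const z0 r f : 0 < r -> holo z0 r f ->
  (forall t, 0 <= t <= 2 * PI -> Im (f (circle z0 r t)) = 0) ->
  forall z, closed_disc z0 r z -> f z = f z0.
Proof.
  intros Hr Hf Him z Hz.
  set (g := fun z => (f z - f z0)%C).
  assert (Hg : holo z0 r g) by (apply holo_minus_const, Hf).
  assert (Him0 : Im (f z0) = 0).
  { rewrite <- (holo_mean z0 r f Hr Hf). simpl. unfold Im at 1. simpl.
    apply Rle_antisym.
    - rewrite <- (ravg_const 0). apply ravg_le_period;
        [apply contC_im, (holo_circle z0 r f Hr Hf)|apply contR_const|].
      intros t Ht. rewrite Him by exact Ht. lra.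
    - rewrite <- (ravg_const 0) at 1. apply ravg_le_period;
        [apply contR_const|apply contC_im, (holo_circle z0 r f Hr Hf)|].
      intros t Ht. rewrite Him by exact Ht. lra. }
  assert (Hgim : forall t, 0 <= t <= 2 * PI -> Im (g (circle z0 r t)) = 0).
  { intros t Ht. unfold g. pose proof (Him t Ht). unfold Im in *. simpl. lra. }
  assert (Hmean : ravg (fun t => Re (g (circle z0 r t) * g (circle z0 r t))%C) = 0).
  { pose proof (holo_mean z0 r _ Hr (holo_sq z0 r g Hg)) as E. apply (f_equal Re) in E.
    transitivity (Re (g z0 * g z0)%C); [exact E|]. unfold g. unfold Re; simpl. ring. }
  pose proof (holo_circle z0 r g Hr Hg) as Hgc.
  assert (Hmean2 : ravg (fun t => Re (g (circle z0 r t)) ^ 2) = 0).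
  { apply Rle_antisym.
    - rewrite <- Hmean. apply ravg_le_period.
      + replace (fun t => Re (g (circle z0 r t)) ^ 2) with
          (fun t => Re (RtoC (Re (g (circle z0 r t))) * RtoC (Re (g (circle z0 r t))))%C).
        * apply (contC_re (fun t => RtoC (Re (g (circle z0 r t))) * RtoC (Re (g (circle z0 r t))))%C).
          assert (contC (fun t => RtoC (Re (g (circle z0 r t))))).
          { apply contC_of; [exact (contC_re _ Hgc)|exact (contR_const 0)]. }
          apply contC_mult; assumption.
        * apply functional_extensionality. intros t. unfold Re; simpl. ring.
      + apply (contC_re (fun t => g (circle z0 r t) * g (circle z0 r t))%C). apply contC_mult; assumption.
      + intros t Ht. specialize (Hgim t Ht). unfold Re, Im in *. simpl in *. nra.
    - rewrite <- (ravg_const 0) at 1. apply ravg_le.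
      + apply contR_const.
      + replace (fun t => Re (g (circle z0 r t)) ^ 2) with
          (fun t => Re (RtoC (Re (g (circle z0 r t))) * RtoC (Re (g (circle z0 r t))))%C).
        * apply (contC_re (fun t => RtoC (Re (g (circle z0 r t))) * RtoC (Re (g (circle z0 r t))))%C).
          assert (contC (fun t => RtoC (Re (g (circle z0 r t))))).
          { apply contC_of; [exact (contC_re _ Hgc)|exact (contR_const 0)]. }
          apply contC_mult; assumption.
        * apply functional_extensionality. intros t. unfold Re; simpl. ring.
      + intros t. apply pow2_ge_0. }
  assert (Hre : forall t, 0 <= t <= 2 * PI -> Re (g (circle z0 r t)) ^ 2 = 0).
  { apply ravg_zero; [|intros t; apply pow2_ge_0|exact Hmean2].
    replace (fun t => Re (g (circle z0 r t)) ^ 2) with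
      (fun t => Re (RtoC (Re (g (circle z0 r t))) * RtoC (Re (g (circle z0 r t))))%C).
    - apply (contC_re (fun t => RtoC (Re (g (circle z0 r t))) * RtoC (Re (g (circle z0 r t))))%C).
      assert (contC (fun t => RtoC (Re (g (circle z0 r t))))).
      { apply contC_of; [exact (contC_re _ Hgc)|exact (contR_const 0)]. }
      apply contC_mult; assumption.
    - apply functional_extensionality. intros t. unfold Re; simpl. ring. }
  assert (Hg0 : g z = RtoC 0).
  { apply (holo_zero_of_boundary z0 r g Hr Hg); [|exact Hz].
    intros t Ht. apply injective_projections; [|apply (Hgim t Ht)].
    pose proof (Hre t Ht) as E. unfold Re in E. simpl in E. simpl. nra. }
  replace (f z) with (g z + f z0)%C by (unfold g; ring). rewrite Hg0. ring.
Qed.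

(** * Second-order expansion of an operator function *)

Section RealDerivative.
Context {V : HilbertSpace}.
Implicit Types F G : R -> BOp V.

Definition rderO F (t : R) (L : BOp V) : Prop :=
  forall eps, 0 < eps -> exists d, 0 < d /\ forall s, Rabs (s - t) < d ->
    bop_norm (minus (minus (F s) (F t)) (scal (RtoC (s - t)) L)) <= eps * Rabs (s - t).

Lemma is_derive_rderO F t L : is_derive (V := BOp_R_NormedModule V) F t L <-> rderO F t L.
Proof.
  split.
  - intros [_ H] eps He.
    specialize (H t (fun P HP => HP) (mkposreal eps He)). destruct H as [d Hd].
    exists d. split; [apply cond_pos|]. intros w Hw. apply (Hd w Hw).
  - intros H. split; [apply is_linear_scal_l|].
    intros x Hx. apply (is_filter_lim_locally_unique (V := R_NormedModule)) in Hx. subst x.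
    intros eps. destruct (H eps (cond_pos eps)) as [d [Hd Hw]].
    exists (mkposreal d Hd). intros w Hb. apply (Hw w Hb).
Qed.

Lemma rderO_inner F t L (u w : V) : rderO F t L ->
  derC (fun s => inner (F s u) w) t (inner (L u) w).
Proof.
  intros HF.
  set (K := norm u * norm w + 1).
  assert (HK : 0 < K).
  { unfold K. pose proof (Rmult_le_pos _ _ (vnorm_ge_0 u) (vnorm_ge_0 w)). lra. }
  assert (Hc : forall eps, 0 < eps -> exists d, 0 < d /\ forall s, Rabs (s - t) < d ->
    Cmod (inner (F s u) w - inner (F t u) w - RtoC (s - t) * inner (L u) w) <= eps * Rabs (s - t)).
  { intros eps He. destruct (HF (eps / K)) as [d [Hd H]]; [apply Rdiv_lt_0_compat; lra|].
    exists d. split; [exact Hd|]. intros s Hs. specialize (H s Hs).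
    set (R0 := minus (minus (F s) (F t)) (scal (RtoC (s - t)) L)) in *.
    replace (inner (F s u) w - inner (F t u) w - RtoC (s - t) * inner (L u) w)%C with (inner (R0 u) w)
      by (unfold R0; inner_simpl; ring).
    eapply Rle_trans; [apply inner_op_le|]. pose proof (bop_norm_ge_0 R0).
    apply Rle_trans with (bop_norm R0 * K); [unfold K; lra|].
    replace (eps * Rabs (s - t)) with (eps / K * Rabs (s - t) * K) by (field; lra).
    apply Rmult_le_compat_r; lra. }
  split; (split; [apply is_linear_scal_l|]);
    intros x Hx; apply (is_filter_lim_locally_unique (V := R_NormedModule)) in Hx; subst x;
    intros eps; destruct (Hc eps (cond_pos eps)) as [d [Hd Hw]];
    exists (mkposreal d Hd); intros s Hb; specialize (Hw s Hb);
    (eapply Rle_trans; [|exact Hw]).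
  - eapply Rle_trans; [|apply re_le_Cmod]. right.
    unfold norm, minus, plus, opp, scal, Re; simpl; unfold abs, mult; simpl. f_equal. ring.
  - eapply Rle_trans; [|apply im_le_Cmod]. right.
    unfold norm, minus, plus, opp, scal, Im; simpl; unfold abs, mult; simpl. f_equal. ring.
Qed.

Lemma rderO_unique F t L M : rderO F t L -> rderO F t M -> L = M.
Proof.
  intros HL HM. apply op_ext_inner. intros u w.
  destruct (rderO_inner F t L u w HL) as [A1 A2]. destruct (rderO_inner F t M u w HM) as [B1 B2].
  apply injective_projections.
  - transitivity (Derive (fun s => Re (inner (F s u) w)) t); [symmetry|]; apply is_derive_unique; assumption.
  - transitivity (Derive (fun s => Im (inner (F s u) w)) t); [symmetry|]; apply is_derive_unique; assumption.
Qed.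

Lemma rderO_plus F G t L M : rderO F t L -> rderO G t M -> rderO (fun s => plus (F s) (G s)) t (plus L M).
Proof.
  intros HF HG eps He. destruct (HF (eps / 2)) as [d1 [Hd1 H1]]; [lra|].
  destruct (HG (eps / 2)) as [d2 [Hd2 H2]]; [lra|].
  exists (Rmin d1 d2). split; [apply Rmin_pos; assumption|]. intros w Hw.
  pose proof (Rmin_l d1 d2). pose proof (Rmin_r d1 d2).
  specialize (H1 w ltac:(lra)). specialize (H2 w ltac:(lra)).
  apply Rle_trans with (bop_norm (plus (minus (minus (F w) (F t)) (scal (RtoC (w - t)) L))
    (minus (minus (G w) (G t)) (scal (RtoC (w - t)) M)))).
  { right. f_equal. op_ring. }
  eapply Rle_trans; [apply bop_norm_triangle|]. lra.
Qed.

Lemma rderO_scal_const (c : C) F t L : rderO F t L -> rderO (fun s => scal c (F s)) t (scal c L).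
Proof.
  intros HF eps He. pose proof (Cmod_ge_0 c).
  destruct (HF (eps / (Cmod c + 1))) as [d [Hd H1]]; [apply Rdiv_lt_0_compat; lra|].
  exists d. split; [exact Hd|]. intros s Hs. specialize (H1 s Hs).
  set (R0 := minus (minus (F s) (F t)) (scal (RtoC (s - t)) L)) in *.
  apply Rle_trans with (bop_norm (scal c R0)).
  { right. f_equal. unfold R0. op_ring. }
  eapply Rle_trans; [apply bop_norm_scal|]. pose proof (bop_norm_ge_0 R0).
  apply Rle_trans with ((Cmod c + 1) * (eps / (Cmod c + 1) * Rabs (s - t))).
  - apply Rmult_le_compat; lra.
  - right; field; lra.
Qed.

Lemma rderO_poly2 (A B : BOp V) a t :
  rderO (fun s => plus (scal (RtoC (s - a)) A) (scal (RtoC ((s - a) ^ 2 / 2)) B)) t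
    (plus A (scal (RtoC (t - a)) B)).
Proof.
  intros eps He. pose proof (bop_norm_ge_0 B).
  exists (eps / (bop_norm B + 1)). split; [apply Rdiv_lt_0_compat; lra|]. intros s Hs.
  apply Rle_trans with (bop_norm (scal (RtoC ((s - t) ^ 2 / 2)) B)).
  { right. f_equal. apply op_ext_inner; intros u w; inner_simpl.
    unfold RtoC. ceq; field. }
  eapply Rle_trans; [apply bop_norm_scal|]. rewrite Cmod_R.
  replace (Rabs ((s - t) ^ 2 / 2)) with (Rabs (s - t) * Rabs (s - t) / 2).
  2:{ pose proof (pow2_ge_0 (s - t)). rewrite <- Rabs_mult.
      rewrite (Rabs_pos_eq ((s - t) ^ 2 / 2)) by lra.
      rewrite Rabs_pos_eq by (simpl in *; lra). field. }
  pose proof (Rabs_pos (s - t)).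
  assert (Rabs (s - t) * (bop_norm B + 1) <= eps).
  { replace eps with (eps / (bop_norm B + 1) * (bop_norm B + 1)) by (field; lra).
    apply Rmult_le_compat_r; lra. }
  assert (Rabs (s - t) * (Rabs (s - t) * (bop_norm B + 1)) <= Rabs (s - t) * eps)
    by (apply Rmult_le_compat_l; assumption).
  assert (0 <= Rabs (s - t) * Rabs (s - t)) by (apply Rmult_le_pos; assumption).
  nra.
Qed.

(** The real mean value theorem is applied to t -> Re <F(t) v, x>, where x is the remainder itself
    evaluated at v; this recovers the norm of the remainder. *)
Lemma mean_value_ineq F F' (L : BOp V) eps a b :
  (forall t, Rmin a b <= t <= Rmax a b -> rderO F t (F' t)) ->
  (forall t, Rmin a b <= t <= Rmax a b -> bop_norm (minus (F' t) L) <= eps) ->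
  bop_norm (minus (minus (F b) (F a)) (scal (RtoC (b - a)) L)) <= eps * Rabs (b - a).
Proof.
  intros HF Hb.
  assert (Heps : 0 <= eps).
  { eapply Rle_trans; [|apply (Hb a)]; [apply bop_norm_ge_0|]. split; [apply Rmin_l|apply Rmax_l]. }
  apply bop_norm_le; [apply Rmult_le_pos; [exact Heps|apply Rabs_pos]|]. intros v.
  set (D := minus (minus (F b) (F a)) (scal (RtoC (b - a)) L)). set (x := D v : V).
  apply norm_le_inner; [apply Rmult_le_pos; [apply Rmult_le_pos; [exact Heps|apply Rabs_pos]|apply vnorm_ge_0]|].
  destruct (MVT_gen (fun t => Re (inner (F t v) x)) a b (fun t => Re (inner (F' t v) x))) as [c [Hc E]].
  - intros t Ht. apply (rderO_inner F t (F' t) v x). apply HF. lra.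
  - intros t Ht. apply continuity_pt_filterlim, limC_re, (derC_cont (fun t => inner (F t v) x) t (inner (F' t v) x)).
    apply rderO_inner, HF, Ht.
  - change (Re (inner x x) <= eps * Rabs (b - a) * norm v * norm x).
    replace (Re (inner x x)) with (Re (inner ((minus (F' c) L : BOp V) v) x) * (b - a)).
    + eapply Rle_trans; [apply Rle_abs|]. rewrite Rabs_mult.
      assert (Rabs (Re (inner ((minus (F' c) L : BOp V) v) x)) <= eps * norm v * norm x).
      { eapply Rle_trans; [apply re_le_Cmod|]. eapply Rle_trans; [apply inner_op_le|].
        apply Rmult_le_compat_r; [apply vnorm_ge_0|].
        apply Rmult_le_compat_r; [apply vnorm_ge_0|]. apply Hb, Hc. }
      replace (eps * Rabs (b - a) * norm v * norm x) with (eps * norm v * norm x * Rabs (b - a)) by ring.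
      apply Rmult_le_compat_r; [apply Rabs_pos|assumption].
    + change (inner x x) with (inner (D v) x). unfold D. inner_simpl.
      unfold Re in *. simpl. rewrite Rmult_0_l, Rminus_0_r.
      replace (fst (inner (F b v) x) + - fst (inner (F a v) x)) with (fst (inner (F b v) x) - fst (inner (F a v) x)) by ring.
      rewrite E. ring.
Qed.

(** After subtracting the quadratic polynomial with second derivative M, [mean_value_ineq] is used
    once for the derivative and once for the function. *)
Lemma taylor2 F F1 F2 (M : BOp V) eps a b :
  (forall t, Rmin a b <= t <= Rmax a b -> rderO F t (F1 t)) ->
  (forall t, Rmin a b <= t <= Rmax a b -> rderO F1 t (F2 t)) ->
  (forall t, Rmin a b <= t <= Rmax a b -> bop_norm (minus (F2 t) M) <= eps) ->
  bop_norm (minus (minus (F b) (F a)) (plus (scal (RtoC (b - a)) (F1 a)) (scal (RtoC ((b - a) ^ 2 / 2)) M)))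
    <= eps * (b - a) ^ 2.
Proof.
  intros H1 H2 Hb.
  assert (Heps : 0 <= eps).
  { eapply Rle_trans; [|apply (Hb a)]; [apply bop_norm_ge_0|]. split; [apply Rmin_l|apply Rmax_l]. }
  set (G := fun s => plus (F s) (scal (RtoC (-1)) (plus (scal (RtoC (s - a)) (F1 a)) (scal (RtoC ((s - a) ^ 2 / 2)) M)))).
  pose proof (mean_value_ineq G (fun s => plus (F1 s) (scal (RtoC (-1)) (plus (F1 a) (scal (RtoC (s - a)) M))))
    zero (eps * Rabs (b - a)) a b) as H.
  apply Rle_trans with (bop_norm (minus (minus (G b) (G a)) (scal (RtoC (b - a)) (zero : BOp V)))).
  { right. f_equal. unfold G. apply op_ext_inner; intros u w; inner_simpl. unfold RtoC. ceq; field. }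
  replace (eps * (b - a) ^ 2) with (eps * Rabs (b - a) * Rabs (b - a)).
  2:{ pose proof (pow2_ge_0 (b - a)). rewrite Rmult_assoc, <- Rabs_mult, Rabs_pos_eq by (simpl in *; lra). ring. }
  apply H.
  - intros t Ht. unfold G. apply rderO_plus; [apply H1, Ht|].
    apply rderO_scal_const, rderO_poly2.
  - intros t Ht.
    apply Rle_trans with (bop_norm (minus (minus (F1 t) (F1 a)) (scal (RtoC (t - a)) M))).
    { right. f_equal. apply op_ext_inner; intros u w; inner_simpl. ceq. }
    assert (Hsub : forall s, Rmin a t <= s <= Rmax a t -> Rmin a b <= s <= Rmax a b).
    { intros s Hs. revert Ht Hs. unfold Rmin, Rmax.
      destruct (Rle_dec a b), (Rle_dec a t); lra. }
    eapply Rle_trans; [apply (mean_value_ineq F1 F2 M eps)|].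
    + intros s Hs. apply H2, Hsub, Hs.
    + intros s Hs. apply Hb, Hsub, Hs.
    + apply Rmult_le_compat_l; [exact Heps|]. revert Ht. unfold Rmin, Rmax, Rabs.
      destruct (Rle_dec a b), (Rcase_abs (t - a)), (Rcase_abs (b - a)); lra.
Qed.

(** Neighbourhoods are squares, so that the axis-parallel paths of the expansions stay inside
    them. *)
Definition near2 (x0 y0 : R) (P : R -> R -> Prop) : Prop :=
  exists d, 0 < d /\ forall x y, Rabs (x - x0) < d -> Rabs (y - y0) < d -> P x y.

Lemma near2_and x0 y0 P Q : near2 x0 y0 P -> near2 x0 y0 Q -> near2 x0 y0 (fun x y => P x y /\ Q x y).
Proof.
  intros [d1 [Hd1 H1]] [d2 [Hd2 H2]]. exists (Rmin d1 d2). split; [apply Rmin_pos; assumption|].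
  intros x y Hx Hy. pose proof (Rmin_l d1 d2). pose proof (Rmin_r d1 d2).
  split; [apply H1|apply H2]; lra.
Qed.

Lemma between_near a x0 d s : Rabs (a - x0) < d -> Rmin x0 a <= s <= Rmax x0 a -> Rabs (s - x0) < d.
Proof.
  unfold Rmin, Rmax, Rabs. destruct (Rle_dec x0 a), (Rcase_abs (a - x0)), (Rcase_abs (s - x0)); lra.
Qed.

Lemma first_order_2d (F Fx Fy : R -> R -> BOp V) x0 y0 :
  near2 x0 y0 (fun x y => rderO (fun s => F s y) x (Fx x y)) ->
  near2 x0 y0 (fun x y => rderO (fun s => F x s) y (Fy x y)) ->
  (forall eps, 0 < eps -> near2 x0 y0 (fun x y => bop_norm (minus (Fx x y) (Fx x0 y0)) < eps)) ->
  (forall eps, 0 < eps -> near2 x0 y0 (fun x y => bop_norm (minus (Fy x y) (Fy x0 y0)) < eps)) ->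
  forall eps, 0 < eps -> near2 x0 y0 (fun x y =>
    bop_norm (minus (minus (F x y) (F x0 y0))
      (plus (scal (RtoC (x - x0)) (Fx x0 y0)) (scal (RtoC (y - y0)) (Fy x0 y0))))
    <= eps * (Rabs (x - x0) + Rabs (y - y0))).
Proof.
  intros H1 H2 H3 H4 eps He.
  destruct (near2_and _ _ _ _ H1 (near2_and _ _ _ _ H2 (near2_and _ _ _ _ (H3 eps He) (H4 eps He))))
    as [d [Hd H]].
  exists d. split; [exact Hd|]. intros x y Hx Hy.
  assert (H0 : Rabs (y0 - y0) < d) by (rewrite Rminus_diag, Rabs_R0; exact Hd).
  assert (A1 : bop_norm (minus (minus (F x y) (F x0 y)) (scal (RtoC (x - x0)) (Fx x0 y0))) <= eps * Rabs (x - x0)).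
  { apply (mean_value_ineq (fun s => F s y) (fun s => Fx s y)).
    - intros t Ht. apply (H t y); [first [exact (between_near _ _ _ _ Hx Ht)|exact (between_near _ _ _ _ Hy Ht)]|exact Hy].
    - intros t Ht. left. apply (H t y); [first [exact (between_near _ _ _ _ Hx Ht)|exact (between_near _ _ _ _ Hy Ht)]|exact Hy]. }
  assert (A2 : bop_norm (minus (minus (F x0 y) (F x0 y0)) (scal (RtoC (y - y0)) (Fy x0 y0))) <= eps * Rabs (y - y0)).
  { apply (mean_value_ineq (fun s => F x0 s) (fun s => Fy x0 s)).
    - intros t Ht. apply (H x0 t); [rewrite Rminus_diag, Rabs_R0; exact Hd|first [exact (between_near _ _ _ _ Hx Ht)|exact (between_near _ _ _ _ Hy Ht)]].
    - intros t Ht. left. apply (H x0 t); [rewrite Rminus_diag, Rabs_R0; exact Hd|first [exact (between_near _ _ _ _ Hx Ht)|exact (between_near _ _ _ _ Hy Ht)]]. }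
  eapply Rle_trans; [|rewrite Rmult_plus_distr_l; apply Rplus_le_compat; [exact A1|exact A2]].
  eapply Rle_trans; [|apply bop_norm_triangle]. right. f_equal. op_ring.
Qed.

(** The path runs from (x0, y0) to (x, y0) and then to (x, y), with a Taylor expansion on each leg.
    The mixed term appears when Fy is moved from (x, y0) back to (x0, y0). *)
Lemma second_order_2d (F Fx Fy Fxx Fxy Fyy : R -> R -> BOp V) x0 y0 :
  near2 x0 y0 (fun x y => rderO (fun s => F s y) x (Fx x y)) ->
  near2 x0 y0 (fun x y => rderO (fun s => Fx s y) x (Fxx x y)) ->
  near2 x0 y0 (fun x y => rderO (fun s => F x s) y (Fy x y)) ->
  near2 x0 y0 (fun x y => rderO (fun s => Fy x s) y (Fyy x y)) ->
  near2 x0 y0 (fun x y => rderO (fun s => Fy s y) x (Fxy x y)) ->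
  (forall eps, 0 < eps -> near2 x0 y0 (fun x y => bop_norm (minus (Fxx x y) (Fxx x0 y0)) < eps)) ->
  (forall eps, 0 < eps -> near2 x0 y0 (fun x y => bop_norm (minus (Fyy x y) (Fyy x0 y0)) < eps)) ->
  (forall eps, 0 < eps -> near2 x0 y0 (fun x y => bop_norm (minus (Fxy x y) (Fxy x0 y0)) < eps)) ->
  forall eps, 0 < eps -> near2 x0 y0 (fun x y =>
    bop_norm (minus (minus (F x y) (F x0 y0))
      (plus (plus (scal (RtoC (x - x0)) (Fx x0 y0)) (scal (RtoC (y - y0)) (Fy x0 y0)))
        (plus (plus (scal (RtoC ((x - x0) ^ 2 / 2)) (Fxx x0 y0)) (scal (RtoC ((y - y0) ^ 2 / 2)) (Fyy x0 y0)))
          (scal (RtoC ((x - x0) * (y - y0))) (Fxy x0 y0)))))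
    <= eps * (Rabs (x - x0) + Rabs (y - y0)) ^ 2).
Proof.
  intros H1 H2 H3 H4 H5 H6 H7 H8 eps He.
  destruct (near2_and _ _ _ _ H1 (near2_and _ _ _ _ H2 (near2_and _ _ _ _ H3 (near2_and _ _ _ _ H4
    (near2_and _ _ _ _ H5 (near2_and _ _ _ _ (H6 eps He) (near2_and _ _ _ _ (H7 eps He) (H8 eps He))))))))
    as [d [Hd H]].
  exists d. split; [exact Hd|]. intros x y Hx Hy.
  assert (H0 : Rabs (y0 - y0) < d) by (rewrite Rminus_diag, Rabs_R0; exact Hd).
  assert (A1 : bop_norm (minus (minus (F x y) (F x y0)) (plus (scal (RtoC (y - y0)) (Fy x y0))
    (scal (RtoC ((y - y0) ^ 2 / 2)) (Fyy x0 y0)))) <= eps * (y - y0) ^ 2).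
  { apply (taylor2 (fun s => F x s) (fun s => Fy x s) (fun s => Fyy x s)).
    - intros t Ht. apply (H x t); [exact Hx|first [exact (between_near _ _ _ _ Hx Ht)|exact (between_near _ _ _ _ Hy Ht)]].
    - intros t Ht. apply (H x t); [exact Hx|first [exact (between_near _ _ _ _ Hx Ht)|exact (between_near _ _ _ _ Hy Ht)]].
    - intros t Ht. left. apply (H x t); [exact Hx|first [exact (between_near _ _ _ _ Hx Ht)|exact (between_near _ _ _ _ Hy Ht)]]. }
  assert (A2 : bop_norm (minus (minus (F x y0) (F x0 y0)) (plus (scal (RtoC (x - x0)) (Fx x0 y0))
    (scal (RtoC ((x - x0) ^ 2 / 2)) (Fxx x0 y0)))) <= eps * (x - x0) ^ 2).
  { apply (taylor2 (fun s => F s y0) (fun s => Fx s y0) (fun s => Fxx s y0)).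
    - intros t Ht. apply (H t y0); [first [exact (between_near _ _ _ _ Hx Ht)|exact (between_near _ _ _ _ Hy Ht)]|exact H0].
    - intros t Ht. apply (H t y0); [first [exact (between_near _ _ _ _ Hx Ht)|exact (between_near _ _ _ _ Hy Ht)]|exact H0].
    - intros t Ht. left. apply (H t y0); [first [exact (between_near _ _ _ _ Hx Ht)|exact (between_near _ _ _ _ Hy Ht)]|exact H0]. }
  assert (A3 : bop_norm (minus (minus (Fy x y0) (Fy x0 y0)) (scal (RtoC (x - x0)) (Fxy x0 y0))) <= eps * Rabs (x - x0)).
  { apply (mean_value_ineq (fun s => Fy s y0) (fun s => Fxy s y0)).
    - intros t Ht. apply (H t y0); [first [exact (between_near _ _ _ _ Hx Ht)|exact (between_near _ _ _ _ Hy Ht)]|exact H0].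
    - intros t Ht. left. apply (H t y0); [first [exact (between_near _ _ _ _ Hx Ht)|exact (between_near _ _ _ _ Hy Ht)]|exact H0]. }
  set (R1 := minus (minus (F x y) (F x y0)) (plus (scal (RtoC (y - y0)) (Fy x y0))
    (scal (RtoC ((y - y0) ^ 2 / 2)) (Fyy x0 y0)))) in *.
  set (R2 := minus (minus (F x y0) (F x0 y0)) (plus (scal (RtoC (x - x0)) (Fx x0 y0))
    (scal (RtoC ((x - x0) ^ 2 / 2)) (Fxx x0 y0)))) in *.
  set (R3 := minus (minus (Fy x y0) (Fy x0 y0)) (scal (RtoC (x - x0)) (Fxy x0 y0))) in *.
  apply Rle_trans with (bop_norm (plus (plus R1 R2) (scal (RtoC (y - y0)) R3))).
  { right. f_equal. unfold R1, R2, R3. apply op_ext_inner; intros u w; inner_simpl.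
    rewrite (RtoC_mult (x - x0)). ring. }
  eapply Rle_trans; [apply bop_norm_triangle|].
  eapply Rle_trans; [apply Rplus_le_compat; [apply bop_norm_triangle|apply bop_norm_scal]|].
  rewrite Cmod_R.
  assert (Rabs (y - y0) * bop_norm R3 <= Rabs (y - y0) * (eps * Rabs (x - x0)))
    by (apply Rmult_le_compat_l; [apply Rabs_pos|exact A3]).
  rewrite <- (pow2_abs (x - x0)) in A2. rewrite <- (pow2_abs (y - y0)) in A1.
  pose proof (Rabs_pos (x - x0)). pose proof (Rabs_pos (y - y0)).
  assert (0 <= eps * (Rabs (x - x0) * Rabs (y - y0))).
  { apply Rmult_le_pos; [lra|]. apply Rmult_le_pos; assumption. }
  simpl in *. lra.
Qed.

(** The expansions along the two orders of the axes agree at (x0 + s, y0 + s) except for s^2 Fxy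
    against s^2 Fyx. With tolerance eps / 8 each remainder is at most eps s^2 / 2. *)
Lemma mixed_partials_eq (F Fx Fy Fxx Fxy Fyx Fyy : R -> R -> BOp V) x0 y0 :
  near2 x0 y0 (fun x y => rderO (fun s => F s y) x (Fx x y)) ->
  near2 x0 y0 (fun x y => rderO (fun s => Fx s y) x (Fxx x y)) ->
  near2 x0 y0 (fun x y => rderO (fun s => F x s) y (Fy x y)) ->
  near2 x0 y0 (fun x y => rderO (fun s => Fy x s) y (Fyy x y)) ->
  near2 x0 y0 (fun x y => rderO (fun s => Fy s y) x (Fxy x y)) ->
  near2 x0 y0 (fun x y => rderO (fun s => Fx x s) y (Fyx x y)) ->
  (forall eps, 0 < eps -> near2 x0 y0 (fun x y => bop_norm (minus (Fxx x y) (Fxx x0 y0)) < eps)) ->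
  (forall eps, 0 < eps -> near2 x0 y0 (fun x y => bop_norm (minus (Fyy x y) (Fyy x0 y0)) < eps)) ->
  (forall eps, 0 < eps -> near2 x0 y0 (fun x y => bop_norm (minus (Fxy x y) (Fxy x0 y0)) < eps)) ->
  (forall eps, 0 < eps -> near2 x0 y0 (fun x y => bop_norm (minus (Fyx x y) (Fyx x0 y0)) < eps)) ->
  Fxy x0 y0 = Fyx x0 y0.
Proof.
  intros H1 H2 H3 H4 H5 H5' H6 H7 H8 H8'.
  assert (Hsw : forall P, near2 x0 y0 P -> near2 y0 x0 (fun y x => P x y)).
  { intros P [d [Hd H]]. exists d. split; [exact Hd|]. auto. }
  assert (E : minus (Fxy x0 y0) (Fyx x0 y0) = (zero : BOp V)).
  { apply bop_norm_eq_0. apply Rle_antisym; [|apply bop_norm_ge_0].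
    apply le_epsilon. intros eps He. rewrite Rplus_0_l.
    destruct (second_order_2d F Fx Fy Fxx Fxy Fyy x0 y0 H1 H2 H3 H4 H5 H6 H7 H8 (eps / 8)) as [d1 [Hd1 A]]; [lra|].
    destruct (second_order_2d (fun y x => F x y) (fun y x => Fy x y) (fun y x => Fx x y)
      (fun y x => Fyy x y) (fun y x => Fyx x y) (fun y x => Fxx x y) y0 x0
      (Hsw _ H3) (Hsw _ H4) (Hsw _ H1) (Hsw _ H2) (Hsw _ H5')
      (fun e He => Hsw _ (H7 e He)) (fun e He => Hsw _ (H6 e He)) (fun e He => Hsw _ (H8' e He)) (eps / 8))
      as [d2 [Hd2 B]]; [lra|].
    set (s := Rmin d1 d2 / 2).
    assert (Hs : 0 < s /\ s < d1 /\ s < d2).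
    { unfold s. pose proof (Rmin_l d1 d2). pose proof (Rmin_r d1 d2).
      assert (0 < Rmin d1 d2) by (apply Rmin_pos; assumption). lra. }
    assert (Es : forall c, c + s - c = s) by (intros; ring).
    assert (Ea : Rabs s = s) by (apply Rabs_pos_eq; lra).
    specialize (A (x0 + s) (y0 + s)). specialize (B (y0 + s) (x0 + s)).
    rewrite !Es, Ea in A, B. specialize (A ltac:(lra) ltac:(lra)). specialize (B ltac:(lra) ltac:(lra)).
    match type of A with bop_norm ?X <= _ => set (R1 := X) in * end.
    match type of B with bop_norm ?X <= _ => set (R2 := X) in * end.
    assert (Hd : bop_norm (scal (RtoC (s * s)) (minus (Fxy x0 y0) (Fyx x0 y0))) <= eps * s ^ 2).
    { apply Rle_trans with (bop_norm (minus R2 R1)).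
      - right. f_equal. unfold R1, R2. op_ring.
      - eapply Rle_trans; [apply bop_norm_minus_le|]. simpl in *. lra. }
    assert (E2 : bop_norm (minus (Fxy x0 y0) (Fyx x0 y0)) <= / (s * s) * bop_norm (scal (RtoC (s * s)) (minus (Fxy x0 y0) (Fyx x0 y0)))).
    { assert (Hss : 0 < s * s) by (apply Rmult_lt_0_compat; lra).
      apply Rle_trans with (bop_norm (scal (RtoC (/ (s * s))) (scal (RtoC (s * s)) (minus (Fxy x0 y0) (Fyx x0 y0))))).
      - right. f_equal. apply op_ext_inner; intros u w; inner_simpl.
        unfold RtoC. ceq; field; lra.
      - eapply Rle_trans; [apply bop_norm_scal|]. rewrite Cmod_R, Rabs_pos_eq; [lra|].
        left. apply Rinv_0_lt_compat, Hss. }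
    eapply Rle_trans; [exact E2|].
    apply Rle_trans with (/ (s * s) * (eps * s ^ 2)).
    - apply Rmult_le_compat_l; [|exact Hd]. left. apply Rinv_0_lt_compat, Rmult_lt_0_compat; lra.
    - right. field. lra. }
  apply op_ext_inner. intros u w. apply (f_equal (fun A : BOp V => inner (A u) w)) in E.
  inner_simpl_in E. replace (inner (Fxy x0 y0 u) w) with (inner (Fxy x0 y0 u) w - inner (Fyx x0 y0 u) w + inner (Fyx x0 y0 u) w)%C by ring.
  rewrite E. ring.
Qed.

End RealDerivative.

(** * Partial and Wirtinger derivatives *)

Section Partial.
Context {V : HilbertSpace}.
Implicit Types F P : C -> BOp V.

Lemma is_dx_iff F z L : is_dx F z L <-> rderO (fun t => F (t, snd z)) (fst z) L.
Proof. apply is_derive_rderO. Qed.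

Lemma is_dy_iff F z L : is_dy F z L <-> rderO (fun t => F (fst z, t)) (snd z) L.
Proof. apply is_derive_rderO. Qed.

Lemma dx_unique F z L : is_dx F z L -> dx F z = L.
Proof.
  intros H. apply (iota_unique (V := BOp_CompleteNormedModule) (is_dx F z)); [|exact H].
  intros M HM. apply is_dx_iff in H, HM. eapply rderO_unique; eassumption.
Qed.

Lemma dy_unique F z L : is_dy F z L -> dy F z = L.
Proof.
  intros H. apply (iota_unique (V := BOp_CompleteNormedModule) (is_dy F z)); [|exact H].
  intros M HM. apply is_dy_iff in H, HM. eapply rderO_unique; eassumption.
Qed.

Variable Omega : C -> Prop.
Hypothesis Omega_open : open Omega.

Lemma open_nbhd z : Omega z -> exists d, 0 < d /\ forall w, Cmod (w - z) < d -> Omega w.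
Proof.
  intros Hz. pose proof (Omega_open z Hz) as H.
  apply (proj1 (locally_C z Omega)) in H. destruct H as [d Hd].
  exists d. split; [apply cond_pos|]. intros w Hw. apply (Hd w Hw).
Qed.

Lemma near2_of_nbhd z (Q : C -> Prop) :
  (exists d, 0 < d /\ forall w, Cmod (w - z) < d -> Q w) -> near2 (fst z) (snd z) (fun x y => Q (x, y)).
Proof.
  intros [d [Hd H]]. exists (d / 2). split; [lra|]. intros x y Hx Hy. apply H.
  eapply Rle_lt_trans; [apply Cmod_le_abs|]. simpl.
  change (x + - fst z) with (x - fst z). change (y + - snd z) with (y - snd z). lra.
Qed.

Lemma nbhd_of_near2 z (Q : C -> Prop) :
  near2 (fst z) (snd z) (fun x y => Q (x, y)) -> exists d, 0 < d /\ forall w, Cmod (w - z) < d -> Q w.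
Proof.
  intros [d [Hd H]]. exists d. split; [exact Hd|]. intros [x y] Hw. apply H.
  - eapply Rle_lt_trans; [|exact Hw]. exact (re_le_Cmod ((x, y) - z)).
  - eapply Rle_lt_trans; [|exact Hw]. exact (im_le_Cmod ((x, y) - z)).
Qed.

Lemma near2_cont F z : continuous_on Omega F -> Omega z -> forall eps, 0 < eps ->
  near2 (fst z) (snd z) (fun x y => bop_norm (minus (F (x, y)) (F (fst z, snd z))) < eps).
Proof.
  intros HF Hz eps He. apply contO_on_iff in HF.
  rewrite <- surjective_pairing.
  apply (near2_of_nbhd z (fun w => bop_norm (minus (F w) (F z)) < eps)).
  destruct (HF z Hz eps He) as [d1 [Hd1 H1]]. destruct (open_nbhd z Hz) as [d2 [Hd2 H2]].
  exists (Rmin d1 d2). split; [apply Rmin_pos; assumption|]. intros w Hw.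
  pose proof (Rmin_l d1 d2). pose proof (Rmin_r d1 d2). apply H1; [apply H2; lra|lra].
Qed.

Lemma dx_spec F z : C1_op Omega F -> Omega z -> rderO (fun t => F (t, snd z)) (fst z) (dx F z).
Proof.
  intros [H _] Hz. destruct (H z Hz) as [[L HL] _].
  rewrite (dx_unique F z L HL). apply is_dx_iff, HL.
Qed.

Lemma dy_spec F z : C1_op Omega F -> Omega z -> rderO (fun t => F (fst z, t)) (snd z) (dy F z).
Proof.
  intros [H _] Hz. destruct (H z Hz) as [_ [L HL]].
  rewrite (dy_unique F z L HL). apply is_dy_iff, HL.
Qed.

Lemma near2_dx F z : C1_op Omega F -> Omega z ->
  near2 (fst z) (snd z) (fun x y => rderO (fun s => F (s, y)) x (dx F (x, y))).
Proof.
  intros HF Hz. apply (near2_of_nbhd z (fun w => rderO (fun s => F (s, snd w)) (fst w) (dx F (fst w, snd w)))).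
  destruct (open_nbhd z Hz) as [d [Hd H]]. exists d. split; [exact Hd|].
  intros w Hw. rewrite <- surjective_pairing. apply dx_spec; auto.
Qed.

Lemma near2_dy F z : C1_op Omega F -> Omega z ->
  near2 (fst z) (snd z) (fun x y => rderO (fun s => F (x, s)) y (dy F (x, y))).
Proof.
  intros HF Hz. apply (near2_of_nbhd z (fun w => rderO (fun s => F (fst w, s)) (snd w) (dy F (fst w, snd w)))).
  destruct (open_nbhd z Hz) as [d [Hd H]]. exists d. split; [exact Hd|].
  intros w Hw. rewrite <- surjective_pairing. apply dy_spec; auto.
Qed.

Lemma first_order_real F z : C1_op Omega F -> Omega z -> forall eps, 0 < eps ->
  exists d, 0 < d /\ forall w, Cmod (w - z) < d ->
  bop_norm (minus (minus (F w) (F z))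
    (plus (scal (RtoC (fst w - fst z)) (dx F z)) (scal (RtoC (snd w - snd z)) (dy F z))))
  <= eps * (Rabs (fst w - fst z) + Rabs (snd w - snd z)).
Proof.
  intros HF Hz eps He.
  pose proof (first_order_2d (fun x y => F (x, y)) (fun x y => dx F (x, y)) (fun x y => dy F (x, y))
    (fst z) (snd z) (near2_dx F z HF Hz) (near2_dy F z HF Hz)
    (near2_cont (dx F) z (proj1 (proj2 HF)) Hz) (near2_cont (dy F) z (proj2 (proj2 HF)) Hz) eps He) as H.
  apply (nbhd_of_near2 z (fun w => bop_norm (minus (minus (F (fst w, snd w)) (F (fst z, snd z)))
    (plus (scal (RtoC (fst w - fst z)) (dx F (fst z, snd z))) (scal (RtoC (snd w - snd z)) (dy F (fst z, snd z)))))
  <= eps * (Rabs (fst w - fst z) + Rabs (snd w - snd z)))) in H.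
  destruct H as [d [Hd H]]. exists d. split; [exact Hd|]. intros w Hw. specialize (H w Hw).
  rewrite <- !surjective_pairing in H. exact H.
Qed.

Lemma abs_sum_le_Cmod (w : C) : Rabs (fst w) + Rabs (snd w) <= 2 * Cmod w.
Proof.
  pose proof (re_le_Cmod w) as H1. pose proof (im_le_Cmod w) as H2. unfold Re in H1; unfold Im in H2. lra.
Qed.

Lemma first_order_complex F z : C1_op Omega F -> Omega z -> forall eps, 0 < eps ->
  exists d, 0 < d /\ forall w, Cmod (w - z) < d ->
  bop_norm (minus (minus (F w) (F z))
    (plus (scal (w - z)%C (d_z F z)) (scal (Cconj (w - z)%C) (d_zbar F z))))
  <= eps * Cmod (w - z).
Proof.
  intros HF Hz eps He. destruct (first_order_real F z HF Hz (eps / 2)) as [d [Hd H]]; [lra|].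
  exists d. split; [exact Hd|]. intros w Hw. specialize (H w Hw).
  eapply Rle_trans; [|eapply Rle_trans; [exact H|]].
  - right. f_equal. unfold d_z, d_zbar. apply op_ext_inner; intros u v; inner_simpl.
    unfold RtoC. ceq; field.
  - pose proof (abs_sum_le_Cmod (w - z)) as Ha. simpl in Ha.
    change (fst w + - fst z) with (fst w - fst z) in Ha. change (snd w + - snd z) with (snd w - snd z) in Ha.
    apply Rle_trans with (eps / 2 * (2 * Cmod (w - z))); [|right; field].
    apply Rmult_le_compat_l; lra.
Qed.

Lemma dx_d_z P z : C2_op Omega P -> Omega z ->
  dx (d_z P) z = scal (RtoC (1 / 2)) (minus (dx (dx P) z) (scal Ci (dx (dy P) z))).
Proof.
  intros [_ [H2 H3]] Hz. apply dx_unique, is_dx_iff. unfold d_z.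
  apply rderO_scal_const.
  pose proof (rderO_plus _ _ _ _ _ (dx_spec (dx P) z H2 Hz)
    (rderO_scal_const (- Ci)%C _ _ _ (dx_spec (dy P) z H3 Hz))) as H.
  replace (minus (dx (dx P) z) (scal Ci (dx (dy P) z))) with
    (plus (dx (dx P) z) (scal (- Ci)%C (dx (dy P) z))) by op_ring.
  replace (fun s => minus (dx P (s, snd z)) (scal Ci (dy P (s, snd z)))) with
    (fun s => plus (dx P (s, snd z)) (scal (- Ci)%C (dy P (s, snd z)))); [exact H|].
  apply functional_extensionality. intros s. op_ring.
Qed.

Lemma dy_d_z P z : C2_op Omega P -> Omega z ->
  dy (d_z P) z = scal (RtoC (1 / 2)) (minus (dy (dx P) z) (scal Ci (dy (dy P) z))).
Proof.
  intros [_ [H2 H3]] Hz. apply dy_unique, is_dy_iff. unfold d_z.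
  apply rderO_scal_const.
  pose proof (rderO_plus _ _ _ _ _ (dy_spec (dx P) z H2 Hz)
    (rderO_scal_const (- Ci)%C _ _ _ (dy_spec (dy P) z H3 Hz))) as H.
  replace (minus (dy (dx P) z) (scal Ci (dy (dy P) z))) with
    (plus (dy (dx P) z) (scal (- Ci)%C (dy (dy P) z))) by op_ring.
  replace (fun s => minus (dx P (fst z, s)) (scal Ci (dy P (fst z, s)))) with
    (fun s => plus (dx P (fst z, s)) (scal (- Ci)%C (dy P (fst z, s)))); [exact H|].
  apply functional_extensionality. intros s. op_ring.
Qed.

Lemma dx_dy_comm P z : C2_op Omega P -> Omega z -> dx (dy P) z = dy (dx P) z.
Proof.
  intros [H1 [H2 H3]] Hz.
  pose proof (mixed_partials_eq (fun x y => P (x, y)) (fun x y => dx P (x, y)) (fun x y => dy P (x, y))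
    (fun x y => dx (dx P) (x, y)) (fun x y => dx (dy P) (x, y)) (fun x y => dy (dx P) (x, y))
    (fun x y => dy (dy P) (x, y)) (fst z) (snd z)) as H. cbv beta in H.
  rewrite <- !surjective_pairing in H. apply H.
  - apply near2_dx; assumption.
  - apply (near2_dx (dx P)); assumption.
  - apply near2_dy; assumption.
  - apply (near2_dy (dy P)); assumption.
  - apply (near2_dx (dy P)); assumption.
  - apply (near2_dy (dx P)); assumption.
  - intros eps He. pose proof (near2_cont (dx (dx P)) z (proj1 (proj2 H2)) Hz eps He) as K.
    rewrite <- surjective_pairing in K. exact K.
  - intros eps He. pose proof (near2_cont (dy (dy P)) z (proj2 (proj2 H3)) Hz eps He) as K.
    rewrite <- surjective_pairing in K. exact K.
  - intros eps He. pose proof (near2_cont (dx (dy P)) z (proj1 (proj2 H3)) Hz eps He) as K.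
    rewrite <- surjective_pairing in K. exact K.
  - intros eps He. pose proof (near2_cont (dy (dx P)) z (proj2 (proj2 H2)) Hz eps He) as K.
    rewrite <- surjective_pairing in K. exact K.
Qed.

Lemma d_zbar_d_z P z : C2_op Omega P -> Omega z ->
  d_zbar (d_z P) z = scal (RtoC (1 / 4)) (plus (dx (dx P) z) (dy (dy P) z)).
Proof.
  intros HP Hz. unfold d_zbar. rewrite dx_d_z, dy_d_z, dx_dy_comm by assumption.
  apply op_ext_inner; intros u w; inner_simpl. unfold RtoC. ceq; field.
Qed.

(** The coefficients of the square of w - z and of its conjugate stay existential: even paired with
    affine holomorphic fields they never reach frequency 0, so they disappear from all circle
    averages. *)
Lemma second_order_complex P z : C2_op Omega P -> Omega z -> exists S S' : BOp V,
  forall eps, 0 < eps -> exists d, 0 < d /\ forall w, Cmod (w - z) < d ->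
  bop_norm (minus (P w) (plus (plus (P z)
    (plus (scal (w - z)%C (d_z P z)) (scal (Cconj (w - z)%C) (d_zbar P z))))
    (plus (plus (scal ((w - z) * (w - z))%C S) (scal (Cconj (w - z) * Cconj (w - z))%C S'))
      (scal ((w - z) * Cconj (w - z))%C (d_zbar (d_z P) z)))))
  <= eps * Cmod (w - z) ^ 2.
Proof.
  intros HP Hz. rewrite (d_zbar_d_z P z HP Hz). destruct HP as [H1 [H2 H3]].
  exists (plus (scal (RtoC (1/8)) (minus (dx (dx P) z) (dy (dy P) z))) (scal (RtoC (- (1/4)) * Ci)%C (dx (dy P) z))).
  exists (plus (scal (RtoC (1/8)) (minus (dx (dx P) z) (dy (dy P) z))) (scal (RtoC (1/4) * Ci)%C (dx (dy P) z))).
  intros eps He.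
  pose proof (second_order_2d (fun x y => P (x, y)) (fun x y => dx P (x, y)) (fun x y => dy P (x, y))
    (fun x y => dx (dx P) (x, y)) (fun x y => dx (dy P) (x, y))
    (fun x y => dy (dy P) (x, y)) (fst z) (snd z)
    (near2_dx P z H1 Hz) (near2_dx (dx P) z H2 Hz) (near2_dy P z H1 Hz) (near2_dy (dy P) z H3 Hz)
    (near2_dx (dy P) z H3 Hz)
    (near2_cont (dx (dx P)) z (proj1 (proj2 H2)) Hz) (near2_cont (dy (dy P)) z (proj2 (proj2 H3)) Hz)
    (near2_cont (dx (dy P)) z (proj1 (proj2 H3)) Hz) (eps / 4) ltac:(lra)) as [d [Hd H]].
  exists d. split; [exact Hd|]. intros w Hw. rewrite <- !surjective_pairing in H.
  specialize (H (fst w) (snd w)). rewrite <- surjective_pairing in H.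
  eapply Rle_trans; [|eapply Rle_trans; [apply H|]].
  - right. f_equal. unfold d_z, d_zbar. apply op_ext_inner; intros u v; inner_simpl.
    unfold RtoC. ceq; field.
  - eapply Rle_lt_trans; [|exact Hw]. exact (re_le_Cmod (w - z)).
  - eapply Rle_lt_trans; [|exact Hw]. exact (im_le_Cmod (w - z)).
  - pose proof (abs_sum_le_Cmod (w - z)) as Ha. simpl in Ha.
    change (fst w + - fst z) with (fst w - fst z) in Ha. change (snd w + - snd z) with (snd w - snd z) in Ha.
    assert (Hsq : (Rabs (fst w - fst z) + Rabs (snd w - snd z)) ^ 2 <= (2 * Cmod (w - z)) ^ 2).
    { apply pow_incr. split; [|exact Ha].
      pose proof (Rabs_pos (fst w - fst z)). pose proof (Rabs_pos (snd w - snd z)). lra. }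
    apply Rle_trans with (eps / 4 * (2 * Cmod (w - z)) ^ 2); [|right; field].
    apply Rmult_le_compat_l; lra.
Qed.

Lemma rderO_adj (F : R -> BOp V) t L : rderO F t L -> rderO (fun s => adj (F s)) t (adj L).
Proof.
  intros HF eps He. destruct (HF eps He) as [d [Hd H]]. exists d. split; [exact Hd|].
  intros s Hs. eapply Rle_trans; [|apply (H s Hs)].
  eapply Rle_trans; [|apply bop_norm_adj_le]. right. f_equal.
  apply op_ext_inner; intros u v; inner_simpl. rewrite !inner_adj_l. inner_simpl.
  unfold RtoC; ceq.
Qed.

Lemma adj_dx F z : C1_op Omega F -> (forall w, Omega w -> adj (F w) = F w) -> Omega z ->
  adj (dx F z) = dx F z.
Proof.
  intros HF Hs Hz. symmetry. pose proof (dx_spec F z HF Hz) as H.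
  apply (rderO_unique _ _ _ _ H). pose proof (rderO_adj _ _ _ H) as H'.
  destruct (open_nbhd z Hz) as [d1 [Hd1 HO]].
  intros eps He. destruct (H' eps He) as [d2 [Hd2 H2]].
  exists (Rmin d1 d2). split; [apply Rmin_pos; assumption|]. intros s Hsd.
  pose proof (Rmin_l d1 d2). pose proof (Rmin_r d1 d2).
  specialize (H2 s ltac:(lra)). rewrite !Hs in H2; [exact H2|rewrite <- surjective_pairing; exact Hz|].
  apply HO. eapply Rle_lt_trans; [apply Cmod_le_abs|]. simpl.
  replace (snd z + - snd z) with 0 by ring. rewrite Rabs_R0, Rplus_0_r.
  change (s + - fst z) with (s - fst z). lra.
Qed.

Lemma adj_dy F z : C1_op Omega F -> (forall w, Omega w -> adj (F w) = F w) -> Omega z ->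
  adj (dy F z) = dy F z.
Proof.
  intros HF Hs Hz. symmetry. pose proof (dy_spec F z HF Hz) as H.
  apply (rderO_unique _ _ _ _ H). pose proof (rderO_adj _ _ _ H) as H'.
  destruct (open_nbhd z Hz) as [d1 [Hd1 HO]].
  intros eps He. destruct (H' eps He) as [d2 [Hd2 H2]].
  exists (Rmin d1 d2). split; [apply Rmin_pos; assumption|]. intros s Hsd.
  pose proof (Rmin_l d1 d2). pose proof (Rmin_r d1 d2).
  specialize (H2 s ltac:(lra)). rewrite !Hs in H2; [exact H2|rewrite <- surjective_pairing; exact Hz|].
  apply HO. eapply Rle_lt_trans; [apply Cmod_le_abs|]. simpl.
  replace (fst z + - fst z) with 0 by ring. rewrite Rabs_R0, Rplus_0_l.
  change (s + - snd z) with (s - snd z). lra.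
Qed.

Lemma cos_lip a b : Rabs (cos a - cos b) <= Rabs (a - b).
Proof.
  rewrite <- (Rmult_1_l (Rabs (a - b))).
  apply (bounded_variation cos (fun t => - sin t)). intros t _. split; [apply is_derive_cos|].
  rewrite Rabs_Ropp. apply Rabs_le. apply SIN_bound.
Qed.

Lemma sin_lip a b : Rabs (sin a - sin b) <= Rabs (a - b).
Proof.
  rewrite <- (Rmult_1_l (Rabs (a - b))).
  apply (bounded_variation sin cos). intros t _. split; [apply is_derive_sin|].
  apply Rabs_le. apply COS_bound.
Qed.

Lemma is_derive_eps (f : R -> R) t l : is_derive f t l -> forall eps, 0 < eps ->
  exists d, 0 < d /\ forall s, Rabs (s - t) < d -> Rabs (f s - f t - l * (s - t)) <= eps * Rabs (s - t).
Proof.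
  intros [_ H] eps He. specialize (H t (fun Q HQ => HQ) (mkposreal eps He)).
  destruct H as [d Hd]. exists d. split; [apply cond_pos|]. intros s Hs. specialize (Hd s Hs).
  unfold norm, minus, plus, opp, scal in Hd; simpl in Hd; unfold abs, mult in Hd; simpl in Hd.
  replace (f s - f t - l * (s - t)) with (f s + - f t + - ((s + - t) * l)) by ring. exact Hd.
Qed.

Lemma rderO_circle F z0 r t : 0 < r -> C1_op Omega F -> Omega (circle z0 r t) ->
  rderO (fun s => F (circle z0 r s)) t
    (plus (scal (RtoC (- r * sin t)) (dx F (circle z0 r t))) (scal (RtoC (r * cos t)) (dy F (circle z0 r t)))).
Proof.
  intros Hr HF Hz eps He. set (z := circle z0 r t) in *.
  set (N := bop_norm (dx F z) + bop_norm (dy F z) + 1).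
  pose proof (bop_norm_ge_0 (dx F z)) as N1. pose proof (bop_norm_ge_0 (dy F z)) as N2.
  assert (HN : 0 < N) by (unfold N; lra).
  assert (HrN : 0 < r * N) by (apply Rmult_lt_0_compat; lra).
  assert (He1 : 0 < eps / (4 * r)) by (apply Rdiv_lt_0_compat; lra).
  assert (He2 : 0 < eps / (4 * (r * N))) by (apply Rdiv_lt_0_compat; lra).
  destruct (first_order_real F z HF Hz _ He1) as [d1 [Hd1 H1]].
  destruct (is_derive_eps cos t _ (is_derive_cos t) _ He2) as [d2 [Hd2 H2]].
  destruct (is_derive_eps sin t _ (is_derive_sin t) _ He2) as [d3 [Hd3 H3]].
  exists (Rmin (d1 / (2 * r)) (Rmin d2 d3)).
  split; [repeat apply Rmin_pos; try assumption; apply Rdiv_lt_0_compat; lra|].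
  intros s Hs. pose proof (Rmin_l (d1 / (2 * r)) (Rmin d2 d3)) as M1. pose proof (Rmin_r (d1 / (2 * r)) (Rmin d2 d3)) as M2.
  pose proof (Rmin_l d2 d3) as M3. pose proof (Rmin_r d2 d3) as M4.
  specialize (H2 s ltac:(lra)). specialize (H3 s ltac:(lra)).
  set (w := circle z0 r s) in *. set (a := Rabs (s - t)) in *.
  assert (Ha : 0 <= a) by apply Rabs_pos.
  assert (Ex : fst w - fst z = r * (cos s - cos t)) by (unfold w, z, circle; simpl; ring).
  assert (Ey : snd w - snd z = r * (sin s - sin t)) by (unfold w, z, circle; simpl; ring).
  assert (Bx : Rabs (fst w - fst z) <= r * a).
  { rewrite Ex, Rabs_mult, (Rabs_pos_eq r) by lra. apply Rmult_le_compat_l; [lra|apply cos_lip]. }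
  assert (By : Rabs (snd w - snd z) <= r * a).
  { rewrite Ey, Rabs_mult, (Rabs_pos_eq r) by lra. apply Rmult_le_compat_l; [lra|apply sin_lip]. }
  assert (Hw : Cmod (w - z) < d1).
  { apply Rle_lt_trans with (Rabs (fst w - fst z) + Rabs (snd w - snd z)); [exact (Cmod_le_abs (w - z))|].
    assert (2 * r * a < d1); [|lra].
    replace d1 with (2 * r * (d1 / (2 * r))) by (field; lra). apply Rmult_lt_compat_l; lra. }
  specialize (H1 w Hw).
  set (R1 := minus (minus (F w) (F z)) (plus (scal (RtoC (fst w - fst z)) (dx F z)) (scal (RtoC (snd w - snd z)) (dy F z)))) in *.
  set (c1 := fst w - fst z + r * sin t * (s - t)). set (c2 := snd w - snd z - r * cos t * (s - t)).
  apply Rle_trans with (bop_norm (plus R1 (plus (scal (RtoC c1) (dx F z)) (scal (RtoC c2) (dy F z))))).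
  { right. f_equal. unfold R1, c1, c2. apply op_ext_inner; intros u v; inner_simpl. unfold RtoC. ceq. }
  eapply Rle_trans; [apply bop_norm_triangle|].
  eapply Rle_trans; [apply Rplus_le_compat_l; eapply Rle_trans; [apply bop_norm_triangle|];
    apply Rplus_le_compat; apply bop_norm_scal|].
  rewrite !Cmod_R.
  assert (A1 : bop_norm R1 <= eps / 2 * a).
  { eapply Rle_trans; [exact H1|]. apply Rle_trans with (eps / (4 * r) * (2 * (r * a))).
    - apply Rmult_le_compat_l; lra.
    - right; field; lra. }
  assert (A2 : Rabs c1 <= r * (eps / (4 * (r * N)) * a)).
  { unfold c1. rewrite Ex. replace (r * (cos s - cos t) + r * sin t * (s - t)) with (r * (cos s - cos t - - sin t * (s - t))) by ring.
    rewrite Rabs_mult, (Rabs_pos_eq r) by lra. apply Rmult_le_compat_l; lra. }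
  assert (A3 : Rabs c2 <= r * (eps / (4 * (r * N)) * a)).
  { unfold c2. rewrite Ey. replace (r * (sin s - sin t) - r * cos t * (s - t)) with (r * (sin s - sin t - cos t * (s - t))) by ring.
    rewrite Rabs_mult, (Rabs_pos_eq r) by lra. apply Rmult_le_compat_l; lra. }
  set (q := r * (eps / (4 * (r * N)) * a)) in *.
  assert (Eq : q * N = eps / 4 * a) by (unfold q; field; lra).
  assert (Rabs c1 * bop_norm (dx F z) <= q * N).
  { apply Rmult_le_compat; [apply Rabs_pos|apply bop_norm_ge_0|exact A2|unfold N; lra]. }
  assert (Rabs c2 * bop_norm (dy F z) <= q * N).
  { apply Rmult_le_compat; [apply Rabs_pos|apply bop_norm_ge_0|exact A3|unfold N; lra]. }
  lra.
Qed.

End Partial.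

(** Frequencies up to 3 are those produced by a quadratic expansion of P paired with two affine
    fields, one of them conjugated. *)
Lemma cavg_trig a0 a1 b1 a2 b2 a3 b3 :
  cavg (fun t => a0 + a1 * ek 1 t + b1 * ek (-1) t + a2 * ek 2 t + b2 * ek (-2) t
    + a3 * ek 3 t + b3 * ek (-3) t)%C = a0.
Proof.
  rewrite !cavg_plus, cavg_const.
  2-13: auto 10 using contC_const, contC_mult, contC_ek, contC_plus.
  rewrite !cavg_scal by apply contC_ek. rewrite !cavg_ek. simpl. ring.
Qed.

Lemma rderO_cont {V : HilbertSpace} (F : R -> BOp V) t L : rderO F t L -> limO (locally t) F (F t).
Proof.
  intros H eps He. destruct (H 1 Rlt_0_1) as [d [Hd Hw]]. pose proof (bop_norm_ge_0 L) as HL.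
  assert (Hd2 : 0 < Rmin d (eps / (bop_norm L + 1))).
  { apply Rmin_pos; [exact Hd|apply Rdiv_lt_0_compat; lra]. }
  exists (mkposreal _ Hd2). intros s Hs. change (Rabs (s - t) < Rmin d (eps / (bop_norm L + 1))) in Hs.
  pose proof (Rmin_l d (eps / (bop_norm L + 1))). pose proof (Rmin_r d (eps / (bop_norm L + 1))).
  specialize (Hw s ltac:(lra)).
  pose proof (bop_norm_dist (minus (F s) (F t)) (scal (RtoC (s - t)) L)) as T1.
  pose proof (bop_norm_scal (RtoC (s - t)) L) as T2.
  change (bop_norm (scal (RtoC (s - t)) L) <= Cmod (RtoC (s - t)) * bop_norm L) in T2. rewrite Cmod_R in T2.
  apply Rle_lt_trans with ((bop_norm L + 1) * Rabs (s - t)).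
  - eapply Rle_trans; [exact T1|]. lra.
  - replace eps with ((bop_norm L + 1) * (eps / (bop_norm L + 1))) by (field; lra).
    apply Rmult_lt_compat_l; lra.
Qed.

(** * Circle averages of P on affine fields, and the curvature *)

Section Key.
Context {V : HilbertSpace}.
Variables (Omega : C -> Prop) (P : C -> BOp V).
Hypothesis Omega_open : open Omega.
Hypothesis P_C2 : C2_op Omega P.

Lemma contO_P_circle z0 r : 0 < r -> (forall t, Omega (circle z0 r t)) -> contO (fun t => P (circle z0 r t)).
Proof.
  intros Hr HO t.
  exact (rderO_cont (fun s => P (circle z0 r s)) t _
    (rderO_circle Omega Omega_open P z0 r t Hr (proj1 P_C2) (HO t))).
Qed.

Definition gfun (v k : V) (zeta : C) : V := plus v (scal zeta k).

Lemma contC_inner_gfun (F : R -> BOp V) (G : R -> BOp V) (v k v' k' : V) (a b : R -> C) : contO F -> contO G ->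
  contC a -> contC b -> contC (fun t => inner (F t (gfun v k (a t))) (G t (gfun v' k' (b t)))).
Proof.
  intros HF HG Ha Hb.
  replace (fun t => inner (F t (gfun v k (a t))) (G t (gfun v' k' (b t)))) with
    (fun t => inner (F t v) (G t v') + Cconj (b t) * inner (F t v) (G t k')
      + a t * (inner (F t k) (G t v') + Cconj (b t) * inner (F t k) (G t k')))%C.
  - auto 10 using contC_plus, contC_mult, contC_conj, contC_inner2.
  - apply functional_extensionality. intros t. unfold gfun. inner_simpl. ring.
Qed.

Lemma norm_gfun v k zeta : Cmod zeta <= 1 -> norm (gfun v k zeta) <= norm v + norm k.
Proof.
  intros Hz. unfold gfun. eapply Rle_trans; [apply vnorm_triangle|].
  rewrite norm_scal_C. pose proof (vnorm_ge_0 k). nra.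
Qed.

(** Only the frequency 0 of the second-order expansion survives the average. One half of eps pays
    for the remainder of the expansion, the other for the leftover term of order rho^4. *)
Lemma avg_second_order z v k : Omega z -> forall eps, 0 < eps -> exists d, 0 < d /\
  forall rho, 0 < rho < d ->
  Cmod (cavg (fun t => inner (P (circle z rho t) (gfun v k (circle z rho t - z)%C)) (gfun v k (circle z rho t - z)%C))
    - inner (P z v) v
    - RtoC (rho ^ 2) * (inner (P z k) k + inner (d_z P z v) k + inner (d_zbar P z k) v
        + inner (d_zbar (d_z P) z v) v))
  <= eps * rho ^ 2.
Proof.
  intros Hz eps He.
  destruct (second_order_complex Omega Omega_open P z P_C2 Hz) as [S [S' Hexp]].
  set (A := d_z P z) in *. set (B := d_zbar P z) in *. set (C2 := d_zbar (d_z P) z) in *. set (P0 := P z) in *.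
  set (M := norm v + norm k). assert (HM : 0 <= M) by (unfold M; pose proof (vnorm_ge_0 v); pose proof (vnorm_ge_0 k); lra).
  set (K := Cmod (inner (C2 k) k)). assert (HK : 0 <= K) by apply Cmod_ge_0.
  assert (He' : 0 < eps / (2 * (M ^ 2 + 1))) by (apply Rdiv_lt_0_compat; [lra|pose proof (pow2_ge_0 M); lra]).
  destruct (Hexp _ He') as [d1 [Hd1 H1]].
  destruct (open_nbhd Omega Omega_open z Hz) as [d2 [Hd2 H2]].
  assert (Hd3 : 0 < eps / (2 * (K + 1))) by (apply Rdiv_lt_0_compat; lra).
  exists (Rmin (Rmin d1 d2) (Rmin 1 (eps / (2 * (K + 1))))).
  split; [repeat apply Rmin_pos; try assumption; lra|].
  intros rho [Hrho0 Hrho].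
  assert (Hr : rho < d1 /\ rho < d2 /\ rho < 1 /\ rho < eps / (2 * (K + 1))).
  { pose proof (Rmin_l (Rmin d1 d2) (Rmin 1 (eps / (2 * (K + 1))))).
    pose proof (Rmin_r (Rmin d1 d2) (Rmin 1 (eps / (2 * (K + 1))))).
    pose proof (Rmin_l d1 d2). pose proof (Rmin_r d1 d2).
    pose proof (Rmin_l 1 (eps / (2 * (K + 1)))). pose proof (Rmin_r 1 (eps / (2 * (K + 1)))). lra. }
  destruct Hr as [R1 [R2 [R3 R4]]].
  set (Nop := fun t => let zeta := (circle z rho t - z)%C in
    plus (plus P0 (plus (scal zeta A) (scal (Cconj zeta) B)))
    (plus (plus (scal (zeta * zeta)%C S) (scal (Cconj zeta * Cconj zeta)%C S'))
      (scal (zeta * Cconj zeta)%C C2))).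
  set (g := fun t => gfun v k (circle z rho t - z)%C).
  assert (Hcz : contC (fun t => circle z rho t - z)%C).
  { replace (fun t => circle z rho t - z)%C with (fun t => RtoC rho * ek 1 t)%C.
    - auto using contC_mult, contC_const, contC_ek.
    - apply functional_extensionality. intros t. rewrite circle_sub. reflexivity. }
  assert (HcP : contO (fun t => P (circle z rho t))).
  { apply contO_P_circle; [exact Hrho0|]. intros t. apply H2. rewrite Cmod_circle_sub; lra. }
  assert (HcN : contO Nop).
  { set (a := fun t => (circle z rho t - z)%C) in Hcz.
    assert (Hcc : contC (fun t => Cconj (a t))) by (apply contC_conj, Hcz).
    apply (contO_plus (fun t => plus P0 (plus (scal (a t) A) (scal (Cconj (a t)) B)))
      (fun t => plus (plus (scal (a t * a t)%C S) (scal (Cconj (a t) * Cconj (a t))%C S'))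
        (scal (a t * Cconj (a t))%C C2))).
    - apply (contO_plus (fun _ => P0)); [apply contO_const|].
      apply (contO_plus (fun t => scal (a t) A)); apply contO_scal; try apply contO_const; assumption.
    - apply (contO_plus (fun t => plus (scal (a t * a t)%C S) (scal (Cconj (a t) * Cconj (a t))%C S'))).
      + apply (contO_plus (fun t => scal (a t * a t)%C S)); apply contO_scal; try apply contO_const;
          apply contC_mult; assumption.
      + apply contO_scal; [apply contC_mult; assumption|apply contO_const]. }
  assert (Hone : contO (fun _ : R => one : BOp V)) by apply contO_const.
  assert (HcPg : contC (fun t => inner (P (circle z rho t) (g t)) (g t))).
  { apply (contC_inner_gfun (fun t => P (circle z rho t)) (fun _ => one)); assumption. }
  assert (HcNg : contC (fun t => inner (Nop t (g t)) (g t))).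
  { apply (contC_inner_gfun Nop (fun _ => one)); assumption. }
  assert (Eexact : cavg (fun t => inner (Nop t (g t)) (g t)) =
    (inner (P0 v) v + RtoC (rho ^ 2) * (inner (P0 k) k + inner (A v) k + inner (B k) v + inner (C2 v) v)
      + RtoC (rho ^ 4) * inner (C2 k) k)%C).
  { etransitivity; [|apply (cavg_trig _
      (RtoC rho * inner (P0 k) v + RtoC rho * inner (A v) v + RtoC (rho ^ 3) * (inner (A k) k + inner (S v) k + inner (C2 k) v))%C
      (RtoC rho * inner (P0 v) k + RtoC rho * inner (B v) v + RtoC (rho ^ 3) * (inner (B k) k + inner (S' k) v + inner (C2 v) k))%C
      (RtoC (rho ^ 2) * (inner (A k) v + inner (S v) v) + RtoC (rho ^ 4) * inner (S k) k)%C
      (RtoC (rho ^ 2) * (inner (B v) k + inner (S' v) v) + RtoC (rho ^ 4) * inner (S' k) k)%C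
      (RtoC (rho ^ 3) * inner (S k) v)%C (RtoC (rho ^ 3) * inner (S' v) k)%C)].
    apply cavg_ext. intros t. unfold Nop, g, gfun. cbv zeta. rewrite circle_sub.
    set (e := ek 1 t).
    assert (Ee : (e * Cconj e = 1)%C) by (unfold e; rewrite Cmult_comm; apply ek_conj_mult).
    assert (E2 : ek 2 t = (e * e)%C) by (unfold e; rewrite <- ek_plus; reflexivity).
    assert (E3 : ek 3 t = (e * e * e)%C) by (unfold e; rewrite <- !ek_plus; reflexivity).
    assert (Em1 : ek (-1) t = Cconj e) by (unfold e; rewrite <- ek_opp; reflexivity).
    assert (Em2 : ek (-2) t = (Cconj e * Cconj e)%C) by (unfold e; rewrite <- ek_opp, <- ek_plus; reflexivity).
    assert (Em3 : ek (-3) t = (Cconj e * Cconj e * Cconj e)%C) by (unfold e; rewrite <- ek_opp, <- !ek_plus; reflexivity).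
    rewrite E2, E3, Em1, Em2, Em3. clear E2 E3 Em1 Em2 Em3.
    assert (Hne : e <> RtoC 0).
    { intros H0. rewrite H0 in Ee. apply (f_equal fst) in Ee. simpl in Ee. lra. }
    (* On the unit circle conjugation is inversion, which turns the identity into one between
       rational functions of e. *)
    assert (Ei : Cconj e = (/ e)%C).
    { replace (Cconj e) with (/ e * (e * Cconj e))%C by (field; exact Hne). rewrite Ee. ring. }
    inner_simpl. rewrite !Cmult_conj, Ei.
    replace (Cconj (RtoC rho)) with (RtoC rho) by ceq.
    rewrite !RtoC_pow. field. exact Hne. }
  assert (Hdiff : Cmod (cavg (fun t => inner (P (circle z rho t) (g t)) (g t)) - cavg (fun t => inner (Nop t (g t)) (g t)))
    <= eps / 2 * rho ^ 2).
  { rewrite <- cavg_minus by assumption. apply cavg_bound; [apply contC_minus; assumption|]. intros t.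
    rewrite <- inner_minus_l, <- app_minus.
    eapply Rle_trans; [apply inner_op_le|].
    assert (Hg : norm (g t) <= M).
    { apply norm_gfun. rewrite Cmod_circle_sub; lra. }
    specialize (H1 (circle z rho t)). rewrite Cmod_circle_sub in H1 by lra. specialize (H1 R1).
    change (bop_norm (minus (P (circle z rho t)) (Nop t)) <= eps / (2 * (M ^ 2 + 1)) * rho ^ 2) in H1.
    pose proof (vnorm_ge_0 (g t)). pose proof (pow2_ge_0 rho).
    apply Rle_trans with (eps / (2 * (M ^ 2 + 1)) * rho ^ 2 * M * M).
    - apply Rmult_le_compat; [apply Rmult_le_pos; [apply bop_norm_ge_0|assumption]|assumption| |exact Hg].
      apply Rmult_le_compat; [apply bop_norm_ge_0|assumption|exact H1|exact Hg].
    - pose proof (pow2_ge_0 M).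
      apply Rle_trans with (eps / (2 * (M ^ 2 + 1)) * rho ^ 2 * (M ^ 2 + 1)); [|right; field; lra].
      rewrite Rmult_assoc. apply Rmult_le_compat_l; [|simpl; lra].
      apply Rmult_le_pos; lra. }
  change (fun t => inner (P (circle z rho t) (gfun v k (circle z rho t - z)%C)) (gfun v k (circle z rho t - z)%C))
    with (fun t => inner (P (circle z rho t) (g t)) (g t)).
  rewrite Eexact in Hdiff.
  set (p := cavg (fun t => inner (P (circle z rho t) (g t)) (g t))) in *.
  set (q := (inner (P0 k) k + inner (A v) k + inner (B k) v + inner (C2 v) v)%C) in *.
  replace (p - inner (P0 v) v - RtoC (rho ^ 2) * q)%C with
    ((p - (inner (P0 v) v + RtoC (rho ^ 2) * q + RtoC (rho ^ 4) * inner (C2 k) k)) + RtoC (rho ^ 4) * inner (C2 k) k)%C by ring.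
  eapply Rle_trans; [apply Cmod_triangle|]. rewrite Cmod_mult, Cmod_R, (Rabs_pos_eq (rho ^ 4)) by (apply pow_le; lra).
  fold K.
  assert (rho ^ 4 * K <= eps / 2 * rho ^ 2); [|lra].
  replace (rho ^ 4 * K) with (rho ^ 2 * (rho * (rho * K))) by ring.
  rewrite (Rmult_comm (eps / 2)). apply Rmult_le_compat_l; [apply pow2_ge_0|].
  assert (rho * K <= eps / 2).
  { apply Rle_trans with (eps / (2 * (K + 1)) * (K + 1)); [|right; field; lra].
    apply Rmult_le_compat; lra. }
  assert (0 <= rho * K) by (apply Rmult_le_pos; lra).
  apply Rle_trans with (1 * (rho * K)); [apply Rmult_le_compat_r; lra|lra].
Qed.

Definition curv (z : C) : BOp V :=
  minus (mult (mult (d_zbar P z) (bop_inv (P z))) (d_z P z)) (d_zbar (d_z P) z).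

(** For positive P this is the slope k minimising the second-order coefficient <P k, k> + 2 Re <P_z
    v, k> + <P_(z zbar) v, v>; the minimum is minus the curvature at v. *)
Definition kvec (z : C) (v : V) : V := opp (bop_inv (P z) (d_z P z v) : V).

Lemma avg_curvature z v : Omega z -> invertible (P z) -> forall eps, 0 < eps -> exists d, 0 < d /\
  forall rho, 0 < rho < d ->
  Cmod (cavg (fun t => inner (P (circle z rho t) (gfun v (kvec z v) (circle z rho t - z)%C))
      (gfun v (kvec z v) (circle z rho t - z)%C))
    - inner (P z v) v + RtoC (rho ^ 2) * inner (curv z v) v)
  <= eps * rho ^ 2.
Proof.
  intros Hz Hi eps He. destruct (avg_second_order z v (kvec z v) Hz eps He) as [d [Hd H]].
  exists d. split; [exact Hd|]. intros rho Hrho. specialize (H rho Hrho).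
  match type of H with Cmod (?a - ?b - ?c * ?q) <= _ =>
    replace q with (- inner (curv z v) v)%C in H end.
  - match goal with |- Cmod (?a - ?b + ?c * ?q) <= _ => replace (a - b + c * q)%C with (a - b - c * - q)%C by ring end.
    exact H.
  - unfold curv, kvec. inner_simpl. rewrite bop_inv_app_r by exact Hi. ring.
Qed.

Hypothesis P_pos : forall z, Omega z -> pos_invertible (P z).

Lemma adj_P z : Omega z -> adj (P z) = P z.
Proof. intros Hz. apply (P_pos z Hz). Qed.

Lemma inner_selfadj (A : BOp V) u w : adj A = A -> inner (A u) w = inner u (A w).
Proof. intros E. rewrite inner_adj_r, E. reflexivity. Qed.

Lemma adj_d_z z : Omega z -> adj (d_z P z) = d_zbar P z.
Proof.
  intros Hz. apply adj_unique. intros u w. unfold d_z, d_zbar. inner_simpl.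
  rewrite (inner_selfadj (dx P z) u w (adj_dx Omega Omega_open P z (proj1 P_C2) adj_P Hz)).
  rewrite (inner_selfadj (dy P z) u w (adj_dy Omega Omega_open P z (proj1 P_C2) adj_P Hz)).
  unfold RtoC; ceq.
Qed.

(** The derivatives P_z and P_zbar are adjoint to each other, and P_(z zbar) is a quarter of the
    Laplacian, a real combination of self-adjoint second partials. *)
Lemma adj_curv z : Omega z -> adj (curv z) = curv z.
Proof.
  intros Hz. apply adj_unique. intros u w. unfold curv.
  rewrite (d_zbar_d_z Omega Omega_open P z P_C2 Hz), <- (adj_d_z z Hz). inner_simpl.
  rewrite inner_adj_l, <- (inner_adj_r (d_z P z)).
  rewrite (inner_selfadj (bop_inv (P z)) _ _ (proj1 (nonneg_bop_inv _ (P_pos z Hz)))).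
  destruct P_C2 as [H1 [H2 H3]].
  rewrite (inner_selfadj (dx (dx P) z) u w (adj_dx Omega Omega_open (dx P) z H2
    (fun x Hx => adj_dx Omega Omega_open P x H1 adj_P Hx) Hz)).
  rewrite (inner_selfadj (dy (dy P) z) u w (adj_dy Omega Omega_open (dy P) z H3
    (fun x Hx => adj_dy Omega Omega_open P x H1 adj_P Hx) Hz)).
  unfold RtoC; ceq.
Qed.

End Key.

(** * The functional S as an average *)

Lemma pos_invertible_coercive {V : HilbertSpace} (A : BOp V) : pos_invertible A ->
  exists c, 0 < c /\ forall v, c * norm v ^ 2 <= Re (inner (A v) v).
Proof.
  intros HA. set (N := bop_norm (bop_inv A) + 1).
  assert (HN : 0 < N) by (unfold N; pose proof (bop_norm_ge_0 (bop_inv A)); lra).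
  exists (/ N). split; [apply Rinv_0_lt_compat, HN|]. intros v.
  pose proof (pos_invertible_lower A v HA) as H. pose proof (proj2 (proj1 HA) v) as H0.
  apply Rmult_le_reg_l with N; [exact HN|]. rewrite <- Rmult_assoc, Rinv_r, Rmult_1_l by lra.
  eapply Rle_trans; [exact H|]. apply Rmult_le_compat_r; [exact H0|unfold N; lra].
Qed.

Lemma bop_le_intro {V : HilbertSpace} (A B : BOp V) :
  (forall v, Im (inner (A v) v) = 0) -> (forall v, Im (inner (B v) v) = 0) ->
  (forall v, Re (inner (A v) v) <= Re (inner (B v) v)) -> bop_le A B.
Proof.
  intros HA HB H. split.
  - apply selfadj_of_quad_real. intros v. inner_simpl. unfold Im in *; simpl. rewrite HA, HB. ring.
  - intros v. inner_simpl. specialize (H v). unfold Re in *; simpl. lra.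
Qed.

Lemma bop_le_elim {V : HilbertSpace} (A B : BOp V) v : bop_le A B ->
  Re (inner (A v) v) <= Re (inner (B v) v).
Proof.
  intros [_ H]. specialize (H v). inner_simpl_in H. unfold Re in *; simpl in *. lra.
Qed.

Lemma contO_norm {V : HilbertSpace} (F : R -> BOp V) : contO F -> contR (fun t => bop_norm (F t)).
Proof.
  intros HF t. apply filterlim_locally. intros eps.
  generalize (HF t eps (cond_pos eps)). apply filter_imp. intros s Hs.
  change (Rabs (bop_norm (F s) - bop_norm (F t)) < eps).
  eapply Rle_lt_trans; [|exact Hs]. apply Rabs_le.
  pose proof (bop_norm_dist (F s) (F t)). pose proof (bop_norm_dist (F t) (F s)) as H2.
  rewrite bop_norm_minus_sym in H2. lra.
Qed.

Lemma circle_bounded {V : HilbertSpace} (f : C -> BOp V) z0 r : 0 < r ->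
  contO (fun t => f (circle z0 r t)) -> exists B, 0 < B /\ forall t, bop_norm (f (circle z0 r t)) <= B.
Proof.
  intros Hr Hf. destruct (contR_bounded _ (contO_norm _ Hf)) as [B [HB H]].
  exists B. split; [exact HB|]. intros t.
  (* Compactness bounds the norm on one period only; every point of the circle has a parameter
     there. *)
  destruct (circle_param z0 r (circle z0 r t) Hr) as [s [Hs E]].
  { apply Cmod_circle_sub. lra. }
  rewrite E. eapply Rle_trans; [apply Rle_abs|apply H, Hs].
Qed.

(** Inversion is continuous, so the inverses are bounded along the circle, and the reciprocal of
    that bound is a common coercivity constant. *)
Lemma circle_coercive {V : HilbertSpace} (f : C -> BOp V) z0 r : 0 < r ->
  contO (fun t => f (circle z0 r t)) -> (forall t, pos_invertible (f (circle z0 r t))) ->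
  exists c, 0 < c /\ forall t v, c * norm v ^ 2 <= Re (inner (f (circle z0 r t) v) v).
Proof.
  intros Hr Hf Hp.
  destruct (circle_bounded (fun z => bop_inv (f z)) z0 r Hr) as [B [HB H]].
  { intros t. apply (limO_bop_inv (fun t => f (circle z0 r t))); [apply Hp| |apply Hf].
    apply filter_forall. intros s. apply Hp. }
  exists (/ B). split; [apply Rinv_0_lt_compat, HB|]. intros t v.
  pose proof (pos_invertible_lower _ v (Hp t)) as H1. pose proof (proj2 (proj1 (Hp t)) v) as H0.
  apply Rmult_le_reg_l with B; [exact HB|]. rewrite <- Rmult_assoc, Rinv_r, Rmult_1_l by lra.
  eapply Rle_trans; [exact H1|]. apply Rmult_le_compat_r; [exact H0|apply H].
Qed.

Lemma admissible_oholo {V : HilbertSpace} z0 r (H : C -> BOp V) : admissible z0 r H -> oholo z0 r H.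
Proof.
  intros [_ [Hc Hd]]. split; [apply contO_on_iff, Hc|].
  intros z Hz. apply ex_derive_oderiv, Hd, Hz.
Qed.

Lemma circle'_ek r t : circle' r t = (Ci * RtoC r * ek 1 t)%C.
Proof. unfold circle', ek. rewrite Rmult_1_l. reflexivity. Qed.

Lemma inner_circle_avg {V : HilbertSpace} (w : R -> C) (Q : C -> BOp V) z0 r (u v : V) : 0 < r ->
  contC w -> contO (fun t => Q (circle z0 r t)) ->
  inner (circle_avg w Q z0 r u) v = (RtoC (/ r) * cavg (fun t => w t * inner (Q (circle z0 r t) u) v))%C.
Proof.
  intros Hr Hw HQ. unfold circle_avg. rewrite app_scal, inner_scal_l.
  rewrite inner_RInt by (apply contO_scal; assumption).
  transitivity (RtoC (/ r) * cavg (fun t => inner ((scal (w t) (Q (circle z0 r t)) : BOp V) u) v))%C.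
  - unfold cavg, ravg. rewrite Rinv_mult. ceq.
  - f_equal. apply cavg_ext. intros t. inner_simpl. reflexivity.
Qed.

Section Twist.
Context {V : HilbertSpace}.
Variables (P H : C -> BOp V) (z0 : C) (r : R).
Hypothesis Hr : 0 < r.
Hypothesis P_cont : contO (fun t => P (circle z0 r t)).
Hypothesis P_pos : forall t, pos_invertible (P (circle z0 r t)).
Hypothesis H_adm : admissible z0 r H.

Let N (z : C) : BOp V := mult (mult (adj (H z)) (P z)) (H z).

Lemma twist_inner_N z (u w : V) : inner (N z u) w = inner (P z (H z u)) (H z w).
Proof. unfold N. inner_simpl. apply inner_adj_l. Qed.

Lemma circle_closed t : closed_disc z0 r (circle z0 r t).
Proof. unfold closed_disc. rewrite Cmod_circle_sub; lra. Qed.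

Lemma twist_N_cont : contO (fun t => N (circle z0 r t)).
Proof.
  assert (HH : contO (fun t => H (circle z0 r t))).
  { apply contO_circle; [exact Hr|]. apply (admissible_oholo _ _ _ H_adm). }
  unfold N. apply contO_mult; [apply contO_mult; [apply contO_adj|]|]; assumption.
Qed.

Lemma twist_N_pos t : pos_invertible (N (circle z0 r t)).
Proof.
  destruct (P_pos t) as [[HP1 HP2] [Pi [HPi1 HPi2]]].
  destruct (proj1 H_adm _ (circle_closed t)) as [Hi [HHi1 HHi2]].
  set (z := circle z0 r t) in *.
  split; [split|].
  - apply selfadj_of_quad_real. intros v. rewrite twist_inner_N. apply nonneg_im. split; assumption.
  - intros v. rewrite twist_inner_N. apply HP2.
  - assert (E1 : mult (adj Hi) (adj (H z)) = one) by (rewrite <- adj_mult, HHi1; apply adj_one).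
    assert (E2 : mult (adj (H z)) (adj Hi) = one) by (rewrite <- adj_mult, HHi2; apply adj_one).
    exists (mult Hi (mult Pi (adj Hi))). unfold N. split.
    + rewrite <- !mult_assoc. rewrite (mult_assoc (H z) Hi), HHi1, mult_one_l.
      rewrite (mult_assoc (P z) Pi), HPi1, mult_one_l. exact E2.
    + rewrite <- !mult_assoc. rewrite (mult_assoc (adj Hi) (adj (H z))), E1, mult_one_l.
      rewrite (mult_assoc Pi (P z)), HPi2, mult_one_l. exact HHi2.
Qed.

Let M0 : BOp V := avg_abs_dz N z0 r.
Let M1 : BOp V := avg_dz N z0 r.
Let M1' : BOp V := avg_dzbar N z0 r.

Lemma twist_M0 (u w : V) : inner (M0 u) w = cavg (fun t => inner (N (circle z0 r t) u) w).
Proof.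
  unfold M0, avg_abs_dz. rewrite inner_circle_avg by (try apply contC_const; try apply twist_N_cont; assumption).
  rewrite cavg_scal by (apply (contC_inner (fun t => N (circle z0 r t))), twist_N_cont).
  rewrite Cmult_assoc, <- RtoC_mult, Rinv_l by lra. ring.
Qed.

Lemma twist_M1 (u w : V) : inner (M1 u) w = cavg (fun t => Ci * ek 1 t * inner (N (circle z0 r t) u) w)%C.
Proof.
  pose proof (contC_inner _ u w twist_N_cont) as Hc.
  unfold M1, avg_dz. rewrite inner_circle_avg; [|exact Hr| |apply twist_N_cont].
  - rewrite (cavg_ext _ (fun t => RtoC r * (Ci * ek 1 t * inner (N (circle z0 r t) u) w))%C).
    + rewrite cavg_scal by auto using contC_mult, contC_const, contC_ek.
      rewrite Cmult_assoc, <- RtoC_mult, Rinv_l by lra. ring.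
    + intros t. rewrite circle'_ek. ring.
  - replace (fun t => circle' r t) with (fun t => Ci * RtoC r * ek 1 t)%C
      by (apply functional_extensionality; intros t; rewrite circle'_ek; reflexivity).
    auto using contC_mult, contC_const, contC_ek.
Qed.

Lemma twist_M1' (u w : V) : inner (M1' u) w = cavg (fun t => - Ci * ek (-1) t * inner (N (circle z0 r t) u) w)%C.
Proof.
  pose proof (contC_inner _ u w twist_N_cont) as Hc.
  assert (E : forall t, Cconj (circle' r t) = (RtoC r * (- Ci * ek (-1) t))%C).
  { intros t. rewrite circle'_ek. change (-1)%Z with (- (1))%Z. rewrite ek_opp.
    set (e := ek 1 t). rewrite !Cmult_conj. ceq. }
  unfold M1', avg_dzbar. rewrite inner_circle_avg; [|exact Hr| |apply twist_N_cont].
  - rewrite (cavg_ext _ (fun t => RtoC r * (- Ci * ek (-1) t * inner (N (circle z0 r t) u) w))%C).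
    + rewrite cavg_scal by auto using contC_mult, contC_const, contC_ek.
      rewrite Cmult_assoc, <- RtoC_mult, Rinv_l by lra. ring.
    + intros t. rewrite E. ring.
  - replace (fun t => Cconj (circle' r t)) with (fun t => RtoC r * (- Ci * ek (-1) t))%C
      by (apply functional_extensionality; intros t; rewrite E; reflexivity).
    auto using contC_mult, contC_const, contC_ek.
Qed.

Lemma twist_M0_invertible : invertible M0.
Proof.
  destruct (circle_coercive N z0 r Hr twist_N_cont twist_N_pos) as [c [Hc HN]].
  apply (coercive_invertible M0 c Hc). intros v. rewrite twist_M0.
  rewrite <- (ravg_const (c * norm v ^ 2)). apply ravg_le; [apply contR_const| |intros t; apply HN].
  apply (contC_re (fun t => inner (N (circle z0 r t) v) v)), contC_inner, twist_N_cont.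
Qed.

(* The Schur complement [frakS] minimises [avg <N (u + e^(it) x), u + e^(it) x>]
   over [x]; the minimiser is [x = - Ci (M0^-1 M1' u)]. *)
Lemma twist_average : exists K : C -> BOp V, oholo z0 r K /\ K z0 = one /\
  forall v, inner (frakS_twist P z0 r H v) v =
    cavg (fun t => inner (P (circle z0 r t) (K (circle z0 r t) v)) (K (circle z0 r t) v)).
Proof.
  set (W := mult (bop_inv M0) M1').
  (* The factor -i / r turns z - z0 into -i e^(it) on the circle, so that L u = u - i e^(it) x
     there, while L is the identity at the centre. *)
  set (L := fun z => plus one (scal ((- Ci * RtoC (/ r)) * (z - z0))%C W)).
  exists (fun z => mult (mult (H z) (L z)) (bop_inv (H z0))).
  assert (Hi : invertible (H z0)).
  { apply (proj1 H_adm). unfold closed_disc. rewrite Cmod_minus_self. lra. }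
  split; [|split].
  - apply oholo_mult; [apply oholo_mult|apply oholo_const].
    + apply admissible_oholo, H_adm.
    + apply oholo_affine.
  - replace (L z0) with (one : BOp V).
    + rewrite mult_one_r. apply (proj1 (bop_inv_spec _ Hi)).
    + unfold L. op_ring.
  - intros v. set (u := bop_inv (H z0) v : V).
    assert (Eadj : bop_inv (adj (H z0)) = adj (bop_inv (H z0))).
    { apply bop_inv_unique. destruct (bop_inv_spec _ Hi) as [A1 A2]. split.
      - rewrite <- adj_mult, A2. apply adj_one.
      - rewrite <- adj_mult, A1. apply adj_one. }
    unfold frakS_twist. rewrite !app_mult, Eadj, inner_adj_l. fold N. fold u.
    unfold frakS. fold M0 M1 M1'.
    set (x := bop_inv M0 (M1' u) : V).
    assert (Ex : forall w : V, inner (M0 x) w = inner (M1' u) w).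
    { intros w. unfold x. rewrite bop_inv_app_r by apply twist_M0_invertible. reflexivity. }
    pose proof twist_N_cont as HcN.
    transitivity (inner (M0 u) u - inner (M1 x) u)%C; [inner_simpl; reflexivity|].
    rewrite (cavg_ext _ (fun t => inner (N (circle z0 r t) u) u
      + (RtoC (-1) * (Ci * ek 1 t * inner (N (circle z0 r t) x) u)
      + (RtoC (-1) * (- Ci * ek (-1) t * inner (N (circle z0 r t) u) x)
      + inner (N (circle z0 r t) x) x)))%C).
    + assert (Hc : forall a b : V, contC (fun t => inner (N (circle z0 r t) a) b))
        by (intros a b; apply (contC_inner (fun t => N (circle z0 r t))), HcN).
      rewrite !cavg_plus, !cavg_scal; auto 10 using contC_plus, contC_mult, contC_const, contC_ek.
      rewrite <- !twist_M0, <- twist_M1, <- twist_M1'. rewrite Ex.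
      replace (RtoC (-1)) with (- RtoC 1)%C by ceq. ring.
    + intros t. rewrite !app_mult. fold u.
      replace (L (circle z0 r t) u) with (plus u (scal (- Ci * ek 1 t)%C x)).
      * rewrite !twist_inner_N. inner_simpl.
        replace (ek (-1) t) with (Cconj (ek 1 t)) by (symmetry; apply (ek_opp 1)).
        pose proof (ek_conj_mult 1 t) as Ee. set (e := ek 1 t) in *.
        replace (Cconj (- Ci * e)) with (Ci * Cconj e)%C by ceq.
        replace (RtoC (-1)) with (- RtoC 1)%C by ceq.
        set (p := inner (P (circle z0 r t) (H (circle z0 r t) x)) (H (circle z0 r t) x)).
        assert (Ep : (Ci * Cconj e * (- Ci * e * p))%C = p).
        { replace (Ci * Cconj e * (- Ci * e * p))%C with (((- Ci * Ci) * (Cconj e * e)) * p)%C by ring.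
          rewrite Ee. unfold Ci. ceq. }
        rewrite <- Ep at 2. ring.
      * unfold L. apply inner_ext. intros w. inner_simpl. rewrite circle_sub.
        change (W u) with (x).
        replace (- Ci * RtoC (/ r) * (RtoC r * ek 1 t))%C with (- Ci * (RtoC (/ r) * RtoC r) * ek 1 t)%C by ring.
        rewrite <- RtoC_mult, Rinv_l by lra. ring.
Qed.

End Twist.

(** Continuity of the function itself is not part of [C1_op]; it is read off the first-order
    expansion. *)
Lemma C1_op_near {V : HilbertSpace} (Omega : C -> Prop) (P : C -> BOp V) z :
  open Omega -> C1_op Omega P -> Omega z -> forall eps, 0 < eps -> exists d, 0 < d /\
  forall w, Cmod (w - z) < d -> bop_norm (minus (P w) (P z)) < eps.
Proof.
  intros HO HP Hz eps He.
  destruct (first_order_complex Omega HO P z HP Hz 1 Rlt_0_1) as [e [Hee Hex]].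
  set (N := bop_norm (d_z P z) + bop_norm (d_zbar P z) + 1).
  pose proof (bop_norm_ge_0 (d_z P z)) as N1. pose proof (bop_norm_ge_0 (d_zbar P z)) as N2.
  assert (HN : 0 < N) by (unfold N; lra).
  exists (Rmin e (eps / N)). split; [apply Rmin_pos; [exact Hee|apply Rdiv_lt_0_compat; lra]|].
  intros w Hw'. pose proof (Rmin_l e (eps / N)). pose proof (Rmin_r e (eps / N)).
  specialize (Hex w ltac:(lra)).
  match type of Hex with bop_norm (minus ?X ?Y) <= _ => pose proof (bop_norm_dist X Y) as T end.
  pose proof (bop_norm_triangle (scal (w - z)%C (d_z P z)) (scal (Cconj (w - z)%C) (d_zbar P z))) as T2.
  pose proof (bop_norm_scal (w - z)%C (d_z P z)) as T3.
  pose proof (bop_norm_scal (Cconj (w - z)%C) (d_zbar P z)) as T4. rewrite Cmod_conj in T4.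
  set (h := Cmod (w - z)) in *.
  apply Rle_lt_trans with (N * h).
  { unfold N. eapply Rle_trans; [exact T|].
    eapply Rle_trans; [apply Rplus_le_compat; [eapply Rle_trans; [exact T2|apply Rplus_le_compat; [exact T3|exact T4]]|exact Hex]|].
    lra. }
  replace eps with (N * (eps / N)) by (field; lra). apply Rmult_lt_compat_l; lra.
Qed.

(** * From the mean inequality to the curvature *)

Section MeanToCurvature.
Context {V : HilbertSpace}.
Variables (Omega : C -> Prop) (P : C -> BOp V).
Hypothesis Omega_open : open Omega.
Hypothesis P_C2 : C2_op Omega P.
Hypothesis P_pos : forall z, Omega z -> pos_invertible (P z).

(* To first order, [P] maps the holomorphic field [gfun v (kvec P z v)] to an
   antiholomorphic one. *)
Lemma P_gfun_first_order z v : Omega z -> forall eta, 0 < eta -> exists d, 0 < d /\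
  forall w, Cmod (w - z) < d ->
  norm (minus (P w (gfun v (kvec P z v) (w - z)%C) : V)
    (plus (P z v : V) (scal (Cconj (w - z)%C) (d_zbar P z v : V))))
  <= eta * Cmod (w - z).
Proof.
  intros Hz eta Heta. set (k := kvec P z v).
  set (M := norm v + norm k + 1).
  pose proof (vnorm_ge_0 v) as Hv. pose proof (vnorm_ge_0 k) as Hk.
  assert (HM : 0 < M) by (unfold M; lra).
  assert (He : 0 < eta / M) by (apply Rdiv_lt_0_compat; lra).
  destruct (first_order_complex Omega Omega_open P z (proj1 P_C2) Hz _ He) as [d1 [Hd1 H1]].
  destruct (C1_op_near Omega P z Omega_open (proj1 P_C2) Hz _ He) as [d2 [Hd2 H2]].
  exists (Rmin d1 d2). split; [apply Rmin_pos; assumption|]. intros w Hw.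
  pose proof (Rmin_l d1 d2). pose proof (Rmin_r d1 d2).
  specialize (H1 w ltac:(lra)). specialize (H2 w ltac:(lra)).
  match type of H1 with bop_norm ?X <= _ => set (R1 := X : BOp V) in * end.
  set (R2 := minus (P w) (P z) : BOp V) in *. set (h := Cmod (w - z)) in *.
  assert (Hh : 0 <= h) by apply Cmod_ge_0.
  match goal with |- norm ?X <= _ => replace X with (plus (R1 v : V) (scal (w - z)%C (R2 k : V))) end.
  - eapply Rle_trans; [apply vnorm_triangle|]. rewrite norm_scal_C. fold h.
    pose proof (bop_norm_bound R1 v) as B1. pose proof (bop_norm_bound R2 k) as B2.
    assert (bop_norm R1 * norm v <= eta / M * h * norm v) by (apply Rmult_le_compat_r; assumption).
    assert (bop_norm R2 * norm k <= eta / M * norm k) by (apply Rmult_le_compat_r; lra).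
    assert (h * norm (R2 k) <= h * (eta / M * norm k)) by (apply Rmult_le_compat_l; lra).
    apply Rle_trans with (eta / M * h * (norm v + norm k)); [lra|].
    replace (eta * h) with (eta / M * h * M) by (field; lra).
    apply Rmult_le_compat_l; [apply Rmult_le_pos; lra|unfold M; lra].
  - apply inner_ext. intros x. unfold R1, R2, gfun. inner_simpl.
    unfold k, kvec. inner_simpl. rewrite (bop_inv_app_r (P z)) by apply (P_pos z Hz). ring.
Qed.

(** Suppose the curvature takes the value -q < 0 at v. On a small circle T <= P(z) yields a
    holomorphic field g + y with value v at z and average energy at most <P v, v>. The field g alone
    has average energy about <P v, v> + q r^2. Since y vanishes at z, it pairs to zero on average
    with the antiholomorphic part s of P g, and the pairing with e = P g - s is absorbed by the
    energy of y at a cost of q r^2 / 4. With the error q r^2 / 4 in the expansion, an excess of at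
    least q r^2 / 2 remains, a contradiction. *)
Theorem semipositive_of_mean :
  (forall (z0 : C) (r : R), 0 < r -> (forall z, closed_disc z0 r z -> Omega z) ->
     exists T : BOp V, is_frakT P z0 r T /\ bop_le T (P z0)) ->
  semipositive_curvature Omega P.
Proof.
  intros Hmean z Hz. change (nonneg (curv P z)).
  split; [apply (adj_curv Omega P Omega_open P_C2 P_pos z Hz)|].
  intros v. apply Rnot_lt_le. intros Hneg.
  set (q := - Re (inner (curv P z v) v)). assert (Hq : 0 < q) by (unfold q; lra).
  destruct (pos_invertible_coercive (P z) (P_pos z Hz)) as [c0 [Hc0 HP0]].
  (* With |e| at most this number times r, the cost 2 / c0 |e|^2 of absorbing e is at most q r^2 /
     4. *)
  assert (Heta : 0 < sqrt (c0 * q / 8)).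
  { apply sqrt_lt_R0. assert (0 < c0 * q) by (apply Rmult_lt_0_compat; assumption). lra. }
  destruct (P_gfun_first_order z v Hz _ Heta) as [d1 [Hd1 H1]].
  destruct (avg_curvature Omega P Omega_open P_C2 z v Hz (proj2 (P_pos z Hz)) (q / 4)) as [d2 [Hd2 H2]]; [lra|].
  destruct (C1_op_near Omega P z Omega_open (proj1 P_C2) Hz (c0 / 2)) as [d3 [Hd3 H3]]; [lra|].
  destruct (open_nbhd Omega Omega_open z Hz) as [d4 [Hd4 H4]].
  set (r := Rmin (Rmin d1 d2) (Rmin d3 d4) / 2).
  assert (Hr : 0 < r /\ r < d1 /\ r < d2 /\ r < d3 /\ r < d4).
  { unfold r. pose proof (Rmin_l (Rmin d1 d2) (Rmin d3 d4)). pose proof (Rmin_r (Rmin d1 d2) (Rmin d3 d4)).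
    pose proof (Rmin_l d1 d2). pose proof (Rmin_r d1 d2). pose proof (Rmin_l d3 d4). pose proof (Rmin_r d3 d4).
    assert (0 < Rmin (Rmin d1 d2) (Rmin d3 d4)) by (repeat apply Rmin_pos; assumption). lra. }
  destruct Hr as [Hr [R1 [R2 [R3 R4]]]].
  assert (HD : forall w, closed_disc z r w -> Omega w).
  { intros w Hw. apply H4. unfold closed_disc in Hw. lra. }
  destruct (Hmean z r Hr HD) as [T [[[H [Hadm ET]] _] HTle]].
  assert (HO : forall t, Omega (circle z r t)).
  { intros t. apply HD, circle_closed, Hr. }
  assert (HcP : contO (fun t => P (circle z r t))) by (apply (contO_P_circle Omega P Omega_open P_C2); assumption).
  destruct (twist_average P H z r Hr HcP (fun t => P_pos _ (HO t)) Hadm) as [K [HK [HK0 HKv]]].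
  apply (bop_le_elim _ _ v) in HTle. rewrite ET, HKv in HTle.
  set (kop := opp (mult (bop_inv (P z)) (d_z P z)) : BOp V).
  set (Y := fun w => plus (K w) (opp (plus one (scal (RtoC 1 * (w - z))%C kop)))).
  assert (HY : oholo z r Y).
  { apply oholo_plus; [exact HK|].
    replace (fun w => opp (plus one (scal (RtoC 1 * (w - z))%C kop))) with
      (fun w => plus (opp one) (scal (RtoC (-1) * (w - z))%C kop) : BOp V).
    - apply oholo_affine.
    - apply functional_extensionality. intros w. apply op_ext_inner; intros a b; inner_simpl. unfold RtoC; ceq. }
  assert (HY0 : Y z = zero).
  { unfold Y. rewrite HK0. apply op_ext_inner; intros a b; inner_simpl. ring. }
  assert (EY : forall t, (Y (circle z r t) v : V) = minus (K (circle z r t) v : V) (gfun v (kvec P z v) (circle z r t - z)%C)).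
  { intros t. apply inner_ext. intros x. unfold Y, gfun, kvec, kop. inner_simpl. ring. }
  (* The conjugate of w - z in s crosses the inner product as the holomorphic factor w - z. The
     shape with [plus zero] is that of [oholo_affine]. *)
  set (Y2 := fun w => mult (plus zero (scal (RtoC 1 * (w - z))%C (one : BOp V))) (Y w)).
  assert (HY2 : oholo z r Y2) by (apply oholo_mult; [apply oholo_affine|exact HY]).
  set (s := fun t => plus (P z v : V) (scal (Cconj (circle z r t - z)%C) (d_zbar P z v : V))).
  assert (Es : forall t, inner (Y (circle z r t) v) (s t) =
    (inner (Y (circle z r t) v) (P z v) + inner (Y2 (circle z r t) v) (d_zbar P z v))%C).
  { intros t. unfold s, Y2. inner_simpl. rewrite Cconj_conj. ring. }
  assert (HcY : contO (fun t => Y (circle z r t))) by (apply contO_circle; [exact Hr|apply HY]).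
  assert (HcY2 : contO (fun t => Y2 (circle z r t))) by (apply contO_circle; [exact Hr|apply HY2]).
  assert (HcYs : contC (fun t => inner (Y (circle z r t) v) (s t))).
  { replace (fun t => inner (Y (circle z r t) v) (s t)) with
      (fun t => inner (Y (circle z r t) v) (P z v) + inner (Y2 (circle z r t) v) (d_zbar P z v))%C
      by (apply functional_extensionality; intros t; rewrite Es; reflexivity).
    apply contC_plus; [apply (contC_inner (fun t => Y (circle z r t)))|apply (contC_inner (fun t => Y2 (circle z r t)))]; assumption. }
  assert (Hsmean : cavg (fun t => inner (Y (circle z r t) v) (s t)) = RtoC 0).
  { rewrite (cavg_ext _ _ Es), cavg_plus;
      [|apply (contC_inner (fun t => Y (circle z r t))); assumption|apply (contC_inner (fun t => Y2 (circle z r t))); assumption].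
    rewrite (oholo_mean z r Y v (P z v) Hr HY), (oholo_mean z r Y2 v (d_zbar P z v) Hr HY2).
    unfold Y2. rewrite HY0. inner_simpl. ring. }
  specialize (H2 r ltac:(lra)).
  set (g := fun t => gfun v (kvec P z v) (circle z r t - z)%C) in *.
  change (Cmod (cavg (fun t => inner (P (circle z r t) (g t)) (g t)) - inner (P z v) v +
    RtoC (r ^ 2) * inner (curv P z v) v) <= q / 4 * r ^ 2) in H2.
  assert (Hcz : contC (fun t => circle z r t - z)%C).
  { replace (fun t => circle z r t - z)%C with (fun t => RtoC r * ek 1 t)%C.
    - auto using contC_mult, contC_const, contC_ek.
    - apply functional_extensionality. intros t. rewrite circle_sub. reflexivity. }
  assert (HcPg : contC (fun t => inner (P (circle z r t) (g t)) (g t))).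
  { apply (contC_inner_gfun (fun t => P (circle z r t)) (fun _ => one)); [exact HcP|apply contO_const|exact Hcz|exact Hcz]. }
  assert (HcK : contO (fun t => K (circle z r t))) by (apply contO_circle; [exact Hr|apply HK]).
  assert (HcPK : contC (fun t => inner (P (circle z r t) (K (circle z r t) v)) (K (circle z r t) v))).
  { apply (contC_inner2 (fun t => mult (P (circle z r t)) (K (circle z r t))) (fun t => K (circle z r t)));
      [apply contO_mult; assumption|assumption]. }
  assert (Hpt : forall t, Re (inner (P (circle z r t) (g t)) (g t) + RtoC 2 * inner (Y (circle z r t) v) (s t)
      + RtoC (- (q / 4 * r ^ 2)))%C
    <= Re (inner (P (circle z r t) (K (circle z r t) v)) (K (circle z r t) v))).
  { intros t. set (w := circle z r t).
    assert (Hwz : Cmod (w - z) = r) by (apply Cmod_circle_sub; lra).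
    specialize (H1 w ltac:(lra)). specialize (H3 w ltac:(lra)). rewrite Hwz in H1.
    fold (g t) in H1. fold w in EY. fold (s t) in H1.
    assert (Eg : (K w v : V) = plus (g t) (Y w v : V)).
    { apply inner_ext. intros x. unfold w. rewrite EY. unfold g. inner_simpl. ring. }
    set (y := Y w v : V) in *. rewrite Eg.
    set (e := minus (P w (g t) : V) (s t)) in *.
    assert (HsymP : forall a b : V, inner (P w a) b = inner a (P w b)).
    { intros a b. apply nonneg_sym, (P_pos _ (HO t)). }
    assert (Hy : c0 / 2 * norm y ^ 2 <= Re (inner (P w y) y)).
    { specialize (HP0 y). set (D := minus (P w) (P z)) in *.
      assert (ED : inner (P w y) y = (inner (P z y) y + inner (D y) y)%C) by (unfold D; inner_simpl; ring).
      rewrite ED. pose proof (inner_op_le D y y) as B. pose proof (re_le_Cmod (inner (D y) y)) as B2.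
      apply Rabs_le_between in B2. pose proof (pow2_ge_0 (norm y)).
      assert (bop_norm D * norm y * norm y <= c0 / 2 * norm y ^ 2).
      { replace (bop_norm D * norm y * norm y) with (bop_norm D * norm y ^ 2) by ring.
        apply Rmult_le_compat_r; lra. }
      unfold Re in *; simpl in *. lra. }
    (* A weighted square: half of the coercivity constant c0, which P keeps near z, is spent on y
       and the reciprocal weight falls on e. *)
    assert (He : - (c0 / 2 * norm y ^ 2) - 2 / c0 * norm e ^ 2 <= 2 * Re (inner y e)).
    { pose proof (re_inner_ge y e) as B. pose proof (vnorm_ge_0 y). pose proof (vnorm_ge_0 e).
      pose proof (pow2_ge_0 (norm y * c0 / 2 - norm e)) as Sq.
      assert (Sq2 : 0 <= 2 / c0 * (norm y * c0 / 2 - norm e) ^ 2).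
      { apply Rmult_le_pos; [left; apply Rdiv_lt_0_compat; lra|exact Sq]. }
      replace (2 / c0 * (norm y * c0 / 2 - norm e) ^ 2) with
        (c0 / 2 * norm y ^ 2 - 2 * (norm y * norm e) + 2 / c0 * norm e ^ 2) in Sq2 by (field; lra). lra. }
    assert (Hee : 2 / c0 * norm e ^ 2 <= q / 4 * r ^ 2).
    { assert (He2 : norm e ^ 2 <= (sqrt (c0 * q / 8) * r) ^ 2).
      { apply pow_incr. split; [apply vnorm_ge_0|exact H1]. }
      rewrite Rpow_mult_distr, pow2_sqrt in He2.
      2:{ assert (0 < c0 * q) by (apply Rmult_lt_0_compat; assumption). lra. }
      apply Rle_trans with (2 / c0 * (c0 * q / 8 * r ^ 2)).
      - apply Rmult_le_compat_l; [left; apply Rdiv_lt_0_compat; lra|exact He2].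
      - right. field. lra. }
    assert (Ey : inner y (s t) = (inner y (P w (g t)) - inner y e)%C) by (unfold e; inner_simpl; ring).
    rewrite Ey. inner_simpl. rewrite (HsymP y (g t)).
    pose proof (inner_conj_re y (P w (g t))) as Ec.
    unfold Re in *; simpl in *. lra. }
  assert (Hav : ravg (fun t => Re (inner (P (circle z r t) (g t)) (g t) + RtoC 2 * inner (Y (circle z r t) v) (s t)
      + RtoC (- (q / 4 * r ^ 2)))%C) <= Re (inner (P z v) v)).
  { eapply Rle_trans; [|exact HTle]. simpl. apply ravg_le.
    - apply (contC_re (fun t => inner (P (circle z r t) (g t)) (g t) + RtoC 2 * inner (Y (circle z r t) v) (s t)
        + RtoC (- (q / 4 * r ^ 2)))%C). auto using contC_plus, contC_mult, contC_const.
    - apply (contC_re _ HcPK).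
    - exact Hpt. }
  assert (Ecav : cavg (fun t => inner (P (circle z r t) (g t)) (g t) + RtoC 2 * inner (Y (circle z r t) v) (s t)
      + RtoC (- (q / 4 * r ^ 2)))%C = (cavg (fun t => inner (P (circle z r t) (g t)) (g t)) + RtoC (- (q / 4 * r ^ 2)))%C).
  { rewrite !cavg_plus, cavg_scal, cavg_const, Hsmean; auto using contC_plus, contC_mult, contC_const. ring. }
  apply (f_equal Re) in Ecav. simpl in Ecav. unfold Re in Hav at 1.
  pose proof (re_le_Cmod (cavg (fun t => inner (P (circle z r t) (g t)) (g t)) - inner (P z v) v +
    RtoC (r ^ 2) * inner (curv P z v) v)) as Hre.
  apply Rabs_le_between in Hre. simpl in Hre.
  assert (Hr2 : 0 < r ^ 2) by (apply pow_lt; exact Hr).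
  unfold q in *. unfold Re in *. simpl in *. nra.
Qed.

End MeanToCurvature.

(** * Operator power series *)

(** A telescoping majorant, by which the tail after n of the series of 1 / (k + 1)^2 is at most 1 /
    (n + 1). *)
Lemma inv_sq_tail n : / (INR (S n) + 1) ^ 2 <= / (INR n + 1) - / (INR (S n) + 1).
Proof.
  rewrite S_INR. pose proof (pos_INR n).
  apply Rmult_le_reg_r with ((INR n + 1) * (INR n + 1 + 1) ^ 2).
  { apply Rmult_lt_0_compat; [lra|apply pow_lt; lra]. }
  field_simplify; lra.
Qed.

Section PowerSeries.
Context {V : HilbertSpace}.
Implicit Types A : nat -> BOp V.

Fixpoint psum A (z : C) (n : nat) : BOp V :=
  match n with
  | O => A O
  | S m => plus (psum A z m) (scal (z ^ S m)%C (A (S m)))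
  end.

Lemma psum_S A z n : psum A z (S n) = plus (psum A z n) (scal (z ^ S n)%C (A (S n))).
Proof. reflexivity. Qed.

Lemma psum_tail A G z n m : (forall k, bop_norm (A k) <= G / (INR k + 1) ^ 2) -> Cmod z <= 1 ->
  bop_norm (minus (psum A z (n + m)) (psum A z n)) <= G * (/ (INR n + 1) - / (INR (n + m) + 1)).
Proof.
  intros HA Hz.
  assert (HG : 0 <= G).
  { pose proof (HA O) as H. simpl in H. pose proof (bop_norm_ge_0 (A O)). lra. }
  induction m as [|m IH].
  - rewrite Nat.add_0_r, Rminus_diag, Rmult_0_r, minus_eq_zero. right. exact bop_norm_zero.
  - rewrite Nat.add_succ_r. rewrite psum_S. set (k := (n + m)%nat) in *.
    apply Rle_trans with (bop_norm (plus (minus (psum A z k) (psum A z n)) (scal (z ^ S k)%C (A (S k))))).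
    { right. f_equal. op_ring. }
    eapply Rle_trans; [apply bop_norm_triangle|].
    assert (H1 : bop_norm (scal (z ^ S k)%C (A (S k))) <= G * / (INR (S k) + 1) ^ 2).
    { eapply Rle_trans; [apply bop_norm_scal|].
      rewrite Cmod_pow. specialize (HA (S k)). pose proof (bop_norm_ge_0 (A (S k))).
      assert (0 <= Cmod z ^ S k <= 1).
      { split; [apply pow_le, Cmod_ge_0|]. rewrite <- (pow1 (S k)). apply pow_incr. split; [apply Cmod_ge_0|exact Hz]. }
      unfold Rdiv in HA. nra. }
    pose proof (inv_sq_tail k) as H2. apply (Rmult_le_compat_l G) in H2; [|exact HG]. lra.
Qed.

Lemma psum_limit A G z : (forall k, bop_norm (A k) <= G / (INR k + 1) ^ 2) -> Cmod z <= 1 ->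
  exists L, forall n, bop_norm (minus L (psum A z n)) <= G / (INR n + 1).
Proof.
  intros HA Hz.
  assert (HG : 0 <= G).
  { pose proof (HA O) as H. simpl in H. pose proof (bop_norm_ge_0 (A O)). lra. }
  destruct (limO_seq_exists (psum A z) (fun n => G * / (INR n + 1) ^ 2) (G * 2)) as [L HL].
  - intros n. pose proof (psum_tail A G z n 1 HA Hz) as H. rewrite Nat.add_1_r in H.
    rewrite psum_S.
    apply Rle_trans with (bop_norm (scal (z ^ S n)%C (A (S n)))).
    { right. f_equal. op_ring. }
    eapply Rle_trans; [apply bop_norm_scal|]. rewrite Cmod_pow. specialize (HA (S n)). pose proof (bop_norm_ge_0 (A (S n))).
    assert (0 <= Cmod z ^ S n <= 1).
    { split; [apply pow_le, Cmod_ge_0|]. rewrite <- (pow1 (S n)). apply pow_incr. split; [apply Cmod_ge_0|exact Hz]. }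
    unfold Rdiv in HA. nra.
  - intros n. apply Rle_trans with (G * (2 - / (INR n + 1))).
    + induction n as [|n IH].
      * simpl. rewrite Rplus_0_l, Rmult_1_r, Rmult_1_r, Rinv_1. lra.
      * rewrite tech5. pose proof (inv_sq_tail n) as H2. apply (Rmult_le_compat_l G) in H2; [|exact HG]. lra.
    + apply Rmult_le_compat_l; [exact HG|]. pose proof (pos_INR n).
      assert (0 < / (INR n + 1)) by (apply Rinv_0_lt_compat; lra). lra.
  - exists L. intros n. rewrite bop_norm_minus_sym.
    apply (limO_norm_bound (F := eventually) (fun m => minus (psum A z n) (psum A z m))).
    + apply limO_minus; [apply limO_const|exact HL].
    + exists n. intros m Hm. replace m with (n + (m - n))%nat by lia.
      rewrite bop_norm_minus_sym. eapply Rle_trans; [apply psum_tail; eassumption|].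
      apply Rmult_le_compat_l; [exact HG|].
      pose proof (pos_INR (n + (m - n))).
      assert (0 < / (INR (n + (m - n)) + 1)) by (apply Rinv_0_lt_compat; lra). lra.
Qed.

(** The sum of the power series where the partial sums converge, an arbitrary operator elsewhere. *)
Definition pser A (z : C) : BOp V :=
  epsilon (inhabits zero) (fun L => limO eventually (psum A z) L).

Lemma INR_inv_small eps : 0 < eps -> exists N, forall n, (N <= n)%nat -> / (INR n + 1) < eps.
Proof.
  intros He. destruct (nfloor_ex (/ eps)) as [N [HN1 HN2]]; [left; apply Rinv_0_lt_compat, He|].
  exists N. intros n Hn. rewrite <- (Rinv_inv eps). apply le_INR in Hn.
  apply Rinv_lt_contravar; [|lra].
  apply Rmult_lt_0_compat; [apply Rinv_0_lt_compat, He|]. pose proof (pos_INR n). lra.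
Qed.

Section WithBound.
Variables (A : nat -> BOp V) (G : R).
Hypothesis HA : forall k, bop_norm (A k) <= G / (INR k + 1) ^ 2.

Lemma pser_G_pos : 0 <= G.
Proof. pose proof (HA O) as H. simpl in H. pose proof (bop_norm_ge_0 (A O)). lra. Qed.

Lemma pser_tail z n : Cmod z <= 1 -> bop_norm (minus (pser A z) (psum A z n)) <= G / (INR n + 1).
Proof.
  intros Hz. destruct (psum_limit A G z HA Hz) as [L HL].
  assert (HLim : limO eventually (psum A z) L).
  { intros eps He. pose proof pser_G_pos as HG.
    destruct (INR_inv_small (eps / (G + 1))) as [N HN]; [apply Rdiv_lt_0_compat; lra|].
    exists N. intros m Hm. rewrite bop_norm_minus_sym. eapply Rle_lt_trans; [apply HL|].
    specialize (HN m Hm). unfold Rdiv.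
    apply Rle_lt_trans with ((G + 1) * / (INR m + 1)).
    - apply Rmult_le_compat_r; [|lra]. left. apply Rinv_0_lt_compat. pose proof (pos_INR m). lra.
    - replace eps with ((G + 1) * (eps / (G + 1))) by (field; lra). apply Rmult_lt_compat_l; lra. }
  assert (E : pser A z = L).
  { apply (limO_unique (F := eventually) (psum A z)); [|exact HLim].
    unfold pser. apply epsilon_spec. exists L. exact HLim. }
  rewrite E. apply HL.
Qed.

Lemma pser_lim z : Cmod z <= 1 -> limO eventually (psum A z) (pser A z).
Proof.
  intros Hz. destruct (psum_limit A G z HA Hz) as [L HL].
  unfold pser. apply epsilon_spec. exists L.
  intros eps He. pose proof pser_G_pos as HG.
  destruct (INR_inv_small (eps / (G + 1))) as [N HN]; [apply Rdiv_lt_0_compat; lra|].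
  exists N. intros m Hm. rewrite bop_norm_minus_sym. eapply Rle_lt_trans; [apply HL|].
  specialize (HN m Hm). unfold Rdiv.
  apply Rle_lt_trans with ((G + 1) * / (INR m + 1)).
  - apply Rmult_le_compat_r; [|lra]. left. apply Rinv_0_lt_compat. pose proof (pos_INR m). lra.
  - replace eps with ((G + 1) * (eps / (G + 1))) by (field; lra). apply Rmult_lt_compat_l; lra.
Qed.

Lemma limC_pow D z n : limC (nearC D z) (fun w => w ^ n)%C (z ^ n)%C.
Proof.
  induction n as [|n IH].
  - exact (limC_const (RtoC 1)).
  - exact (limC_mult (F := nearC D z) (fun w => w) (fun w => w ^ n)%C z (z ^ n)%C (limC_id D z) IH).
Qed.

Lemma psum_cont D z n : limO (nearC D z) (fun w => psum A w n) (psum A z n).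
Proof.
  induction n as [|n IH]; [exact (limO_const (F := nearC D z) (A O))|].
  exact (limO_plus (F := nearC D z) _ _ _ _ IH
    (limO_scal (F := nearC D z) _ _ _ _ (limC_pow D z (S n)) (limO_const (A (S n))))).
Qed.

Lemma pser_cont : contO_on (closed_disc (RtoC 0) 1) (pser A).
Proof.
  intros z Hz eps He.
  assert (Hu : forall w, closed_disc (RtoC 0) 1 w -> Cmod w <= 1).
  { intros w Hw. unfold closed_disc in Hw. replace w with (w - RtoC 0)%C by ring. exact Hw. }
  pose proof pser_G_pos as HG.
  destruct (INR_inv_small (eps / 3 / (G + 1))) as [N HN]; [repeat apply Rdiv_lt_0_compat; lra|].
  specialize (HN N (le_n _)).
  assert (HN' : G / (INR N + 1) < eps / 3).
  { apply Rle_lt_trans with ((G + 1) * / (INR N + 1)).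
    - apply Rmult_le_compat_r; [|lra]. left. apply Rinv_0_lt_compat. pose proof (pos_INR N). lra.
    - replace (eps / 3) with ((G + 1) * (eps / 3 / (G + 1))) by (field; lra). apply Rmult_lt_compat_l; lra. }
  destruct (psum_cont (closed_disc (RtoC 0) 1) z N (eps / 3) ltac:(lra)) as [d [Hd H]].
  exists d. split; [exact Hd|]. intros w Hw Hwz. specialize (H w Hw Hwz).
  pose proof (pser_tail w N (Hu w Hw)) as T1. pose proof (pser_tail z N (Hu z Hz)) as T2.
  rewrite bop_norm_minus_sym in T2.
  apply Rle_lt_trans with (bop_norm (plus (plus (minus (pser A w) (psum A w N)) (minus (psum A w N) (psum A z N)))
    (minus (psum A z N) (pser A z)))).
  { right. f_equal. op_ring. }
  eapply Rle_lt_trans; [apply bop_norm_triangle|].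
  eapply Rle_lt_trans; [apply Rplus_le_compat_r, bop_norm_triangle|]. lra.
Qed.

Definition dpow (k : nat) (z : C) : C :=
  match k with O => RtoC 0 | S m => (RtoC (INR (S m)) * z ^ m)%C end.

(** Induction: the remainder for k + 1 is w times that for k plus [dpow k z] times (w - z)^2. The
    bound k^2 sigma^(k - 2) is written with a division to avoid truncated subtraction in the
    exponent. *)
Lemma pow_second_order z w sigma k : 0 < sigma -> Cmod z <= sigma -> Cmod w <= sigma ->
  Cmod (w ^ k - z ^ k - dpow k z * (w - z)) <= INR k ^ 2 * sigma ^ k / sigma ^ 2 * Cmod (w - z) ^ 2.
Proof.
  intros Hs Hz Hw. set (h := (w - z)%C).
  assert (Hdp : forall k, Cmod (dpow k z) <= INR k * sigma ^ S k / sigma ^ 2).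
  { intros [|m].
    - simpl. rewrite Cmod_0. unfold Rdiv. rewrite !Rmult_0_l. lra.
    - unfold dpow. rewrite Cmod_mult, Cmod_R, (Rabs_pos_eq _ (pos_INR _)), Cmod_pow.
      replace (INR (S m) * sigma ^ S (S m) / sigma ^ 2) with (INR (S m) * sigma ^ m) by (simpl; field; lra).
      apply Rmult_le_compat_l; [apply pos_INR|]. apply pow_incr. split; [apply Cmod_ge_0|exact Hz]. }
  induction k as [|k IH].
  - replace (w ^ 0 - z ^ 0 - dpow 0 z * h)%C with (RtoC 0) by (simpl; ring).
    rewrite Cmod_0. simpl. lra.
  - assert (E : (w ^ S k - z ^ S k - dpow (S k) z * h = w * (w ^ k - z ^ k - dpow k z * h) + dpow k z * h * h)%C).
    { unfold h. destruct k as [|m].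
      - simpl. ring.
      - unfold dpow. rewrite (S_INR (S m)), RtoC_plus. simpl. ring. }
    rewrite E. eapply Rle_trans; [apply Cmod_triangle|]. rewrite !Cmod_mult.
    specialize (Hdp k). set (a := Cmod h) in *. assert (Ha : 0 <= a) by apply Cmod_ge_0.
    assert (A1 : Cmod w * Cmod (w ^ k - z ^ k - dpow k z * h) <= sigma * (INR k ^ 2 * sigma ^ k / sigma ^ 2 * a ^ 2)).
    { apply Rmult_le_compat; [apply Cmod_ge_0|apply Cmod_ge_0|exact Hw|exact IH]. }
    assert (A2 : Cmod (dpow k z) * a * a <= INR k * sigma ^ S k / sigma ^ 2 * a * a).
    { apply Rmult_le_compat_r; [exact Ha|]. apply Rmult_le_compat_r; [exact Ha|exact Hdp]. }
    rewrite S_INR. pose proof (pos_INR k).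
    assert (Hk : 0 <= sigma ^ S k / sigma ^ 2 * a ^ 2).
    { apply Rmult_le_pos; [|apply pow2_ge_0]. apply Rdiv_le_0_compat; [apply pow_le; lra|apply pow_lt; lra]. }
    apply Rle_trans with ((INR k ^ 2 + INR k) * (sigma ^ S k / sigma ^ 2 * a ^ 2)).
    + replace ((INR k ^ 2 + INR k) * (sigma ^ S k / sigma ^ 2 * a ^ 2)) with
        (sigma * (INR k ^ 2 * sigma ^ k / sigma ^ 2 * a ^ 2) + INR k * sigma ^ S k / sigma ^ 2 * a * a)
        by (simpl; field; lra). lra.
    + replace ((INR k + 1) ^ 2 * sigma ^ S k / sigma ^ 2 * a ^ 2) with ((INR k + 1) ^ 2 * (sigma ^ S k / sigma ^ 2 * a ^ 2))
        by (field; lra).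
      apply Rmult_le_compat_r; [exact Hk|]. nra.
Qed.

Fixpoint dpsum (z : C) (n : nat) : BOp V :=
  match n with O => zero | S m => plus (dpsum z m) (scal (dpow (S m) z) (A (S m))) end.

Lemma dpsum_S z n : dpsum z (S n) = plus (dpsum z n) (scal (dpow (S n) z) (A (S n))).
Proof. reflexivity. Qed.

Lemma geom_bound sigma n : 0 <= sigma < 1 -> sum_f_R0 (fun k => sigma ^ k) n <= / (1 - sigma).
Proof.
  intros Hs. rewrite tech3 by lra. apply Rmult_le_reg_r with (1 - sigma); [lra|].
  unfold Rdiv. rewrite Rmult_assoc, Rinv_l by lra. pose proof (pow_le sigma (S n) (proj1 Hs)). lra.
Qed.

(** For sigma strictly between |z| and 1, the factor k^2 of [pow_second_order] is compensated by the
    decay G / (k + 1)^2 of the coefficients, which leaves a geometric series in sigma and a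
    quadratic remainder. *)
Lemma pser_deriv z : Cmod z < 1 -> exists L, oderiv (pser A) z L.
Proof.
  intros Hz. set (sigma := (1 + Cmod z) / 2). pose proof (Cmod_ge_0 z) as Hz0. pose proof pser_G_pos as HG.
  assert (Hs : 0 < sigma < 1) by (unfold sigma; lra).
  assert (Hzs : Cmod z < sigma) by (unfold sigma; lra).
  assert (Hs2 : 0 < sigma ^ 2) by (apply pow_lt; lra).
  destruct (limO_seq_exists (dpsum z) (fun n => G / sigma * sigma ^ n) (G / sigma * / (1 - sigma))) as [L HL].
  { intros n. rewrite dpsum_S.
    apply Rle_trans with (bop_norm (scal (dpow (S n) z) (A (S n)))).
    { right. f_equal. op_ring. }
    eapply Rle_trans; [apply bop_norm_scal|]. unfold dpow.
    rewrite Cmod_mult, Cmod_R, (Rabs_pos_eq _ (pos_INR _)), Cmod_pow.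
    assert (Hp : Cmod z ^ n <= sigma ^ n) by (apply pow_incr; lra).
    pose proof (HA (S n)) as HAn. pose proof (pos_INR (S n)) as Hn. pose proof (bop_norm_ge_0 (A (S n))).
    assert (Hq : 0 <= Cmod z ^ n) by (apply pow_le; lra).
    assert (HAn2 : INR (S n) * bop_norm (A (S n)) <= G).
    { apply Rle_trans with ((INR (S n) + 1) ^ 2 * (G / (INR (S n) + 1) ^ 2)).
      - apply Rmult_le_compat; try assumption. nra.
      - right. field. lra. }
    replace (G / sigma * sigma ^ S n) with (G * sigma ^ n) by (simpl; field; lra).
    replace (INR (S n) * Cmod z ^ n * bop_norm (A (S n))) with (INR (S n) * bop_norm (A (S n)) * Cmod z ^ n) by ring.
    apply Rmult_le_compat; try assumption. apply Rmult_le_pos; assumption. }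
  { intros n. apply Rle_trans with (G / sigma * sum_f_R0 (fun k => sigma ^ k) n).
    - right. rewrite scal_sum. apply sum_eq. intros; ring.
    - apply Rmult_le_compat_l; [apply Rdiv_le_0_compat; lra|]. apply geom_bound. lra. }
  exists L. set (K := G / sigma ^ 2 * / (1 - sigma)).
  assert (HK : 0 <= K).
  { unfold K. apply Rmult_le_pos; [apply Rdiv_le_0_compat; lra|]. left. apply Rinv_0_lt_compat. lra. }
  assert (Hb : forall w, Cmod w <= sigma ->
    bop_norm (minus (minus (pser A w) (pser A z)) (scal (w - z)%C L)) <= K * Cmod (w - z) ^ 2).
  { intros w Hw.
    apply (limO_norm_bound (F := eventually)
      (fun n => minus (minus (psum A w n) (psum A z n)) (scal (w - z)%C (dpsum z n)))).
    - apply limO_minus; [apply limO_minus; apply pser_lim; lra|].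
      apply limO_scal; [apply limC_const|exact HL].
    - exists 0%nat. intros n _. pose proof (pow2_ge_0 (Cmod (w - z))) as Hsq.
      apply Rle_trans with (G / sigma ^ 2 * sum_f_R0 (fun k => sigma ^ k) n * Cmod (w - z) ^ 2).
      2:{ apply Rmult_le_compat_r; [exact Hsq|]. unfold K.
          apply Rmult_le_compat_l; [apply Rdiv_le_0_compat; lra|apply geom_bound; lra]. }
      induction n as [|n IH].
      + change (psum A w 0) with (A O). change (psum A z 0) with (A O).
        change (dpsum z 0) with (zero : BOp V).
        apply Rle_trans with (bop_norm (zero : BOp V)).
        * right. f_equal. op_ring.
        * eapply Rle_trans; [right; exact bop_norm_zero|]. apply Rmult_le_pos; [|exact Hsq].
          simpl sum_f_R0. rewrite Rmult_1_r. apply Rdiv_le_0_compat; [lra|exact Hs2].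
      + rewrite !psum_S. rewrite dpsum_S. rewrite tech5.
        apply Rle_trans with (bop_norm (plus (minus (minus (psum A w n) (psum A z n)) (scal (w - z)%C (dpsum z n)))
          (scal (w ^ S n - z ^ S n - dpow (S n) z * (w - z))%C (A (S n))))).
        { right. f_equal. op_ring. }
        eapply Rle_trans; [apply bop_norm_triangle|].
        eapply Rle_trans; [apply Rplus_le_compat; [exact IH|apply bop_norm_scal]|].
        pose proof (pow_second_order z w sigma (S n) ltac:(lra) ltac:(lra) Hw) as H1.
        pose proof (HA (S n)) as HAn. pose proof (pos_INR (S n)) as Hn.
        assert (H2 : Cmod (w ^ S n - z ^ S n - dpow (S n) z * (w - z)) * bop_norm (A (S n)) <=
          G / sigma ^ 2 * sigma ^ S n * Cmod (w - z) ^ 2).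
        { apply Rle_trans with ((INR (S n) ^ 2 * sigma ^ S n / sigma ^ 2 * Cmod (w - z) ^ 2) * (G / (INR (S n) + 1) ^ 2)).
          - apply Rmult_le_compat; [apply Cmod_ge_0|apply bop_norm_ge_0|exact H1|exact HAn].
          - set (q := sigma ^ S n / sigma ^ 2 * Cmod (w - z) ^ 2 * G).
            assert (Hq : 0 <= q).
            { unfold q. apply Rmult_le_pos; [|exact HG]. apply Rmult_le_pos; [|exact Hsq].
              apply Rdiv_le_0_compat; [apply pow_le; lra|exact Hs2]. }
            replace (INR (S n) ^ 2 * sigma ^ S n / sigma ^ 2 * Cmod (w - z) ^ 2 * (G / (INR (S n) + 1) ^ 2)) with
              ((INR (S n) ^ 2 / (INR (S n) + 1) ^ 2) * q) by (unfold q; field; lra).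
            replace (G / sigma ^ 2 * sigma ^ S n * Cmod (w - z) ^ 2) with (1 * q) by (unfold q; field; lra).
            apply Rmult_le_compat_r; [exact Hq|]. apply Rle_div_l; [apply pow_lt; lra|].
            rewrite Rmult_1_l. apply pow_incr. lra. }
        change (sigma * sigma ^ n) with (sigma ^ S n). lra. }
  intros eps He. exists (Rmin (sigma - Cmod z) (eps / (K + 1))).
  split; [apply Rmin_pos; [lra|apply Rdiv_lt_0_compat; lra]|]. intros w Hw.
  pose proof (Rmin_l (sigma - Cmod z) (eps / (K + 1))). pose proof (Rmin_r (sigma - Cmod z) (eps / (K + 1))).
  eapply Rle_trans; [apply Hb|].
  - replace w with ((w - z) + z)%C by ring. eapply Rle_trans; [apply Cmod_triangle|]. lra.
  - pose proof (Cmod_ge_0 (w - z)). replace (K * Cmod (w - z) ^ 2) with (K * Cmod (w - z) * Cmod (w - z)) by ring.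
    apply Rmult_le_compat_r; [assumption|].
    replace eps with ((K + 1) * (eps / (K + 1))) by (field; lra).
    apply Rmult_le_compat; lra.
Qed.

Lemma pser_oholo : oholo (RtoC 0) 1 (pser A).
Proof.
  split; [exact pser_cont|]. intros z Hz. apply pser_deriv.
  unfold open_disc in Hz. replace z with (z - RtoC 0)%C by ring. exact Hz.
Qed.

Lemma pser_0 : pser A (RtoC 0) = A O.
Proof.
  apply (limO_unique (F := eventually) (psum A (RtoC 0))).
  - apply pser_lim. rewrite Cmod_0. lra.
  - apply limO_ext with (fun _ => A O); [|apply limO_const].
    intros n. induction n as [|n IH]; [reflexivity|]. rewrite psum_S, <- IH.
    apply op_ext_inner; intros u w; inner_simpl. simpl. ring.
Qed.

End WithBound.
End PowerSeries.

(** * Fourier coefficients and truncated square sums *)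

Lemma ek_pow k t : ek (Z.of_nat k) t = (ek 1 t ^ k)%C.
Proof.
  induction k as [|k IH]; [apply ek_0|].
  rewrite Nat2Z.inj_succ, <- Z.add_1_l, ek_plus, IH. reflexivity.
Qed.

(** The product g h is split into squares with weights b / a and a / b. Since a and b may vanish,
    the bound is first proved for larger positive numbers. *)
Lemma cavg_cauchy_schwarz f g h m a b : contC f -> contR g -> contR h -> 0 <= m -> 0 <= a -> 0 <= b ->
  (forall t, Cmod (f t) <= m * (g t * h t)) -> (forall t, 0 <= g t) -> (forall t, 0 <= h t) ->
  contR (fun t => g t ^ 2) -> contR (fun t => h t ^ 2) ->
  ravg (fun t => g t ^ 2) <= a ^ 2 -> ravg (fun t => h t ^ 2) <= b ^ 2 ->
  Cmod (cavg f) <= m * (a * b).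
Proof.
  intros Hf Hg Hh Hm Ha Hb Hfgh Hg0 Hh0 Hg2 Hh2 Hga Hhb.
  assert (Hpos : forall a' b', 0 < a' -> 0 < b' -> a <= a' -> b <= b' -> Cmod (cavg f) <= m * (a' * b')).
  { intros a' b' Ha' Hb' Haa Hbb.
    assert (H1 : Cmod (cavg f) <= ravg (fun t => m / 2 * (b' / a') * g t ^ 2 + m / 2 * (a' / b') * h t ^ 2)).
    { apply cavg_le_ravg; [exact Hf|apply contR_plus; apply contR_scal; assumption|].
      intros t. eapply Rle_trans; [apply Hfgh|].
      pose proof (pow2_ge_0 (b' * g t - a' * h t)) as Hs.
      assert (Hi : 0 < / (a' * b')) by (apply Rinv_0_lt_compat, Rmult_lt_0_compat; assumption).
      assert (0 <= m / 2 * (/ (a' * b') * (b' * g t - a' * h t) ^ 2)).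
      { apply Rmult_le_pos; [lra|]. apply Rmult_le_pos; lra. }
      replace (m / 2 * (/ (a' * b') * (b' * g t - a' * h t) ^ 2)) with
        (m / 2 * (b' / a') * g t ^ 2 + m / 2 * (a' / b') * h t ^ 2 - m * (g t * h t)) in H by (field; lra).
      lra. }
    rewrite ravg_plus, !ravg_scal in H1 by (try apply contR_scal; assumption).
    assert (Hba : 0 < b' / a') by (apply Rdiv_lt_0_compat; assumption).
    assert (Hab : 0 < a' / b') by (apply Rdiv_lt_0_compat; assumption).
    assert (Ga : ravg (fun t => g t ^ 2) <= a' ^ 2).
    { eapply Rle_trans; [exact Hga|]. apply pow_incr. lra. }
    assert (Gb : ravg (fun t => h t ^ 2) <= b' ^ 2).
    { eapply Rle_trans; [exact Hhb|]. apply pow_incr. lra. }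
    assert (A1 : m / 2 * (b' / a') * ravg (fun t => g t ^ 2) <= m / 2 * (b' / a') * a' ^ 2).
    { apply Rmult_le_compat_l; [|exact Ga]. apply Rmult_le_pos; lra. }
    assert (A2 : m / 2 * (a' / b') * ravg (fun t => h t ^ 2) <= m / 2 * (a' / b') * b' ^ 2).
    { apply Rmult_le_compat_l; [|exact Gb]. apply Rmult_le_pos; lra. }
    replace (m / 2 * (b' / a') * a' ^ 2) with (m / 2 * (a' * b')) in A1 by (field; lra).
    replace (m / 2 * (a' / b') * b' ^ 2) with (m / 2 * (a' * b')) in A2 by (field; lra). lra. }
  apply le_epsilon. intros eps He.
  set (d := Rmin 1 (eps / (m * (a + b + 1) + 1))).
  assert (Hden : 0 < m * (a + b + 1) + 1) by (assert (0 <= m * (a + b + 1)) by (apply Rmult_le_pos; lra); lra).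
  assert (Hd : 0 < d) by (apply Rmin_pos; [lra|apply Rdiv_lt_0_compat; assumption]).
  pose proof (Rmin_l 1 (eps / (m * (a + b + 1) + 1))) as D1. pose proof (Rmin_r 1 (eps / (m * (a + b + 1) + 1))) as D2.
  fold d in D1, D2.
  eapply Rle_trans; [apply (Hpos (a + d) (b + d)); lra|].
  replace (m * ((a + d) * (b + d))) with (m * (a * b) + m * (a + b + d) * d) by ring.
  apply Rplus_le_compat_l.
  apply Rle_trans with ((m * (a + b + 1) + 1) * (eps / (m * (a + b + 1) + 1))).
  - apply Rmult_le_compat; [apply Rmult_le_pos; lra|lra| |exact D2].
    assert (m * (a + b + d) <= m * (a + b + 1)) by (apply Rmult_le_compat_l; lra). lra.
  - right. field. lra.
Qed.

Fixpoint csum (f : nat -> C) (n : nat) : C :=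
  match n with O => f O | S m => (csum f m + f (S m))%C end.

Lemma csum_ext f g n : (forall k, (k <= n)%nat -> f k = g k) -> csum f n = csum g n.
Proof.
  induction n as [|n IH]; intros H; simpl; [apply H; lia|].
  rewrite IH by (intros; apply H; lia). rewrite H by lia. reflexivity.
Qed.

Lemma csum_plus f g n : csum (fun k => f k + g k)%C n = (csum f n + csum g n)%C.
Proof. induction n as [|n IH]; simpl; [reflexivity|]. rewrite IH. ring. Qed.

Section FourierEstimates.
Context {V : HilbertSpace}.
Implicit Types (A B : nat -> BOp V) (F : R -> BOp V) (v w : V).

Definition nsq A v (n : nat) : R := sum_f_R0 (fun k => norm (A k v) ^ 2) n.
Definition l2 A v n : R := sqrt (nsq A v n).

Lemma nsq_ge_0 A v n : 0 <= nsq A v n.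
Proof. apply cond_pos_sum. intros k. apply pow2_ge_0. Qed.

Lemma l2_sq A v n : l2 A v n ^ 2 = nsq A v n.
Proof. unfold l2. rewrite pow2_sqrt; [reflexivity|apply nsq_ge_0]. Qed.

Lemma l2_ge_0 A v n : 0 <= l2 A v n.
Proof. apply sqrt_pos. Qed.

Lemma l2_coef A v n k : (k <= n)%nat -> norm (A k v) <= l2 A v n.
Proof.
  intros Hk. apply Rsqr_incr_0; [|apply vnorm_ge_0|apply l2_ge_0].
  rewrite !Rsqr_pow2, l2_sq. unfold nsq.
  induction n as [|n IH].
  - replace k with O by lia. simpl. lra.
  - rewrite tech5. destruct (Nat.eq_dec k (S n)) as [->|Hne].
    + pose proof (nsq_ge_0 A v n) as H. unfold nsq in H. lra.
    + pose proof (IH ltac:(lia)). pose proof (pow2_ge_0 (norm (A (S n) v))). lra.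
Qed.

Lemma contC_cexp_pow k : contC (fun t => ek 1 t ^ k)%C.
Proof.
  replace (fun t => ek 1 t ^ k)%C with (ek (Z.of_nat k)); [apply contC_ek|].
  apply functional_extensionality. intros t. apply ek_pow.
Qed.

Lemma contO_psum A n : contO (fun t => psum A (ek 1 t) n).
Proof.
  induction n as [|n IH]; [exact (contO_const (A O))|].
  apply (contO_plus (fun t => psum A (ek 1 t) n) (fun t => scal (ek 1 t ^ S n)%C (A (S n)))); [exact IH|].
  apply contO_scal; [apply contC_cexp_pow|apply contO_const].
Qed.

Lemma contC_inner_psum F A n v w : contO F -> contC (fun t => inner (F t (psum A (ek 1 t) n v)) w).
Proof.
  intros HF. apply (contC_inner (fun t => mult (F t) (psum A (ek 1 t) n))).
  apply contO_mult; [exact HF|apply contO_psum].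
Qed.

Lemma inner_psum_r A n v (a : V) z :
  inner a (psum A z n v) = csum (fun k => Cconj (z ^ k) * inner a (A k v))%C n.
Proof.
  induction n as [|n IH].
  - simpl. replace (Cconj (RtoC 1)) with (RtoC 1) by ceq. ring.
  - rewrite psum_S. inner_simpl. rewrite IH. reflexivity.
Qed.

Lemma ek_neg_pow k t : ek (- Z.of_nat k) t = Cconj (ek 1 t ^ k)%C.
Proof. rewrite ek_opp, ek_pow. reflexivity. Qed.

Lemma cavg_csum (f : nat -> R -> C) n : (forall k, contC (f k)) ->
  cavg (fun t => csum (fun k => f k t) n) = csum (fun k => cavg (f k)) n.
Proof.
  intros Hf. assert (Hc : forall n, contC (fun t => csum (fun k => f k t) n)).
  { intros m. induction m as [|m IH]; [apply Hf|]. simpl. apply contC_plus; [exact IH|apply Hf]. }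
  induction n as [|n IH]; [reflexivity|]. simpl. rewrite cavg_plus, IH; [reflexivity|apply Hc|apply Hf].
Qed.

Lemma pairing F A n v B m w : contO F ->
  cavg (fun t => inner (F t (psum A (ek 1 t) n v)) (psum B (ek 1 t) m w)) =
  csum (fun k => cavg (fun t => ek (- Z.of_nat k) t * inner (F t (psum A (ek 1 t) n v)) (B k w))%C) m.
Proof.
  intros HF.
  rewrite <- (cavg_csum (fun k t => ek (- Z.of_nat k) t * inner (F t (psum A (ek 1 t) n v)) (B k w))%C).
  - apply cavg_ext. intros t. rewrite inner_psum_r. apply csum_ext. intros k _. rewrite ek_neg_pow. reflexivity.
  - intros k. apply contC_mult; [apply contC_ek|apply contC_inner_psum, HF].
Qed.

Lemma psum_coef A n v w (k : Z) :
  cavg (fun t => ek (- k) t * inner (psum A (ek 1 t) n v) w)%C =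
  if Z_le_dec 0 k then if Z_le_dec k (Z.of_nat n) then inner (A (Z.to_nat k) v) w else RtoC 0 else RtoC 0.
Proof.
  induction n as [|n IH].
  - rewrite (cavg_ext _ (fun t => inner (A O v) w * ek (- k) t)%C) by (intros t; simpl; ring).
    rewrite cavg_scal, cavg_ek by apply contC_ek. simpl (Z.of_nat 0).
    destruct (Z.eq_dec (- k) 0), (Z_le_dec 0 k), (Z_le_dec k 0); try lia; try ring.
    replace (Z.to_nat k) with O by lia. ring.
  - rewrite (cavg_ext _ (fun t => ek (- k) t * inner (psum A (ek 1 t) n v) w +
      inner (A (S n) v) w * ek (- k + Z.of_nat (S n)) t)%C).
    + rewrite cavg_plus, cavg_scal, IH, cavg_ek.
      * destruct (Z.eq_dec (- k + Z.of_nat (S n)) 0), (Z_le_dec 0 k), (Z_le_dec k (Z.of_nat n)), (Z_le_dec k (Z.of_nat (S n)));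
          try lia; try ring.
        replace (Z.to_nat k) with (S n) by lia. ring.
      * apply contC_ek.
      * apply contC_mult; [apply contC_ek|]. apply (contC_inner (fun t => psum A (ek 1 t) n)), contO_psum.
      * apply contC_mult; [apply contC_const|apply contC_ek].
    + intros t. rewrite psum_S, ek_plus, ek_pow. inner_simpl. ring.
Qed.

(** Parseval for trigonometric polynomials: [pairing] with F = 1, where each coefficient of the
    polynomial meets itself. *)
Lemma ravg_psum_sq A n v : ravg (fun t => norm (psum A (ek 1 t) n v) ^ 2) = nsq A v n.
Proof.
  transitivity (Re (cavg (fun t => inner ((one : BOp V) (psum A (ek 1 t) n v)) (psum A (ek 1 t) n v)))).
  - simpl. apply ravg_ext. intros t. apply norm_sq_inner.
  - rewrite pairing by apply contO_const.
    rewrite (csum_ext _ (fun k => inner (A k v) (A k v))).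
    + unfold nsq. induction n as [|n IH].
      * simpl. rewrite <- norm_sq_inner. reflexivity.
      * rewrite tech5, <- IH. simpl csum. rewrite norm_sq_inner. reflexivity.
    + intros k Hk.
      pose proof (psum_coef A n v (A k v) (Z.of_nat k)) as E.
      destruct (Z_le_dec 0 (Z.of_nat k)); [|lia]. destruct (Z_le_dec (Z.of_nat k) (Z.of_nat n)); [|lia].
      rewrite Nat2Z.id in E. exact E.
Qed.

Lemma contR_norm_psum_sq A n v : contR (fun t => norm (psum A (ek 1 t) n v) ^ 2).
Proof.
  replace (fun t => norm (psum A (ek 1 t) n v) ^ 2) with
    (fun t => Re (inner (psum A (ek 1 t) n v) (psum A (ek 1 t) n v))).
  - apply (contC_re (fun t => inner (psum A (ek 1 t) n v) (psum A (ek 1 t) n v))).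
    apply (contC_inner2 (fun t => psum A (ek 1 t) n) (fun t => psum A (ek 1 t) n)); apply contO_psum.
  - apply functional_extensionality. intros t. rewrite norm_sq_inner. reflexivity.
Qed.

Lemma contR_norm_psum A n v : contR (fun t => norm (psum A (ek 1 t) n v)).
Proof.
  replace (fun t => norm (psum A (ek 1 t) n v)) with (fun t => sqrt (norm (psum A (ek 1 t) n v) ^ 2)).
  - intros t. apply (continuous_comp (fun t => norm (psum A (ek 1 t) n v) ^ 2) sqrt).
    + apply contR_norm_psum_sq.
    + apply continuous_sqrt.
  - apply functional_extensionality. intros t. apply sqrt_pow2, vnorm_ge_0.
Qed.

(** Boundedness of L as a functional on square-summable vector sequences, required on every
    truncation. A sequence of vectors is presented as a sequence of operators applied to one
    vector. *)
Definition bounded_on_l2 (L : nat -> V -> C) (c : R) : Prop :=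
  forall B w n, Cmod (csum (fun k => L k (B k w)) n) <= c * l2 B w n.

(** The k-th Fourier coefficient of t -> F(t) p(t) v tested against w, where p is the polynomial
    with coefficients A up to degree n. *)
Definition coef F A (n : nat) (v : V) (k : Z) (w : V) : C :=
  cavg (fun t => ek (- k) t * inner (F t (psum A (ek 1 t) n v)) w)%C.

Lemma coef_bounded_on_l2 F A n v mu : contO F -> 0 <= mu -> (forall t, bop_norm (F t) <= mu) ->
  bounded_on_l2 (fun k w => coef F A n v (Z.of_nat k) w) (mu * l2 A v n).
Proof.
  intros HF Hmu Hb B w m. unfold coef. rewrite <- pairing by exact HF.
  rewrite Rmult_assoc.
  apply (cavg_cauchy_schwarz _ (fun t => norm (psum A (ek 1 t) n v)) (fun t => norm (psum B (ek 1 t) m w))).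
  - apply (contC_inner2 (fun t => mult (F t) (psum A (ek 1 t) n)) (fun t => psum B (ek 1 t) m));
      [apply contO_mult; [exact HF|]|]; apply contO_psum.
  - apply contR_norm_psum.
  - apply contR_norm_psum.
  - exact Hmu.
  - apply l2_ge_0.
  - apply l2_ge_0.
  - intros t. eapply Rle_trans; [apply inner_op_le|].
    rewrite Rmult_assoc. apply Rmult_le_compat_r; [|apply Hb].
    apply Rmult_le_pos; apply vnorm_ge_0.
  - intros t. apply vnorm_ge_0.
  - intros t. apply vnorm_ge_0.
  - apply contR_norm_psum_sq.
  - apply contR_norm_psum_sq.
  - rewrite ravg_psum_sq, l2_sq. lra.
  - rewrite ravg_psum_sq, l2_sq. lra.
Qed.

Lemma coef_le F A n v mu k w : contO F -> 0 <= mu -> (forall t, bop_norm (F t) <= mu) ->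
  Cmod (coef F A n v k w) <= mu * (l2 A v n * norm w).
Proof.
  intros HF Hmu Hb. unfold coef.
  apply (cavg_cauchy_schwarz _ (fun t => norm (psum A (ek 1 t) n v)) (fun _ => norm w)).
  - apply contC_mult; [apply contC_ek|apply contC_inner_psum, HF].
  - apply contR_norm_psum.
  - apply contR_const.
  - exact Hmu.
  - apply l2_ge_0.
  - apply vnorm_ge_0.
  - intros t. rewrite Cmod_mult, Cmod_ek, Rmult_1_l.
    eapply Rle_trans; [apply inner_op_le|].
    rewrite Rmult_assoc. apply Rmult_le_compat_r; [|apply Hb].
    apply Rmult_le_pos; apply vnorm_ge_0.
  - intros t. apply vnorm_ge_0.
  - intros t. apply vnorm_ge_0.
  - apply contR_norm_psum_sq.
  - apply contR_const.
  - rewrite ravg_psum_sq, l2_sq. lra.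
  - rewrite ravg_const. lra.
Qed.

Lemma bounded_on_l2_plus L L' c c' : bounded_on_l2 L c -> bounded_on_l2 L' c' ->
  bounded_on_l2 (fun k w => L k w + L' k w)%C (c + c').
Proof.
  intros H H' B w n. rewrite csum_plus. eapply Rle_trans; [apply Cmod_triangle|].
  specialize (H B w n). specialize (H' B w n). lra.
Qed.

(* Riesz representation for the truncated sequence space: test [L] against [q]. *)
Lemma l2_le_of_bounded L c (q : nat -> BOp V) v n : 0 <= c -> bounded_on_l2 L c -> (q O v : V) = zero ->
  (forall k, (1 <= k <= n)%nat -> forall w, inner (q k v) w = L k w) -> l2 q v n <= c.
Proof.
  intros Hc HL H0 Hq.
  assert (HL0 : L O zero = RtoC 0).
  { pose proof (HL (fun _ => zero) v O) as H. simpl in H. unfold l2, nsq in H. simpl in H.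
    change (Cmod (L O zero) <= c * sqrt (norm (zero : V) * (norm (zero : V) * 1))) in H.
    rewrite vnorm_zero, Rmult_0_l, sqrt_0, Rmult_0_r in H.
    apply Cmod_eq_0. pose proof (Cmod_ge_0 (L O zero)). lra. }
  assert (E : csum (fun k => L k (q k v)) n = RtoC (nsq q v n)).
  { unfold nsq. rewrite (csum_ext _ (fun k => RtoC (norm (q k v) ^ 2))).
    - clear. induction n as [|n IH]; [reflexivity|]. rewrite tech5, RtoC_plus, <- IH. reflexivity.
    - intros k Hk. destruct k as [|k].
      + rewrite H0, HL0, vnorm_zero. f_equal. simpl. ring.
      + rewrite <- Hq by lia. apply inner_norm. }
  pose proof (HL q v n) as H. rewrite E, Cmod_R, Rabs_pos_eq, <- l2_sq in H by apply nsq_ge_0.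
  pose proof (l2_ge_0 q v n). simpl in H. destruct (Req_dec (l2 q v n) 0) as [E0|E0]; [lra|].
  apply Rmult_le_reg_r with (l2 q v n); lra.
Qed.

(** The coefficients of D p for D = -i d/dt on the circle. *)
Definition dseq A (k : nat) : BOp V := scal (RtoC (INR k)) (A k).

(** The Leibniz rule for D = -i d/dt on the product F p, read on Fourier coefficients: D multiplies
    the k-th one by k, sends F to F1 and p to the polynomial with coefficients [dseq A]. The proof
    treats one monomial at a time by parts. *)
Lemma coef_shift F F1 A n v (k : Z) w : contO F -> contO F1 ->
  (forall (a b : V) t, derC (fun s => inner (F s a) b) t (Ci * inner (F1 t a) b)%C) ->
  F (2 * PI) = F 0 ->
  (RtoC (IZR k) * coef F A n v k w = coef F (dseq A) n v k w + coef F1 A n v k w)%C.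
Proof.
  intros HF HF1 Hder Hper. unfold coef.
  assert (Hone : forall (a : V) (j : nat),
    (RtoC (IZR k) * cavg (fun t => ek (- k) t * (ek 1 t ^ j * inner (F t a) w)) =
     RtoC (INR j) * cavg (fun t => ek (- k) t * (ek 1 t ^ j * inner (F t a) w)) +
     cavg (fun t => ek (- k) t * (ek 1 t ^ j * inner (F1 t a) w)))%C).
  { intros a j.
    assert (Hc : contC (fun t => ek 1 t ^ j * inner (F t a) w)%C).
    { apply contC_mult; [apply contC_cexp_pow|apply contC_inner, HF]. }
    assert (Hc1 : contC (fun t => ek 1 t ^ j * inner (F1 t a) w)%C).
    { apply contC_mult; [apply contC_cexp_pow|apply contC_inner, HF1]. }
    rewrite (cavg_by_parts k (fun t => ek 1 t ^ j * inner (F t a) w)%C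
      (fun t => Ci * RtoC (IZR (Z.of_nat j)) * ek (Z.of_nat j) t * inner (F t a) w + ek (Z.of_nat j) t * (Ci * inner (F1 t a) w))%C).
    - rewrite <- cavg_scal by auto using contC_mult, contC_ek.
      rewrite <- cavg_plus by auto using contC_mult, contC_ek, contC_const.
      apply cavg_ext. intros t. rewrite ek_pow, <- INR_IZR_INZ.
      set (p := (ek 1 t ^ j)%C). set (x := inner (F t a) w). set (y := inner (F1 t a) w).
      replace (- Ci * (Ci * RtoC (INR j) * p * x + p * (Ci * y)))%C with ((- Ci * Ci) * (RtoC (INR j) * p * x + p * y))%C by ring.
      replace (- Ci * Ci)%C with (RtoC 1) by (unfold Ci; ceq). ring.
    - intros t. replace (fun t => ek 1 t ^ j * inner (F t a) w)%C with (fun t => ek (Z.of_nat j) t * inner (F t a) w)%C.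
      + apply derC_mult; [apply derC_ek|apply Hder].
      + apply functional_extensionality. intros s. rewrite ek_pow. reflexivity.
    - replace (fun t => (Ci * RtoC (IZR (Z.of_nat j)) * ek (Z.of_nat j) t * inner (F t a) w + ek (Z.of_nat j) t * (Ci * inner (F1 t a) w))%C) with
        (fun t => (Ci * RtoC (IZR (Z.of_nat j)) * (ek (Z.of_nat j) t * inner (F t a) w) + ek (Z.of_nat j) t * (Ci * inner (F1 t a) w))%C)
        by (apply functional_extensionality; intros; ring).
      pose proof (contC_inner F a w HF). pose proof (contC_inner F1 a w HF1).
      apply contC_plus; repeat apply contC_mult; auto using contC_const, contC_ek.
    - rewrite Hper. rewrite <- !ek_pow, ek_period. reflexivity. }
  induction n as [|n IH].
  - simpl psum. pose proof (Hone (A O v) O) as E.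
    rewrite (cavg_ext (fun t => ek (- k) t * (ek 1 t ^ 0 * inner (F t (A O v)) w))%C
      (fun t => ek (- k) t * inner (F t (A O v)) w)%C) in E by (intros t; simpl; ring).
    rewrite (cavg_ext (fun t => ek (- k) t * (ek 1 t ^ 0 * inner (F1 t (A O v)) w))%C
      (fun t => ek (- k) t * inner (F1 t (A O v)) w)%C) in E by (intros t; simpl; ring).
    rewrite E. f_equal.
    rewrite <- cavg_scal by (apply contC_mult; [apply contC_ek|apply contC_inner, HF]).
    apply cavg_ext. intros t. unfold dseq. inner_simpl. ring.
  - assert (Hsplit : forall G (B : nat -> BOp V), contO G ->
      cavg (fun t => ek (- k) t * inner (G t (psum B (ek 1 t) (S n) v)) w)%C =
      (cavg (fun t => ek (- k) t * inner (G t (psum B (ek 1 t) n v)) w) +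
       cavg (fun t => ek (- k) t * (ek 1 t ^ S n * inner (G t (B (S n) v)) w)))%C).
    { intros G B HG. rewrite <- cavg_plus.
      - apply cavg_ext. intros t. rewrite psum_S. inner_simpl. ring.
      - apply contC_mult; [apply contC_ek|apply contC_inner_psum, HG].
      - apply contC_mult; [apply contC_ek|]. apply contC_mult; [apply contC_cexp_pow|apply contC_inner, HG]. }
    rewrite !Hsplit by assumption. rewrite Cmult_plus_distr_l, IH, Hone.
    replace (cavg (fun t => ek (- k) t * (ek 1 t ^ S n * inner (F t (dseq A (S n) v)) w))%C) with
      (RtoC (INR (S n)) * cavg (fun t => ek (- k) t * (ek 1 t ^ S n * inner (F t (A (S n) v)) w)))%C.
    + ring.
    + rewrite <- cavg_scal.
      * apply cavg_ext. intros t. unfold dseq. inner_simpl. ring.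
      * apply contC_mult; [apply contC_ek|]. apply contC_mult; [apply contC_cexp_pow|apply contC_inner, HF].
Qed.

End FourierEstimates.

Section L2More.
Context {V : HilbertSpace}.
Implicit Types (A B : nat -> BOp V) (F : R -> BOp V) (v w : V).

(** The coefficient at 0 of the iterates is prescribed; the recursion, and with it the contraction
    estimate, concerns only the others. *)
Definition drop_head A (k : nat) : BOp V := match k with O => zero | S _ => A k end.

Lemma sqrt_sum_le a b : 0 <= a -> 0 <= b -> sqrt (a ^ 2 + b ^ 2) <= a + b.
Proof.
  intros Ha Hb. rewrite <- (sqrt_pow2 (a + b)) by lra. apply sqrt_le_1_alt.
  assert (0 <= a * b) by (apply Rmult_le_pos; assumption). nra.
Qed.

Lemma l2_head A v n : l2 A v n <= norm (A O v) + l2 (drop_head A) v n.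
Proof.
  assert (E : nsq A v n = norm (A O v) ^ 2 + nsq (drop_head A) v n).
  { unfold nsq. induction n as [|n IH].
    - cbn [sum_f_R0 drop_head]. change ((zero : BOp V) v) with (zero : V). rewrite vnorm_zero. ring.
    - rewrite !tech5, IH. cbn [drop_head]. ring. }
  unfold l2 at 1. rewrite E, <- (l2_sq (drop_head A)).
  apply sqrt_sum_le; [apply vnorm_ge_0|apply l2_ge_0].
Qed.

Lemma l2_last A v n : l2 A v (S n) <= l2 A v n + norm (A (S n) v).
Proof.
  unfold l2 at 1. unfold nsq. rewrite tech5. fold (nsq A v n). rewrite <- l2_sq.
  apply sqrt_sum_le; [apply l2_ge_0|apply vnorm_ge_0].
Qed.

Lemma coef_minus F A B n v k w : contO F ->
  coef F (fun i => minus (A i) (B i)) n v k w = (coef F A n v k w - coef F B n v k w)%C.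
Proof.
  intros HF. unfold coef.
  rewrite <- cavg_minus by (apply contC_mult; [apply contC_ek|apply contC_inner_psum, HF]).
  apply cavg_ext. intros t.
  replace (psum (fun i => minus (A i) (B i)) (ek 1 t) n) with (minus (psum A (ek 1 t) n) (psum B (ek 1 t) n) : BOp V).
  - inner_simpl. ring.
  - induction n as [|n IH]; [reflexivity|]. rewrite !psum_S, <- IH. op_ring.
Qed.

Lemma inner_bound_norm (A : BOp V) c : 0 <= c ->
  (forall v w, Cmod (inner (A v) w) <= c * (norm v * norm w)) -> bop_norm A <= c.
Proof.
  intros Hc H. apply bop_norm_le; [exact Hc|]. intros v. apply norm_le_inner.
  - apply Rmult_le_pos; [exact Hc|apply vnorm_ge_0].
  - eapply Rle_trans; [eapply Rle_trans; [apply Rle_abs|apply re_le_Cmod]|].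
    eapply Rle_trans; [apply H|]. lra.
Qed.

End L2More.

(** * Factorization of a positive operator function on the circle *)

Section Factorization.
Context {V : HilbertSpace}.
Variables (E E1 E2 : R -> BOp V) (rho M : R).
Hypothesis E_cont : contO E.
Hypothesis E1_cont : contO E1.
Hypothesis E2_cont : contO E2.
Hypothesis E_der : forall (a b : V) t, derC (fun s => inner (E s a) b) t (Ci * inner (E1 t a) b)%C.
Hypothesis E1_der : forall (a b : V) t, derC (fun s => inner (E1 s a) b) t (Ci * inner (E2 t a) b)%C.
Hypothesis E_per : E (2 * PI) = E 0.
Hypothesis E1_per : E1 (2 * PI) = E1 0.
Hypothesis rho_bd : 0 <= rho < 1.
Hypothesis M_pos : 0 <= M.
Hypothesis E_bd : forall t, bop_norm (E t) <= rho.
Hypothesis E1_bd : forall t, bop_norm (E1 t) <= M.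
Hypothesis E2_bd : forall t, bop_norm (E2 t) <= M.

(* Iterates for the equation [h = 1 + (positive frequencies of E h)], with the
   frequencies truncated at [j] in the [j]-th step. *)
Fixpoint approx (j : nat) : nat -> BOp V :=
  match j with
  | O => fun k => match k with O => one | S _ => zero end
  | S i => fun k => match k with
      | O => one
      | S _ => if le_dec k (S i) then
          oavg (fun t => scal (ek (- Z.of_nat k) t) (mult (E t) (psum (approx i) (ek 1 t) i)))
        else zero
      end
  end.

Lemma approx_0 j : approx j O = one.
Proof. destruct j; reflexivity. Qed.

Lemma approx_out j k : (j < k)%nat -> approx j k = zero.
Proof.
  intros H. destruct k as [|k]; [lia|]. destruct j as [|j]; [reflexivity|].
  simpl approx. destruct (le_dec (S k) (S j)); [lia|reflexivity].
Qed.

Lemma approx_coef i k v w : (1 <= k <= S i)%nat ->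
  inner (approx (S i) k v) w = coef E (approx i) i v (Z.of_nat k) w.
Proof.
  intros H. destruct k as [|k]; [lia|]. cbn [approx].
  destruct (le_dec (S k) (S i)); [|lia].
  rewrite inner_oavg.
  - unfold coef. apply cavg_ext. intros t. inner_simpl. reflexivity.
  - apply contO_scal; [apply contC_ek|]. apply contO_mult; [exact E_cont|apply contO_psum].
Qed.

(** The constants [alpha], [beta], [gamma] bound the square sums of h, D h and D^2 h. They are the
    fixed points of the recursive estimates: alpha = 1 + rho alpha, beta = rho beta + M alpha, gamma
    = rho gamma + 2 M beta + M alpha. *)
Definition alpha : R := / (1 - rho).
Definition beta : R := M * alpha / (1 - rho).
Definition gamma : R := (2 * M * beta + M * alpha) / (1 - rho).

Lemma alpha_pos : 0 < alpha.
Proof. apply Rinv_0_lt_compat. lra. Qed.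
Lemma beta_pos : 0 <= beta.
Proof. unfold beta. pose proof alpha_pos. apply Rdiv_le_0_compat; [apply Rmult_le_pos; lra|lra]. Qed.
Lemma gamma_pos : 0 <= gamma.
Proof.
  unfold gamma. pose proof alpha_pos. pose proof beta_pos. apply Rdiv_le_0_compat; [|lra].
  assert (0 <= M * beta) by (apply Rmult_le_pos; lra).
  assert (0 <= M * alpha) by (apply Rmult_le_pos; lra). lra.
Qed.

(** A step applies E, of norm at most rho, discards frequencies and puts v at frequency 0, so the
    bound is preserved by alpha = 1 + rho alpha. *)
Lemma approx_l2 j v : l2 (approx j) v j <= alpha * norm v.
Proof.
  pose proof (vnorm_ge_0 v) as Hv. pose proof alpha_pos as Ha.
  assert (E0 : 1 + rho * alpha = alpha) by (unfold alpha; field; lra).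
  induction j as [|j IH].
  - eapply Rle_trans; [apply l2_head|]. rewrite approx_0. change ((one : BOp V) v) with v.
    replace (l2 (drop_head (approx 0)) v 0) with 0.
    + assert (0 <= rho * alpha * norm v) by (repeat apply Rmult_le_pos; lra). nra.
    + unfold l2, nsq. cbn [sum_f_R0 drop_head]. change ((zero : BOp V) v) with (zero : V).
      rewrite vnorm_zero. replace (0 ^ 2) with 0 by ring. rewrite sqrt_0. reflexivity.
  - eapply Rle_trans; [apply l2_head|]. rewrite approx_0. change ((one : BOp V) v) with v.
    assert (H : l2 (drop_head (approx (S j))) v (S j) <= rho * l2 (approx j) v j).
    { apply (l2_le_of_bounded (fun k w => coef E (approx j) j v (Z.of_nat k) w)).
      - apply Rmult_le_pos; [lra|apply l2_ge_0].
      - apply coef_bounded_on_l2; [exact E_cont|lra|exact E_bd].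
      - reflexivity.
      - intros k Hk w. destruct k as [|k]; [lia|]. apply approx_coef. lia. }
    assert (rho * l2 (approx j) v j <= rho * (alpha * norm v)) by (apply Rmult_le_compat_l; lra).
    replace (alpha * norm v) with ((1 + rho * alpha) * norm v) by (rewrite E0; reflexivity). lra.
Qed.

Lemma dseq_0 (A : nat -> BOp V) v : (dseq A O v : V) = zero.
Proof. apply inner_ext. intros w. unfold dseq. inner_simpl. simpl. ring. Qed.

Lemma inner_dseq (A : nat -> BOp V) k v w : inner (dseq A k v) w = (RtoC (INR k) * inner (A k v) w)%C.
Proof. unfold dseq. inner_simpl. reflexivity. Qed.

Lemma coef_dseq1 i v k w : (RtoC (IZR k) * coef E (approx i) i v k w =
  coef E (dseq (approx i)) i v k w + coef E1 (approx i) i v k w)%C.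
Proof. apply coef_shift; assumption. Qed.

Lemma coef_dseq2 i v k w : (RtoC (IZR k) * (RtoC (IZR k) * coef E (approx i) i v k w) =
  coef E (dseq (dseq (approx i))) i v k w + coef E1 (dseq (approx i)) i v k w
  + coef E1 (dseq (approx i)) i v k w + coef E2 (approx i) i v k w)%C.
Proof.
  rewrite coef_dseq1, Cmult_plus_distr_l.
  rewrite (coef_shift E E1 (dseq (approx i))), (coef_shift E1 E2 (approx i)) by assumption. ring.
Qed.

(** Applying D to the recursion gives E (D h) + E1 h at the retained frequencies: a contraction of
    the quantity to be bounded plus a term already bounded. *)
Lemma approx_dl2 j v : l2 (dseq (approx j)) v j <= beta * norm v.
Proof.
  pose proof (vnorm_ge_0 v) as Hv. pose proof alpha_pos as Ha. pose proof beta_pos as Hb.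
  assert (E0 : rho * beta + M * alpha = beta) by (unfold beta; field; lra).
  induction j as [|j IH].
  - unfold l2, nsq. cbn [sum_f_R0]. rewrite dseq_0, vnorm_zero.
    replace (0 ^ 2) with 0 by ring. rewrite sqrt_0. apply Rmult_le_pos; assumption.
  - apply Rle_trans with (rho * l2 (dseq (approx j)) v j + M * l2 (approx j) v j).
    + apply (l2_le_of_bounded (fun k w => coef E (dseq (approx j)) j v (Z.of_nat k) w + coef E1 (approx j) j v (Z.of_nat k) w)%C).
      * pose proof (l2_ge_0 (dseq (approx j)) v j). pose proof (l2_ge_0 (approx j) v j).
        assert (0 <= rho * l2 (dseq (approx j)) v j) by (apply Rmult_le_pos; lra).
        assert (0 <= M * l2 (approx j) v j) by (apply Rmult_le_pos; lra). lra.
      * apply bounded_on_l2_plus; apply coef_bounded_on_l2; try assumption; lra.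
      * apply dseq_0.
      * intros k Hk w. rewrite inner_dseq, approx_coef, INR_IZR_INZ by exact Hk. apply coef_dseq1.
    + pose proof (approx_l2 j v).
      assert (rho * l2 (dseq (approx j)) v j <= rho * (beta * norm v)) by (apply Rmult_le_compat_l; lra).
      assert (M * l2 (approx j) v j <= M * (alpha * norm v)) by (apply Rmult_le_compat_l; lra).
      replace (beta * norm v) with ((rho * beta + M * alpha) * norm v) by (rewrite E0; reflexivity). lra.
Qed.

(** Applying D twice gives E (D^2 h) + 2 E1 (D h) + E2 h. This is where two derivatives of E are
    consumed. *)
Lemma approx_ddl2 j v : l2 (dseq (dseq (approx j))) v j <= gamma * norm v.
Proof.
  pose proof (vnorm_ge_0 v) as Hv. pose proof alpha_pos as Ha. pose proof beta_pos as Hb. pose proof gamma_pos as Hg.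
  assert (E0 : rho * gamma + (M * beta + M * beta) + M * alpha = gamma) by (unfold gamma; field; lra).
  induction j as [|j IH].
  - unfold l2, nsq. cbn [sum_f_R0]. rewrite dseq_0, vnorm_zero.
    replace (0 ^ 2) with 0 by ring. rewrite sqrt_0. apply Rmult_le_pos; assumption.
  - pose proof (l2_ge_0 (dseq (dseq (approx j))) v j). pose proof (l2_ge_0 (dseq (approx j)) v j). pose proof (l2_ge_0 (approx j) v j).
    assert (0 <= rho * l2 (dseq (dseq (approx j))) v j) by (apply Rmult_le_pos; lra).
    assert (0 <= M * l2 (dseq (approx j)) v j) by (apply Rmult_le_pos; lra).
    assert (0 <= M * l2 (approx j) v j) by (apply Rmult_le_pos; lra).
    apply Rle_trans with (rho * l2 (dseq (dseq (approx j))) v j + M * l2 (dseq (approx j)) v j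
      + M * l2 (dseq (approx j)) v j + M * l2 (approx j) v j).
    + apply (l2_le_of_bounded (fun k w => coef E (dseq (dseq (approx j))) j v (Z.of_nat k) w
        + coef E1 (dseq (approx j)) j v (Z.of_nat k) w
        + coef E1 (dseq (approx j)) j v (Z.of_nat k) w + coef E2 (approx j) j v (Z.of_nat k) w)%C).
      * lra.
      * repeat (apply bounded_on_l2_plus); apply coef_bounded_on_l2; try assumption; lra.
      * apply dseq_0.
      * intros k Hk w. rewrite !inner_dseq, approx_coef, INR_IZR_INZ by exact Hk. apply coef_dseq2.
    + pose proof (approx_l2 j v). pose proof (approx_dl2 j v).
      assert (rho * l2 (dseq (dseq (approx j))) v j <= rho * (gamma * norm v)) by (apply Rmult_le_compat_l; lra).
      assert (M * l2 (dseq (approx j)) v j <= M * (beta * norm v)) by (apply Rmult_le_compat_l; lra).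
      assert (M * l2 (approx j) v j <= M * (alpha * norm v)) by (apply Rmult_le_compat_l; lra).
      replace (gamma * norm v) with ((rho * gamma + (M * beta + M * beta) + M * alpha) * norm v) by (rewrite E0; reflexivity). lra.
Qed.

Lemma approx_sq_bound j k v : INR k ^ 2 * norm (approx j k v) <= gamma * norm v.
Proof.
  destruct (le_lt_dec k j) as [H|H].
  - eapply Rle_trans; [|apply (approx_ddl2 j v)].
    eapply Rle_trans; [|apply (l2_coef _ v j k H)]. right.
    replace (dseq (dseq (approx j)) k v : V) with (scal (RtoC (INR k ^ 2)) (approx j k v : V)).
    + rewrite norm_scal_C, Cmod_R, Rabs_pos_eq by apply pow2_ge_0. reflexivity.
    + apply inner_ext. intros w. rewrite !inner_dseq. inner_simpl.
      replace (RtoC (INR k ^ 2)) with (RtoC (INR k) * RtoC (INR k))%C by (rewrite <- RtoC_mult; f_equal; ring). ring.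
  - rewrite approx_out by exact H. change ((zero : BOp V) v) with (zero : V). rewrite vnorm_zero, Rmult_0_r.
    apply Rmult_le_pos; [apply gamma_pos|apply vnorm_ge_0].
Qed.

(** The 1 covers the identity at frequency 0; the 4 comes from (k + 1)^2 <= 4 k^2 for k >= 1. *)
Definition Gbound : R := 1 + 4 * gamma.

Lemma approx_norm j k : bop_norm (approx j k) <= Gbound / (INR k + 1) ^ 2.
Proof.
  pose proof gamma_pos as Hg. pose proof (pos_INR k) as Hk.
  destruct k as [|k].
  - rewrite approx_0. eapply Rle_trans; [apply bop_norm_one|]. unfold Gbound. simpl. lra.
  - apply bop_norm_le.
    + apply Rdiv_le_0_compat; [unfold Gbound; lra|apply pow_lt; lra].
    + intros v. pose proof (approx_sq_bound j (S k) v) as H. pose proof (vnorm_ge_0 v) as Hv.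
      assert (Hk1 : 1 <= INR (S k)) by (rewrite S_INR; pose proof (pos_INR k); lra).
      set (x := INR (S k)) in *. set (n := norm (approx j (S k) v)) in *.
      assert (Hn : 0 <= n) by apply vnorm_ge_0.
      apply Rmult_le_reg_l with ((x + 1) ^ 2); [apply pow_lt; lra|].
      replace ((x + 1) ^ 2 * (Gbound / (x + 1) ^ 2 * norm v)) with (Gbound * norm v) by (field; lra).
      assert ((x + 1) ^ 2 * n <= 4 * (x ^ 2 * n)).
      { rewrite <- Rmult_assoc. apply Rmult_le_compat_r; [exact Hn|]. nra. }
      unfold Gbound. lra.
Qed.

Definition incr (j k : nat) : BOp V := minus (approx (S j) k) (approx j k).

Fixpoint del (j : nat) : R :=
  match j with O => gamma | S i => rho * del i + gamma * / (INR (S i) + 1) ^ 2 end.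

Lemma incr_0 j v : (incr j O v : V) = zero.
Proof. apply inner_ext. intros w. unfold incr. rewrite !approx_0. inner_simpl. ring. Qed.

Lemma incr_last j v : (incr j (S j) v : V) = approx (S j) (S j) v.
Proof.
  apply inner_ext. intros w. unfold incr. rewrite (approx_out j (S j)) by lia. inner_simpl. ring.
Qed.

Lemma incr_l2 j v : l2 (incr j) v (S j) <= del j * norm v.
Proof.
  induction j as [|j IH].
  - eapply Rle_trans; [apply l2_last|]. rewrite incr_last.
    replace (l2 (incr 0) v 0) with 0.
    + pose proof (approx_sq_bound 1 1 v) as H. simpl in H. simpl. lra.
    + unfold l2, nsq. cbn [sum_f_R0]. rewrite incr_0, vnorm_zero. replace (0 ^ 2) with 0 by ring. rewrite sqrt_0. reflexivity.
  - eapply Rle_trans; [apply l2_last|]. rewrite incr_last.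
    assert (H1 : l2 (incr (S j)) v (S j) <= rho * l2 (incr j) v (S j)).
    { apply (l2_le_of_bounded (fun k w => coef E (incr j) (S j) v (Z.of_nat k) w)).
      - apply Rmult_le_pos; [lra|apply l2_ge_0].
      - apply coef_bounded_on_l2; [exact E_cont|lra|exact E_bd].
      - apply incr_0.
      - intros k Hk w. unfold incr. rewrite coef_minus by exact E_cont. inner_simpl.
        rewrite !approx_coef by lia.
        (* The two iterates are computed from polynomials truncated at different degrees; the
           shorter one may be read at the larger degree because its next coefficient is zero. *)
        assert (Hc : coef E (approx j) j v (Z.of_nat k) w = coef E (approx j) (S j) v (Z.of_nat k) w).
        { unfold coef. apply cavg_ext. intros t. rewrite psum_S, (approx_out j (S j)) by lia.
          assert (Ez : psum (approx j) (ek 1 t) j = plus (psum (approx j) (ek 1 t) j) (scal (ek 1 t ^ S j)%C (zero : BOp V)) :> BOp V) by op_ring.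
          rewrite <- Ez. reflexivity. }
        rewrite Hc. reflexivity. }
    assert (H2 : norm (approx (S (S j)) (S (S j)) v) <= gamma * / (INR (S j) + 1) ^ 2 * norm v).
    { pose proof (approx_sq_bound (S (S j)) (S (S j)) v) as H. rewrite S_INR in H.
      pose proof (pos_INR (S j)). set (x := INR (S j) + 1) in *.
      apply Rmult_le_reg_l with (x ^ 2); [apply pow_lt; unfold x; lra|].
      replace (x ^ 2 * (gamma * / x ^ 2 * norm v)) with (gamma * norm v) by (field; unfold x; lra). exact H. }
    assert (rho * l2 (incr j) v (S j) <= rho * (del j * norm v)) by (apply Rmult_le_compat_l; lra).
    cbn [del]. lra.
Qed.

Lemma del_pos j : 0 <= del j.
Proof.
  pose proof gamma_pos. induction j as [|j IH]; [exact H|]. cbn [del].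
  pose proof (pos_INR (S j)).
  assert (0 <= rho * del j) by (apply Rmult_le_pos; lra).
  assert (0 <= gamma * / (INR (S j) + 1) ^ 2).
  { apply Rmult_le_pos; [exact H|]. left. apply Rinv_0_lt_compat, pow_lt. lra. }
  lra.
Qed.

(** Summing the recursion bounds the sum by rho times itself plus 2 gamma, and rho < 1 allows
    solving for it. *)
Lemma del_sum n : sum_f_R0 del n <= 2 * gamma / (1 - rho).
Proof.
  pose proof gamma_pos as Hg.
  assert (H : sum_f_R0 del n <= rho * (sum_f_R0 del n - del n) + gamma * (2 - / (INR n + 1))).
  { induction n as [|n IH].
    - simpl. rewrite Rplus_0_l, Rinv_1. lra.
    - rewrite tech5. cbn [del]. pose proof (inv_sq_tail n) as H2. apply (Rmult_le_compat_l gamma) in H2; [|exact Hg].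
      lra. }
  pose proof (del_pos n) as Hd. pose proof (pos_INR n).
  assert (0 < / (INR n + 1)) by (apply Rinv_0_lt_compat; lra).
  assert (0 <= gamma * / (INR n + 1)) by (apply Rmult_le_pos; lra).
  assert (0 <= rho * del n) by (apply Rmult_le_pos; lra).
  apply Rmult_le_reg_l with (1 - rho); [lra|].
  replace ((1 - rho) * (2 * gamma / (1 - rho))) with (2 * gamma) by (field; lra). lra.
Qed.

Lemma approx_step j k : bop_norm (minus (approx (S j) k) (approx j k)) <= del j.
Proof.
  destruct (le_lt_dec k (S j)) as [H|H].
  - apply bop_norm_le; [apply del_pos|]. intros v.
    eapply Rle_trans; [apply (l2_coef (incr j) v (S j) k H)|apply incr_l2].
  - rewrite !approx_out by lia. rewrite minus_eq_zero.
    eapply Rle_trans; [right; exact bop_norm_zero|apply del_pos].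
Qed.

Lemma approx_converges k : exists L, limO eventually (fun j => approx j k) L.
Proof.
  apply (limO_seq_exists (fun j => approx j k) (fun n => match n with O => 0 | S m => del m end) (2 * gamma / (1 - rho))).
  - intros n. apply approx_step.
  - intros n. destruct n as [|n].
    + simpl. apply Rdiv_le_0_compat; [pose proof gamma_pos; lra|lra].
    + eapply Rle_trans; [|apply (del_sum n)]. right.
      induction n as [|n IH]; [simpl; ring|]. rewrite tech5, IH, tech5. reflexivity.
Qed.

Definition hseq (k : nat) : BOp V :=
  proj1_sig (constructive_indefinite_description _ (approx_converges k)).

Lemma hseq_lim k : limO eventually (fun j => approx j k) (hseq k).
Proof. apply (proj2_sig (constructive_indefinite_description _ (approx_converges k))). Qed.

Lemma hseq_norm k : bop_norm (hseq k) <= Gbound / (INR k + 1) ^ 2.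
Proof.
  apply (limO_norm_bound (F := eventually) (fun j => approx j k)); [apply hseq_lim|].
  exists O. intros j _. apply approx_norm.
Qed.

Lemma hseq_0 : hseq O = one.
Proof.
  apply (limO_unique (F := eventually) (fun j => approx j O)); [apply hseq_lim|].
  apply limO_ext with (fun _ => one); [intros j; rewrite approx_0; reflexivity|apply limO_const].
Qed.

Lemma approx_finite_close N eps : 0 < eps -> exists J, forall j, (J <= j)%nat -> forall z, Cmod z <= 1 ->
  bop_norm (minus (psum (approx j) z N) (psum hseq z N)) < eps.
Proof.
  revert eps. induction N as [|N IH]; intros eps He.
  - destruct (hseq_lim O eps He) as [J HJ]. exists J. intros j Hj z _. apply HJ, Hj.
  - destruct (IH (eps / 2)) as [J1 H1]; [lra|]. destruct (hseq_lim (S N) (eps / 2)) as [J2 H2]; [lra|].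
    exists (max J1 J2). intros j Hj z Hz. specialize (H1 j ltac:(lia) z Hz). specialize (H2 j ltac:(lia)).
    apply Rle_lt_trans with (bop_norm (plus (minus (psum (approx j) z N) (psum hseq z N))
      (scal (z ^ S N)%C (minus (approx j (S N)) (hseq (S N)))))).
    { right. f_equal. rewrite !psum_S. op_ring. }
    eapply Rle_lt_trans; [apply bop_norm_triangle|].
    assert (H3 : bop_norm (scal (z ^ S N)%C (minus (approx j (S N)) (hseq (S N)))) <= bop_norm (minus (approx j (S N)) (hseq (S N)))).
    { eapply Rle_trans; [apply bop_norm_scal|]. rewrite Cmod_pow.
      pose proof (bop_norm_ge_0 (minus (approx j (S N)) (hseq (S N)))).
      assert (0 <= Cmod z ^ S N <= 1).
      { split; [apply pow_le, Cmod_ge_0|]. rewrite <- (pow1 (S N)). apply pow_incr. split; [apply Cmod_ge_0|exact Hz]. }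
      nra. }
    lra.
Qed.

(** The tails beyond N are uniformly small because all iterates share the decay [Gbound]; the
    finitely many remaining coefficients converge one by one. *)
Lemma approx_uniform eps : 0 < eps -> exists J, forall j, (J <= j)%nat -> forall z, Cmod z <= 1 ->
  bop_norm (minus (psum (approx j) z j) (pser hseq z)) < eps.
Proof.
  intros He. pose proof gamma_pos as Hg. assert (HG : 0 < Gbound) by (unfold Gbound; lra).
  destruct (INR_inv_small (eps / 3 / Gbound)) as [N HN]; [repeat apply Rdiv_lt_0_compat; lra|].
  specialize (HN N (le_n _)).
  assert (HN' : Gbound / (INR N + 1) < eps / 3).
  { replace (eps / 3) with (Gbound * (eps / 3 / Gbound)) by (field; lra). apply Rmult_lt_compat_l; assumption. }
  destruct (approx_finite_close N (eps / 3)) as [J HJ]; [lra|].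
  exists (max J N). intros j Hj z Hz. specialize (HJ j ltac:(lia) z Hz).
  pose proof (psum_tail (approx j) Gbound z N (j - N) (approx_norm j) Hz) as T1.
  replace (N + (j - N))%nat with j in T1 by lia.
  assert (T1' : bop_norm (minus (psum (approx j) z j) (psum (approx j) z N)) <= Gbound / (INR N + 1)).
  { eapply Rle_trans; [exact T1|]. apply Rmult_le_compat_l; [lra|].
    pose proof (pos_INR j). assert (0 < / (INR j + 1)) by (apply Rinv_0_lt_compat; lra). lra. }
  pose proof (pser_tail hseq Gbound hseq_norm z N Hz) as T2. rewrite bop_norm_minus_sym in T2.
  apply Rle_lt_trans with (bop_norm (plus (plus (minus (psum (approx j) z j) (psum (approx j) z N))
    (minus (psum (approx j) z N) (psum hseq z N))) (minus (psum hseq z N) (pser hseq z)))).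
  { right. f_equal. op_ring. }
  eapply Rle_lt_trans; [apply bop_norm_triangle|].
  eapply Rle_lt_trans; [apply Rplus_le_compat_r, bop_norm_triangle|]. lra.
Qed.

Lemma circle_unit t : circle (RtoC 0) 1 t = ek 1 t.
Proof. unfold circle, ek. rewrite Rmult_1_l. ceq. Qed.

Lemma contO_unit_circle (G : C -> BOp V) : oholo (RtoC 0) 1 G -> contO (fun t => G (ek 1 t)).
Proof.
  intros HG. replace (fun t => G (ek 1 t)) with (fun t => G (circle (RtoC 0) 1 t)).
  - apply contO_circle; [lra|apply HG].
  - apply functional_extensionality. intros t. rewrite circle_unit. reflexivity.
Qed.

Let H (z : C) : BOp V := pser hseq z.

Lemma H_oholo : oholo (RtoC 0) 1 H.
Proof. apply (pser_oholo hseq Gbound hseq_norm). Qed.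

Lemma H_cont : contO (fun t => H (ek 1 t)).
Proof. apply contO_unit_circle, H_oholo. Qed.

Definition coefH (F : R -> BOp V) (v : V) (k : Z) (w : V) : C :=
  cavg (fun t => ek (- k) t * inner (F t (H (ek 1 t) v)) w)%C.

Lemma coef_lim (F : R -> BOp V) mu v k w : contO F -> 0 <= mu -> (forall t, bop_norm (F t) <= mu) ->
  limC eventually (fun j => coef F (approx j) j v k w) (coefH F v k w).
Proof.
  intros HF Hmu Hb eps He. pose proof (vnorm_ge_0 v) as Hv. pose proof (vnorm_ge_0 w) as Hw.
  set (K := mu * norm v * norm w + 1).
  assert (HK : 0 < K).
  { unfold K. assert (0 <= mu * norm v * norm w) by (repeat apply Rmult_le_pos; assumption). lra. }
  destruct (approx_uniform (eps / K / 2)) as [J HJ]; [repeat apply Rdiv_lt_0_compat; lra|].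
  exists J. intros j Hj. unfold coef, coefH.
  assert (HcH : contC (fun t => inner (F t (H (ek 1 t) v)) w)).
  { apply (contC_inner (fun t => mult (F t) (H (ek 1 t)))). apply contO_mult; [exact HF|apply H_cont]. }
  rewrite <- cavg_minus; [|apply contC_mult; [apply contC_ek|apply contC_inner_psum, HF]|apply contC_mult; [apply contC_ek|exact HcH]].
  apply Rle_lt_trans with (eps / 2); [|lra].
  apply cavg_bound.
  - apply contC_minus; apply contC_mult; try apply contC_ek; [apply contC_inner_psum, HF|exact HcH].
  - intros t. specialize (HJ j Hj (ek 1 t) ltac:(rewrite Cmod_ek; lra)).
    set (D := minus (psum (approx j) (ek 1 t) j) (pser hseq (ek 1 t))) in *.
    replace (ek (- k) t * inner (F t (psum (approx j) (ek 1 t) j v)) w - ek (- k) t * inner (F t (H (ek 1 t) v)) w)%C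
      with (ek (- k) t * inner (F t (D v)) w)%C by (unfold D, H; inner_simpl; ring).
    rewrite Cmod_mult, Cmod_ek, Rmult_1_l. eapply Rle_trans; [apply inner_op_le|].
    pose proof (bop_norm_bound D v) as HDv. pose proof (bop_norm_ge_0 D) as HD0.
    apply Rle_trans with (mu * (bop_norm D * norm v) * norm w).
    + apply Rmult_le_compat_r; [exact Hw|]. apply Rmult_le_compat; [apply bop_norm_ge_0|apply vnorm_ge_0|apply Hb|exact HDv].
    + apply Rle_trans with (K * (eps / K / 2)); [|right; field; lra].
      replace (mu * (bop_norm D * norm v) * norm w) with (mu * norm v * norm w * bop_norm D) by ring.
      apply Rmult_le_compat; [repeat apply Rmult_le_pos; assumption|exact HD0|unfold K; lra|lra].
Qed.

Lemma approx_inner_lim k v w : limC eventually (fun j => inner (approx j k v) w) (inner (hseq k v) w).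
Proof. exact (limC_inner (fun j => approx j k) (hseq k) v w (hseq_lim k)). Qed.

Lemma limC_eventually_ext (f g : nat -> C) a N : (forall j, (N <= j)%nat -> f j = g j) ->
  limC eventually f a -> limC eventually g a.
Proof.
  intros Hfg Hf eps He. destruct (Hf eps He) as [J HJ]. exists (max J N). intros j Hj.
  rewrite <- Hfg by lia. apply HJ. lia.
Qed.

(** The limit of the recursion, that is the Toeplitz equation: E H and H have the same positive
    frequencies, so (1 - E) H has none. *)
Lemma H_coef_pos k v w : (1 <= k)%nat -> coefH E v (Z.of_nat k) w = inner (hseq k v) w.
Proof.
  intros Hk. apply (limC_unique (F := eventually) (fun j => coef E (approx j) j v (Z.of_nat k) w)).
  - apply (coef_lim E rho); [exact E_cont|lra|exact E_bd].
  - apply (limC_eventually_ext (fun j => inner (approx (S j) k v) w) _ _ k).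
    + intros j Hj. apply approx_coef. lia.
    + intros eps He. destruct (approx_inner_lim k v w eps He) as [J HJ]. exists J. intros j Hj. apply HJ. lia.
Qed.

Lemma bop_norm_one_le t : bop_norm ((fun _ : R => one : BOp V) t) <= 1.
Proof. apply bop_norm_one. Qed.

Lemma H_coef_one (k : Z) v w : coefH (fun _ => one) v k w =
  if Z_le_dec 0 k then inner (hseq (Z.to_nat k) v) w else RtoC 0.
Proof.
  apply (limC_unique (F := eventually) (fun j => coef (fun _ => one) (approx j) j v k w)).
  - apply (coef_lim (fun _ => one) 1); [apply contO_const|lra|apply bop_norm_one_le].
  - pose proof (fun j => psum_coef (approx j) j v w k) as Ec.
    destruct (Z_le_dec 0 k) as [H0|H0].
    + apply (limC_eventually_ext (fun j => inner (approx j (Z.to_nat k) v) w) _ _ (Z.to_nat k)).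
      * intros j Hj. symmetry. etransitivity; [exact (Ec j)|].
        destruct (Z_le_dec k (Z.of_nat j)); [reflexivity|lia].
      * apply approx_inner_lim.
    + apply limC_ext with (fun _ => RtoC 0); [|apply limC_const]. intros j. symmetry. exact (Ec j).
Qed.

Definition neg_bound : R := rho * gamma + 2 * M * beta + M * alpha.

(** The equation leaves negative frequencies free, so their decay comes from D^2 of the product E h,
    expanded by [coef_dseq2] and bounded term by term before passing to the limit. *)
Lemma coefH_neg_bound k v w : INR k ^ 2 * Cmod (coefH E v (- Z.of_nat k) w) <= neg_bound * (norm v * norm w).
Proof.
  pose proof (coef_lim E rho v (- Z.of_nat k) w E_cont (proj1 rho_bd) E_bd) as HL.
  pose proof (vnorm_ge_0 v) as Hv. pose proof (vnorm_ge_0 w) as Hw.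
  apply le_epsilon. intros eps He.
  assert (Hk : 0 < INR k ^ 2 + 1) by (pose proof (pow2_ge_0 (INR k)); lra).
  destruct (HL (eps / (INR k ^ 2 + 1))) as [J HJ]; [apply Rdiv_lt_0_compat; lra|].
  specialize (HJ J (le_n _)). set (c := coef E (approx J) J v (- Z.of_nat k) w) in *.
  set (l := coefH E v (- Z.of_nat k) w) in *.
  assert (Hc : INR k ^ 2 * Cmod c <= neg_bound * (norm v * norm w)).
  { pose proof (coef_dseq2 J v (- Z.of_nat k) w) as Ec. fold c in Ec.
    apply (f_equal Cmod) in Ec. rewrite !Cmod_mult, !Cmod_R in Ec.
    rewrite opp_IZR, Rabs_Ropp, <- INR_IZR_INZ, (Rabs_pos_eq _ (pos_INR k)) in Ec.
    replace (INR k ^ 2 * Cmod c) with (INR k * (INR k * Cmod c)) by ring. rewrite Ec.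
    pose proof (coef_le E (dseq (dseq (approx J))) J v rho (- Z.of_nat k) w E_cont (proj1 rho_bd) E_bd) as C1.
    pose proof (coef_le E1 (dseq (approx J)) J v M (- Z.of_nat k) w E1_cont M_pos E1_bd) as C2.
    pose proof (coef_le E2 (approx J) J v M (- Z.of_nat k) w E2_cont M_pos E2_bd) as C3.
    eapply Rle_trans; [apply Cmod_triangle|]. eapply Rle_trans; [apply Rplus_le_compat_r, Cmod_triangle|].
    eapply Rle_trans; [apply Rplus_le_compat_r, Rplus_le_compat_r, Cmod_triangle|].
    assert (D1 : rho * (l2 (dseq (dseq (approx J))) v J * norm w) <= rho * (gamma * norm v * norm w)).
    { apply Rmult_le_compat_l; [lra|]. apply Rmult_le_compat_r; [exact Hw|apply approx_ddl2]. }
    assert (D2 : M * (l2 (dseq (approx J)) v J * norm w) <= M * (beta * norm v * norm w)).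
    { apply Rmult_le_compat_l; [lra|]. apply Rmult_le_compat_r; [exact Hw|apply approx_dl2]. }
    assert (D3 : M * (l2 (approx J) v J * norm w) <= M * (alpha * norm v * norm w)).
    { apply Rmult_le_compat_l; [lra|]. apply Rmult_le_compat_r; [exact Hw|apply approx_l2]. }
    unfold neg_bound. lra. }
  assert (Hl : Cmod l <= Cmod c + eps / (INR k ^ 2 + 1)).
  { replace l with (c + - (c - l))%C by ring. eapply Rle_trans; [apply Cmod_triangle|].
    rewrite Cmod_opp. lra. }
  apply Rle_trans with (INR k ^ 2 * (Cmod c + eps / (INR k ^ 2 + 1))).
  - apply Rmult_le_compat_l; [apply pow2_ge_0|exact Hl].
  - rewrite Rmult_plus_distr_l. apply Rplus_le_compat; [exact Hc|].
    apply Rle_trans with ((INR k ^ 2 + 1) * (eps / (INR k ^ 2 + 1))); [|right; field; lra].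
    apply Rmult_le_compat_r; [left; apply Rdiv_lt_0_compat; lra|lra].
Qed.

(** The Fourier coefficient of (1 - E) H at the frequency -k. *)
Definition zseq (k : nat) : BOp V :=
  oavg (fun t => scal (ek (Z.of_nat k) t) (mult (minus one (E t)) (H (ek 1 t)))).

Lemma one_minus_E_cont : contO (fun t => minus one (E t)).
Proof. apply (contO_minus (fun _ => one)); [apply contO_const|exact E_cont]. Qed.

Lemma W_cont : contO (fun t => mult (minus one (E t)) (H (ek 1 t))).
Proof. apply contO_mult; [exact one_minus_E_cont|exact H_cont]. Qed.

Lemma coefH_minus v k w : coefH (fun t => minus one (E t)) v k w = (coefH (fun _ => one) v k w - coefH E v k w)%C.
Proof.
  unfold coefH.
  assert (HcH : forall F : R -> BOp V, contO F -> contC (fun t => ek (- k) t * inner (F t (H (ek 1 t) v)) w)%C).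
  { intros F HF. apply contC_mult; [apply contC_ek|].
    apply (contC_inner (fun t => mult (F t) (H (ek 1 t)))). apply contO_mult; [exact HF|apply H_cont]. }
  rewrite <- cavg_minus; [|apply (HcH (fun _ => one)), contO_const|apply HcH, E_cont].
  apply cavg_ext. intros t. inner_simpl. ring.
Qed.

Lemma inner_zseq k v w : inner (zseq k v) w = coefH (fun t => minus one (E t)) v (- Z.of_nat k) w.
Proof.
  unfold zseq. rewrite inner_oavg by (apply contO_scal; [apply contC_ek|exact W_cont]).
  unfold coefH. apply cavg_ext. intros t. rewrite Z.opp_involutive. inner_simpl. reflexivity.
Qed.

(** The first term bounds (1 - E) H in norm and serves k = 0; the second serves k >= 1 through (k +
    1)^2 <= 4 k^2. *)
Definition Zbound : R := 2 * (Gbound + 1) + 4 * neg_bound.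

Lemma zseq_norm k : bop_norm (zseq k) <= Zbound / (INR k + 1) ^ 2.
Proof.
  pose proof gamma_pos as Hg. pose proof alpha_pos. pose proof beta_pos.
  assert (HG : 0 < Gbound) by (unfold Gbound; lra).
  assert (Hn : 0 <= neg_bound).
  { unfold neg_bound. assert (0 <= rho * gamma) by (apply Rmult_le_pos; lra).
    assert (0 <= M * beta) by (apply Rmult_le_pos; lra). assert (0 <= M * alpha) by (apply Rmult_le_pos; lra). lra. }
  destruct k as [|k].
  - simpl INR. replace (Zbound / (0 + 1) ^ 2) with Zbound by field.
    unfold zseq. apply (oavg_bound (fun t => scal (ek (Z.of_nat 0) t) (mult (minus one (E t)) (H (ek 1 t))))).
    + apply contO_scal; [apply contC_ek|exact W_cont].
    + unfold Zbound. lra.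
    + intros t. eapply Rle_trans; [apply bop_norm_scal|]. rewrite Cmod_ek, Rmult_1_l.
      eapply Rle_trans; [apply bop_norm_mult|].
      apply Rle_trans with (2 * (Gbound + 1)); [|unfold Zbound; lra].
      apply Rmult_le_compat; try apply bop_norm_ge_0.
      * eapply Rle_trans; [apply bop_norm_minus_le|]. pose proof (bop_norm_one (V := V)). pose proof (E_bd t). lra.
      * pose proof (pser_tail hseq Gbound hseq_norm (ek 1 t) O ltac:(rewrite Cmod_ek; lra)) as T.
        pose proof (bop_norm_dist (H (ek 1 t)) (hseq O)) as T2. rewrite hseq_0 in T2.
        simpl in T. rewrite hseq_0 in T. pose proof (bop_norm_one (V := V)).
        replace (Gbound / (0 + 1)) with Gbound in T by field. unfold H in *. lra.
  - pose proof (pos_INR k) as Hk. rewrite S_INR. set (x := INR k + 1). assert (Hx : 1 <= x) by (unfold x; lra).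
    apply inner_bound_norm.
    + apply Rdiv_le_0_compat; [unfold Zbound; lra|apply pow_lt; lra].
    + intros v w. rewrite inner_zseq, coefH_minus, H_coef_one.
      destruct (Z_le_dec 0 (- Z.of_nat (S k))); [lia|].
      replace (RtoC 0 - coefH E v (- Z.of_nat (S k)) w)%C with (- coefH E v (- Z.of_nat (S k)) w)%C by ring.
      rewrite Cmod_opp. pose proof (coefH_neg_bound (S k) v w) as B. rewrite S_INR in B. fold x in B.
      set (c := Cmod (coefH E v (- Z.of_nat (S k)) w)) in *. assert (Hc : 0 <= c) by apply Cmod_ge_0.
      pose proof (Rmult_le_pos _ _ (vnorm_ge_0 v) (vnorm_ge_0 w)) as Hvw. set (y := norm v * norm w) in *.
      apply Rmult_le_reg_l with ((x + 1) ^ 2); [apply pow_lt; lra|].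
      replace ((x + 1) ^ 2 * (Zbound / (x + 1) ^ 2 * y)) with (Zbound * y) by (field; lra).
      assert ((x + 1) ^ 2 * c <= 4 * (x ^ 2 * c)).
      { rewrite <- Rmult_assoc. apply Rmult_le_compat_r; [exact Hc|]. nra. }
      assert (0 <= Gbound * y) by (apply Rmult_le_pos; lra).
      unfold Zbound. lra.
Qed.

(** Taking adjoints turns the frequency -k into k, so these are the coefficients of a holomorphic
    function. *)
Definition yseq (k : nat) : BOp V := adj (zseq k).

Lemma yseq_norm k : bop_norm (yseq k) <= Zbound / (INR k + 1) ^ 2.
Proof. eapply Rle_trans; [apply bop_norm_adj_le|apply zseq_norm]. Qed.

Let Y (z : C) : BOp V := pser yseq z.

Lemma Y_oholo : oholo (RtoC 0) 1 Y.
Proof. apply (pser_oholo yseq Zbound yseq_norm). Qed.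

Lemma Y_coef (k : Z) a b : cavg (fun t => ek k t * inner a (Y (ek 1 t) b))%C =
  if Z_le_dec 0 k then inner (zseq (Z.to_nat k) a) b else RtoC 0.
Proof.
  assert (HcY : contC (fun t => inner (Y (ek 1 t) b) a)).
  { apply (contC_inner (fun t => Y (ek 1 t))), contO_unit_circle, Y_oholo. }
  assert (Hconj : cavg (fun t => ek k t * inner a (Y (ek 1 t) b))%C =
    Cconj (cavg (fun t => ek (- k) t * inner (Y (ek 1 t) b) a)%C)).
  { rewrite <- cavg_conj by (apply contC_mult; [apply contC_ek|exact HcY]).
    apply cavg_ext. intros t. rewrite Cmult_conj, ek_opp, Cconj_conj, <- inner_conj. reflexivity. }
  rewrite Hconj.
  assert (E3 : cavg (fun t => ek (- k) t * inner (Y (ek 1 t) b) a)%C =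
    if Z_le_dec 0 k then inner (yseq (Z.to_nat k) b) a else RtoC 0).
  { apply (limC_unique (F := eventually) (fun n => cavg (fun t => ek (- k) t * inner (psum yseq (ek 1 t) n b) a)%C)).
    - intros eps He. pose proof (pser_G_pos yseq Zbound yseq_norm) as HZ.
      set (K := Zbound * norm b * norm a + 1).
      pose proof (vnorm_ge_0 a) as Ha. pose proof (vnorm_ge_0 b) as Hb.
      assert (HK : 0 < K) by (unfold K; assert (0 <= Zbound * norm b * norm a) by (repeat apply Rmult_le_pos; assumption); lra).
      destruct (INR_inv_small (eps / K)) as [N HN]; [apply Rdiv_lt_0_compat; lra|].
      exists N. intros n Hn. specialize (HN n Hn).
      assert (Hcp : contC (fun t => inner (psum yseq (ek 1 t) n b) a)).
      { apply (contC_inner (fun t => psum yseq (ek 1 t) n)), contO_psum. }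
      rewrite <- cavg_minus by (apply contC_mult; [apply contC_ek|assumption]).
      apply Rle_lt_trans with (K * / (INR n + 1)).
      + apply cavg_bound.
        * apply contC_minus; apply contC_mult; try apply contC_ek; assumption.
        * intros t. pose proof (pser_tail yseq Zbound yseq_norm (ek 1 t) n ltac:(rewrite Cmod_ek; lra)) as T.
          rewrite bop_norm_minus_sym in T. set (D := minus (psum yseq (ek 1 t) n) (pser yseq (ek 1 t))) in *.
          replace (ek (- k) t * inner (psum yseq (ek 1 t) n b) a - ek (- k) t * inner (Y (ek 1 t) b) a)%C
            with (ek (- k) t * inner (D b) a)%C by (unfold D, Y; inner_simpl; ring).
          rewrite Cmod_mult, Cmod_ek, Rmult_1_l. eapply Rle_trans; [apply inner_op_le|].
          assert (Hi : 0 < / (INR n + 1)) by (apply Rinv_0_lt_compat; pose proof (pos_INR n); lra).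
          apply Rle_trans with (Zbound / (INR n + 1) * norm b * norm a).
          -- apply Rmult_le_compat_r; [exact Ha|]. apply Rmult_le_compat_r; [exact Hb|exact T].
          -- unfold K, Rdiv. replace (Zbound * / (INR n + 1) * norm b * norm a) with (Zbound * norm b * norm a * / (INR n + 1)) by ring.
             apply Rmult_le_compat_r; lra.
      + replace eps with (K * (eps / K)) by (field; lra). apply Rmult_lt_compat_l; assumption.
    - pose proof (fun n => psum_coef yseq n b a k) as Ec.
      destruct (Z_le_dec 0 k) as [H0|H0].
      + apply (limC_eventually_ext (fun _ => inner (yseq (Z.to_nat k) b) a) _ _ (Z.to_nat k)); [|apply limC_const].
        intros n Hn. rewrite Ec. destruct (Z_le_dec k (Z.of_nat n)); [reflexivity|lia].
      + apply limC_ext with (fun _ => RtoC 0); [|apply limC_const]. intros n. symmetry. exact (Ec n). }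
  rewrite E3. destruct (Z_le_dec 0 k).
  - unfold yseq. rewrite <- inner_conj, <- inner_adj_r. reflexivity.
  - unfold Cconj, RtoC; simpl. f_equal. ring.
Qed.

(** Both sides are continuous in t with equal Fourier coefficients: the positive frequencies vanish
    on the left by the Toeplitz equation and on the right because Y enters conjugated, and the
    others agree by the choice of [yseq]. *)
Theorem factorization : exists H Y : C -> BOp V,
  oholo (RtoC 0) 1 H /\ H (RtoC 0) = one /\ oholo (RtoC 0) 1 Y /\
  forall t, 0 <= t <= 2 * PI -> forall a b : V,
    inner ((minus one (E t) : BOp V) (H (ek 1 t) a)) b = inner a (Y (ek 1 t) b).
Proof.
  exists H, Y. split; [exact H_oholo|]. split; [|split; [exact Y_oholo|]].
  - unfold H. rewrite (pser_0 hseq Gbound hseq_norm). apply hseq_0.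
  - intros t Ht a b.
    assert (Hc1 : contC (fun t => inner ((minus one (E t) : BOp V) (H (ek 1 t) a)) b)).
    { apply (contC_inner (fun t => mult (minus one (E t)) (H (ek 1 t)))), W_cont. }
    assert (Hc2 : contC (fun t => inner a (Y (ek 1 t) b))).
    { apply (contC_inner2 (fun _ => one) (fun t => Y (ek 1 t))); [apply contO_const|apply contO_unit_circle, Y_oholo]. }
    assert (Hz : (inner ((minus one (E t) : BOp V) (H (ek 1 t) a)) b - inner a (Y (ek 1 t) b))%C = RtoC 0).
    { revert t Ht. apply (fourier_unique (fun t => inner ((minus one (E t) : BOp V) (H (ek 1 t) a)) b - inner a (Y (ek 1 t) b))%C).
      - apply contC_minus; assumption.
      - intros k.
        rewrite (cavg_ext _ (fun t => ek k t * inner ((minus one (E t) : BOp V) (H (ek 1 t) a)) b - ek k t * inner a (Y (ek 1 t) b))%C)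
          by (intros t; ring).
        rewrite cavg_minus by (apply contC_mult; [apply contC_ek|assumption]).
        rewrite Y_coef.
        assert (Ek : cavg (fun t => ek k t * inner ((minus one (E t) : BOp V) (H (ek 1 t) a)) b)%C =
          coefH (fun t => minus one (E t)) a (- k) b).
        { unfold coefH. apply cavg_ext. intros t. rewrite Z.opp_involutive. reflexivity. }
        rewrite Ek. destruct (Z_le_dec 0 k) as [H0|H0].
        + rewrite inner_zseq, Z2Nat.id by exact H0. ring.
        + rewrite coefH_minus, H_coef_one. destruct (Z_le_dec 0 (- k)); [|lia].
          replace (- k)%Z with (Z.of_nat (Z.to_nat (- k))) at 2 by lia.
          rewrite H_coef_pos by lia. ring. }
    match type of Hz with (?x - ?y)%C = _ => replace x with (x - y + y)%C by ring end.
    rewrite Hz. ring.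
Qed.

End Factorization.

Lemma contO_on_sub {V : HilbertSpace} (D D' : C -> Prop) (F : C -> BOp V) :
  (forall z, D z -> D' z) -> contO_on D' F -> contO_on D F.
Proof.
  intros HD HF z Hz eps He. destruct (HF z (HD z Hz) eps He) as [d [Hd H]].
  exists d. split; [exact Hd|]. intros w Hw. apply H, HD, Hw.
Qed.

Lemma circle_2PI z0 r : circle z0 r (2 * PI) = circle z0 r 0.
Proof. unfold circle. rewrite cos_2PI, sin_2PI, cos_0, sin_0. reflexivity. Qed.

Lemma derC_plus f g t a b : derC f t a -> derC g t b -> derC (fun s => f s + g s)%C t (a + b)%C.
Proof.
  intros [H1 H2] [H3 H4]. split.
  - exact (is_derive_plus (K := R_AbsRing) (V := R_NormedModule) _ _ t _ _ H1 H3).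
  - exact (is_derive_plus (K := R_AbsRing) (V := R_NormedModule) _ _ t _ _ H2 H4).
Qed.

Lemma derC_const a t : derC (fun _ => a) t (RtoC 0).
Proof. split; exact (is_derive_const (K := R_AbsRing) (V := R_NormedModule) _ t). Qed.

(** * Holomorphic factorization of P on a circle *)

Section CircleFactorization.
Context {V : HilbertSpace}.
Variables (Omega : C -> Prop) (P : C -> BOp V) (z0 : C) (r : R).
Hypothesis Omega_open : open Omega.
Hypothesis P_C2 : C2_op Omega P.
Hypothesis P_pos : forall z, Omega z -> pos_invertible (P z).
Hypothesis Hr : 0 < r.
Hypothesis disc_in : forall z, closed_disc z0 r z -> Omega z.

Lemma circle_Omega t : Omega (circle z0 r t).
Proof. apply disc_in, circle_closed, Hr. Qed.

Lemma contO_circle_Omega (F : C -> BOp V) : continuous_on Omega F -> contO (fun t => F (circle z0 r t)).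
Proof.
  intros HF. apply contO_circle; [exact Hr|].
  apply (contO_on_sub _ Omega); [exact disc_in|]. apply contO_on_iff, HF.
Qed.

(** The rotation field about z0 applied to F, that is the derivative along circles with respect to
    the angle t. *)
Definition angular (F : C -> BOp V) (z : C) : BOp V :=
  plus (scal (RtoC (- snd (z - z0)%C)) (dx F z)) (scal (RtoC (fst (z - z0)%C)) (dy F z)).

(** The second angular derivative, expanded by the product rule; the coefficients -y and x of the
    rotation field have angular derivatives -x and -y. *)
Definition angular2 (F : C -> BOp V) (z : C) : BOp V :=
  plus (plus (scal (RtoC (- fst (z - z0)%C)) (dx F z)) (scal (RtoC (- snd (z - z0)%C)) (angular (dx F) z)))
    (plus (scal (RtoC (- snd (z - z0)%C)) (dy F z)) (scal (RtoC (fst (z - z0)%C)) (angular (dy F) z))).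

Lemma derC_fst_circle t : derC (fun s => RtoC (fst (circle z0 r s - z0)%C)) t (RtoC (- snd (circle z0 r t - z0)%C)).
Proof. split; unfold Re, Im; simpl; auto_derive; auto; ring. Qed.

Lemma derC_snd_circle t : derC (fun s => RtoC (- snd (circle z0 r s - z0)%C)) t (RtoC (- fst (circle z0 r t - z0)%C)).
Proof. split; unfold Re, Im; simpl; auto_derive; auto; ring. Qed.

Lemma derC_angular F (a b : V) t : C1_op Omega F ->
  derC (fun s => inner (F (circle z0 r s) a) b) t (inner (angular F (circle z0 r t) a) b).
Proof.
  intros HF. apply (rderO_inner (fun s => F (circle z0 r s))).
  replace (angular F (circle z0 r t)) with (plus (scal (RtoC (- r * sin t)) (dx F (circle z0 r t)))
    (scal (RtoC (r * cos t)) (dy F (circle z0 r t))) : BOp V).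
  - apply (rderO_circle Omega Omega_open F z0 r t Hr HF), circle_Omega.
  - unfold angular. rewrite circle_sub. unfold ek. rewrite Rmult_1_l. f_equal; f_equal; f_equal; simpl; ring.
Qed.

Lemma derC_angular2 (a b : V) t :
  derC (fun s => inner (angular P (circle z0 r s) a) b) t (inner (angular2 P (circle z0 r t) a) b).
Proof.
  destruct P_C2 as [H1 [H2 H3]].
  replace (fun s => inner (angular P (circle z0 r s) a) b) with
    (fun s => RtoC (- snd (circle z0 r s - z0)%C) * inner (dx P (circle z0 r s) a) b
      + RtoC (fst (circle z0 r s - z0)%C) * inner (dy P (circle z0 r s) a) b)%C
    by (apply functional_extensionality; intros s; unfold angular; inner_simpl; reflexivity).
  replace (inner (angular2 P (circle z0 r t) a) b) with
    ((RtoC (- fst (circle z0 r t - z0)%C) * inner (dx P (circle z0 r t) a) b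
      + RtoC (- snd (circle z0 r t - z0)%C) * inner (angular (dx P) (circle z0 r t) a) b)
    + (RtoC (- snd (circle z0 r t - z0)%C) * inner (dy P (circle z0 r t) a) b
      + RtoC (fst (circle z0 r t - z0)%C) * inner (angular (dy P) (circle z0 r t) a) b))%C
    by (unfold angular2; inner_simpl; reflexivity).
  apply derC_plus.
  - exact (derC_mult _ _ t _ _ (derC_snd_circle t) (derC_angular (dx P) a b t H2)).
  - exact (derC_mult _ _ t _ _ (derC_fst_circle t) (derC_angular (dy P) a b t H3)).
Qed.

Lemma contO_angular F : C1_op Omega F -> contO (fun t => angular F (circle z0 r t)).
Proof.
  intros [_ [Hx Hy]]. unfold angular. apply contO_plus; apply contO_scal; try (apply contO_circle_Omega; assumption).
  - intros t. exact (derC_cont _ t _ (derC_snd_circle t)).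
  - intros t. exact (derC_cont _ t _ (derC_fst_circle t)).
Qed.

Lemma contO_angular2 : contO (fun t => angular2 P (circle z0 r t)).
Proof.
  destruct P_C2 as [[_ [Hx Hy]] [H2 H3]]. unfold angular2.
  assert (C1 : contC (fun t => RtoC (- snd (circle z0 r t - z0)%C))).
  { intros t. exact (derC_cont _ t _ (derC_snd_circle t)). }
  assert (C2 : contC (fun t => RtoC (fst (circle z0 r t - z0)%C))).
  { intros t. exact (derC_cont _ t _ (derC_fst_circle t)). }
  assert (C3 : contC (fun t => RtoC (- fst (circle z0 r t - z0)%C))).
  { replace (fun t => RtoC (- fst (circle z0 r t - z0)%C)) with (fun t => - RtoC (fst (circle z0 r t - z0)%C))%C.
    - apply contC_opp, C2.
    - apply functional_extensionality; intros t. rewrite RtoC_opp. reflexivity. }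
  apply contO_plus; apply contO_plus; apply contO_scal; try assumption;
    first [apply contO_circle_Omega; assumption|apply contO_angular; assumption].
Qed.

Lemma oholo_rescale (F : C -> BOp V) : oholo (RtoC 0) 1 F -> oholo z0 r (fun z => F ((z - z0) * RtoC (/ r))%C).
Proof.
  intros [H1 H2]. assert (Hi : 0 < / r) by (apply Rinv_0_lt_compat, Hr).
  assert (Em : forall w z : C, Cmod ((w - z0) * RtoC (/ r) - (z - z0) * RtoC (/ r))%C = Cmod (w - z) * / r).
  { intros w z. replace ((w - z0) * RtoC (/ r) - (z - z0) * RtoC (/ r))%C with ((w - z) * RtoC (/ r))%C by ring.
    rewrite Cmod_mult, Cmod_R, Rabs_pos_eq by lra. reflexivity. }
  assert (E0 : forall z : C, Cmod ((z - z0) * RtoC (/ r) - RtoC 0)%C = Cmod (z - z0) * / r).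
  { intros z. rewrite <- (Em z z0). f_equal. ring. }
  assert (Hlt : forall x d, x < d * r -> x * / r < d).
  { intros x d Hx. apply Rmult_lt_reg_r with r; [exact Hr|]. rewrite Rmult_assoc, Rinv_l by lra. lra. }
  split.
  - intros z Hz. assert (Hz' : closed_disc (RtoC 0) 1 ((z - z0) * RtoC (/ r))%C).
    { unfold closed_disc in *. rewrite E0. apply Rmult_le_reg_r with r; [exact Hr|]. rewrite Rmult_assoc, Rinv_l by lra. lra. }
    intros eps He. destruct (H1 _ Hz' eps He) as [d [Hd H]].
    exists (d * r). split; [apply Rmult_lt_0_compat; assumption|]. intros w Hw Hwz. apply H.
    + unfold closed_disc in *. rewrite E0. apply Rmult_le_reg_r with r; [exact Hr|]. rewrite Rmult_assoc, Rinv_l by lra. lra.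
    + rewrite Em. apply Hlt, Hwz.
  - intros z Hz. assert (Hz' : open_disc (RtoC 0) 1 ((z - z0) * RtoC (/ r))%C).
    { unfold open_disc in *. rewrite E0. apply Hlt. lra. }
    destruct (H2 _ Hz') as [L HL]. exists (scal (RtoC (/ r)) L). intros eps He.
    destruct (HL (eps * r)) as [d [Hd H]]; [apply Rmult_lt_0_compat; assumption|].
    exists (d * r). split; [apply Rmult_lt_0_compat; assumption|]. intros w Hwz.
    specialize (H ((w - z0) * RtoC (/ r))%C). rewrite Em in H. specialize (H (Hlt _ _ Hwz)).
    replace (eps * Cmod (w - z)) with (eps * r * (Cmod (w - z) * / r)) by (field; lra).
    eapply Rle_trans; [|exact H]. right. f_equal. op_ring.
Qed.

(* [factorization] is applied to [E = 1 - tau P], a strict contraction for small [tau]. *)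
Theorem circle_factorization : exists H Y : C -> BOp V,
  oholo z0 r H /\ H z0 = one /\ oholo z0 r Y /\
  forall t, 0 <= t <= 2 * PI -> forall a b : V,
    inner (P (circle z0 r t) (H (circle z0 r t) a)) b = inner a (Y (circle z0 r t) b).
Proof.
  assert (HcP : contO (fun t => P (circle z0 r t))) by (apply (contO_P_circle Omega P Omega_open P_C2); [exact Hr|apply circle_Omega]).
  destruct (circle_coercive P z0 r Hr HcP (fun t => P_pos _ (circle_Omega t))) as [c [Hc Hcoer]].
  destruct (circle_bounded P z0 r Hr HcP) as [N0 [HN0 HB0]].
  (* The maximum with c secures c <= N, as [coercive_contraction] requires; tau and rho below are
     its step and its contraction factor. *)
  set (N := Rmax c N0).
  assert (HcN : 0 < c <= N) by (split; [exact Hc|apply Rmax_l]).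
  assert (HB : forall t, bop_norm (P (circle z0 r t)) <= N) by (intros t; eapply Rle_trans; [apply HB0|apply Rmax_r]).
  set (tau := c / N ^ 2). assert (Htau : 0 < tau) by (apply Rdiv_lt_0_compat; [lra|apply pow_lt; lra]).
  destruct (circle_bounded (angular P) z0 r Hr (contO_angular P (proj1 P_C2))) as [M1 [HM1 HB1]].
  destruct (circle_bounded (angular2 P) z0 r Hr contO_angular2) as [M2 [HM2 HB2]].
  set (M := tau * Rmax M1 M2).
  set (E := fun t => minus one (scal (RtoC tau) (P (circle z0 r t))) : BOp V).
  (* The factor i makes i E1 the derivative of E = 1 - tau P, and likewise i E2 that of E1. *)
  set (E1 := fun t => scal (Ci * RtoC tau)%C (angular P (circle z0 r t)) : BOp V).
  set (E2 := fun t => scal (RtoC tau) (angular2 P (circle z0 r t)) : BOp V).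
  set (rho := sqrt (1 - (c / N) ^ 2)).
  assert (Hq : 0 < c / N <= 1).
  { split; [apply Rdiv_lt_0_compat; lra|]. apply Rmult_le_reg_r with N; [lra|]. unfold Rdiv. rewrite Rmult_assoc, Rinv_l by lra. lra. }
  assert (Hrho : 0 <= rho < 1).
  { split; [apply sqrt_pos|]. unfold rho. rewrite <- sqrt_1 at 2. apply sqrt_lt_1_alt. nra. }
  destruct (factorization E E1 E2 rho M) as [H [Y [HH [H0 [HY HHY]]]]].
  - exact (contO_minus (fun _ => one) (fun t => scal (RtoC tau) (P (circle z0 r t))) (contO_const one)
      (contO_scal (fun _ => RtoC tau) _ (contC_const _) HcP)).
  - apply (contO_scal (fun _ => (Ci * RtoC tau)%C)); [apply contC_const|]. exact (contO_angular P (proj1 P_C2)).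
  - apply (contO_scal (fun _ => RtoC tau)); [apply contC_const|]. apply contO_angular2.
  - intros a b t.
    replace (fun s => inner (E s a) b) with (fun s => inner a b + (- RtoC tau) * inner (P (circle z0 r s) a) b)%C
      by (apply functional_extensionality; intros s; unfold E; inner_simpl; ring).
    replace (Ci * inner (E1 t a) b)%C with (RtoC 0 + (RtoC 0 * inner (P (circle z0 r t) a) b + (- RtoC tau) * inner (angular P (circle z0 r t) a) b))%C.
    + apply derC_plus; [apply derC_const|].
      exact (derC_mult (fun _ => (- RtoC tau)%C) _ t _ _ (derC_const _ t) (derC_angular P a b t (proj1 P_C2))).
    + unfold E1. inner_simpl. rewrite Cmult_assoc, (Cmult_assoc Ci Ci).
      replace (Ci * Ci)%C with (- RtoC 1)%C by (unfold Ci; ceq). ring.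
  - intros a b t.
    replace (fun s => inner (E1 s a) b) with (fun s => (Ci * RtoC tau) * inner (angular P (circle z0 r s) a) b)%C
      by (apply functional_extensionality; intros s; unfold E1; inner_simpl; ring).
    replace (Ci * inner (E2 t a) b)%C with (RtoC 0 * inner (angular P (circle z0 r t) a) b + (Ci * RtoC tau) * inner (angular2 P (circle z0 r t) a) b)%C.
    + apply (derC_mult (fun _ => (Ci * RtoC tau)%C)); [apply derC_const|]. apply derC_angular2.
    + unfold E2. inner_simpl. ring.
  - unfold E. rewrite circle_2PI. reflexivity.
  - unfold E1. rewrite circle_2PI. reflexivity.
  - exact Hrho.
  - unfold M. apply Rmult_le_pos; [lra|]. apply Rle_trans with M1; [lra|apply Rmax_l].
  - intros t. apply bop_norm_le; [apply Hrho|]. intros v.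
    apply (coercive_contraction (P (circle z0 r t)) c N v HcN (Hcoer t v)).
    eapply Rle_trans; [apply bop_norm_bound|]. apply Rmult_le_compat_r; [apply vnorm_ge_0|apply HB].
  - intros t. eapply Rle_trans; [apply bop_norm_scal|]. rewrite Cmod_mult, Cmod_Ci, Cmod_R, Rabs_pos_eq, Rmult_1_l by lra.
    apply Rmult_le_compat_l; [lra|]. eapply Rle_trans; [apply HB1|apply Rmax_l].
  - intros t. eapply Rle_trans; [apply bop_norm_scal|]. rewrite Cmod_R, Rabs_pos_eq by lra.
    apply Rmult_le_compat_l; [lra|]. eapply Rle_trans; [apply HB2|apply Rmax_r].
  (* The factorization obtained is that of 1 - E = tau P on the unit circle, hence the rescaling of
     the variable and the division of Y by tau. *)
  - exists (fun z => H ((z - z0) * RtoC (/ r))%C), (fun z => scal (RtoC (/ tau)) (Y ((z - z0) * RtoC (/ r))%C)).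
    assert (Ec : forall t, ((circle z0 r t - z0) * RtoC (/ r))%C = ek 1 t).
    { intros t. rewrite circle_sub. replace (RtoC r * ek 1 t * RtoC (/ r))%C with (RtoC r * RtoC (/ r) * ek 1 t)%C by ring.
      rewrite <- RtoC_mult, Rinv_r by lra. ring. }
    split; [apply oholo_rescale, HH|]. split; [|split].
    + replace ((z0 - z0) * RtoC (/ r))%C with (RtoC 0) by ring. exact H0.
    + replace (fun z => scal (RtoC (/ tau)) (Y ((z - z0) * RtoC (/ r))%C)) with
        (fun z => mult (scal (RtoC (/ tau)) (one : BOp V)) (Y ((z - z0) * RtoC (/ r))%C) : BOp V).
      * apply oholo_mult; [apply oholo_const|apply oholo_rescale, HY].
      * apply functional_extensionality. intros z. op_ring.
    + intros t Ht a b. rewrite Ec. specialize (HHY t Ht a b).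
      replace (inner a (scal (RtoC (/ tau)) (Y (ek 1 t)) b)) with (RtoC (/ tau) * inner a (Y (ek 1 t) b))%C
        by (inner_simpl; f_equal; ceq).
      rewrite <- HHY. unfold E. inner_simpl.
      set (X := inner (P (circle z0 r t) (H (ek 1 t) a)) b).
      transitivity ((RtoC (/ tau) * RtoC tau) * X)%C; [|ring].
      rewrite <- RtoC_mult, Rinv_l by lra. ring.
Qed.

End CircleFactorization.

Lemma closed_disc_center z0 r : 0 < r -> closed_disc z0 r z0.
Proof. intros Hr. unfold closed_disc. rewrite Cmod_minus_self. lra. Qed.

(** The Legendre inequality for the form of A: expand <A (g - h), g - h> >= 0 with h = A^-1 f.
    Equality holds at g = h. *)
Lemma bop_inv_quad_ge {V : HilbertSpace} (A : BOp V) (f g : V) : pos_invertible A ->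
  2 * Re (inner g f) - Re (inner (A g) g) <= Re (inner (bop_inv A f) f).
Proof.
  intros HA. set (h := bop_inv A f : V).
  assert (Eh : A h = f) by (apply bop_inv_app_r, HA).
  pose proof (proj2 (proj1 HA) (minus g h)) as H. rewrite lin_minus, Eh in H. inner_simpl_in H.
  assert (E1 : inner (A g) h = inner g f) by (rewrite (nonneg_sym A g h (proj1 HA)), Eh; reflexivity).
  rewrite E1 in H. pose proof (inner_conj_re f g) as E2. pose proof (inner_conj_re f h) as E3.
  unfold Re in *; simpl in *. lra.
Qed.

(** A convex quadratic form lies above its tangent at x: expand <A (y - x), y - x> >= 0. *)
Lemma pos_quad_ge {V : HilbertSpace} (A : BOp V) (x y : V) : nonneg A ->
  2 * Re (inner (A x) y) - Re (inner (A x) x) <= Re (inner (A y) y).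
Proof.
  intros HA. pose proof (proj2 HA (minus y x)) as H. rewrite lin_minus in H. inner_simpl_in H.
  rewrite (nonneg_sym A y x HA) in H. pose proof (inner_conj_re y (A x)) as E2.
  unfold Re in *; simpl in *. lra.
Qed.

Lemma clamp_lip a b : Rabs (Rmax 0 (Rmin 1 a) - Rmax 0 (Rmin 1 b)) <= Rabs (a - b).
Proof.
  unfold Rmax, Rmin, Rabs.
  repeat (destruct (Rle_dec _ _) || destruct (Rcase_abs _)); lra.
Qed.

(* A nonzero idempotent has norm at least one, so its norm cannot leave zero continuously. *)
Lemma idempotent_zero_on_disc {V : HilbertSpace} z0 r (F : C -> BOp V) : 0 < r ->
  contO_on (closed_disc z0 r) F -> (forall z, closed_disc z0 r z -> mult (F z) (F z) = F z) ->
  F z0 = zero -> forall z, closed_disc z0 r z -> F z = zero.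
Proof.
  intros Hr HF Hid H0 z Hz.
  assert (Hn : forall x, closed_disc z0 r x -> bop_norm (F x) <= bop_norm (F x) * bop_norm (F x)).
  { intros x Hx. rewrite <- (Hid x Hx) at 1. apply bop_norm_mult. }
  destruct (Rle_lt_dec (bop_norm (F z)) 0) as [Hle|Hgt].
  { apply bop_norm_eq_0. apply Rle_antisym; [exact Hle|apply bop_norm_ge_0]. }
  exfalso. assert (H1 : 1 <= bop_norm (F z)).
  { apply Rmult_le_reg_l with (bop_norm (F z)); [exact Hgt|]. rewrite Rmult_1_r. apply Hn, Hz. }
  (* The segment from z0 to z, with the parameter clamped to [0, 1] so that the path is defined and
     continuous on the whole line. The intermediate value 1 / 2 of the norm then contradicts n <=
     n^2. *)
  set (p := fun s : R => (z0 + RtoC (Rmax 0 (Rmin 1 s)) * (z - z0))%C).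
  assert (Hp : forall s, closed_disc z0 r (p s)).
  { intros s. unfold closed_disc, p in *.
    replace (z0 + RtoC (Rmax 0 (Rmin 1 s)) * (z - z0) - z0)%C with (RtoC (Rmax 0 (Rmin 1 s)) * (z - z0))%C by ring.
    rewrite Cmod_mult, Cmod_R. pose proof (Rmax_l 0 (Rmin 1 s)) as B1.
    assert (B2 : Rmax 0 (Rmin 1 s) <= 1) by (apply Rmax_lub; [lra|apply Rmin_l]).
    rewrite Rabs_pos_eq by exact B1. pose proof (Cmod_ge_0 (z - z0)). nra. }
  assert (Hc : contO (fun s => F (p s))).
  { intros s eps He. destruct (HF (p s) (Hp s) eps He) as [d [Hd Hw]].
    assert (Hd' : 0 < d / (r + 1)) by (apply Rdiv_lt_0_compat; lra).
    exists (mkposreal _ Hd'). intros s' Hs'. change (Rabs (s' - s) < d / (r + 1)) in Hs'.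
    apply Hw; [apply Hp|].
    replace (p s' - p s)%C with (RtoC (Rmax 0 (Rmin 1 s') - Rmax 0 (Rmin 1 s)) * (z - z0))%C
      by (unfold p; rewrite RtoC_minus; ring).
    rewrite Cmod_mult, Cmod_R. pose proof (clamp_lip s' s). unfold closed_disc in Hz.
    apply Rle_lt_trans with (Rabs (s' - s) * r).
    - apply Rmult_le_compat; [apply Rabs_pos|apply Cmod_ge_0|assumption|exact Hz].
    - pose proof (Rabs_pos (s' - s)).
      apply Rmult_lt_compat_r with (r := r + 1) in Hs'; [|lra].
      unfold Rdiv in Hs'. rewrite Rmult_assoc, Rinv_l in Hs' by lra. lra. }
  assert (P0 : p 0 = z0).
  { unfold p. rewrite Rmin_right, Rmax_left by lra. ring. }
  assert (P1 : p 1 = z).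
  { unfold p. rewrite Rmin_left, Rmax_right by lra. ring. }
  destruct (IVT_gen (fun s => bop_norm (F (p s))) 0 1 (1 / 2)) as [s [_ Hs]].
  - intros s. apply continuity_pt_filterlim. apply (contO_norm _ Hc).
  - rewrite P0, P1, H0. assert (Ez : bop_norm (zero : BOp V) = 0) by exact bop_norm_zero. rewrite Ez.
    rewrite Rmin_left, Rmax_right by lra. lra.
  - pose proof (Hn (p s) (Hp s)) as B. cbv beta in Hs. rewrite Hs in B. lra.
Qed.

(** * The minimiser and the inequality at the centre *)

Section CurvatureToMean.
Context {V : HilbertSpace}.
Variables (Omega : C -> Prop) (P : C -> BOp V) (z0 : C) (r : R).
Hypothesis Omega_open : open Omega.
Hypothesis P_C2 : C2_op Omega P.
Hypothesis P_pos : forall z, Omega z -> pos_invertible (P z).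
Hypothesis Hr : 0 < r.
Hypothesis disc_in : forall z, closed_disc z0 r z -> Omega z.
Variables H Y : C -> BOp V.
Hypothesis HH : oholo z0 r H.
Hypothesis H_center : H z0 = one.
Hypothesis HY : oholo z0 r Y.
Hypothesis HHY : forall t, 0 <= t <= 2 * PI -> forall a b : V,
  inner (P (circle z0 r t) (H (circle z0 r t) a)) b = inner a (Y (circle z0 r t) b).

Let T : BOp V := Y z0.

Lemma PH_adj_Y t (a b : V) : inner (P (circle z0 r t) (H (circle z0 r t) a)) b = inner a (Y (circle z0 r t) b).
Proof.
  destruct (circle_param z0 r (circle z0 r t) Hr) as [s [Hs E]].
  { apply Cmod_circle_sub. lra. }
  rewrite E. apply HHY, Hs.
Qed.

Lemma P_circle_pos t : pos_invertible (P (circle z0 r t)).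
Proof. apply P_pos, disc_in, circle_closed, Hr. Qed.

Lemma P_circle_cont : contO (fun t => P (circle z0 r t)).
Proof. apply (contO_P_circle Omega P Omega_open P_C2); [exact Hr|]. intros t. apply disc_in, circle_closed, Hr. Qed.

(* On the circle [Y H = H^* P H] is self-adjoint, so it is constant by holomorphy. *)
Lemma YH_quad_const a z : closed_disc z0 r z -> inner (Y z (H z a)) a = inner (T a) a.
Proof.
  intros Hz.
  transitivity (inner (mult (Y z0) (H z0) a) a); [|rewrite H_center, mult_one_r; reflexivity].
  apply (holo_real_const z0 r (fun z => inner (mult (Y z) (H z) a) a) Hr); [|clear z Hz|exact Hz].
  - apply (holo_inner z0 r (fun z => mult (Y z) (H z))), oholo_mult; assumption.
  - intros t _. rewrite app_mult. rewrite inner_conj_im, <- PH_adj_Y, nonneg_im; [ring|apply P_circle_pos].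
Qed.

Lemma YH_const z : closed_disc z0 r z -> mult (Y z) (H z) = T.
Proof. intros Hz. apply op_ext_quad. intros a. apply (YH_quad_const a z Hz). Qed.

Lemma PHH_circle t (a b : V) : inner (P (circle z0 r t) (H (circle z0 r t) a)) (H (circle z0 r t) b) = inner a (T b).
Proof. rewrite PH_adj_Y, <- (YH_const (circle z0 r t)) by apply circle_closed, Hr. reflexivity. Qed.

Lemma T_real a : Im (inner (T a) a) = 0.
Proof.
  rewrite inner_conj_im, <- (PHH_circle 0), nonneg_im; [ring|apply P_circle_pos].
Qed.

Lemma T_adj : adj T = T.
Proof. apply selfadj_of_quad_real, T_real. Qed.

(** On the circle <T a, a> = <P H a, H a> is at least c |H a|^2, and a, being the value of H a at
    the centre, is an average of these vectors and so no longer than their common bound. *)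
Lemma T_coercive : exists c, 0 < c /\ forall a, c * norm a ^ 2 <= Re (inner (T a) a).
Proof.
  destruct (circle_coercive P z0 r Hr P_circle_cont P_circle_pos) as [c [Hc Hco]].
  exists c. split; [exact Hc|]. intros a.
  assert (Hb : forall t, c * norm (H (circle z0 r t) a) ^ 2 <= Re (inner (T a) a)).
  { intros t. rewrite inner_conj_re, <- (PHH_circle t). apply Hco. }
  set (q := Re (inner (T a) a)) in *.
  assert (Hq : 0 <= q / c).
  { apply Rdiv_le_0_compat; [|exact Hc]. eapply Rle_trans; [|apply (Hb 0)].
    apply Rmult_le_pos; [lra|apply pow2_ge_0]. }
  assert (Hn : forall t, norm (H (circle z0 r t) a) <= sqrt (q / c)).
  { intros t. rewrite <- (sqrt_pow2 (norm (H (circle z0 r t) a))) by apply vnorm_ge_0.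
    apply sqrt_le_1_alt. apply Rmult_le_reg_l with c; [exact Hc|].
    eapply Rle_trans; [apply Hb|]. right. field. lra. }
  pose proof (vnorm_ge_0 a) as Ha. pose proof (sqrt_pos (q / c)) as Hs.
  assert (Hm : norm a <= sqrt (q / c)).
  { apply norm_le_inner; [exact Hs|].
    pose proof (oholo_mean z0 r H a a Hr HH) as Em. rewrite H_center in Em.
    change ((one : BOp V) a) with a in Em. rewrite <- Em.
    eapply Rle_trans; [eapply Rle_trans; [apply Rle_abs|apply re_le_Cmod]|]. apply cavg_bound.
    - apply (contC_inner (fun t => H (circle z0 r t))), contO_circle; [exact Hr|apply HH].
    - intros t. eapply Rle_trans; [apply inner_le|]. apply Rmult_le_compat_r; [exact Ha|apply Hn]. }
  apply Rle_trans with (c * sqrt (q / c) ^ 2).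
  - apply Rmult_le_compat_l; [lra|]. apply pow_incr. split; assumption.
  - rewrite pow2_sqrt by exact Hq. right. field. lra.
Qed.

Lemma T_invertible : invertible T.
Proof. destruct T_coercive as [c [Hc H1]]. exact (coercive_invertible T c Hc H1). Qed.

(** The operator L = T^-1 Y is a left inverse of H, which makes 1 - H L idempotent; it vanishes at
    z0, where H = 1 and Y = T, so [idempotent_zero_on_disc] shows that L is a right inverse too. *)
Lemma H_invertible z : closed_disc z0 r z -> invertible (H z).
Proof.
  intros Hz. set (L := fun z => mult (bop_inv T) (Y z)).
  destruct (bop_inv_spec T T_invertible) as [I1 I2].
  assert (HLH : forall z, closed_disc z0 r z -> mult (L z) (H z) = one).
  { intros x Hx. unfold L. rewrite <- mult_assoc, YH_const by exact Hx. exact I2. }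
  set (F := fun z => minus one (mult (H z) (L z))).
  assert (HF : F z = zero).
  { apply (idempotent_zero_on_disc z0 r F); [exact Hr| | | |exact Hz].
    - intros x Hx. apply (limO_minus (F := nearC _ x) (fun _ => one)); [apply limO_const|].
      apply (limO_mult (F := nearC _ x)); [apply HH, Hx|].
      apply (limO_mult (F := nearC _ x) (fun _ => bop_inv T)); [apply limO_const|apply HY, Hx].
    - intros x Hx. specialize (HLH x Hx). unfold F. set (X := H x) in *. set (Z := L x) in *. clearbody X Z.
      assert (Ek : forall u : V, Z (X u) = u) by (intros u; apply (f_equal (fun A : BOp V => A u) HLH)).
      apply op_ext_inner; intros u w. inner_simpl. rewrite Ek. ring.
    - unfold F, L. rewrite H_center, mult_one_l. fold T. rewrite I2. op_ring. }
  exists (L z). split; [|apply HLH, Hz].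
  apply op_ext_inner; intros u w. apply (f_equal (fun A : BOp V => inner (A u) w)) in HF.
  unfold F in HF. inner_simpl_in HF. inner_simpl.
  match type of HF with (?x - ?y)%C = _ => replace y with (x - (x - y))%C by ring end.
  rewrite HF. ring.
Qed.

Lemma H_admissible : admissible z0 r H.
Proof.
  split; [apply H_invertible|]. split.
  - apply contO_on_iff, HH.
  - intros z Hz. apply ex_derive_oderiv, HH, Hz.
Qed.

(** On the circle the adjoint of H times P H is the constant T, whose average against dz is zero;
    the correction term of [frakS] drops out. *)
Lemma frakS_twist_H : frakS_twist P z0 r H = T.
Proof.
  unfold frakS_twist. rewrite H_center, adj_one.
  assert (E1 : bop_inv (one : BOp V) = one) by (apply bop_inv_unique; split; apply mult_one_l).
  rewrite E1, mult_one_l, mult_one_r.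
  set (N := fun z => mult (mult (adj (H z)) (P z)) (H z)).
  assert (EN : forall t u w, inner (N (circle z0 r t) u) w = inner (T u) w).
  { intros t u w. unfold N. rewrite !app_mult, inner_adj_l, PHH_circle. symmetry. apply inner_selfadj, T_adj. }
  assert (E0 : avg_abs_dz N z0 r = T).
  { apply op_ext_inner. intros u w.
    transitivity (cavg (fun t => inner (N (circle z0 r t) u) w));
      [exact (twist_M0 P H z0 r Hr P_circle_cont H_admissible u w)|].
    rewrite (cavg_ext _ (fun _ => inner (T u) w)) by (intros t; apply EN). apply cavg_const. }
  assert (E2 : avg_dz N z0 r = zero).
  { apply op_ext_inner. intros u w.
    transitivity (cavg (fun t => Ci * ek 1 t * inner (N (circle z0 r t) u) w)%C);
      [exact (twist_M1 P H z0 r Hr P_circle_cont H_admissible u w)|].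
    rewrite (cavg_ext _ (fun t => (Ci * inner (T u) w) * ek 1 t)%C) by (intros t; rewrite EN; ring).
    rewrite cavg_scal by apply contC_ek. rewrite cavg_ek. simpl. inner_simpl. ring. }
  unfold frakS. rewrite E0, E2. op_ring.
Qed.

(* [<P H v, K v> = <v, Y K v>] has average [<v, T v>] because [K z0 = 1]. *)
Lemma T_minimal H2 : admissible z0 r H2 -> bop_le T (frakS_twist P z0 r H2).
Proof.
  intros Hadm.
  destruct (twist_average P H2 z0 r Hr P_circle_cont P_circle_pos Hadm) as [K [HK [HK0 HKv]]].
  assert (HcK : contO (fun t => K (circle z0 r t))) by (apply contO_circle; [exact Hr|apply HK]).
  assert (HcPK : forall v : V, contC (fun t => inner (P (circle z0 r t) (K (circle z0 r t) v)) (K (circle z0 r t) v))).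
  { intros v. apply (contC_inner2 (fun t => mult (P (circle z0 r t)) (K (circle z0 r t))) (fun t => K (circle z0 r t)));
      [apply contO_mult; [exact P_circle_cont|exact HcK]|exact HcK]. }
  apply bop_le_intro.
  - apply T_real.
  - intros v. rewrite HKv. unfold Im, cavg at 1. cbn [snd].
    rewrite (ravg_ext _ (fun _ => 0)); [apply ravg_const|]. intros t. apply nonneg_im, P_circle_pos.
  - intros v. rewrite HKv.
    assert (HYK : oholo z0 r (fun z => mult (Y z) (K z))) by (apply oholo_mult; assumption).
    pose proof (oholo_mean z0 r _ v v Hr HYK) as Em. cbv beta in Em. rewrite HK0, mult_one_r in Em. fold T in Em.
    assert (HcYK : contC (fun t => inner (mult (Y (circle z0 r t)) (K (circle z0 r t)) v) v)).
    { apply (contC_inner (fun t => mult (Y (circle z0 r t)) (K (circle z0 r t)))).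
      apply (contO_circle z0 r (fun z => mult (Y z) (K z))); [exact Hr|apply HYK]. }
    apply Rle_trans with (ravg (fun t => Re (RtoC 2 * inner (mult (Y (circle z0 r t)) (K (circle z0 r t)) v) v
      + - inner (T v) v)%C)).
    + right. change (Re (inner (T v) v) = Re (cavg (fun t => RtoC 2 * inner (mult (Y (circle z0 r t)) (K (circle z0 r t)) v) v
      + - inner (T v) v)%C)).
      rewrite cavg_plus, cavg_scal, cavg_const, Em; [|exact HcYK|apply contC_mult; [apply contC_const|exact HcYK]|apply contC_const].
      f_equal. ceq.
    + change (Re (cavg (fun t => inner (P (circle z0 r t) (K (circle z0 r t) v)) (K (circle z0 r t) v)))) with
        (ravg (fun t => Re (inner (P (circle z0 r t) (K (circle z0 r t) v)) (K (circle z0 r t) v)))).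
      apply ravg_le.
      * apply (contC_re (fun t => RtoC 2 * inner (mult (Y (circle z0 r t)) (K (circle z0 r t)) v) v
          + - inner (T v) v)%C). apply contC_plus; [apply contC_mult; [apply contC_const|exact HcYK]|apply contC_const].
      * apply (contC_re _ (HcPK v)).
      (* The tangent inequality at x = H v for y = K v: its cross term is holomorphic up to
         conjugation, and its constant term is <T v, v>. *)
      * intros t. eapply Rle_trans; [|apply (pos_quad_ge _ (H (circle z0 r t) v)), P_circle_pos].
        rewrite PHH_circle, PH_adj_Y, app_mult.
        pose proof (inner_conj_re v (Y (circle z0 r t) (K (circle z0 r t) v))) as A1.
        pose proof (inner_conj_re v (T v)) as A2.
        unfold Re in *; simpl in *. lra.
Qed.

Hypothesis P_curv : semipositive_curvature Omega P.

Let phi (w : V) (z : C) : R := Re (inner (bop_inv (P z) (adj (Y z) w)) (adj (Y z) w)).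

Lemma phi_cont w : contR_on (closed_disc z0 r) (phi w).
Proof.
  apply (contR_on_of_re (closed_disc z0 r) (fun z => inner (bop_inv (P z) (adj (Y z) w)) (adj (Y z) w))).
  intros z Hz.
  assert (HlP : limO (nearC (closed_disc z0 r) z) P (P z)).
  { intros eps He. destruct (C1_op_near Omega P z Omega_open (proj1 P_C2) (disc_in z Hz) eps He) as [d [Hd Hw]].
    exists d. split; [exact Hd|]. intros x _ Hx. apply Hw, Hx. }
  assert (HlPi : limO (nearC (closed_disc z0 r) z) (fun x => bop_inv (P x)) (bop_inv (P z))).
  { apply (limO_bop_inv (F := nearC _ z)); [apply P_pos, disc_in, Hz| |exact HlP].
    exists 1. split; [lra|]. intros x Hx _. apply P_pos, disc_in, Hx. }
  pose proof (proj1 HY z Hz) as HlY.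
  pose proof (limC_inner (F := nearC _ z) _ _ w w (limO_mult (F := nearC _ z) _ _ _ _ HlY
    (limO_mult (F := nearC _ z) _ _ _ _ HlPi (limO_adj (F := nearC _ z) _ _ HlY)))) as HL.
  assert (Ex : forall x, inner (mult (Y x) (mult (bop_inv (P x)) (adj (Y x))) w) w =
    inner (bop_inv (P x) (adj (Y x) w)) (adj (Y x) w)) by (intros x; rewrite !app_mult; apply inner_adj_r).
  intros eps He. destruct (HL eps He) as [d [Hd Hw]]. exists d. split; [exact Hd|].
  intros x Dx Hx. specialize (Hw x Dx Hx). rewrite !Ex in Hw. exact Hw.
Qed.

Lemma phi_boundary w t : phi w (circle z0 r t) = Re (inner (T w) w).
Proof.
  assert (E : (adj (Y (circle z0 r t)) w : V) = P (circle z0 r t) (H (circle z0 r t) w)).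
  { apply inner_ext. intros b. rewrite inner_adj_l, PH_adj_Y. reflexivity. }
  unfold phi. rewrite E, bop_inv_app_l by apply P_circle_pos.
  rewrite inner_conj_re, PHH_circle, inner_conj_re. reflexivity.
Qed.

(* [phi w z] dominates [2 Re <g, Y^* w> - <P g, g>] for every holomorphic [g], and
   [Y^* w] pairs holomorphically with [g]. *)
Lemma phi_submean w z1 : open_disc z0 r z1 -> forall eps, 0 < eps -> exists d, 0 < d /\
  forall rho, 0 < rho < d -> phi w z1 <= ravg (fun t => phi w (circle z1 rho t)) + eps * rho ^ 2.
Proof.
  intros Hz1 eps He. assert (HO : Omega z1) by apply disc_in, open_closed_disc, Hz1.
  (* The vector g0 gives equality in the Legendre inequality at z1, so the lower bound built from an
     affine field through g0 is exact at the centre of the circle. *)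
  set (f1 := adj (Y z1) w : V). set (g0 := bop_inv (P z1) f1 : V).
  destruct (avg_curvature Omega P Omega_open P_C2 z1 g0 HO (proj2 (P_pos z1 HO)) eps He) as [d1 [Hd1 HA]].
  set (d2 := r - Cmod (z1 - z0)). assert (Hd2 : 0 < d2) by (unfold d2, open_disc in *; lra).
  exists (Rmin d1 d2). split; [apply Rmin_pos; assumption|]. intros rho Hrho.
  assert (R1 : 0 < rho < d1) by (pose proof (Rmin_l d1 d2); lra).
  assert (R2 : rho < d2) by (pose proof (Rmin_r d1 d2); lra).
  specialize (HA rho R1).
  assert (Hin : forall z, closed_disc z1 rho z -> closed_disc z0 r z).
  { intros z Hz. unfold closed_disc in *. replace (z - z0)%C with ((z - z1) + (z1 - z0))%C by ring.
    eapply Rle_trans; [apply Cmod_triangle|]. unfold d2 in R2. lra. }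
  set (kop := opp (mult (bop_inv (P z1)) (d_z P z1)) : BOp V).
  (* The pairing of the field with the adjoint of Y applied to w, rewritten as a matrix coefficient
     of a holomorphic operator function so that the mean value property applies. *)
  set (X := fun z => mult (Y z) (plus one (scal (RtoC 1 * (z - z1))%C kop))).
  assert (HX : oholo z1 rho X).
  { apply oholo_mult; [|apply oholo_affine]. apply (oholo_sub z0 r); [exact HY|lra|unfold d2 in R2; lra]. }
  assert (Hrho0 : 0 < rho) by lra.
  pose proof (oholo_mean z1 rho X g0 w Hrho0 HX) as Em.
  assert (EX1 : inner (X z1 g0) w = inner g0 f1).
  { unfold X. transitivity (inner (Y z1 g0) w).
    - f_equal. rewrite app_mult. f_equal. apply inner_ext. intros x. inner_simpl. ring.
    - unfold f1. apply inner_adj_r. }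
  rewrite EX1 in Em.
  set (g := fun t => gfun g0 (kvec P z1 g0) (circle z1 rho t - z1)%C).
  change (Cmod (cavg (fun t => inner (P (circle z1 rho t) (g t)) (g t)) - inner (P z1 g0) g0
    + RtoC (rho ^ 2) * inner (curv P z1 g0) g0) <= eps * rho ^ 2) in HA.
  assert (EXg : forall t, inner (X (circle z1 rho t) g0) w = inner (g t) (adj (Y (circle z1 rho t)) w)).
  { intros t. unfold X. rewrite app_mult, inner_adj_r. f_equal. apply inner_ext. intros x.
    unfold g, gfun, kvec, kop. inner_simpl. ring. }
  assert (HcX : contC (fun t => inner (X (circle z1 rho t) g0) w)).
  { apply (contC_inner (fun t => X (circle z1 rho t))), contO_circle; [exact Hrho0|apply HX]. }
  assert (HcPg : contC (fun t => inner (P (circle z1 rho t) (g t)) (g t))).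
  { apply (contC_inner_gfun (fun t => P (circle z1 rho t)) (fun _ => one)); [|apply contO_const| |].
    - apply (contO_P_circle Omega P Omega_open P_C2); [exact Hrho0|]. intros t. apply disc_in, Hin, circle_closed, Hrho0.
    - replace (fun t => circle z1 rho t - z1)%C with (fun t => RtoC rho * ek 1 t)%C.
      + apply contC_mult; [apply contC_const|apply contC_ek].
      + apply functional_extensionality. intros t. rewrite circle_sub. reflexivity.
    - replace (fun t => circle z1 rho t - z1)%C with (fun t => RtoC rho * ek 1 t)%C.
      + apply contC_mult; [apply contC_const|apply contC_ek].
      + apply functional_extensionality. intros t. rewrite circle_sub. reflexivity. }
  set (low := fun t => (RtoC 2 * inner (X (circle z1 rho t) g0) w - inner (P (circle z1 rho t) (g t)) (g t))%C).
  assert (HcX2 : contC (fun t => RtoC 2 * inner (X (circle z1 rho t) g0) w)%C) by (apply contC_mult; [apply contC_const|exact HcX]).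
  assert (Elow : cavg low = (RtoC 2 * inner g0 f1 - cavg (fun t => inner (P (circle z1 rho t) (g t)) (g t)))%C).
  { unfold low. rewrite cavg_minus, cavg_scal, Em by assumption. reflexivity. }
  assert (Hlow : Re (cavg low) <= ravg (fun t => phi w (circle z1 rho t))).
  { change (Re (cavg low)) with (ravg (fun t => Re (low t))). apply ravg_le.
    - apply (contC_re low). unfold low. apply contC_minus; assumption.
    - apply (contR_circle_on (closed_disc z0 r)); [lra|apply phi_cont|]. intros t. apply Hin, circle_closed, Hrho0.
    - intros t. unfold low. rewrite EXg.
      eapply Rle_trans; [|apply (bop_inv_quad_ge (P (circle z1 rho t)) _ (g t)), P_pos, disc_in, Hin, circle_closed, Hrho0].
      unfold Re; simpl. lra. }
  rewrite Elow in Hlow.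
  pose proof (proj2 (P_curv z1 HO) g0) as Hcv. change (0 <= Re (inner (curv P z1 g0) g0)) in Hcv.
  assert (Eg : P z1 g0 = f1) by (apply bop_inv_app_r, P_pos, HO).
  rewrite Eg in HA. change (phi w z1) with (Re (inner g0 f1)).
  pose proof (inner_conj_re f1 g0) as Ec.
  set (A := cavg (fun t => inner (P (circle z1 rho t) (g t)) (g t))) in *.
  pose proof (re_le_Cmod (A - inner f1 g0 + RtoC (rho ^ 2) * inner (curv P z1 g0) g0)) as Hre.
  apply Rabs_le_between in Hre.
  assert (H5 : 0 <= rho ^ 2 * Re (inner (curv P z1 g0) g0)) by (apply Rmult_le_pos; [apply pow2_ge_0|exact Hcv]).
  set (q := rho ^ 2) in *. set (k := inner (curv P z1 g0) g0) in *. set (i1 := inner f1 g0) in *.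
  set (i2 := inner g0 f1) in *. clearbody q k i1 i2 A.
  unfold Re in *. simpl in Hre, Hlow. lra.
Qed.

(** The maximum principle bounds <P^-1 T w, T w> at z0 by <T w, w>, while the Legendre inequality
    with g = w bounds it below by 2 <T w, w> - <P w, w>. Comparing the two avoids multiplying by the
    inverse of T. *)
Lemma T_le_P : bop_le T (P z0).
Proof.
  pose proof (closed_disc_center z0 r Hr) as Hc. pose proof (P_pos z0 (disc_in z0 Hc)) as HP0.
  apply bop_le_intro; [apply T_real|intros v; apply nonneg_im, HP0|]. intros w.
  assert (Hmax : phi w z0 <= Re (inner (T w) w)).
  { apply (max_principle z0 r (phi w) (Re (inner (T w) w)) Hr (phi_cont w)); [|apply phi_submean|exact Hc].
    intros t _. right. apply phi_boundary. }
  unfold phi in Hmax. fold T in Hmax. rewrite T_adj in Hmax.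
  pose proof (bop_inv_quad_ge (P z0) (T w) w HP0) as H1.
  rewrite (inner_conj_re (T w) w) in H1. lra.
Qed.

End CurvatureToMean.

Theorem theorem4p7 (V : HilbertSpace) (Omega : C -> Prop) (P : C -> BOp V)
  (Omega_open : open Omega)
  (P_C2 : C2_op Omega P)
  (P_pos : forall z : C, Omega z -> pos_invertible (P z)) :
  semipositive_curvature Omega P <->
  (forall (z0 : C) (r : R), (0 < r)%R ->
     (forall z : C, closed_disc z0 r z -> Omega z) ->
     exists T : BOp V, is_frakT P z0 r T /\ bop_le T (P z0)).
Proof.
  split; [|apply semipositive_of_mean; assumption].
  intros Hcurv z0 r Hr HD.
  destruct (circle_factorization Omega P z0 r Omega_open P_C2 P_pos Hr HD) as [H [Y [HH [H0 [HY HHY]]]]].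
  (* The constant value of Y H, read at the centre where H = 1. *)
  exists (Y z0). split; [split|].
  - exists H. split; [exact (H_admissible Omega P z0 r Omega_open P_C2 P_pos Hr HD H Y HH H0 HY HHY)|].
    symmetry. exact (frakS_twist_H Omega P z0 r Omega_open P_C2 P_pos Hr HD H Y HH H0 HY HHY).
  - exact (T_minimal Omega P z0 r Omega_open P_C2 P_pos Hr HD H Y HH H0 HY HHY).
  - exact (T_le_P Omega P z0 r Omega_open P_C2 P_pos Hr HD H Y HH H0 HY HHY Hcurv).
Qed.
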